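(* Let $\nu>0$, $\lambda\ge 0$ and $M>0$ satisfy $\nu+\lambda\le \tfrac12$, $M\le \min\{(\nu+\lambda)^{-1},\lambda^{-1/2},\nu^{-1/3}\}$ and $M^2\le \min\Big\{\frac{1}{\nu+\lambda},\ \frac{\nu+\lambda}{16\nu},\ \big(\frac{\nu+\lambda}{32\pi\nu}\big)^{1/2}\Big\}$. Let the sign $\pm$ be $+$ (ion system) or $-$ (electron system), and let $(\eta_\pm,u_\pm)$ be the solution of the corresponding linearized system given in the context, with $\psi_\pm=\nabla\cdot u_\pm$, $\omega_\pm=\nabla^\perp\cdot u_\pm$ and initial data $\eta_\pm^{in}\in H^1(\mathbb{T}\times\mathbb{R})$, $\psi_\pm^{in},\omega_\pm^{in}\in L^2(\mathbb{T}\times\mathbb{R})$. Set $$D_{in}^\pm=\|\psi_\pm^{in}-\psi_{\pm,0}^{in}\|_{L^2}+\frac1M\|\nabla(\eta_\pm^{in}-\eta_{\pm,0}^{in})\|_{L^2}+\|\omega_\pm^{in}-\omega_{\pm,0}^{in}\|_{L^2}.$$ Then for all $t\ge0$ $$\|(\psi_\pm-\psi_{\pm,0})(t)\|_{L^2}+\frac1M\|\nabla(\eta_\pm-\eta_{\pm,0})(t)\|_{L^2}+\|(\omega_\pm-\omega_{\pm,0})(t)\|_{L^2}\lesssim \nu^{-\frac12}e^{-\frac{\nu^{1/3}}{32}t}D_{in}^\pm,$$ and in addition $$\|(u_\pm-u_{\pm,0})(t)\|_{L^2}+\frac1M\|(\eta_\pm-\eta_{\pm,0})(t)\|_{L^2}\lesssim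 \nu^{-\frac16}e^{-\frac{\nu^{1/3}}{32}t}D_{in}^\pm.$$
   Context: The domain is $\mathbb{T}\times\mathbb{R}\ni(x,y)$ with $\mathbb{T}=\mathbb{R}/2\pi\mathbb{Z}$; $\nabla^\perp=(-\partial_y,\partial_x)^T$. Linearized ion Navier-Stokes-Poisson system around Couette flow (density $1$, velocity $(y,0)^T$, potential $0$), with $u_+=(u_+^x,u_+^y)^T$: $\partial_t\eta_++y\partial_x\eta_++\nabla\cdot u_+=0$; $\partial_tu_++y\partial_xu_++(u_+^y,0)^T+\frac1{M^2}\nabla\eta_+=-\nabla\phi+\nu\Delta u_++\lambda\nabla(\nabla\cdot u_+)$; $\Delta\phi=4\pi(M^2\phi-\eta_+)$. Linearized electron system: $\partial_t\eta_-+y\partial_x\eta_-+\nabla\cdot u_-=0$; $\partial_tu_-+y\partial_xu_-+(u_-^y,0)^T+\frac1{M^2}\nabla\eta_-=\nabla\phi+\nu\Delta u_-+\lambda\nabla(\nabla\cdot u_-)$; $\Delta\phi=4\pi\eta_-$. The velocity is recovered by $u=\nabla\Delta^{-1}\psi+\nabla^\perp\Delta^{-1}\omega$. The subscript $0$ denotes the $x$-average (zero mode in $x$): $f_0(y)=\frac1{2\pi}\int_{\mathbb{T}}f(x,y)\,dx$. The superscript $in$ denotes the value at $t=0$. $A\lesssim B$ means $A\le CB$ with a constant $C$ independent of $t$, $\nu$, $\lambda$ and the data, but which may depend on $M$ through factors of the form $(1+M)^{b}$ or $\exp(M^{b})$, $b\ge1$ (so $C$ stays bounded as $M\to0$). If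 $\lambda=0$, $\lambda^{-1/2}$ is read as $+\infty$. *)

(* Defs.v *)
From HB Require Import structures.
From mathcomp Require Import all_boot all_order all_algebra.
From mathcomp Require Import all_classical all_reals all_analysis.

Set Implicit Arguments.
Unset Strict Implicit.
Unset Printing Implicit Defensive.

Import Order.TTheory GRing.Theory Num.Theory.
Import numFieldNormedType.Exports.

Local Open Scope classical_set_scope.
Local Open Scope ring_scope.

(* A function on T x R, T = R / 2 pi Z, is a function of (x, y) in R * R that is
   2 pi-periodic in x; it is integrated over one period in x. *)

Section Cylinder.
Variable R : realType.

Definition period : set (measurableTypeR R) := `[0, 2 * pi[.

Lemma measurable_period : measurable period.
Proof. exact: measurable_itv. Qed.

Lemma period_lty : (@lebesgue_measure R period < +oo)%E.
Proof. by rewrite /period lebesgue_measure_itv/= -EFinD; case: ifP; rewrite ltry. Qed.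

Definition torus := mfrestr measurable_period period_lty.

Definition cylinder := (torus \x @lebesgue_measure R)%E.

Definition periodic (f : R * R -> R) :=
  forall x y, f (x + 2 * pi, y) = f (x, y).

Definition in_L1loc (f : R * R -> R) :=
  [/\ periodic f, measurable_fun setT f &
      forall A : R, cylinder.-integrable (setT `*` `[- A, A]) (EFin \o f)].

Definition in_L2 (f : R * R -> R) :=
  periodic f /\ f \in Lfun cylinder 2%:E.

Definition L2norm (f : R * R -> R) : \bar R :=
  ('N[cylinder]_2%:E [EFin \o f])%E.

Definition L2norm_vec (f g : R * R -> R) : \bar R :=
  L2norm (fun z => Num.sqrt (f z ^+ 2 + g z ^+ 2)).

Definition xavg (f : R * R -> R) : R * R -> R :=
  fun z => (2 * pi)^-1 * \int[torus]_x f (x, z.2).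

Definition nonzero_modes (f : R * R -> R) : R * R -> R := f - xavg f.

Definition pdx (f : R * R -> R) : R * R -> R :=
  fun z => derive1 (fun x : R => f (x, z.2)) z.1.

Definition pdy (f : R * R -> R) : R * R -> R :=
  fun z => derive1 (fun y : R => f (z.1, y)) z.2.

(* The iterated partial derivative encoded by a word: true for x, false for y. *)
Definition pd_word (w : seq bool) (f : R * R -> R) : R * R -> R :=
  foldr (fun b g => if b then pdx g else pdy g) f w.

Definition smooth (f : R * R -> R) :=
  forall w : seq bool,
    [/\ continuous (pd_word w f),
        forall x y, derivable (fun x' : R => pd_word w f (x', y)) x 1 &
        forall x y, derivable (fun y' : R => pd_word w f (x, y')) y 1].

Definition test_fun (chi : R * R -> R) :=
  [/\ periodic chi, smooth chi &
      exists A : R, forall x y, A < `|y| -> chi (x, y) = 0].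

(* Distributions are only ever evaluated at test functions. *)
Definition distr := (R * R -> R) -> R.

Definition distr_eq (S T : distr) :=
  forall chi, test_fun chi -> S chi = T chi.

Definition distr_of (f : R * R -> R) : distr :=
  fun chi => \int[cylinder]_z (f z * chi z).

Definition Dx (T : distr) : distr := fun chi => - T (pdx chi).
Definition Dy (T : distr) : distr := fun chi => - T (pdy chi).
Definition ymul (T : distr) : distr := fun chi => T (fun z => z.2 * chi z).
Definition Lap (T : distr) : distr := Dx (Dx T) + Dy (Dy T).
Definition Div (S T : distr) : distr := Dx S + Dy T.
(* nabla^perp . (S, T) with nabla^perp = (- d_y, d_x) *)
Definition Curl (S T : distr) : distr := - Dy S + Dx T.

Definition weak_grad (f gx gy : R * R -> R) :=
  [/\ in_L1loc gx, in_L1loc gy,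
      distr_eq (Dx (distr_of f)) (distr_of gx) &
      distr_eq (Dy (distr_of f)) (distr_of gy)].

Definition in_H1 (f : R * R -> R) :=
  in_L2 f /\ exists gx gy, [/\ weak_grad f gx gy, in_L2 gx & in_L2 gy].

(* The L^2 norm of the weak gradient. The weak gradient is unique almost
   everywhere, so the infimum is over a single value, or is +oo if there is no
   weak gradient. *)
Definition L2norm_grad (f : R * R -> R) : \bar R :=
  ereal_inf [set n | exists gx gy, weak_grad f gx gy /\ n = L2norm_vec gx gy].

Definition strongly_continuous (N : (R * R -> R) -> \bar R)
    (f : R -> R * R -> R) :=
  forall t : R, 0 <= t ->
    N (f s - f t) @[s --> within [set s | 0 <= s] (nbhs t)] --> 0%E.

Definition weakly_continuous (f : R -> R * R -> R) :=
  forall chi, test_fun chi -> forall t : R, 0 <= t ->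
    distr_of (f s) chi @[s --> within [set s | 0 <= s] (nbhs t)]
      --> distr_of (f t) chi.

(* d_t f = T at time t: classical in time, in the sense of distributions in
   space. *)
Definition dt_eq (f : R -> R * R -> R) (t : R) (T : distr) :=
  forall chi, test_fun chi ->
    is_derive t (1 : R) (fun s => distr_of (f s) chi) (T chi).

End Cylinder.

Variant species := ion | electron.

Section System.
Variables (R : realType) (sp : species) (nu lambda M : R).

Definition field_sign : R := match sp with ion => 1 | electron => -1 end.

Definition charge_density (Phi Eta : distr R) : distr R :=
  match sp with
  | ion => M ^+ 2 *: Phi - Eta
  | electron => Eta
  end.

(* (eta, u) with u = (ux, uy) is a solution with potential phi, and
   psi = div u, omega = nabla^perp . u.  The solution is taken in
   C([0, +oo[; H^1 x L^2 x L^2) for (eta, psi, omega), and the equations hold in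
   the sense of distributions.  That u and phi have L^2 nonzero modes is what
   singles out u = nabla Lap^-1 psi + nabla^perp Lap^-1 omega, and phi, among the
   fields with the same derivatives: it excludes adding exp(k y) cos(k x) and the
   like.  On the zero mode, Lap^-1 is only defined up to affine functions of y,
   which are left free. *)
Record is_solution (eta ux uy phi psi omega : R -> R * R -> R) : Prop := {
  sol_eta : forall t : R, 0 <= t -> in_H1 (eta t) ;
  sol_psi : forall t : R, 0 <= t -> in_L2 (psi t) ;
  sol_omega : forall t : R, 0 <= t -> in_L2 (omega t) ;
  sol_u : forall t : R, 0 <= t ->
    [/\ in_L1loc (ux t), in_L1loc (uy t),
        in_L2 (nonzero_modes (ux t)) & in_L2 (nonzero_modes (uy t))] ;
  sol_phi : forall t : R, 0 <= t ->
    in_L1loc (phi t) /\ in_L2 (nonzero_modes (phi t)) ;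
  sol_eta_continuous :
    strongly_continuous (fun f => L2norm f + L2norm_grad f)%E eta ;
  sol_psi_continuous : strongly_continuous (@L2norm R) psi ;
  sol_omega_continuous : strongly_continuous (@L2norm R) omega ;
  sol_u_continuous : weakly_continuous ux /\ weakly_continuous uy ;
  sol_div : forall t : R, 0 <= t ->
    distr_eq (distr_of (psi t)) (Div (distr_of (ux t)) (distr_of (uy t))) ;
  sol_curl : forall t : R, 0 <= t ->
    distr_eq (distr_of (omega t)) (Curl (distr_of (ux t)) (distr_of (uy t))) ;
  sol_mass : forall t : R, 0 < t ->
    let Eta := distr_of (eta t) in
    let Ux := distr_of (ux t) in
    let Uy := distr_of (uy t) in
    dt_eq eta t (- ymul (Dx Eta) - Div Ux Uy) ;
  sol_momentum_x : forall t : R, 0 < t ->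
    let Eta := distr_of (eta t) in
    let Ux := distr_of (ux t) in
    let Uy := distr_of (uy t) in
    let Phi := distr_of (phi t) in
    dt_eq ux t (- ymul (Dx Ux) - Uy - (M ^+ 2)^-1 *: Dx Eta
                - field_sign *: Dx Phi
                + nu *: Lap Ux + lambda *: Dx (Div Ux Uy)) ;
  sol_momentum_y : forall t : R, 0 < t ->
    let Eta := distr_of (eta t) in
    let Ux := distr_of (ux t) in
    let Uy := distr_of (uy t) in
    let Phi := distr_of (phi t) in
    dt_eq uy t (- ymul (Dx Uy) - (M ^+ 2)^-1 *: Dy Eta
                - field_sign *: Dy Phi
                + nu *: Lap Uy + lambda *: Dy (Div Ux Uy)) ;
  sol_poisson : forall t : R, 0 <= t ->
    distr_eq (Lap (distr_of (phi t)))
      ((4 * pi) *: charge_density (distr_of (phi t)) (distr_of (eta t)))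
}.

End System.

(* Main.v *)
(* After a Fourier transform in x (frequency k) and in y along the moving
   frequency zeta = xi - k t, the system becomes an ODE for each (k, xi) in
   N = eta^, Psi = psi^ and Om = omega^.  With p = k^2 + zeta^2, the energy
   Psi^2 + p N^2 / M^2 + (Om + N)^2, corrected by a cross term (G - h) Psi N and
   multiplied by a time weight, is nonincreasing up to cutoff errors.  The G-part of the cross term
   makes the growth of Psi and of p^(1/2) N / M equal, of order <t>^(3/2), the h-part
   transfers the dissipation of Psi to N, and the weight exp(c (n t - atan (n tau)))
   with n = nu^(1/3) and tau = - zeta / k turns the dissipation nu p into the rate n.  Dividing by p,
   which controls u and eta, saves a factor <t>^2.

   Distributions are only tested against functions of compact support in y, so the
   transform is taken after a cutoff theta (r y): the ODE gets an error containing a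
   derivative of theta, which is O(r) in L^2.  The estimate is integrated in xi
   (Plancherel), r tends to 0, and the modes are summed (Parseval). *)

Require Import Defs.
From HB Require Import structures.
From mathcomp Require Import all_boot all_order all_algebra.
From mathcomp Require Import all_classical all_reals all_analysis measurable_realfun.
From mathcomp Require Import ring lra.

Set Implicit Arguments.
Unset Strict Implicit.
Unset Printing Implicit Defensive.

Import Order.TTheory GRing.Theory Num.Theory.
Import numFieldNormedType.Exports.

Local Open Scope classical_set_scope.
Local Open Scope ring_scope.

(** * Plancherel's formula on the line *)

(** Why [Om + N]: from [N' = - Psi] and [Om' = Psi - nu * p * Om] the sum is driven only by
    [nu * p * N], which the dissipation handed to [N] absorbs when
    [16 * nu * M ^+ 2 <= nu + lambda]. Origin of the powers of [nu]: with n = nu^(1/3), <t>^3 exp(-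
    n t / 12) is at most a constant times n^-3 exp(- n t / 16), and n^-3 = 1 / nu; the root of the
    energy gives nu^(-1/2) and the rate n / 32. After the division by p only <t> is left, hence
    nu^(-1/6). Main obstacle: the equations hold for a fixed test function, whereas the wave that
    follows the shear moves with time. Differentiating along it needs strong continuity in time of
    every mode of every field; for u and phi this is deduced from elliptic estimates on differences
    of the solution at two times. The cutoff errors are only bounded for a fixed mode and a fixed
    time interval, with constants depending on the solution. This suffices because the cutoff is
    removed before the modes are summed. Everything stays real: cosines with phases 0 and pi / 2,
    for k and - k, stand for complex exponentials. *)

Section DerivativeRules.
Variable R : realType.
Implicit Types (f g : R -> R) (x c df dg : R).

Lemma der_cst c x : is_derive x (1 : R) (fun _ : R => c) 0.
Proof. exact: is_derive_cst. Qed.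

Lemma der_id x : is_derive x (1 : R) (fun y : R => y) 1.
Proof. exact: is_derive_id. Qed.

Lemma der_add f g x df dg : is_derive x (1 : R) f df -> is_derive x (1 : R) g dg ->
  is_derive x (1 : R) (fun y => f y + g y) (df + dg).
Proof. by move=> ? ?; exact: is_deriveD. Qed.

Lemma der_opp f x df : is_derive x (1 : R) f df ->
  is_derive x (1 : R) (fun y => - f y) (- df).
Proof. by move=> ?; exact: is_deriveN. Qed.

Lemma der_mul f g x df dg : is_derive x (1 : R) f df -> is_derive x (1 : R) g dg ->
  is_derive x (1 : R) (fun y => f y * g y) (df * g x + f x * dg).
Proof.
move=> hf hg; have := is_deriveM hf hg.
by rewrite /GRing.scale/= addrC (mulrC (g x)).
Qed.

Lemma der_comp (h : R -> R) f x dh df : is_derive (f x) (1 : R) h dh ->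
  is_derive x (1 : R) f df -> is_derive x (1 : R) (fun y => h (f y)) (dh * df).
Proof.
move=> hh hf; have := @is_derive1_comp _ h f x dh df hh hf.
by [].
Qed.

Lemma der_exprn f x df n : is_derive x (1 : R) f df ->
  is_derive x (1 : R) (fun y => f y ^+ n) (n%:R * f x ^+ n.-1 * df).
Proof.
move=> hf; elim: n => [|n IH].
  by apply: is_derive_eq; [exact: der_cst|rewrite !mul0r].
under eq_fun do rewrite exprS.
have h := der_mul hf IH; apply: (is_derive_eq h).
case: n {IH h} => [|n] /=; first by rewrite !expr0; ring.
by rewrite -(natr1 n.+1) exprS; ring.
Qed.

Lemma der_inv f x df : f x != 0 -> is_derive x (1 : R) f df ->
  is_derive x (1 : R) (fun y => (f y)^-1) (- (f x ^- 2) * df).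
Proof. by move=> f0 hf; exact: (is_deriveV f0 hf). Qed.

Lemma der_expR f x df : is_derive x (1 : R) f df ->
  is_derive x (1 : R) (fun y => expR (f y)) (expR (f x) * df).
Proof. by move=> hf; apply: der_comp => //; exact: is_derive_expR. Qed.

Lemma der_cos f x df : is_derive x (1 : R) f df ->
  is_derive x (1 : R) (fun y => cos (f y)) (- sin (f x) * df).
Proof. by move=> hf; apply: der_comp => //; exact: is_derive_cos. Qed.

Lemma der_sin f x df : is_derive x (1 : R) f df ->
  is_derive x (1 : R) (fun y => sin (f y)) (cos (f x) * df).
Proof. by move=> hf; apply: der_comp => //; exact: is_derive_sin. Qed.

Lemma der_atan f x df : is_derive x (1 : R) f df ->
  is_derive x (1 : R) (fun y => atan (f y)) ((1 + f x ^+ 2)^-1 * df).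
Proof. by move=> hf; apply: der_comp => //; exact: is_derive1_atan. Qed.

Lemma der_ln f x df : 0 < f x -> is_derive x (1 : R) f df ->
  is_derive x (1 : R) (fun y => ln (f y)) ((f x)^-1 * df).
Proof. by move=> f0 hf; apply: der_comp => //; exact: is_derive1_ln. Qed.

Lemma der_continuous f x df : is_derive x (1 : R) f df -> {for x, continuous f}.
Proof.
move=> hf; apply: differentiable_continuous; apply/derivable1_diffP.
by case: hf.
Qed.

Lemma der_derive1 f x df : is_derive x (1 : R) f df -> derive1 f x = df.
Proof. by move=> [_ h]; rewrite derive1E. Qed.

Lemma derE f x df df' : is_derive x (1 : R) f df -> df = df' -> is_derive x (1 : R) f df'.
Proof. by move=> ? <-. Qed.

End DerivativeRules.

(** Syntax-directed differentiation. [is_derive] is a class, so [notypeclasses refine] keeps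
    instance search away from the subgoals, and the second-order patterns fix the function to which
    each rule applies. Conditions of nonvanishing or positivity are left as goals. *)
Ltac der1 :=
  first [notypeclasses refine (@der_cst _ _ _) | lazymatch goal with
  | |- is_derive _ _ (fun y => y) _ => notypeclasses refine (@der_id _ _)
  | |- is_derive _ _ (fun y => @?f y + @?g y) _ => notypeclasses refine (@der_add _ f g _ _ _ _ _)
  | |- is_derive _ _ (fun y => - @?f y) _ => notypeclasses refine (@der_opp _ f _ _ _)
  | |- is_derive _ _ (fun y => @?f y * @?g y) _ => notypeclasses refine (@der_mul _ f g _ _ _ _ _)
  | |- is_derive _ _ (fun y => @?f y ^+ ?n) _ => notypeclasses refine (@der_exprn _ f _ _ _ _)
  | |- is_derive _ _ (fun y => (@?f y)^-1) _ => notypeclasses refine (@der_inv _ f _ _ _ _)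
  | |- is_derive _ _ (fun y => expR (@?f y)) _ => notypeclasses refine (@der_expR _ f _ _ _)
  | |- is_derive _ _ (fun y => cos (@?f y)) _ => notypeclasses refine (@der_cos _ f _ _ _)
  | |- is_derive _ _ (fun y => sin (@?f y)) _ => notypeclasses refine (@der_sin _ f _ _ _)
  | |- is_derive _ _ (fun y => atan (@?f y)) _ => notypeclasses refine (@der_atan _ f _ _ _)
  | |- is_derive _ _ (fun y => ln (@?f y)) _ => notypeclasses refine (@der_ln _ f _ _ _ _)
  | |- is_derive _ _ _ _ => eassumption
  end].
Ltac der := notypeclasses refine (@derE _ _ _ _ _ _ _); [repeat der1|cbv beta].
Ltac dcont := notypeclasses refine (@der_continuous _ _ _ _ _); repeat der1.

Section AffineChange.
Variable R : realType.
Local Notation mu := (@lebesgue_measure R).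

Let affine (a b : R) : measurableTypeR R -> measurableTypeR R := fun x => a * x + b.

Let measurable_affine a b : measurable_fun setT (affine a b).
Proof. by apply: measurable_funD => //; apply: measurable_funM. Qed.

Let affine_measure a b : {measure set (measurableTypeR R) -> \bar R} :=
  measure_function_pushforward__canonical__measure_function_Measure mu (measurable_affine a b).

(** Uniqueness of the Lebesgue measure reduces the claim to half-open intervals, where the preimage
    under x |-> a x + b has length (d - c) / a. *)
Let lebesgue_measure_affine (a b : R) (a0 : 0 < a) (A : set R) : measurable A ->
  mscale (NngNum (ltW a0)) (affine_measure a b) A = mu A.
Proof.
move=> mA; apply/esym.
apply: (@lebesgue_measure_unique R (mscale (NngNum (ltW a0)) (affine_measure a b))) => //= _ [[c d]] _ <-.
rewrite /mscale/= /pushforward.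
have -> : affine a b @^-1` `]c, d]%classic = `](c - b) / a, (d - b) / a]%classic.
  by apply/seteqP; split => x /=; rewrite /affine !in_itv/= ltr_pdivrMr// ler_pdivlMr// ltrBlDr lerBrDr mulrC.
rewrite !lebesgue_measure_itv/= !lte_fin ltr_pM2r ?invr_gt0// ltrD2r.
case: ifP => _; last by rewrite mule0.
rewrite -!EFinD -EFinM; congr EFin; field; exact: lt0r_neq0.
Qed.

Lemma ge0_integral_affine (f : R -> \bar R) (a b : R) : 0 < a ->
  measurable_fun setT f -> (forall x, 0 <= f x)%E ->
  (\int[mu]_x f x = a%:E * \int[mu]_x f (a * x + b)%R)%E.
Proof.
move=> a0 mf f0.
transitivity (\int[mscale (NngNum (ltW a0)) (affine_measure a b)]_x f x)%E.
  by apply: eq_measure_integral => A mA _; exact/esym/lebesgue_measure_affine.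
rewrite ge0_integral_mscale//=; congr (_ * _)%E.
by rewrite ge0_integral_pushforward//; exact: measurable_affine.
Qed.

Lemma ge0_integral_shift (f : R -> \bar R) (b : R) :
  measurable_fun setT f -> (forall x, 0 <= f x)%E ->
  (\int[mu]_x f (x + b)%R = \int[mu]_x f x)%E.
Proof.
move=> mf f0; rewrite [RHS](@ge0_integral_affine _ 1 b)//.
by rewrite mul1e; under [RHS]eq_integral do rewrite mul1r.
Qed.

End AffineChange.

Section Integrable.
Context d (T : measurableType d) (R : realType) (mu : {measure set T -> \bar R}).

Lemma integrable_fine (h : T -> \bar R) : mu.-integrable setT h ->
  mu.-integrable setT (EFin \o (fun x => fine (h x))) /\
  (\int[mu]_x (fine (h x))%:E = \int[mu]_x h x)%E.
Proof.
move=> ih; have mh : measurable_fun setT h by case/integrableP: ih.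
have mf : measurable_fun setT (EFin \o (fun x => fine (h x))).
  by apply/measurable_EFinP; apply: measurableT_comp => //.
split.
  apply: (le_integrable _ _ _ ih) => // x _ /=.
  by case: (h x) => //=; rewrite normr0 leey.
apply: ae_eq_integral => //.
apply: filterS (integrable_ae measurableT ih) => x hx _.
by rewrite fineK// hx.
Qed.

Lemma integrableM_bounded (g k : T -> R) (c : R) :
  measurable_fun setT k -> (forall x, `|k x| <= c) ->
  mu.-integrable setT (EFin \o g) -> mu.-integrable setT (EFin \o (fun x => g x * k x)).
Proof.
move=> mk kc ig.
have mg : measurable_fun setT g by case/integrableP: ig => /measurable_EFinP.
have i2 : mu.-integrable setT (fun x => c%:E * (EFin \o g) x)%E by exact: integrableZl.
apply: (le_integrable _ _ _ i2) => //.
  by apply/measurable_EFinP; apply: measurable_funM.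
move=> x _ /=; rewrite lee_fin [leRHS]normrM normrM mulrC ler_wpM2r//.
by rewrite (le_trans (kc x))// ler_norm.
Qed.

Lemma integrableRD (f g : T -> R) : mu.-integrable setT (EFin \o f) ->
  mu.-integrable setT (EFin \o g) -> mu.-integrable setT (EFin \o (fun x => f x + g x)).
Proof. by move=> hf hg; have := integrableD measurableT hf hg. Qed.

Lemma integrableRB (f g : T -> R) : mu.-integrable setT (EFin \o f) ->
  mu.-integrable setT (EFin \o g) -> mu.-integrable setT (EFin \o (fun x => f x - g x)).
Proof. by move=> hf hg; have := integrableB measurableT hf hg. Qed.

Lemma integrableRZ (c : R) (f : T -> R) : mu.-integrable setT (EFin \o f) ->
  mu.-integrable setT (EFin \o (fun x => c * f x)).
Proof. by move=> hf; have := integrableZl measurableT c hf. Qed.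

Lemma ge0_fin_integrable (f : T -> R) : measurable_fun setT f -> (forall x, 0 <= f x) ->
  (\int[mu]_x (f x)%:E < +oo)%E -> mu.-integrable setT (EFin \o f).
Proof.
move=> mf f0 fi; apply/integrableP; split; first exact/measurable_EFinP.
by under eq_integral do rewrite /= ger0_norm//.
Qed.

Lemma EFin_Rintegral (f : T -> R) : mu.-integrable setT (EFin \o f) ->
  ((\int[mu]_x f x)%:E = \int[mu]_x (f x)%:E)%E.
Proof. by move=> fi; rewrite fineK//; exact: integrable_fin_num. Qed.

Lemma ge0_integralRD (f g : T -> R) : measurable_fun setT f -> measurable_fun setT g ->
  (forall x, 0 <= f x) -> (forall x, 0 <= g x) ->
  (\int[mu]_x ((f x)%:E + (g x)%:E) = \int[mu]_x (f x)%:E + \int[mu]_x (g x)%:E)%E.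
Proof.
move=> mf mg f0 g0; apply: ge0_integralD => //.
- by move=> x _; rewrite lee_fin.
- exact/measurable_EFinP.
- by move=> x _; rewrite lee_fin.
- exact/measurable_EFinP.
Qed.

Lemma fatou_le (f_ : nat -> T -> \bar R) (f : T -> \bar R) (B : \bar R) :
  (forall n, measurable_fun setT (f_ n)) -> (forall n x, (0 <= f_ n x)%E) ->
  (forall x, f_ n x @[n --> \oo] --> f x) ->
  (forall n, (\int[mu]_x f_ n x <= B)%E) -> (\int[mu]_x f x <= B)%E.
Proof.
move=> mf f0 ff fB.
have := fatou mu measurableT mf (fun n x _ => f0 n x).
rewrite [leLHS](_ : _ = \int[mu]_x f x)%E; last first.
  by apply: eq_integral => z _; rewrite (cvg_limn_einf_sup (ff z)).
move=> /le_trans; apply; rewrite limn_einf_lim; apply: lime_le; first exact: is_cvg_einfs.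
apply: nearW => n; rewrite (le_trans _ (fB n))//.
by rewrite /einfs/=; apply: ereal_inf_lbound; exists n => /=.
Qed.

Lemma Rdominated_cvg (f_ : nat -> T -> R) (f g : T -> R) :
  (forall n, measurable_fun setT (f_ n)) -> measurable_fun setT f ->
  (forall x, f_ n x @[n --> \oo] --> f x) ->
  (forall n x, `|f_ n x| <= g x) -> mu.-integrable setT (EFin \o g) ->
  \int[mu]_x f_ n x @[n --> \oo] --> \int[mu]_x f x.
Proof.
move=> mf_ mf ff fg ig.
have ff' x : (EFin \o f_ n) x @[n --> \oo] --> (EFin \o f) x.
  by apply: cvg_EFin; [exact: nearW|exact: ff].
have [i1 _ i3] := @dominated_convergence _ _ _ mu setT measurableT (fun n => EFin \o f_ n) (EFin \o f) (EFin \o g)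
  (fun n => (measurable_EFinP _ _).2 (mf_ n)) ((measurable_EFinP _ _).2 mf)
  (aeW _ (fun x _ => ff' x)) ig (aeW _ (fun x n _ => fg n x)).
apply: fine_cvg; rewrite fineK//; exact: integrable_fin_num.
Qed.

End Integrable.

Section FubiniKernel.
Context d1 d2 (T1 : measurableType d1) (T2 : measurableType d2) (R : realType).
Variables (m1 : {sigma_finite_measure set T1 -> \bar R}) (m2 : {sigma_finite_measure set T2 -> \bar R}).

Lemma integrable_prodM (w : T1 -> R) (g : T2 -> R) (k : T1 * T2 -> R) (c : R) :
  m1.-integrable setT (EFin \o w) -> m2.-integrable setT (EFin \o g) ->
  measurable_fun setT k -> (forall z, `|k z| <= c) ->
  (m1 \x m2)%E.-integrable setT (EFin \o (fun z => w z.1 * g z.2 * k z)).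
Proof.
move=> iw ig mk kc.
have mw : measurable_fun setT w by case/integrableP: iw => /measurable_EFinP.
have mg : measurable_fun setT g by case/integrableP: ig => /measurable_EFinP.
have mw1 : measurable_fun setT (fun z : T1 * T2 => w z.1) by exact: measurableT_comp.
have mg2 : measurable_fun setT (fun z : T1 * T2 => g z.2) by exact: measurableT_comp.
have mwg : measurable_fun setT (fun z : T1 * T2 => w z.1 * g z.2) by exact: measurable_funM.
suff iwg : (m1 \x m2)%E.-integrable setT (EFin \o (fun z : T1 * T2 => c * (w z.1 * g z.2))).
  apply: (le_integrable _ _ _ iwg) => //.
    by apply/measurable_EFinP; exact: measurable_funM.
  move=> z _ /=; rewrite lee_fin normrM [leRHS]normrM mulrC.
  by rewrite ler_wpM2r// (le_trans (kc z))// ler_norm.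
rewrite (_ : _ \o _ = (fun z : T1 * T2 => c%:E * (w z.1 * g z.2)%:E)%E); last first.
  by apply/funext => z /=; rewrite EFinM.
apply: integrableZl => //.
apply/integrable12ltyP; first exact/measurable_EFinP.
under eq_integral => x _.
  under eq_integral => y _ do rewrite /= normrM EFinM.
  rewrite ge0_integralZl//; last 1 first.
  - by apply/measurable_EFinP; apply: measurableT_comp.
  over.
rewrite /= ge0_integralZr//.
- case/integrableP: iw => _ iw; case/integrableP: ig => _ ig.
  by apply: lte_mul_pinfty => //; rewrite ?integral_ge0// ge0_fin_numE// integral_ge0.
- by apply/measurable_EFinP; apply: measurableT_comp.
- by rewrite integral_ge0.
Qed.

Lemma integrable_fubini_G (f : T1 * T2 -> \bar R) :
  (m1 \x m2)%E.-integrable setT f -> m2.-integrable setT (fubini_G m1 f).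
Proof.
move=> iF; have mf : measurable_fun setT f by case/integrableP: iF.
have mG := measurable_fubini_G iF.
apply/integrableP; split => //.
have h := (@integrable21ltyP _ _ _ _ _ m1 m2 _ mf).1 iF.
refine (le_lt_trans _ h).
apply: ge0_le_integral => //=.
- exact: measurableT_comp.
- apply: (measurable_fun_fubini_tonelli_G (abse \o f)) => //=.
  exact: measurableT_comp.
- move=> y _; apply: le_abse_integral => //.
  exact: measurableT_comp.
Qed.

Lemma Rfubini (F : T1 * T2 -> R) :
  (m1 \x m2)%E.-integrable setT (EFin \o F) ->
  (m1.-integrable setT (EFin \o (fun x => \int[m2]_y F (x, y)))
   /\ \int[m1]_x (\int[m2]_y F (x, y)) = \int[(m1 \x m2)%E]_z F z) /\
  (m2.-integrable setT (EFin \o (fun y => \int[m1]_x F (x, y)))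
   /\ \int[m2]_y (\int[m1]_x F (x, y)) = \int[(m1 \x m2)%E]_z F z).
Proof.
move=> iF.
have [i1 e1] := integrable_fine (integrable_fubini_F iF).
have [i2 e2] := integrable_fine (integrable_fubini_G iF).
split; split => //.
- by rewrite /Rintegral -(integral12_prod_meas1 iF) -e1.
- by rewrite /Rintegral -(integral21_prod_meas1 iF) -e2.
Qed.

(** The form in which transforms are exchanged: two integrable factors and a bounded kernel, so that
    no integrability of the product has to be checked at each use. *)
Lemma Rfubini_kernel (w : T1 -> R) (g : T2 -> R) (k : T1 * T2 -> R) (c : R) :
  m1.-integrable setT (EFin \o w) -> m2.-integrable setT (EFin \o g) ->
  measurable_fun setT k -> (forall z, `|k z| <= c) ->
  \int[m1]_x (w x * \int[m2]_y (g y * k (x, y))) =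
  \int[m2]_y (g y * \int[m1]_x (w x * k (x, y))).
Proof.
move=> iw ig mk kc.
have iF := integrable_prodM iw ig mk kc.
have mg : measurable_fun setT g by case/integrableP: ig => /measurable_EFinP.
have mw : measurable_fun setT w by case/integrableP: iw => /measurable_EFinP.
have [[_ e1] [_ e2]] := Rfubini iF.
transitivity (\int[m1]_x (\int[m2]_y (w x * g y * k (x, y)))).
  apply: eq_Rintegral => x _; rewrite -RintegralZl//.
    by apply: eq_Rintegral => y _; rewrite mulrA.
  by apply: (integrableM_bounded (c := c) _ _ ig) => //; apply: measurableT_comp.
rewrite e1 -e2; apply: eq_Rintegral => y _; rewrite -RintegralZl//.
  by apply: eq_Rintegral => x _; rewrite mulrA (mulrC (w x)).
by apply: (integrableM_bounded (c := c) _ _ iw) => //; apply: measurableT_comp.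
Qed.

End FubiniKernel.

(** * Abel summation and the Poisson kernel *)

Section PoissonKernel.
Variable R : realType.
Local Notation mu := (@lebesgue_measure R).
Variable e : R.
Hypothesis e0 : 0 < e.

(** The one-sided Abel factor makes the integral of the spectrum absolutely convergent; its cosine
    transform is the Poisson kernel, here of total mass pi. The half line suffices since the
    spectrum of a real function is even. *)
Definition abel (z : R) : R := if 0 <= z then expR (- (e * z)) else 0.

Definition poisson (a : R) : R := e / (e ^+ 2 + a ^+ 2).

Lemma abel_ge0 z : 0 <= abel z.
Proof. by rewrite /abel; case: ifP => // _; exact: expR_ge0. Qed.

Let den a : e ^+ 2 + a ^+ 2 != 0.
Proof. by rewrite gt_eqF// ltr_pwDl ?exprn_gt0 ?sqr_ge0. Qed.

Let exp_cvg0 : expR (- (e * z)) @[z --> +oo] --> (0 : R).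
Proof.
apply/cvgrPdist_le => d d0; near=> z.
rewrite sub0r normrN ger0_norm ?expR_ge0//.
have z0 : 0 < e * z by apply: mulr_gt0 => //; near: z; exact: nbhs_pinfty_gt.
have h : e * z <= expR (e * z) by rewrite (le_trans _ (expR_ge1Dx _))// lerDr.
rewrite expRN -[leRHS]invrK lef_pV2 ?posrE ?invr_gt0 ?expR_gt0//.
apply: le_trans h; rewrite mulrC -ler_pdivrMr//.

Unshelve. all: by end_near. Qed.

(** Adding 1 to the cosine makes the integrand nonnegative, so that the improper fundamental theorem
    of calculus for nonnegative functions applies. The case a = 0 gives the integral of the
    exponential alone, which is subtracted again later. *)
Lemma ge0_integral_cos_damped (a : R) :
  (\int[mu]_(z in `[0%R, +oo[) (expR (- (e * z)) * (1 + cos (a * z)))%:E =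
   (e^-1 + poisson a)%:E)%E.
Proof.
pose G z := - e^-1 + (a * sin (a * z) - e * cos (a * z)) / (e ^+ 2 + a ^+ 2).
pose F z := expR (- (e * z)) * G z.
have dF z : is_derive z (1:R) F (expR (- (e * z)) * (1 + cos (a * z))).
  rewrite /F /G; der.
  have d0 := den a; have e1 : e != 0 by rewrite gt_eqF.
  by field; rewrite e1 d0.
have cF : continuous F by move=> z; exact: der_continuous (dF z).
have ce : continuous (fun z : R => expR (- (e * z)) * (1 + cos (a * z))).
  move=> z; dcont.
rewrite (@ge0_continuous_FTC2y _ _ F _ 0).
- rewrite sub0e -EFinN /F /G mulr0 oppr0 expR0 mulr0 sin0 cos0; congr EFin.
  by rewrite /poisson; field; rewrite den gt_eqF.
- by move=> z _; rewrite mulr_ge0 ?expR_ge0// -lerBlDl sub0r; exact: cos_geN1.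
- exact: continuous_subspaceT.
- have bG z : `|G z| <= e^-1 + (`|a| + e) / (e ^+ 2 + a ^+ 2).
    rewrite /G (le_trans (ler_normD _ _))// normrN gtr0_norm ?invr_gt0// lerD2l.
    rewrite normrM [X in _ * X]ger0_norm ?invr_ge0 ?addr_ge0 ?sqr_ge0//.
    rewrite ler_wpM2r ?invr_ge0 ?addr_ge0 ?sqr_ge0//.
    rewrite (le_trans (ler_normB _ _))// !normrM (gtr0_norm e0) lerD//.
      by rewrite ler_piMr// ler_norml sin_geN1 sin_le1.
    by rewrite ler_piMr ?(ltW e0)// ler_norml cos_geN1 cos_le1.
  apply/cvgrPdist_le => d d0.
  set B := e^-1 + _ in bG.
  have B0 : 0 < B.
    by rewrite ltr_pwDl ?invr_gt0// divr_ge0 ?addr_ge0 ?sqr_ge0// ltW.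
  have dB : 0 < d / B by rewrite divr_gt0.
  move/cvgrPdist_le : exp_cvg0 => /(_ _ dB); apply: filterS => z.
  rewrite !sub0r !normrN /F normrM => h.
  by rewrite -(divfK (lt0r_neq0 B0) d) ler_pM.
- by move=> z _; case: (dF z).
- exact/cvg_at_right_filter/cF.
- by move=> z _; rewrite derive1E; case: (dF z).
Qed.

Lemma ge0_integral_damped : (\int[mu]_(z in `[0%R, +oo[) (expR (- (e * z)))%:E = (e^-1)%:E)%E.
Proof.
have := ge0_integral_cos_damped 0.
have -> : poisson 0 = e^-1 by rewrite /poisson expr0n addr0; field; rewrite gt_eqF.
under eq_integral do rewrite mul0r cos0 mulrDr mulr1 EFinD.
rewrite ge0_integralD//; try (by move=> z _; rewrite lee_fin expR_ge0);
  try (by apply/measurable_EFinP; apply: measurable_funTS; apply: continuous_measurable_fun => z; dcont).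
case: (\int[mu]_(z in _) _)%E => // r; rewrite -EFinD => -[] h; congr EFin; lra.
Qed.

Lemma integrable_abel : mu.-integrable setT (EFin \o abel).
Proof.
have mexp : measurable_fun setT (fun z : R => expR (- (e * z))).
  by apply: continuous_measurable_fun => z; dcont.
have -> : abel = (fun z => expR (- (e * z))) \_ `[0, +oo[.
  by apply/funext => z; rewrite /abel patchE mem_setE in_itv/= andbT.
rewrite -restrict_EFin; apply/(integrable_mkcond _ _).1 => //.
apply/integrableP; split.
  by apply/measurable_EFinP; exact: measurable_funTS.
under eq_integral => z _ do rewrite /= ger0_norm ?expR_ge0//.
by rewrite ge0_integral_damped ltry.
Qed.

Let abelE : abel = (fun z => expR (- (e * z))) \_ `[0, +oo[.
Proof. by apply/funext => z; rewrite /abel patchE mem_setE in_itv/= andbT. Qed.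

Lemma integrable_abel_cos a : mu.-integrable setT (EFin \o (fun z => abel z * cos (a * z))).
Proof.
apply: (integrableM_bounded (c := 1)) => //.
- by apply: continuous_measurable_fun => z; dcont.
- by move=> z; rewrite ler_norml cos_geN1 cos_le1.
- exact: integrable_abel.
Qed.

Lemma Rintegral_abel_cos a : \int[mu]_z (abel z * cos (a * z)) = poisson a.
Proof.
have e1 : \int[mu]_z (abel z) = e^-1.
  rewrite /Rintegral; have := ge0_integral_damped.
  move=> h; rewrite -[RHS]/(fine e^-1%:E) -h [in RHS]integral_mkcond; congr fine.
  by apply: eq_integral => z _; rewrite /= abelE !patchE; case: ifP.
have e2 : \int[mu]_z (abel z * (1 + cos (a * z))) = e^-1 + poisson a.
  rewrite /Rintegral.
  have := ge0_integral_cos_damped a.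
  move=> h; rewrite -[RHS]/(fine (e^-1 + poisson a)%:E) -h [in RHS]integral_mkcond; congr fine.
  apply: eq_integral => z _; rewrite /= abelE !patchE; case: ifP => //.
  by rewrite mul0r.
apply: (addrI (e^-1)); rewrite -e2 -{1}e1 -RintegralD//.
- by apply: eq_Rintegral => z _; rewrite mulrDr mulr1.
- exact: integrable_abel.
- exact: integrable_abel_cos.
Qed.
Lemma poisson_ge0 a : 0 <= poisson a.
Proof. by rewrite /poisson divr_ge0 ?addr_ge0 ?sqr_ge0// ltW. Qed.

Lemma poisson_le a : poisson a <= e^-1.
Proof.
rewrite /poisson ler_pdivrMr ?ltr_pwDl ?exprn_gt0 ?sqr_ge0//.
rewrite -[leLHS]mul1r -(mulVf (lt0r_neq0 e0)) -mulrA ler_wpM2l ?invr_ge0 ?(ltW e0)//.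
by rewrite -expr2 lerDl sqr_ge0.
Qed.

Lemma poissonN a : poisson (- a) = poisson a.
Proof. by rewrite /poisson sqrrN. Qed.

Lemma continuous_poisson : continuous poisson.
Proof. by move=> a; rewrite /poisson; dcont. Qed.

Lemma measurable_poissonB : measurable_fun setT (fun z : R * R => poisson (z.1 - z.2)).
Proof.
apply: (measurableT_comp (f := poisson)); first exact: continuous_measurable_fun continuous_poisson.
by apply: measurable_funB.
Qed.

Lemma ge0_integral_cauchy : (\int[mu]_s ((1 + s ^+ 2)^-1)%:E = (pi : R)%:E)%E.
Proof.
rewrite ge0_symfun_integralT//; last 3 first.
- by move=> x; rewrite invr_ge0 addr_ge0 ?sqr_ge0.
- by move=> x; dcont; rewrite gt_eqF// ltr_pwDl ?sqr_ge0.
- by move=> x /=; rewrite sqrrN.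
rewrite -set_itvcy (@ge0_continuous_FTC2y _ _ (@atan R) _ (pi / 2)).
- by rewrite atan0 sube0 -EFinM; congr EFin; field.
- by move=> x _; rewrite invr_ge0 addr_ge0 ?sqr_ge0.
- apply: continuous_subspaceT => x; dcont; by rewrite gt_eqF// ltr_pwDl ?sqr_ge0.
- exact: cvgy_atan.
- by move=> x _; case: (is_derive1_atan x).
- exact/cvg_at_right_filter/continuous_atan.
- by move=> x _; rewrite derive1E; case: (is_derive1_atan x).
Qed.

(** The substitution x = y + e s turns the kernel into the fixed Cauchy density; letting e tend to 0
    then only moves the argument of f. *)
Lemma ge0_integral_poisson (f : R -> R) y : measurable_fun setT f -> (forall x, 0 <= f x) ->
  (\int[mu]_x (f x * poisson (y - x))%:E = \int[mu]_s (f (y + e * s) * (1 + s ^+ 2)^-1)%:E)%E.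
Proof.
move=> mf f0.
have mp : measurable_fun setT (fun x : R => poisson (y - x)).
  apply: (measurableT_comp (f := poisson)); first exact: continuous_measurable_fun continuous_poisson.
  by apply: measurable_funB.
rewrite (ge0_integral_affine y e0).
- rewrite -ge0_integralZl//.
  + apply: eq_integral => s _; rewrite -EFinM; congr EFin.
    rewrite addrC mulrCA; congr (_ * _).
    have s0 : 1 + s ^+ 2 != 0 by rewrite gt_eqF// ltr_pwDl ?sqr_ge0.
    have e1 := lt0r_neq0 e0.
    have s1 : e ^+ 2 + (y - (e * s + y)) ^+ 2 != 0 by exact: den.
    have -> : y - (y + e * s) = - (e * s) by ring.
    rewrite poissonN /poisson exprMn.
    have -> : e ^+ 2 + e ^+ 2 * s ^+ 2 = e ^+ 2 * (1 + s ^+ 2) by ring.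
    by field; rewrite e1 s0.
  + apply/measurable_EFinP; apply: measurable_funM.
    * apply: (measurableT_comp mf); apply: measurable_funD => //; apply: measurable_funM => //.
    * apply: (measurableT_comp mp); apply: measurable_funD => //; apply: measurable_funM => //.
  + by move=> s _; rewrite lee_fin mulr_ge0 ?poisson_ge0.
  + by rewrite lee_fin ltW.
- by apply/measurable_EFinP; apply: measurable_funM.
- by move=> x; rewrite lee_fin mulr_ge0 ?poisson_ge0.
Qed.

Lemma ge0_integral_poissonT y : (\int[mu]_x (poisson (y - x))%:E = (pi : R)%:E)%E.
Proof.
under eq_integral do rewrite -[poisson _]mul1r.
rewrite (ge0_integral_poisson y (f := cst 1))//.
by rewrite -ge0_integral_cauchy; apply: eq_integral => s _; rewrite mul1r.
Qed.

End PoissonKernel.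

Section FourierTransform.
Variable R : realType.
Local Notation mu := (@lebesgue_measure R).
Local Notation mR := (measurableTypeR R).
Implicit Types (g h : R -> R).

Definition ftrans h g (z : R) : R := \int[mu]_y (g y * h (z * y)).

(** The squared modulus of the Fourier transform of the real function [g]. *)
Definition spec g (z : R) : R := ftrans cos g z ^+ 2 + ftrans sin g z ^+ 2.

Definition unit_wave h := continuous h /\ forall x, `|h x| <= 1.

Lemma unit_wave_cos : unit_wave (@cos R).
Proof.
split; first exact: continuous_cos.
by move=> x; rewrite ler_norml cos_geN1 cos_le1.
Qed.

Lemma unit_wave_sin : unit_wave (@sin R).
Proof.
split; first exact: continuous_sin.
by move=> x; rewrite ler_norml sin_geN1 sin_le1.
Qed.

Lemma measurable_waveM h : unit_wave h -> measurable_fun setT (fun z : R * R => h (z.1 * z.2)).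
Proof.
move=> [ch _]; apply: (measurableT_comp (f := h)); first exact: continuous_measurable_fun.
exact: measurable_funM.
Qed.

Lemma integrable_wave h g z : unit_wave h -> mu.-integrable setT (EFin \o g) ->
  mu.-integrable setT (EFin \o (fun y => g y * h (z * y))).
Proof.
move=> [ch h1] ig; apply: (integrableM_bounded (c := 1)) => //.
apply: (measurableT_comp (f := h)); first exact: continuous_measurable_fun.
exact: measurable_funM.
Qed.

Lemma continuous_ftrans h g : unit_wave h -> mu.-integrable setT (EFin \o g) ->
  continuous (ftrans h g).
Proof.
move=> hh ig z.
have := @continuity_under_integral _ _ _ mu (fun z y => g y * h (z * y)) setT measurableT (z - 1) (z + 1) _ _ (fun y => `|g y|) _ _.
apply.
- by move=> x _; exact: integrable_wave.
- apply: aeW => y _ x _ /=.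
  have cm : {for x, continuous (fun x : R => x * y)} by dcont.
  have ch : {for x, continuous (fun x : R => h (x * y))}.
    by apply: (continuous_comp cm); exact: hh.1.
  exact: (@cvgM _ _ _ _ _ _ (g y) _ (cvg_cst _) ch).
- exact: integrable_norm.
- by move=> x _; apply: aeW => y _; rewrite normrM ler_piMr// hh.2.
- by rewrite inE/= in_itv/= ltrBlDr !ltrDl ltr01.
Qed.

Lemma ftrans_le h g z : unit_wave h -> mu.-integrable setT (EFin \o g) ->
  `|ftrans h g z| <= \int[mu]_y `|g y|.
Proof.
move=> hh ig; rewrite (le_trans (le_normr_Rintegral _ _))//; first exact: integrable_wave.
apply: le_Rintegral => //.
- by apply: integrable_norm; exact: integrable_wave.
- exact: integrable_norm.
- by move=> y _; rewrite normrM ler_piMr// hh.2.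
Qed.

(** Two applications of Fubini, one for each factor of the square; the Abel factor supplies the
    integrability in z. *)
Lemma ftrans_abel h g (e : R) (k : R -> R -> R) : 0 < e -> unit_wave h ->
  mu.-integrable setT (EFin \o g) ->
  (forall y y', \int[mu]_z (abel e z * h (z * y) * h (z * y')) = k y y') ->
  mu.-integrable setT (EFin \o (fun z => abel e z * ftrans h g z ^+ 2)) /\
  \int[mu]_z (abel e z * ftrans h g z ^+ 2) =
    \int[mu]_y (g y * \int[mu]_y' (g y' * k y y')).
Proof.
move=> e0 hh ig hk.
have ia := integrable_abel e0.
have mf : measurable_fun setT (ftrans h g).
  by apply: continuous_measurable_fun; exact: continuous_ftrans.
have iaf : mu.-integrable setT (EFin \o (fun z => abel e z * ftrans h g z)).
  by apply: (integrableM_bounded (c := \int[mu]_y `|g y|)) => // x; exact: ftrans_le.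
split.
  rewrite (_ : _ \o _ = EFin \o (fun z => abel e z * ftrans h g z * ftrans h g z)); last first.
    by apply/funext => z /=; rewrite expr2 mulrA.
  by apply: (integrableM_bounded (c := \int[mu]_y `|g y|)) => // x; exact: ftrans_le.
transitivity (\int[mu]_z (abel e z * ftrans h g z * \int[mu]_y (g y * h (z * y)))).
  by apply: eq_Rintegral => z _; rewrite expr2 mulrA.
rewrite (Rfubini_kernel (k := fun z : mR * mR => h (z.1 * z.2)) (c := 1) iaf ig).
- apply: eq_Rintegral => y _; congr (_ * _).
  transitivity (\int[mu]_z (abel e z * h (z * y) * \int[mu]_y (g y * h (z * y)))).
    by apply: eq_Rintegral => z _; rewrite /= mulrAC.
  rewrite (Rfubini_kernel (k := fun z : mR * mR => h (z.1 * z.2)) (c := 1) _ ig).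
  + by apply: eq_Rintegral => y' _; rewrite hk.
  + apply: (integrableM_bounded (c := 1)) => //; last by move=> x; exact: hh.2.
    apply: (measurableT_comp (f := h)); first exact: continuous_measurable_fun hh.1.
    exact: measurable_funM.
  + exact: measurable_waveM.
  + by move=> z; exact: hh.2.
- exact: measurable_waveM.
- by move=> z; exact: hh.2.
Qed.

Lemma integrable_poisson_conv g (e : R) (y s : R) : 0 < e ->
  mu.-integrable setT (EFin \o g) ->
  mu.-integrable setT (EFin \o (fun y' => g y' * poisson e (y + s * y'))).
Proof.
move=> e0 ig; apply: (integrableM_bounded (c := e^-1)) => //.
- apply: (measurableT_comp (f := poisson e)); first exact: continuous_measurable_fun (continuous_poisson e0).
  by apply: measurable_funD => //; exact: measurable_funM.
- by move=> x; rewrite ger0_norm ?poisson_ge0// poisson_le.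
Qed.

Lemma integrable_bilinear g (k : R * R -> R) (c : R) : mu.-integrable setT (EFin \o g) ->
  measurable_fun setT k -> (forall z, `|k z| <= c) ->
  mu.-integrable setT (EFin \o (fun y => g y * \int[mu]_y' (g y' * k (y, y')))).
Proof.
move=> ig mk kc; have := @Rfubini _ _ _ _ _ mu mu _ (integrable_prodM ig ig mk kc).
move=> [[ih _] _]; move: ih; congr (_.-integrable _ _).
apply/funext => y /=; rewrite -RintegralZl//.
  by congr EFin; apply: eq_Rintegral => y' _; rewrite mulrA.
by apply: (integrableM_bounded (c := c) _ _ ig) => //; apply: measurableT_comp.
Qed.

Lemma spec_abel g (e : R) : 0 < e -> mu.-integrable setT (EFin \o g) ->
  mu.-integrable setT (EFin \o (fun z => abel e z * spec g z)) /\
  \int[mu]_z (abel e z * spec g z) =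
    \int[mu]_y (g y * \int[mu]_y' (g y' * poisson e (y - y'))).
Proof.
move=> e0 ig.
have ic a := integrable_abel_cos e0 a.
(* The cosine-cosine kernel is [k false] and the sine-sine kernel is [k true]; the terms in y + y'
   cancel in their sum. *)
pose k (s : bool) (y y' : R) := 2^-1 * (poisson e (y - y') + (-1) ^+ s * poisson e (y + y')).
have kc y y' : \int[mu]_z (abel e z * cos (z * y) * cos (z * y')) = k false y y'.
  rewrite /k expr0 mul1r -!(Rintegral_abel_cos e0) -RintegralD// -RintegralZl//; last exact: integrableRD.
  by apply: eq_Rintegral => z _; rewrite !(mulrC z) mulrBl mulrDl cosB cosD; field.
have ks y y' : \int[mu]_z (abel e z * sin (z * y) * sin (z * y')) = k true y y'.
  rewrite /k expr1 mulN1r -!(Rintegral_abel_cos e0) -RintegralB// -RintegralZl//; last exact: integrableRB.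
  by apply: eq_Rintegral => z _; rewrite !(mulrC z) mulrBl mulrDl cosB cosD; field.
have [i1 e1] := ftrans_abel e0 unit_wave_cos ig kc.
have [i2 e2] := ftrans_abel e0 unit_wave_sin ig ks.
have eqs : (fun z => abel e z * spec g z) = (fun z => abel e z * ftrans cos g z ^+ 2 + abel e z * ftrans sin g z ^+ 2).
  by apply/funext => z; rewrite /spec mulrDr.
split; first by rewrite eqs; exact: integrableRD.
rewrite eqs (RintegralD measurableT i1 i2) e1 e2.
have mpz (t : R) : measurable_fun setT (fun z : R * R => poisson e (z.1 + t * z.2)).
  apply: (measurableT_comp (f := poisson e)); first exact: continuous_measurable_fun (continuous_poisson e0).
  by apply: measurable_funD => //; exact: measurable_funM.
have mk s : measurable_fun setT (fun z : R * R => k s z.1 z.2).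
  apply: measurable_funM => //; apply: measurable_funD.
    by have := mpz (-1); under eq_fun do rewrite mulN1r.
  by apply: measurable_funM => //; have := mpz 1; under eq_fun do rewrite mul1r.
have kb s (z : R * R) : `|k s z.1 z.2| <= e^-1.
  rewrite normrM gtr0_norm ?invr_gt0// ler_pdivrMl//.
  have [p1 p2] := (poisson_ge0 e0 (z.1 - z.2), poisson_le e0 (z.1 - z.2)).
  have [p3 p4] := (poisson_ge0 e0 (z.1 + z.2), poisson_le e0 (z.1 + z.2)).
  move: p1 p2 p3 p4; move: (poisson _ _) (poisson _ _) => p q.
  clear; move: e^-1 => u p1 p2 p3 p4.
  by case: s; rewrite ?expr0 ?expr1 ler_norml; apply/andP; split; lra.
have ib s := integrable_bilinear ig (mk s) (kb s).
have ik s y : mu.-integrable setT (EFin \o (fun y' => g y' * k s y y')).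
  apply: (integrableM_bounded (c := e^-1)) => //; last by move=> y'; exact: (kb s (y, y')).
  have -> : k s y = (fun z : R * R => k s z.1 z.2) \o pair y by [].
  exact: measurableT_comp.
rewrite -(RintegralD measurableT (ib false) (ib true)).
apply: eq_Rintegral => y _; rewrite -mulrDr; congr (_ * _).
rewrite -(RintegralD measurableT (ik false y) (ik true y)).
by apply: eq_Rintegral => y' _; rewrite /k expr0 expr1; field.
Qed.

(** Polarization, 2 g(y) g(y') = g(y)^2 + g(y')^2 - (g(y) - g(y'))^2, together with the mass pi of
    the kernel in either variable. The defect is nonnegative, which is all that the upper half of
    Plancherel's formula needs. *)
Lemma spec_abel_identity g (e : R) : 0 < e -> mu.-integrable setT (EFin \o g) ->
  mu.-integrable setT (EFin \o (fun y => g y ^+ 2)) ->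
  (\int[mu]_z (abel e z * spec g z)%:E +
   2^-1%:E * \int[mu]_y \int[mu]_y' ((g y - g y') ^+ 2 * poisson e (y - y'))%:E
   = pi%:E * \int[mu]_y (g y ^+ 2)%:E)%E.
Proof.
move=> e0 ig ig2.
have mg : measurable_fun setT g by case/integrableP: ig => /measurable_EFinP.
have mg2 : measurable_fun setT (fun y => g y ^+ 2) by exact: measurable_funX.
have mp := @measurable_poissonB R e e0.
have p0 x : 0 <= poisson e x by rewrite poisson_ge0.
have [ia ea] := spec_abel e0 ig.
pose P := (mu \x mu)%E.
have i1 : P.-integrable setT (EFin \o (fun z : R * R => g z.1 * g z.2 * poisson e (z.1 - z.2))).
  by apply: (integrable_prodM (c := e^-1)) => // z; rewrite ger0_norm// poisson_le.
have mF2 : measurable_fun setT (fun z : R * R => g z.1 ^+ 2 * poisson e (z.1 - z.2)).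
  by apply: measurable_funM => //; exact: (measurableT_comp (f := fun y => g y ^+ 2) mg2).
have mF3 : measurable_fun setT (fun z : R * R => g z.2 ^+ 2 * poisson e (z.1 - z.2)).
  by apply: measurable_funM => //; exact: (measurableT_comp (f := fun y => g y ^+ 2) mg2).
have F0 (a : R) : 0 <= a -> forall x, (0 <= (a * poisson e x)%:E)%E by move=> a0 x; rewrite lee_fin mulr_ge0.
have e2 : (\int[P]_z (g z.1 ^+ 2 * poisson e (z.1 - z.2))%:E = pi%:E * \int[mu]_y (g y ^+ 2)%:E)%E.
  rewrite fubini_tonelli1//=; [|exact/measurable_EFinP|by move=> z; rewrite F0// sqr_ge0].
  rewrite -ge0_integralZl//; last 3 first.
  - exact/measurable_EFinP.
  - by move=> y _; rewrite lee_fin sqr_ge0.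
  - by rewrite lee_fin pi_ge0.
  apply: eq_integral => y _; rewrite /fubini_F/=.
  under eq_integral do rewrite EFinM.
  rewrite ge0_integralZl//; first by rewrite ge0_integral_poissonT// muleC.
  - by apply/measurable_EFinP; apply: (measurableT_comp (f := fun z : R * R => poisson e (z.1 - z.2)) _ (g := pair y)).
  - by move=> x _; rewrite lee_fin.
  - by rewrite lee_fin sqr_ge0.
have e3 : (\int[P]_z (g z.2 ^+ 2 * poisson e (z.1 - z.2))%:E = pi%:E * \int[mu]_y (g y ^+ 2)%:E)%E.
  rewrite fubini_tonelli2//=; [|exact/measurable_EFinP|by move=> z; rewrite F0// sqr_ge0].
  rewrite -ge0_integralZl//; last 3 first.
  - exact/measurable_EFinP.
  - by move=> y _; rewrite lee_fin sqr_ge0.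
  - by rewrite lee_fin pi_ge0.
  apply: eq_integral => y _; rewrite /fubini_G/=.
  under eq_integral do rewrite EFinM.
  rewrite ge0_integralZl//.
  - rewrite -(ge0_integral_poissonT e0 y) muleC; congr (_ * _)%E; apply: eq_integral => x _.
    by rewrite -poissonN opprB.
  - by apply/measurable_EFinP; apply: (measurableT_comp (f := fun z : R * R => poisson e (z.1 - z.2)) _ (g := pair^~ y)).
  - by move=> x _; rewrite lee_fin.
  - by rewrite lee_fin sqr_ge0.
have fin2 : (pi%:E * \int[mu]_y (g y ^+ 2)%:E < +oo)%E.
  by rewrite -EFin_Rintegral// -EFinM ltry.
have i2 : P.-integrable setT (EFin \o (fun z : R * R => g z.1 ^+ 2 * poisson e (z.1 - z.2))).
  by apply: ge0_fin_integrable => //; [move=> z; rewrite mulr_ge0 ?sqr_ge0|rewrite e2].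
have i3 : P.-integrable setT (EFin \o (fun z : R * R => g z.2 ^+ 2 * poisson e (z.1 - z.2))).
  by apply: ge0_fin_integrable => //; [move=> z; rewrite mulr_ge0 ?sqr_ge0|rewrite e3].
have i4 : P.-integrable setT (EFin \o (fun z : R * R => (g z.1 - g z.2) ^+ 2 * poisson e (z.1 - z.2))).
  rewrite (_ : (fun z => _) = fun z : R * R => (g z.1 ^+ 2 * poisson e (z.1 - z.2) + g z.2 ^+ 2 * poisson e (z.1 - z.2)) - 2 * (g z.1 * g z.2 * poisson e (z.1 - z.2))).
    by apply: integrableRB; [exact: integrableRD|exact: integrableRZ].
  by apply/funext => z; ring.
have -> : (\int[mu]_y \int[mu]_y' ((g y - g y') ^+ 2 * poisson e (y - y'))%:E =
   \int[P]_z ((g z.1 - g z.2) ^+ 2 * poisson e (z.1 - z.2))%:E)%E.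
  rewrite fubini_tonelli1//=; first by case/integrableP: i4.
  by move=> z; rewrite F0// sqr_ge0.
rewrite -!EFin_Rintegral// ea.
have -> : \int[mu]_y (g y * \int[mu]_y' (g y' * poisson e (y - y'))) = \int[P]_z (g z.1 * g z.2 * poisson e (z.1 - z.2)).
  have [[_ <-] _] := @Rfubini _ _ _ _ _ mu mu _ i1.
  apply: eq_Rintegral => y _; rewrite -RintegralZl//.
    by apply: eq_Rintegral => y' _; rewrite mulrA.
  have := integrable_poisson_conv y (-1) e0 ig; congr (_.-integrable _ _).
  by apply/funext => y' /=; rewrite mulN1r.
have -> : \int[P]_z ((g z.1 - g z.2) ^+ 2 * poisson e (z.1 - z.2)) =
   \int[P]_z (g z.1 ^+ 2 * poisson e (z.1 - z.2)) + \int[P]_z (g z.2 ^+ 2 * poisson e (z.1 - z.2))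
   - 2 * \int[P]_z (g z.1 * g z.2 * poisson e (z.1 - z.2)).
  rewrite -RintegralD// -RintegralZl// -RintegralB//; last 2 first.
  - exact: integrableRD.
  - exact: integrableRZ.
  by apply: eq_Rintegral => z _; ring.
have := e2; rewrite -!EFin_Rintegral// -EFinM => -[->].
have := e3; rewrite -!EFin_Rintegral// -EFinM => -[->].
rewrite -!EFinM -EFinD; congr EFin.
by field.
Qed.

Lemma spec_ge0 g z : 0 <= spec g z.
Proof. by rewrite addr_ge0 ?sqr_ge0. Qed.

Lemma continuous_spec g : mu.-integrable setT (EFin \o g) -> continuous (spec g).
Proof.
move=> ig z; have hc h : unit_wave h -> {for z, continuous (fun z => ftrans h g z ^+ 2)}.
  move=> hh; have h1 : {for z, continuous (ftrans h g)} by exact: continuous_ftrans.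
  rewrite (_ : (fun z => _) = ftrans h g \* ftrans h g); last by apply/funext => x; rewrite expr2.
  exact: (cvgM h1 h1).
exact: cvgD (hc _ unit_wave_cos) (hc _ unit_wave_sin).
Qed.

Lemma measurable_spec g : mu.-integrable setT (EFin \o g) -> measurable_fun setT (spec g).
Proof. by move=> ig; apply: continuous_measurable_fun; exact: continuous_spec. Qed.

Lemma specN g z : mu.-integrable setT (EFin \o g) -> spec g (- z) = spec g z.
Proof.
move=> ig; rewrite /spec; congr (_ ^+ 2 + _).
  by apply: eq_Rintegral => y _; rewrite mulNr cosN.
have -> : ftrans sin g (- z) = -1 * ftrans sin g z; last by rewrite mulN1r sqrrN.
rewrite -RintegralZl//; last exact: integrable_wave unit_wave_sin ig.
by apply: eq_Rintegral => y _; rewrite mulNr sinN mulN1r mulrN.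
Qed.

Let iota (n : nat) : R := n.+1%:R^-1.

Let iota_gt0 n : 0 < iota n.
Proof. by rewrite invr_gt0. Qed.

Let iota_cvg0 : iota n @[n --> \oo] --> 0.
Proof. exact: cvg_harmonic. Qed.

Lemma abel_le1 (e z : R) : 0 < e -> abel e z <= 1.
Proof.
move=> e0; rewrite /abel; case: ifPn => // z0.
by rewrite -expR0 ler_expR oppr_le0 mulr_ge0// ltW.
Qed.

Lemma spec_half_le g : mu.-integrable setT (EFin \o g) ->
  mu.-integrable setT (EFin \o (fun y => g y ^+ 2)) ->
  (\int[mu]_(z in `[0%R, +oo[) (spec g z)%:E <= pi%:E * \int[mu]_y (g y ^+ 2)%:E)%E.
Proof.
move=> ig ig2.
have ma n : measurable_fun setT (abel (iota n)).
  by case/integrableP : (integrable_abel (iota_gt0 n)) => /measurable_EFinP.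
pose f n z := (abel (iota n) z * spec g z)%:E.
have mf n : measurable_fun setT (f n).
  by apply/measurable_EFinP; apply: measurable_funM => //; exact: measurable_spec.
have f0 n z : setT z -> (0 <= f n z)%E by move=> _; rewrite lee_fin mulr_ge0 ?abel_ge0 ?spec_ge0.
have fle n : (\int[mu]_z f n z <= pi%:E * \int[mu]_y (g y ^+ 2)%:E)%E.
  rewrite -(spec_abel_identity (iota_gt0 n) ig ig2) leeDl// mule_ge0 ?lee_fin ?invr_ge0//.
  apply: integral_ge0 => y _; apply: integral_ge0 => y' _.
  by rewrite lee_fin mulr_ge0 ?sqr_ge0 ?poisson_ge0.
have cf z : f n z @[n --> \oo] --> (((EFin \o spec g) \_ `[0%R, +oo[) z).
  rewrite patchE mem_setE in_itv/= andbT /f /abel; case: ifPn => z0; last first.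
    by under eq_fun do rewrite mul0r; exact: cvg_cst.
  apply: cvg_EFin; first exact: nearW.
  rewrite (_ : _ \o _ = (fun n => expR (- (iota n * z)) * spec g z)) // -[X in _ --> X]mul1r.
  apply: cvgMr_tmp; rewrite -expR0; apply: continuous_cvg; first exact: continuous_expR.
  by rewrite -oppr0; apply: cvgN; rewrite -(mul0r z); apply: cvgMr_tmp.
have h := fatou_le (mu := mu) mf (fun n z => f0 n z I) cf fle.
by rewrite integral_mkcond.
Qed.

Lemma integrable_spec_half g : mu.-integrable setT (EFin \o g) ->
  mu.-integrable setT (EFin \o (fun y => g y ^+ 2)) ->
  mu.-integrable `[0, +oo[ (EFin \o spec g).
Proof.
move=> ig ig2; apply/integrableP; split.
  by apply/measurable_EFinP; apply: measurable_funTS; exact: measurable_spec.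
under eq_integral do rewrite /= ger0_norm ?spec_ge0//.
by rewrite (le_lt_trans (spec_half_le ig ig2))// -EFin_Rintegral// -EFinM ltry.
Qed.

Lemma ftransD h g1 g2 (a : R) z : unit_wave h -> mu.-integrable setT (EFin \o g1) ->
  mu.-integrable setT (EFin \o g2) ->
  ftrans h (fun y => g1 y - a * g2 y) z = ftrans h g1 z - a * ftrans h g2 z.
Proof.
move=> hh i1 i2; rewrite /ftrans -RintegralZl//; last exact: integrable_wave.
rewrite -RintegralB//; last 2 first.
- exact: integrable_wave.
- by apply: integrableRZ; exact: integrable_wave.
by apply: eq_Rintegral => y _; ring.
Qed.

(** Young's inequality with a free parameter in place of the triangle inequality in L2; a tends to 0
    at the end of [plancherel_half_closure]. *)
Lemma spec_le_perturb c g (a : R) z : 0 < a -> mu.-integrable setT (EFin \o g) ->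
  mu.-integrable setT (EFin \o c) ->
  spec c z <= (1 + a) * spec g z + (1 + a^-1) * spec (fun y => g y - 1 * c y) z.
Proof.
move=> a0 ig ic.
have sq (x y : R) : x ^+ 2 <= (1 + a) * y ^+ 2 + (1 + a^-1) * (y - 1 * x) ^+ 2.
  rewrite -subr_ge0.
  have -> : (1 + a) * y ^+ 2 + (1 + a^-1) * (y - 1 * x) ^+ 2 - x ^+ 2 = a^-1 * (x - (1 + a) * y) ^+ 2.
    by field; rewrite gt_eqF.
  by rewrite mulr_ge0 ?sqr_ge0// invr_ge0 ltW.
rewrite /spec !ftransD//; [|exact: unit_wave_sin|exact: unit_wave_cos].
move: (sq (ftrans cos c z) (ftrans cos g z)) (sq (ftrans sin c z) (ftrans sin g z)).
by rewrite !mulrDr => h1 h2; rewrite addrACA lerD.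
Qed.

Definition sqint g : R := \int[mu]_y (g y ^+ 2).

Definition spec_half g : R := \int[mu]_(z in `[0, +oo[) spec g z.

Lemma spec_half_ler g : mu.-integrable setT (EFin \o g) ->
  mu.-integrable setT (EFin \o (fun y => g y ^+ 2)) -> spec_half g <= pi * sqint g.
Proof.
move=> ig ig2; have := spec_half_le ig ig2.
rewrite -EFin_Rintegral// -EFinM -lee_fin /spec_half /Rintegral fineK//.
exact: integrable_fin_num (integrable_spec_half ig ig2).
Qed.

Lemma integrable_poisson (e y : R) : 0 < e -> mu.-integrable setT (EFin \o (fun y' => poisson e (y - y'))).
Proof.
move=> e0; apply: ge0_fin_integrable.
- exact: (measurableT_comp (f := fun z : R * R => poisson e (z.1 - z.2)) (measurable_poissonB e0) (g := pair y)).
- by move=> x; rewrite poisson_ge0.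
- by rewrite ge0_integral_poissonT// ltry.
Qed.

Lemma Rintegral_poissonT (e y : R) : 0 < e -> \int[mu]_y' (poisson e (y - y')) = pi.
Proof. by move=> e0; rewrite /Rintegral ge0_integral_poissonT. Qed.

Lemma integrable_cauchy : mu.-integrable setT (EFin \o (fun s : R => (1 + s ^+ 2)^-1)).
Proof.
apply: ge0_fin_integrable.
- by apply: continuous_measurable_fun => x; dcont; rewrite gt_eqF// ltr_pwDl ?sqr_ge0.
- by move=> x; rewrite invr_ge0 addr_ge0 ?sqr_ge0.
- by rewrite ge0_integral_cauchy ltry.
Qed.

(** The Poisson integrals of a bounded continuous function converge pointwise to pi times it, by
    dominated convergence against the Cauchy density. Pairing them with c gives the lower bound,
    since the Abel factor is at most 1. *)
Lemma plancherel_half_continuous (c : R -> R) (b : R) : continuous c -> (forall y, `|c y| <= b) ->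
  mu.-integrable setT (EFin \o c) ->
  mu.-integrable setT (EFin \o (fun y => c y ^+ 2)) ->
  pi * sqint c <= spec_half c.
Proof.
move=> cc cb ic ic2.
have b0 : 0 <= b by rewrite (le_trans _ (cb 0)).
have mc : measurable_fun setT c by exact: continuous_measurable_fun.
pose P n y := \int[mu]_y' (c y' * poisson (iota n) (y - y')).
pose F n y := c y * P n y.
have icp n y : mu.-integrable setT (EFin \o (fun y' => c y' * poisson (iota n) (y - y'))).
  have := integrable_poisson_conv y (-1) (iota_gt0 n) ic; congr (_.-integrable _ _).
  by apply/funext => y' /=; rewrite mulN1r.
have Pcvg y : P n y @[n --> \oo] --> pi * c y.
  pose D n := \int[mu]_s (`|c (y + iota n * s) - c y| * (1 + s ^+ 2)^-1).
  have Dcvg : D n @[n --> \oo] --> 0.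
    have -> : (0 : R) = \int[mu]_s (cst 0 s : R) by rewrite Rintegral_cst// mul0r.
    apply: (@Rdominated_cvg _ _ _ mu _ _ (fun s => 2 * b * (1 + s ^+ 2)^-1)).
    - move=> n; apply: measurable_funM; last by case/integrableP: integrable_cauchy => /measurable_EFinP.
      apply: measurableT_comp => //; apply: measurable_funB => //.
      by apply: (measurableT_comp mc); apply: measurable_funD => //; exact: measurable_funM.
    - exact: measurable_cst.
    - move=> s; rewrite -(mul0r (1 + s ^+ 2)^-1); apply: cvgMr_tmp.
      rewrite -(normr0 R); apply: cvg_norm; rewrite -[X in _ --> X](subrr (c y)); apply: cvgB; last exact: cvg_cst.
      apply: continuous_cvg; first exact: cc.
      rewrite -[X in _ --> X]addr0; apply: cvgD; first exact: cvg_cst.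
      by rewrite -(mul0r s); apply: cvgMr_tmp.
    - move=> n s; rewrite normrM normr_id [X in _ * X]ger0_norm ?invr_ge0 ?addr_ge0 ?sqr_ge0//.
      rewrite ler_wpM2r ?invr_ge0 ?addr_ge0 ?sqr_ge0// (le_trans (ler_normB _ _))//.
      by rewrite mulr_natl mulr2n lerD.
    - by apply: integrableRZ; exact: integrable_cauchy.
  have PD n : `|pi * c y - P n y| <= D n.
    have ip := integrable_poisson y (iota_gt0 n).
    have -> : pi * c y - P n y = \int[mu]_y' ((c y - c y') * poisson (iota n) (y - y')).
      rewrite -(Rintegral_poissonT y (iota_gt0 n)) mulrC -RintegralZl// -RintegralB//; last exact: integrableRZ.
      by apply: eq_Rintegral => y' _; rewrite mulrBl.
    have id : mu.-integrable setT (EFin \o (fun y' => (c y - c y') * poisson (iota n) (y - y'))).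
      rewrite (_ : (fun y' => _) = (fun y' => c y * poisson (iota n) (y - y') - c y' * poisson (iota n) (y - y'))).
        by apply: integrableRB => //; exact: integrableRZ.
      by apply/funext => y'; rewrite mulrBl.
    apply: (le_trans (le_normr_Rintegral measurableT id)).
    rewrite /D /Rintegral -(@ge0_integral_poisson _ _ (iota_gt0 n) (fun y' => `|c y' - c y|)).
    - rewrite le_eqVlt; apply/orP; left; apply/eqP; congr fine; apply: eq_integral => y' _.
      by rewrite normrM distrC (ger0_norm (poisson_ge0 _ _)).
    - by apply: measurableT_comp => //; apply: measurable_funB.
    - by [].
  apply/subr_cvg0; apply: norm_cvg0.
  apply: (squeeze_cvgr _ (cvg_cst 0) Dcvg).
  by apply: nearW => n; rewrite normr_ge0/= distrC PD.
have Pb n y : `|P n y| <= b * pi.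
  apply: (le_trans (le_normr_Rintegral measurableT (icp n y))).
  rewrite -(Rintegral_poissonT y (iota_gt0 n)) -RintegralZl//; last exact: integrable_poisson.
  apply: le_Rintegral => //.
  - exact: integrable_norm.
  - by apply: integrableRZ; exact: integrable_poisson.
  - by move=> x _; rewrite normrM (ger0_norm (poisson_ge0 _ _))// ler_wpM2r// poisson_ge0.
have Fcvg : \int[mu]_y F n y @[n --> \oo] --> \int[mu]_y (c y * (pi * c y)).
  apply: (@Rdominated_cvg _ _ _ mu _ _ (fun y => b * pi * `|c y|)).
  - move=> n; have ib : mu.-integrable setT (EFin \o F n).
      apply: (integrable_bilinear (c := (iota n)^-1) (k := fun z => poisson (iota n) (z.1 - z.2)) ic).
        exact: measurable_poissonB.
      by move=> z; rewrite ger0_norm ?poisson_ge0// poisson_le.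
    by case/integrableP: ib => /measurable_EFinP.
  - by apply: measurable_funM => //; exact: measurable_funM.
  - by move=> y; apply: cvgMl_tmp.
  - by move=> n y; rewrite normrM mulrC ler_wpM2r.
  - by apply: integrableRZ; exact: integrable_norm.
have le_half n : \int[mu]_y F n y <= spec_half c.
  have [ia ea] := spec_abel (iota_gt0 n) ic.
  rewrite /F /P -ea /spec_half [leRHS]Rintegral_mkcond.
  have := integrable_spec_half ic ic2 => /(integrable_mkcond _ _).1 ih.
  apply: le_Rintegral => //.
    by move: (ih (measurable_itv _)); congr (_.-integrable _ _); rewrite restrict_EFin.
  move=> z _; rewrite patchE mem_setE in_itv/= andbT /abel; case: ifPn => z0; last by rewrite mul0r.
  rewrite ler_piMl ?spec_ge0//.
  by have := abel_le1 z (iota_gt0 n); rewrite /abel z0.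
have -> : pi * sqint c = \int[mu]_y (c y * (pi * c y)).
  by rewrite /sqint -RintegralZl//; apply: eq_Rintegral => y _; ring.
rewrite -(cvg_lim _ Fcvg)//; apply: limr_le; first by apply/cvg_ex; eexists; exact: Fcvg.
exact: nearW.
Qed.

(** The lower bound passes to L2 limits because the upper bound, already known for every function,
    controls the spectrum of the differences [g - c n]. *)
Lemma plancherel_half_closure g (c : nat -> R -> R) :
  mu.-integrable setT (EFin \o g) ->
  mu.-integrable setT (EFin \o (fun y => g y ^+ 2)) ->
  (forall n, mu.-integrable setT (EFin \o c n)) ->
  (forall n, mu.-integrable setT (EFin \o (fun y => c n y ^+ 2))) ->
  (forall n, pi * sqint (c n) <= spec_half (c n)) ->
  sqint (fun y => g y - 1 * c n y) @[n --> \oo] --> 0 ->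
  pi * sqint g <= spec_half g.
Proof.
move=> ig ig2 ic ic2 hc hcvg.
pose d n y := g y - 1 * c n y.
have id n : mu.-integrable setT (EFin \o d n).
  by apply: integrableRB => //; exact: integrableRZ.
have id2 n : mu.-integrable setT (EFin \o (fun y => d n y ^+ 2)).
  have i4 : mu.-integrable setT (EFin \o (fun y => 2 * g y ^+ 2 + 2 * c n y ^+ 2)).
    by apply: integrableRD; exact: integrableRZ.
  apply: (le_integrable _ _ _ i4) => //.
    apply/measurable_EFinP; apply: measurable_funX.
    by case/integrableP: (id n) => /measurable_EFinP.
  have h0 y : 0 <= 2 * g y ^+ 2 + 2 * c n y ^+ 2 by apply: addr_ge0; apply: mulr_ge0 => //; exact: sqr_ge0.
  move=> y _; rewrite /= lee_fin (ger0_norm (sqr_ge0 _)) (ger0_norm (h0 y)).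
  rewrite -subr_ge0 /d; have -> : 2 * g y ^+ 2 + 2 * c n y ^+ 2 - (g y - 1 * c n y) ^+ 2 = (g y + c n y) ^+ 2 by ring.
  exact: sqr_ge0.
have key (a : R) n : 0 < a -> pi * sqint g <= (1 + a) ^+ 2 * spec_half g + (1 + (1 + a)) * (1 + a^-1) * pi * sqint (d n).
  move=> a0.
  have s1 : sqint g <= (1 + a) * sqint (c n) + (1 + a^-1) * sqint (d n).
    rewrite /sqint -!RintegralZl// -RintegralD//; try exact: integrableRZ.
    apply: le_Rintegral => //; first by apply: integrableRD; exact: integrableRZ.
    move=> y _; rewrite -subr_ge0 /d.
    have -> : (1 + a) * c n y ^+ 2 + (1 + a^-1) * (g y - 1 * c n y) ^+ 2 - g y ^+ 2 = a^-1 * (g y - (1 + a) * c n y) ^+ 2.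
      by field; rewrite gt_eqF.
    by rewrite mulr_ge0 ?sqr_ge0// invr_ge0 ltW.
  have s2 : spec_half (c n) <= (1 + a) * spec_half g + (1 + a^-1) * spec_half (d n).
    have hi f := integrable_spec_half (g := f).
    have mitv : measurable (`[0%R, +oo[%classic : set mR) by exact: measurable_itv.
    have iz f k : mu.-integrable setT (EFin \o f) -> mu.-integrable setT (EFin \o (fun y => f y ^+ 2)) ->
      mu.-integrable `[0, +oo[ (EFin \o (fun z => k * spec f z)).
      by move=> h1 h2; have := integrableZl mitv k (hi f h1 h2).
    have i12 := integrableD mitv (iz g (1 + a) ig ig2) (iz (d n) (1 + a^-1) (id n) (id2 n)).
    rewrite /spec_half -!RintegralZl//; try exact: hi.
    rewrite -RintegralD//; try exact: iz.
    apply: le_Rintegral => //; first exact: hi.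
    by move=> z _; exact: spec_le_perturb.
  have s3 := spec_half_ler (id n) (id2 n).
  have pi0 := pi_gt0 R.
  have a1 : 0 < a^-1 by rewrite invr_gt0.
  have s4 := hc n.
  move: s1 s2 s3 s4; clear -a0 pi0 a1.
  move: (sqint g) (sqint (c n)) (sqint (d n)) (spec_half g) (spec_half (c n)) (spec_half (d n)) (pi : R) pi0 a^-1 a1.
  move=> G C D JG JC JD p p0 u u0 s1 s2 s3 s4.
  have h1 : p * G <= (1 + a) * (p * C) + (1 + u) * (p * D).
    have := ler_wpM2l (ltW p0) s1; rewrite mulrDr => /le_trans; apply.
    by rewrite le_eqVlt; apply/orP; left; apply/eqP; ring.
  have h2 : (1 + a) * (p * C) <= (1 + a) * JC by rewrite ler_wpM2l// addr_ge0// ltW.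
  have h3 : (1 + a) * JC <= (1 + a) * ((1 + a) * JG + (1 + u) * JD) by rewrite ler_wpM2l// addr_ge0// ltW.
  have h4 : (1 + a) * ((1 + u) * JD) <= (1 + a) * ((1 + u) * (p * D)).
    by rewrite !ler_wpM2l// addr_ge0// ltW.
  apply: (le_trans h1); apply: (le_trans (lerD h2 (lexx _))); apply: (le_trans (lerD h3 (lexx _))).
  rewrite [X in X + _]mulrDr -addrA; apply: (le_trans (lerD (lexx _) (lerD h4 (lexx _)))).
  by rewrite le_eqVlt; apply/orP; left; apply/eqP; ring.
have key2 (a : R) : 0 < a -> pi * sqint g <= (1 + a) ^+ 2 * spec_half g.
  move=> a0; set k := (1 + (1 + a)) * (1 + a^-1) * pi.
  have cv : (1 + a) ^+ 2 * spec_half g + k * sqint (d n) @[n --> \oo] --> (1 + a) ^+ 2 * spec_half g.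
    rewrite -[X in _ --> X]addr0; apply: cvgD; first exact: cvg_cst.
    by rewrite -(mulr0 k); apply: cvgMl_tmp.
  rewrite -(cvg_lim _ cv)//; apply: limr_ge; first by apply/cvg_ex; eexists; exact: cv.
  by apply: nearW => n; exact: key.
have cv : (1 + iota n) ^+ 2 * spec_half g @[n --> \oo] --> spec_half g.
  rewrite -[X in _ --> X]mul1r; apply: cvgMr_tmp.
  have h : 1 + iota n @[n --> \oo] --> (1 + 0 : R) by apply: cvgD => //; exact: cvg_cst.
  have h2 := cvgM h h; rewrite addr0 mulr1 in h2.
  have e2 : (fun n => (1 + iota n) ^+ 2) = ((fun n => 1 + iota n) \* (fun n => 1 + iota n)).
    by apply/funext => n; rewrite expr2.
  by rewrite e2; exact: h2.
rewrite -(cvg_lim _ cv)//; apply: limr_ge; first by apply/cvg_ex; eexists; exact: cv.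
by apply: nearW => n; exact: key2.
Qed.

Let clip (n : nat) (x : R) : R := Order.max (- n%:R) (Order.min n%:R x).

Let clip_bound n x : `|clip n x| <= n%:R.
Proof.
by rewrite /clip ler_norml le_max lexx/= ge_max ge_min lexx/= andbT (@le_trans _ _ 0)// oppr_le0.
Qed.

Let clip_id n x : `|x| <= n%:R -> clip n x = x.
Proof. by rewrite ler_norml /clip => /andP[h1 h2]; rewrite min_r// max_r. Qed.

Let lip_max (a x y : R) : `|Order.max a x - Order.max a y| <= `|x - y|.
Proof.
have := ler_norm (x - y); have := ler_norm (y - x); rewrite distrC.
move: `|x - y| => d h1 h2.
by case: (leP a x) => a1; case: (leP a y) => a2; rewrite ler_norml; apply/andP; split; lra.
Qed.

Let lip_min (a x y : R) : `|Order.min a x - Order.min a y| <= `|x - y|.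
Proof.
have := ler_norm (x - y); have := ler_norm (y - x); rewrite distrC.
move: `|x - y| => d h1 h2.
by case: (leP a x) => a1; case: (leP a y) => a2; rewrite ler_norml; apply/andP; split; lra.
Qed.

Let lip_continuous (f : R -> R) : (forall x y, `|f x - f y| <= `|x - y|) -> continuous f.
Proof.
move=> hf x; apply/cvgrPdist_lt => e e0; near=> y.
rewrite (le_lt_trans (hf _ _))//; near: y; exact: cvgr_dist_lt.
Unshelve. all: by end_near. Qed.

Let clip_lip n x y : `|clip n x - clip n y| <= `|x - y|.
Proof. exact: le_trans (lip_max _ _ _) (lip_min _ _ _). Qed.

Let continuous_clip n : continuous (clip n).
Proof. exact: lip_continuous (clip_lip n). Qed.

Let trap (n : nat) (y : R) : R := Order.max 0 (Order.min 1 (n.+1%:R - `|y|)).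

Let trap01 n y : 0 <= trap n y <= 1.
Proof. by rewrite /trap le_max lexx/= ge_max ler01 ge_min lexx. Qed.

Let trap1 n y : `|y| <= n%:R -> trap n y = 1.
Proof.
move=> h; rewrite /trap min_l ?max_r// lerBrDr -natr1 addrC lerD2r//.
Qed.

Let trap0 n y : n.+1%:R <= `|y| -> trap n y = 0.
Proof. by move=> h; rewrite /trap max_l// ge_min subr_le0 h orbT. Qed.

Let continuous_trap n : continuous (trap n).
Proof.
apply: lip_continuous => x y; apply: le_trans (lip_max _ _ _) _.
apply: le_trans (lip_min _ _ _) _.
have -> : n.+1%:R - `|x| - (n.+1%:R - `|y|) = `|y| - `|x| by ring.
by rewrite (distrC x); exact: ler_dist_dist.
Qed.

Let itvn n : set mR := `[- n.+1%:R, n.+1%:R]%classic.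

Let itvnP n (y : R) : itvn n y = (`|y| <= n.+1%:R) :> Prop.
Proof. by rewrite /itvn/= in_itv/= -ler_norml. Qed.

Let mu_itvn n : (mu (itvn n) < +oo)%E.
Proof. by rewrite /itvn lebesgue_measure_itv/=; case: ifP; rewrite ?ltry// -EFinB ltry. Qed.

(* A bounded function with support in [-n, n] is the L^2 limit of continuous
   ones: clipping an L^1 approximation h at height n makes the L^1 error
   control the L^2 error. *)
Let approx_bounded n (g : R -> R) (e : R) : 0 < e -> measurable_fun setT g ->
  (forall y, `|g y| <= n%:R) -> (forall y, n%:R < `|y| -> g y = 0) ->
  exists c : R -> R, [/\ continuous c, forall y, `|c y| <= n%:R,
    forall y, n.+1%:R < `|y| -> c y = 0 & (\int[mu]_y ((g y - c y) ^+ 2)%:E <= e%:E)%E].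
Proof.
move=> e0 mg gb g0.
have mE : measurable (itvn n) by exact: measurable_itv.
have ig : mu.-integrable (itvn n) (EFin \o g).
  apply: measurable_bounded_integrable => //.
  - exact: mu_itvn.
  - exact: measurable_funTS.
  - exists n%:R; split; first by rewrite num_real.
    by move=> M nM; rewrite /globally/= => y _; rewrite (le_trans (gb y))// ltW.
have [h [ch ih hcvg]] := approximation_continuous_integrable mE (mu_itvn n) ig.
have [m hm] : exists m, (\int[mu]_(z in itvn n) `|(g z - h m z)%:E| < (e / (2 * n.+1%:R))%:E)%E.
  have e1 : 0 < e / (2 * n.+1%:R) by rewrite divr_gt0// mulr_gt0.
  case/fine_cvgP: hcvg => hf /cvgrPdist_lt /(_ _ e1) he.
  have [m [hm1 hm2]] := @filter_ex _ _ _ _ (filterI hf he).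
  exists m; move: hm1 hm2; rewrite /= sub0r normrN => /fineK <-.
  by rewrite lte_fin => /(le_lt_trans (ler_norm _)).
have mc : measurable_fun setT (fun y => trap n y * clip n (h m y)).
  apply: continuous_measurable_fun => y.
  have hc : {for y, continuous (fun y => clip n (h m y))} by apply: continuous_comp; [exact: ch|exact: continuous_clip].
  exact: cvgM (@continuous_trap n y) hc.
pose c y := trap n y * clip n (h m y).
have tb y : `|trap n y| <= 1 by have /andP[t0 t1] := trap01 n y; rewrite ger0_norm.
exists c; split.
- move=> y; have hc : {for y, continuous (fun y => clip n (h m y))} by apply: continuous_comp; [exact: ch|exact: continuous_clip].
  exact: cvgM (@continuous_trap n y) hc.
- by move=> y; rewrite normrM -[leRHS]mul1r ler_pM.
- by move=> y hy; rewrite /c trap0 ?mul0r// ltW.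
have key y : (g y - c y) ^+ 2 <= if `|y| <= n.+1%:R then (2 * n.+1%:R) * `|g y - h m y| else 0.
  case: ifPn => hy; last first.
    rewrite -ltNge in hy; rewrite /c trap0 ?(ltW hy)// g0 ?mul0r ?subrr ?expr0n//.
    by rewrite (lt_trans _ hy)// ltr_nat.
  have h1 : `|g y - c y| <= 2 * n.+1%:R.
    rewrite (le_trans (ler_normB _ _))// mulr_natl mulr2n lerD//.
      by rewrite (le_trans (gb y))// ler_nat.
    by rewrite normrM -[leRHS]mul1r ler_pM// (le_trans (clip_bound _ _))// ler_nat.
  have h2 : `|g y - c y| <= `|g y - h m y|.
    have [yn|yn] := leP `|y| n%:R.
      rewrite /c trap1// mul1r -{1}(clip_id (gb y)); exact: clip_lip.
    rewrite g0// !sub0r !normrN normrM.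
    rewrite -[leRHS]mul1r ler_pM//.
    by have := clip_lip n (h m y) 0; rewrite (@clip_id n 0) ?normr0// !subr0.
  by rewrite -(ger0_norm (sqr_ge0 _)) normrX expr2 ler_pM.
apply: (@le_trans _ _ (\int[mu]_(y in itvn n) ((2 * n.+1%:R)%:E * `|(g y - h m y)%:E|))%E).
  rewrite [leRHS]integral_mkcond; apply: ge0_le_integral => //.
  - by move=> y _; rewrite lee_fin sqr_ge0.
  - by apply/measurable_EFinP; apply: measurable_funX; apply: measurable_funB.
  - have mh : measurable_fun setT (fun x : mR => ((2 * n.+1%:R)%:E * `|(g x - h m x)%:E|)%E).
      by apply: measurable_funeM; apply: measurableT_comp => //; apply/measurable_EFinP; apply: measurable_funB => //; exact: continuous_measurable_fun.
    have mh2 : measurable_fun (itvn n) (fun x : mR => ((2 * n.+1%:R)%:E * `|(g x - h m x)%:E|)%E) by exact: measurable_funS mh.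
    exact: (measurable_restrictT _ mE).1 mh2.
  - move=> y _; rewrite patchE; have := key y.
    case: ifPn => hy; case: ifPn => yE; rewrite ?lee_fin//.
    + by move: yE; rewrite notin_setE itvnP hy.
    + by move: yE hy; rewrite inE itvnP => ->.
rewrite ge0_integralZl//.
- apply: (le_trans (lee_wpmul2l _ (ltW hm))) => //.
  by rewrite -EFinM lee_fin mulrC divfK// mulf_neq0.
- by apply: measurable_funTS; apply: measurableT_comp => //; apply/measurable_EFinP; apply: measurable_funB => //; exact: continuous_measurable_fun.
Qed.


Let bounded_supp_integrable n (c : R -> R) : measurable_fun setT c ->
  (forall y, `|c y| <= n%:R) -> (forall y, n.+1%:R < `|y| -> c y = 0) ->
  mu.-integrable setT (EFin \o c) /\ mu.-integrable setT (EFin \o (fun y => c y ^+ 2)).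
Proof.
move=> mc cb c0; have mE : measurable (itvn n) by exact: measurable_itv.
have i1 : mu.-integrable setT (EFin \o (\1_(itvn n) : mR -> R)).
  apply: ge0_fin_integrable; first exact: measurable_indic.
    by move=> y; rewrite indicE.
  by rewrite integral_indic// setIT; exact: mu_itvn.
split.
- have i2 := integrableRZ n%:R i1; apply: (le_integrable _ _ _ i2) => //; first exact/measurable_EFinP.
  move=> y _; rewrite /= lee_fin indicE; case: (boolP (y \in itvn n)) => h.
    by rewrite mulr1 (le_trans (cb y))// ler_norm.
  by rewrite c0 ?normr0// ltNge; apply/negP; move: h; rewrite notin_setE itvnP.
- have i2 := integrableRZ (n%:R ^+ 2) i1; apply: (le_integrable _ _ _ i2) => //.
    by apply/measurable_EFinP; exact: measurable_funX.
  move=> y _; rewrite /= lee_fin indicE; case: (boolP (y \in itvn n)) => h.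
    by rewrite mulr1 normrX (ger0_norm (sqr_ge0 _)) lerXn2r// nnegrE.
  by rewrite c0 ?expr0n ?normr0// ltNge; apply/negP; move: h; rewrite notin_setE itvnP.
Qed.

Lemma plancherel_half_bounded n g : measurable_fun setT g -> (forall y, `|g y| <= n%:R) ->
  (forall y, n%:R < `|y| -> g y = 0) -> pi * sqint g <= spec_half g.
Proof.
move=> mg gb g0.
have g1 y : n.+1%:R < `|y| -> g y = 0 by move=> h; rewrite g0// (lt_trans _ h)// ltr_nat.
have [ig ig2] := bounded_supp_integrable mg gb g1.
have hc k := cid (approx_bounded (iota_gt0 k) mg gb g0).
pose c k := sval (hc k).
have cP k : [/\ continuous (c k), forall y, `|c k y| <= n%:R,
    forall y, n.+1%:R < `|y| -> c k y = 0 & (\int[mu]_y ((g y - c k y) ^+ 2)%:E <= (iota k)%:E)%E].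
  by rewrite /c; case: (hc k).
have mc k : measurable_fun setT (c k).
  by have [? _ _ _] := cP k; exact: continuous_measurable_fun.
have ic k : mu.-integrable setT (EFin \o c k) /\ mu.-integrable setT (EFin \o (fun y => c k y ^+ 2)).
  by have [_ cb c0 _] := cP k; exact: bounded_supp_integrable.
apply: (@plancherel_half_closure g c) => //.
- by move=> k; exact: (ic k).1.
- by move=> k; exact: (ic k).2.
- move=> k; have [cc cb c0 _] := cP k.
  exact: (plancherel_half_continuous cc cb (ic k).1 (ic k).2).
- apply: (squeeze_cvgr _ (cvg_cst 0) iota_cvg0); apply: nearW => k.
  rewrite /sqint Rintegral_ge0/=; last by move=> y _; rewrite sqr_ge0.
  have [_ _ _ h] := cP k; rewrite -lee_fin.
  have fin : (\int[mu]_y ((g y - c k y) ^+ 2)%:E \is a fin_num)%E.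
    by rewrite ge0_fin_numE ?(le_lt_trans h) ?ltry// integral_ge0// => y _; rewrite lee_fin sqr_ge0.
  rewrite /Rintegral fineK; first by under eq_integral do rewrite mul1r.
  by under eq_integral do rewrite mul1r.
Qed.

(** Truncating both the values and the support at n approximates g in L2, with 4 g^2 as dominating
    function. *)
Lemma plancherel_half g : mu.-integrable setT (EFin \o g) ->
  mu.-integrable setT (EFin \o (fun y => g y ^+ 2)) -> pi * sqint g = spec_half g.
Proof.
move=> ig ig2; apply/eqP; rewrite eq_le (spec_half_ler ig ig2) andbT.
have mg : measurable_fun setT g by case/integrableP: ig => /measurable_EFinP.
pose E n : set mR := `[- n%:R, n%:R]%classic.
have EP n (y : R) : (y \in E n) = (`|y| <= n%:R) by rewrite mem_setE in_itv/= -ler_norml.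
pose c n := (fun y => clip n (g y)) \_ (E n).
have cE n y : c n y = if `|y| <= n%:R then clip n (g y) else 0 by rewrite /c patchE EP.
have mc n : measurable_fun setT (c n).
  apply/(measurable_restrictT _ _).1; first exact: measurable_itv.
  apply: measurable_funTS; apply: (measurableT_comp _ mg); exact: continuous_measurable_fun (@continuous_clip n).
have cb n y : `|c n y| <= n%:R by rewrite cE; case: ifP => // _; rewrite normr0.
have c0 n y : n%:R < `|y| -> c n y = 0 by move=> h; rewrite cE leNgt h.
have c1 n y : n.+1%:R < `|y| -> c n y = 0 by move=> h; rewrite c0// (lt_trans _ h)// ltr_nat.
have ic n := bounded_supp_integrable (mc n) (cb n) (c1 n).
have clipn0 n : clip n 0 = 0 by rewrite clip_id// normr0.
apply: (@plancherel_half_closure g c) => //.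
- by move=> n; exact: (ic n).1.
- by move=> n; exact: (ic n).2.
- by move=> n; exact: (plancherel_half_bounded (mc n) (cb n) (c0 n)).
- have -> : (0 : R) = \int[mu]_y (cst 0 y : R) by rewrite Rintegral_cst// mul0r.
  apply: (@Rdominated_cvg _ _ _ mu _ _ (fun y => 4 * g y ^+ 2)).
  + by move=> n; apply: measurable_funX; apply: measurable_funB => //; exact: measurable_funM.
  + exact: measurable_cst.
  + move=> y; apply: cvg_near_cst; near=> n.
    have h1 : `|y| <= n%:R by near: n; exact: nbhs_infty_ger.
    have h2 : `|g y| <= n%:R by near: n; exact: nbhs_infty_ger.
    by rewrite cE h1 clip_id// mul1r subrr expr0n.
  + move=> n y; rewrite mul1r (ger0_norm (sqr_ge0 _)).
    have -> : 4 * g y ^+ 2 = (2 * `|g y|) ^+ 2 by rewrite exprMn -normrX (ger0_norm (sqr_ge0 _)); ring.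
    rewrite -(ger0_norm (sqr_ge0 _)) normrX lerXn2r ?nnegrE// ?mulr_ge0//.
    rewrite (le_trans (ler_normB _ _))// mulr_natl mulr2n lerD//.
    rewrite cE; case: ifP => _; last by rewrite normr0.
    by have := clip_lip n (g y) 0; rewrite clipn0 !subr0.
  + exact: integrableRZ.
Unshelve. all: by end_near. Qed.

Lemma plancherel g : mu.-integrable setT (EFin \o g) ->
  mu.-integrable setT (EFin \o (fun y => g y ^+ 2)) ->
  (\int[mu]_z (spec g z)%:E = (2 * pi)%:E * \int[mu]_y (g y ^+ 2)%:E)%E.
Proof.
move=> ig ig2; rewrite ge0_symfun_integralT//.
- rewrite -set_itvcy EFinM -muleA; congr (_ * _)%E.
  have := plancherel_half ig ig2; rewrite /sqint /spec_half => h.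
  rewrite -EFin_Rintegral// -EFinM h /Rintegral fineK//.
  exact: integrable_fin_num (integrable_spec_half ig ig2).
- exact: spec_ge0.
- exact: continuous_spec.
- by move=> z /=; rewrite specN.
Qed.

End FourierTransform.

(** * Parseval's formula on the circle *)

Section Periods.
Variable R : realType.
Local Notation mu := (@lebesgue_measure R).
Local Notation mR := (measurableTypeR R).
Local Notation per := (@period R).
Implicit Types u v : R -> R.

(** Functions on one period are extended by 0 to the line, so that the transform on the line, taken
    at integers, gives the Fourier coefficients. *)
Definition L2per u := [/\ measurable_fun setT u, (forall x, ~ per x -> u x = 0) &
  mu.-integrable setT (EFin \o (fun x => u x ^+ 2))].

Lemma periodP (x : R) : per x = (0 <= x < 2 * pi) :> Prop.
Proof. by rewrite /period/= in_itv. Qed.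

Lemma integrable_period_indic : mu.-integrable setT (EFin \o (\1_per : mR -> R)).
Proof.
apply: ge0_fin_integrable; first exact: measurable_indic (@measurable_period R).
  by move=> y; rewrite indicE.
by rewrite integral_indic//; [rewrite setIT; exact: (@period_lty R)|exact: (@measurable_period R)].
Qed.

Lemma L2per_integrable u : L2per u -> mu.-integrable setT (EFin \o u).
Proof.
move=> [mu0 u0 u2].
have h := integrableRD integrable_period_indic u2.
apply: (le_integrable _ _ _ h) => //; first exact/measurable_EFinP.
move=> x _ /=; rewrite lee_fin indicE; case: (boolP (x \in per)) => hx.
  rewrite [leRHS]ger0_norm ?addr_ge0 ?sqr_ge0// -(ger0_norm (sqr_ge0 (u x))) normrX.
  rewrite -[true%:R]/(1 : R); have := sqr_ge0 (`|u x| - 1); have := normr_ge0 (u x); move: `|u x| => a; clear; nra.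
by rewrite u0 ?normr0//; move: hx; rewrite notin_setE.
Qed.

Lemma L2perZ (b : R -> R) (c : R) u : measurable_fun setT b -> (forall x, `|b x| <= c) ->
  L2per u -> L2per (fun x => u x * b x).
Proof.
move=> mb bc [m0 u0 u2]; split.
- exact: measurable_funM.
- by move=> x /u0 ->; rewrite mul0r.
- rewrite (_ : (fun x => _) = (fun x => u x ^+ 2 * b x ^+ 2)); last by apply/funext => x; rewrite exprMn.
  apply: (integrableM_bounded (c := c ^+ 2)) => //; first exact: measurable_funX.
  by move=> x; rewrite normrX lerXn2r ?nnegrE// (le_trans _ (bc x)).
Qed.

Lemma L2perD u v : L2per u -> L2per v -> L2per (fun x => u x + v x).
Proof.
move=> [m0 u0 u2] [m1 v0 v2]; split.
- exact: measurable_funD.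
- by move=> x nx; rewrite u0// v0// addr0.
- have h : mu.-integrable setT (EFin \o (fun y => 2 * u y ^+ 2 + 2 * v y ^+ 2)).
    by apply: integrableRD; exact: integrableRZ.
  apply: (le_integrable _ _ _ h) => //.
    by apply/measurable_EFinP; apply: measurable_funX; exact: measurable_funD.
  have h0 y : 0 <= 2 * u y ^+ 2 + 2 * v y ^+ 2 by apply: addr_ge0; apply: mulr_ge0 => //; exact: sqr_ge0.
  move=> y _; rewrite /= lee_fin (ger0_norm (sqr_ge0 _)) (ger0_norm (h0 y)).
  by have := sqr_ge0 (u y - v y); move: (u y) (v y) => a b; clear; nra.
Qed.

Lemma L2per_bounded (b : R -> R) (c : R) : measurable_fun setT b -> (forall x, `|b x| <= c) ->
  L2per (fun x => \1_per x * b x).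
Proof.
move=> mb bc; apply: (L2perZ mb bc); split.
- exact: measurable_indic (@measurable_period R).
- by move=> x nx; rewrite indicE memNset.
- rewrite (_ : (fun x => _) = (\1_per : mR -> R)); first exact: integrable_period_indic.
  by apply/funext => x; rewrite indicE; case: (_ \in _); rewrite ?expr1n ?expr0n.
Qed.

Lemma measurable_wave h (a : R) : unit_wave h -> measurable_fun setT (fun x : R => h (a * x)).
Proof.
move=> hh; apply: (measurableT_comp (f := h)); first exact: continuous_measurable_fun hh.1.
exact: measurable_funM.
Qed.

Lemma continuous_mulwave h (a : R) : unit_wave h -> continuous (fun x : R => h (a * x)).
Proof.
move=> hh x; have cm : {for x, continuous (fun x : R => a * x)} by dcont.
by apply: (continuous_comp cm); exact: hh.1.
Qed.

Lemma Rintegral_period (F f : R -> R) : (forall x, is_derive x (1 : R) F (f x)) -> continuous f ->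
  \int[mu]_x (\1_per x * f x) = F (2 * pi) - F 0.
Proof.
move=> dF cf.
have p0 : 0 < 2 * pi :> R by rewrite mulr_gt0// pi_gt0.
have := @continuous_FTC2 _ f F 0 (2 * pi) p0 (continuous_subspaceT cf) _ _.
move=> h; rewrite /Rintegral -[RHS]/(fine (F (2 * pi) - F 0)%:E) EFinB -h; last 2 first.
- split=> //.
  + by apply: cvg_at_right_filter; exact: der_continuous (dF 0).
  + by apply: cvg_at_left_filter; exact: der_continuous (dF _).
- by move=> x _; rewrite derive1E; case: (dF x).
congr fine; rewrite -integral_itv_bndo_bndc; last first.
  by apply: measurable_funTS; apply/measurable_EFinP; exact: continuous_measurable_fun.
rewrite [RHS]integral_mkcond; apply: eq_integral => x _; rewrite patchE indicE.
rewrite -[X in x \in X]/per; case: (x \in per); first by rewrite mul1r.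
by rewrite mul0r.
Qed.

(** Integrality of c, in the form exp(2 pi i c) = 1 that integrals over a period use. *)
Definition mode2pi (c : R) := sin (2 * pi * c) = 0 /\ cos (2 * pi * c) = 1.

Lemma Rintegral_period_cos c : c != 0 -> mode2pi c -> \int[mu]_x (\1_per x * cos (c * x)) = 0.
Proof.
move=> c0 [h1 h2].
have dF (x : R) : is_derive x (1 : R) (fun x => c^-1 * sin (c * x)) (cos (c * x)).
  by der; field.
rewrite (Rintegral_period dF); last exact: continuous_mulwave (unit_wave_cos R).
by rewrite mulr0 sin0 (mulrC c (2 * pi)) h1; ring.
Qed.

Lemma Rintegral_period_sin c : c != 0 -> mode2pi c -> \int[mu]_x (\1_per x * sin (c * x)) = 0.
Proof.
move=> c0 [h1 h2].
have dF (x : R) : is_derive x (1 : R) (fun x => - c^-1 * cos (c * x)) (sin (c * x)) by der; field.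
rewrite (Rintegral_period dF); last exact: continuous_mulwave (unit_wave_sin R).
by rewrite mulr0 cos0 (mulrC c (2 * pi)) h2; ring.
Qed.

Lemma Rintegral_period1 : \int[mu]_x (\1_per x * 1) = 2 * pi.
Proof.
rewrite (Rintegral_period (fun x => der_id x)); first by rewrite subr0.
by move=> x; exact: cst_continuous.
Qed.

(** [P] and [Q] are the real and imaginary parts of the Fourier coefficient of u + i v at the
    frequency a. *)
Let P (a : R) u v := \int[mu]_x (u x * cos (a * x) + v x * sin (a * x)).
Let Q (a : R) u v := \int[mu]_x (v x * cos (a * x) - u x * sin (a * x)).

(** Induction on the list of frequencies. Subtracting the projection of u + i v on exp(i a x) lowers
    the squared norm by the squared coefficient over 2 pi and, by orthogonality, leaves the
    remaining coefficients unchanged. *)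
Let bessel_pair (s : seq R) u v : uniq s -> {in s &, forall a b, a != b -> mode2pi (a - b)} ->
  L2per u -> L2per v ->
  \sum_(a <- s) (P a u v ^+ 2 + Q a u v ^+ 2) <= 2 * pi * \int[mu]_x (u x ^+ 2 + v x ^+ 2).
Proof.
elim: s u v => [|a s IH] u v.
  move=> _ _ _ _; rewrite big_nil mulr_ge0 ?mulr_ge0 ?pi_ge0//.
  by apply: Rintegral_ge0 => x _; rewrite addr_ge0 ?sqr_ge0.
move=> /= /andP[nas us] hs hu hv.
have pi0 := pi_gt0 R.
pose p := P a u v; pose q := Q a u v; pose w : R := (2 * pi)^-1.
pose ca x := cos (a * x); pose sa x := sin (a * x).
have mc := measurable_wave a (unit_wave_cos R); have ms := measurable_wave a (unit_wave_sin R).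
have bc x : `|ca x| <= 1 := (unit_wave_cos R).2 _.
have bs x : `|sa x| <= 1 := (unit_wave_sin R).2 _.
pose u' x := u x + \1_per x * (- w * (p * ca x - q * sa x)).
pose v' x := v x + \1_per x * (- w * (p * sa x + q * ca x)).
have bd (r t : R) (c d : R -> R) : (forall x, `|c x| <= 1) -> (forall x, `|d x| <= 1) ->
    forall x, `|- w * (r * c x + t * d x)| <= `|w| * (`|r| + `|t|).
  move=> hc hd x; rewrite normrM normrN ler_wpM2l// (le_trans (ler_normD _ _))// !normrM.
  by rewrite lerD// ler_piMr.
have md (r t : R) (c d : R -> R) : measurable_fun setT c -> measurable_fun setT d ->
    measurable_fun setT (fun x => - w * (r * c x + t * d x)).
  by move=> ? ?; apply: measurable_funM => //; apply: measurable_funD; exact: measurable_funM.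
have hu' : L2per u'.
  apply: L2perD => //; have := L2per_bounded (md p (- q) _ _ mc ms) (bd p (- q) _ _ bc bs).
  have -> : (fun x => \1_per x * (- w * (p * ca x - q * sa x))) =
            (fun x => \1_per x * (- w * (p * ca x + - q * sa x))) by apply/funext => x; rewrite (mulNr q).
  by [].
have hv' : L2per v'.
  by apply: L2perD => //; have := L2per_bounded (md p q _ _ ms mc) (bd p q _ _ bs bc).
have [_ u0 _] := hu; have [_ v0 _] := hv.
have uX x : u x * \1_per x = u x.
  by rewrite indicE; case: (boolP (x \in per)) => h; rewrite ?mulr1// u0 ?mulr0//; move: h; rewrite notin_setE.
have vX x : v x * \1_per x = v x.
  by rewrite indicE; case: (boolP (x \in per)) => h; rewrite ?mulr1// v0 ?mulr0//; move: h; rewrite notin_setE.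
have XX x : \1_per x * \1_per x = \1_per x :> R.
  by rewrite indicE; case: (x \in per); rewrite ?mulr1 ?mulr0.
have cs x : ca x ^+ 2 + sa x ^+ 2 = 1 by exact: cos2Dsin2.
have iL b (h : R -> R) z : unit_wave h -> L2per z -> mu.-integrable setT (EFin \o (fun x => z x * h (b * x))).
  by move=> hh hz; apply: L2per_integrable; apply: (L2perZ (c := 1)) => //; [exact: measurable_wave|move=> x; exact: hh.2].
have iP b z1 z2 : L2per z1 -> L2per z2 -> mu.-integrable setT (EFin \o (fun x => z1 x * cos (b * x) + z2 x * sin (b * x))).
  by move=> h1 h2; apply: integrableRD; [exact: (iL _ _ _ (unit_wave_cos R))|exact: (iL _ _ _ (unit_wave_sin R))].
have iQ b z1 z2 : L2per z1 -> L2per z2 -> mu.-integrable setT (EFin \o (fun x => z1 x * cos (b * x) - z2 x * sin (b * x))).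
  by move=> h1 h2; apply: integrableRB; [exact: (iL _ _ _ (unit_wave_cos R))|exact: (iL _ _ _ (unit_wave_sin R))].
have iX h b : unit_wave h -> mu.-integrable setT (EFin \o (fun x => \1_per x * h (b * x))).
  move=> hh; apply: L2per_integrable; apply: (L2per_bounded (c := 1)); first exact: measurable_wave.
  by move=> x; exact: hh.2.
have i2 : mu.-integrable setT (EFin \o (fun x => u x ^+ 2 + v x ^+ 2)).
  by apply: integrableRD; [case: hu|case: hv].
have step : \int[mu]_x (u' x ^+ 2 + v' x ^+ 2) = \int[mu]_x (u x ^+ 2 + v x ^+ 2) - w * (p ^+ 2 + q ^+ 2).
  transitivity (\int[mu]_x ((u x ^+ 2 + v x ^+ 2) + (w ^+ 2 * (p ^+ 2 + q ^+ 2)) * (\1_per x * 1)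
     + ((- 2 * w * p) * (u x * ca x + v x * sa x) + (- 2 * w * q) * (v x * ca x - u x * sa x)))).
    apply: eq_Rintegral => x _; rewrite /u' /v'.
    transitivity ((u x ^+ 2 + v x ^+ 2) + (w ^+ 2 * (p ^+ 2 + q ^+ 2)) * (\1_per x * \1_per x) * (ca x ^+ 2 + sa x ^+ 2)
       + ((- 2 * w * p) * (u x * \1_per x * ca x + v x * \1_per x * sa x) + (- 2 * w * q) * (v x * \1_per x * ca x - u x * \1_per x * sa x))).
      by ring.
    by rewrite XX uX vX cs !mulr1.
  have i1 : mu.-integrable setT (EFin \o (fun x => \1_per x * 1 : R)).
    by apply: L2per_integrable; apply: (L2per_bounded (c := 1)) => // x; rewrite normr1.
  have h1 := integrableRZ (w ^+ 2 * (p ^+ 2 + q ^+ 2)) i1.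
  have h2 := integrableRZ (- 2 * w * p) (iP a _ _ hu hv).
  have h3 := integrableRZ (- 2 * w * q) (iQ a _ _ hv hu).
  rewrite (RintegralD measurableT (integrableRD i2 h1) (integrableRD h2 h3)).
  rewrite (RintegralD measurableT i2 h1) (RintegralD measurableT h2 h3).
  rewrite (RintegralZl _ measurableT i1) Rintegral_period1.
  rewrite (RintegralZl _ measurableT (iP a _ _ hu hv)) (RintegralZl _ measurableT (iQ a _ _ hv hu)).
  rewrite -/(P a u v) -/(Q a u v) -/p -/q.
  have -> : w ^+ 2 * (p ^+ 2 + q ^+ 2) * (2 * pi) = w * (p ^+ 2 + q ^+ 2).
    have w2 : w * (2 * pi) = 1 by rewrite /w mulVf// mulf_neq0// gt_eqF.
    by move: w2; clear; move: w (2 * pi) (p ^+ 2 + q ^+ 2) => x y z h; rewrite -[RHS]mulr1 -h; ring.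
  by ring.
have PQ b : b \in s -> P b u' v' = P b u v /\ Q b u' v' = Q b u v.
  move=> bs'; have ab : a != b by apply: contraNneq nas => ->.
  have m2 : mode2pi (a - b) by apply: hs; rewrite ?inE ?eqxx ?bs' ?orbT.
  have ab0 : a - b != 0 by rewrite subr_eq0.
  have zc := Rintegral_period_cos ab0 m2; have zs := Rintegral_period_sin ab0 m2.
  have ic := iX _ (a - b) (unit_wave_cos R); have si := iX _ (a - b) (unit_wave_sin R).
  split.
  - transitivity (\int[mu]_x ((u x * cos (b * x) + v x * sin (b * x)) +
      ((- w * p) * (\1_per x * cos ((a - b) * x)) + (w * q) * (\1_per x * sin ((a - b) * x))))).
      by apply: eq_Rintegral => x _; rewrite /u' /v' /ca /sa mulrBl cosB sinB; ring.
    have h1 := integrableRZ (- w * p) ic; have h2 := integrableRZ (w * q) si.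
    rewrite (RintegralD measurableT (iP b _ _ hu hv) (integrableRD h1 h2)) (RintegralD measurableT h1 h2).
    rewrite (RintegralZl _ measurableT ic) (RintegralZl _ measurableT si).
    by rewrite zc zs !mulr0 !addr0.
  - transitivity (\int[mu]_x ((v x * cos (b * x) - u x * sin (b * x)) +
      ((- w * p) * (\1_per x * sin ((a - b) * x)) + (- w * q) * (\1_per x * cos ((a - b) * x))))).
      by apply: eq_Rintegral => x _; rewrite /u' /v' /ca /sa mulrBl cosB sinB; ring.
    have h1 := integrableRZ (- w * p) si; have h2 := integrableRZ (- w * q) ic.
    rewrite (RintegralD measurableT (iQ b _ _ hv hu) (integrableRD h1 h2)) (RintegralD measurableT h1 h2).
    rewrite (RintegralZl _ measurableT si) (RintegralZl _ measurableT ic).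
    by rewrite zc zs !mulr0 !addr0.
rewrite big_cons.
have := IH u' v' us _ hu' hv'; rewrite step.
move=> h; have {}h := h (fun x y xs ys => hs x y (@mem_behead _ (a :: s) _ xs) (@mem_behead _ (a :: s) _ ys)).
rewrite (eq_big_seq (fun b => P b u v ^+ 2 + Q b u v ^+ 2)) in h; last first.
  by move=> b bs'; have [-> ->] := PQ b bs'.
rewrite -/p -/q; move: h; rewrite mulrBr mulrA /w divff ?mul1r; last by rewrite gt_eqF// mulr_gt0.
by rewrite lerBrDr addrC.
Qed.

Lemma L2per_waveM h (b : R) u : unit_wave h -> L2per u -> L2per (fun x => u x * h (b * x)).
Proof. by move=> hh; apply: (L2perZ (c := 1)); [exact: measurable_wave|move=> x; exact: hh.2]. Qed.

Let zeroL2 : L2per (fun=> 0 : R).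
Proof.
split; first exact: measurable_cst.
- by [].
- by rewrite (_ : (fun x => _) = fun=> 0 :> R); [exact: integrable0|apply/funext => x; rewrite expr0n].
Qed.

Lemma mode2pi_int (m n : nat) : mode2pi (m%:R - n%:R).
Proof.
have h (k : nat) : cos (2 * pi * k%:R) = 1 :> R /\ sin (2 * pi * k%:R) = 0 :> R.
  elim: k => [|k [IHc IHs]]; first by rewrite mulr0 cos0 sin0.
  have -> : 2 * pi * k.+1%:R = 2 * pi * k%:R + pi *+ 2 :> R by rewrite -natr1 -mulr_natl; ring.
  by rewrite cosD2pi sinD2pi.
have [cm sm] := h m; have [cn sn] := h n.
by rewrite /mode2pi mulrBr sinB cosB cm sm cn sn; split; ring.
Qed.

Lemma bessel (s : seq R) u v : uniq s -> {in s &, forall a b, a != b -> mode2pi (a - b)} ->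
  L2per u -> L2per v ->
  \sum_(a <- s) ((ftrans cos u a + ftrans sin v a) ^+ 2 + (ftrans cos v a - ftrans sin u a) ^+ 2)
  <= 2 * pi * \int[mu]_x (u x ^+ 2 + v x ^+ 2).
Proof.
move=> us hs hu hv; have := bessel_pair us hs hu hv.
have ic a z : L2per z -> mu.-integrable setT (EFin \o (fun x => z x * cos (a * x))).
  by move=> hz; apply: L2per_integrable; exact: L2per_waveM (unit_wave_cos R) hz.
have si a z : L2per z -> mu.-integrable setT (EFin \o (fun x => z x * sin (a * x))).
  by move=> hz; apply: L2per_integrable; exact: L2per_waveM (unit_wave_sin R) hz.
apply: le_trans; rewrite le_eqVlt; apply/orP; left; apply/eqP; apply: eq_bigr => a _.
by rewrite /P /Q RintegralD ?RintegralB//; try exact: ic; exact: si.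
Qed.

Let freq (n : nat) (al : R) (k : nat) : R := k%:R - n%:R + al.

Let freq_uniq n al m : uniq [seq freq n al k | k <- index_iota 0 m].
Proof.
rewrite map_inj_uniq ?iota_uniq// => i j; rewrite /freq => h.
by apply/eqP; rewrite -(eqr_nat R); apply/eqP; lra.
Qed.

Let freq_mode n al m : {in [seq freq n al k | k <- index_iota 0 m] &, forall a b, a != b -> mode2pi (a - b)}.
Proof.
move=> _ _ /mapP[i _ ->] /mapP[j _ ->] _; rewrite /freq.
have -> : i%:R - n%:R + al - (j%:R - n%:R + al) = i%:R - j%:R :> R by ring.
exact: mode2pi_int.
Qed.

Let sum_freq n al (f : R -> R) :
  \sum_(a <- [seq freq n al k | k <- index_iota 0 (n + n)]) f a =
  \sum_(0 <= k < n) (f (al + k%:R) + f (al - k.+1%:R)).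
Proof.
rewrite big_map (@big_cat_nat _ _ _ n)//= ?leq_addr// big_split/= addrC; congr (_ + _).
  rewrite -{1}[n]add0n big_addn addnK; apply: eq_bigr => k _.
  by rewrite /freq natrD addrK addrC.
rewrite big_nat_rev/= add0n; apply: eq_big_nat => k /andP[_ kn]; rewrite /freq.
by rewrite natrB//; congr (f _); ring.
Qed.

(** Partial sums over the lattice al + Z, with shifts from - n to n - 1. Averaging them over al in
    [0, 1] gives the integral of the spectrum over [- n, n], which links Parseval's formula to
    Plancherel's. *)
Definition dsum n u (al : R) := \sum_(0 <= k < n) (spec u (al + k%:R) + spec u (al - k.+1%:R)).

Lemma bessel_spec n (al : R) u : L2per u -> dsum n u al <= 2 * pi * sqint u.
Proof.
move=> hu; rewrite /dsum -sum_freq.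
have := bessel (@freq_uniq n al (n + n)) (@freq_mode n al (n + n)) hu zeroL2.
have z h a : ftrans h (fun=> 0) a = 0.
  by rewrite /ftrans; under eq_Rintegral do rewrite mul0r; rewrite Rintegral_cst// mul0r.
under [X in X <= _ -> _]eq_bigr do rewrite !z addr0 sub0r sqrrN.
by under [X in _ <= _ * X -> _]eq_Rintegral do rewrite expr0n addr0.
Qed.

Let shift_err u (al : R) := \int[mu]_x (u x ^+ 2 * (2 - 2 * cos (al * x))).

(** Moving the lattice by al amounts to multiplying u by exp(- i al x). Bessel's inequality for the
    difference u (exp(- i al x) - 1) = u1 + i v1 bounds the change of the whole sum at once. *)
Let dsum_shift n (al a : R) u : 0 < a -> L2per u ->
  dsum n u al <= (1 + a) * dsum n u 0 + (1 + a^-1) * (2 * pi * shift_err u al).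
Proof.
move=> a0 hu; have iu := L2per_integrable hu.
pose u1 x := u x * (cos (al * x) - 1); pose v1 x := u x * (-1 * sin (al * x)).
have hu1 : L2per u1.
  apply: (L2perZ (c := 2)) hu.
    by apply: measurable_funB => //; exact: measurable_wave (unit_wave_cos R).
  by move=> x; rewrite (le_trans (ler_normB _ _))// normr1 -[leRHS]/(1 + 1) lerD2r; exact: (unit_wave_cos R).2.
have hv1 : L2per v1.
  apply: (L2perZ (c := 1)) hu.
    by apply: measurable_funM => //; exact: measurable_wave (unit_wave_sin R).
  by move=> x; rewrite normrM normrN1 mul1r; exact: (unit_wave_sin R).2.
have := bessel (@freq_uniq n 0 (n + n)) (@freq_mode n 0 (n + n)) hu1 hv1.
rewrite sum_freq.
have -> : \int[mu]_x (u1 x ^+ 2 + v1 x ^+ 2) = shift_err u al.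
  apply: eq_Rintegral => x _; rewrite /u1 /v1.
  have := cos2Dsin2 (al * x); move: (cos _) (sin _) (u x) => c s w h.
  rewrite !exprMn; have -> : s ^+ 2 = 1 - c ^+ 2 by rewrite -h; ring.
  by ring.
have ic b z : L2per z -> mu.-integrable setT (EFin \o (fun x => z x * cos (b * x))).
  by move=> hz; apply: L2per_integrable; exact: L2per_waveM (unit_wave_cos R) hz.
have si b z : L2per z -> mu.-integrable setT (EFin \o (fun x => z x * sin (b * x))).
  by move=> hz; apply: L2per_integrable; exact: L2per_waveM (unit_wave_sin R) hz.
have eP b : ftrans cos u1 b + ftrans sin v1 b = ftrans cos u (al + b) - ftrans cos u b.
  rewrite /ftrans -RintegralD ?ic ?si// -RintegralB ?ic//.
  by apply: eq_Rintegral => x _; rewrite /u1 /v1 mulrDl cosD; ring.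
have eQ b : ftrans cos v1 b - ftrans sin u1 b = - (ftrans sin u (al + b) - ftrans sin u b).
  rewrite /ftrans -RintegralB ?ic ?si// -RintegralB ?si// -[RHS]mulN1r -RintegralZl//; last first.
    by apply: integrableRB; exact: si.
  by apply: eq_Rintegral => x _; rewrite /u1 /v1 mulrDl sinD; ring.
set D := \sum_(0 <= k < n) _ => hD.
have sq (x y : R) : x ^+ 2 <= (1 + a) * y ^+ 2 + (1 + a^-1) * (x - y) ^+ 2.
  rewrite -subr_ge0.
  have -> : (1 + a) * y ^+ 2 + (1 + a^-1) * (x - y) ^+ 2 - x ^+ 2 = a^-1 * (x - (1 + a) * y) ^+ 2.
    by field; rewrite gt_eqF.
  by rewrite mulr_ge0 ?sqr_ge0// invr_ge0 ltW.
have a1 : 0 <= 1 + a^-1 by rewrite addr_ge0// invr_ge0 ltW.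
apply: (@le_trans _ _ ((1 + a) * dsum n u 0 + (1 + a^-1) * D)); last first.
  by rewrite lerD2l ler_wpM2l.
rewrite /dsum /D !mulr_sumr -big_split/=; apply: ler_sum => k _.
have e1 b : spec u (al + b) <= (1 + a) * spec u b + (1 + a^-1) *
    ((ftrans cos u1 b + ftrans sin v1 b) ^+ 2 + (ftrans cos v1 b - ftrans sin u1 b) ^+ 2).
  rewrite eP eQ sqrrN /spec.
  have := sq (ftrans cos u (al + b)) (ftrans cos u b).
  have := sq (ftrans sin u (al + b)) (ftrans sin u b).
  by rewrite !mulrDr => h1 h2; rewrite addrACA lerD.
have := lerD (e1 k%:R) (e1 (- k.+1%:R)); rewrite !add0r.
by move=> /le_trans; apply; rewrite le_eqVlt; apply/orP; left; apply/eqP; ring.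
Qed.

Let shift_err_cvg u (al : nat -> R) : L2per u -> al n @[n --> \oo] --> 0 ->
  shift_err u (al n) @[n --> \oo] --> 0.
Proof.
move=> [m0 u0 u2] hal.
have -> : (0 : R) = \int[mu]_y (cst 0 y : R) by rewrite Rintegral_cst// mul0r.
apply: (@Rdominated_cvg _ _ _ mu _ _ (fun x => 4 * u x ^+ 2)).
- move=> n; apply: measurable_funM; first exact: measurable_funX.
  apply: measurable_funB => //; apply: measurable_funM => //; exact: measurable_wave (unit_wave_cos R).
- exact: measurable_cst.
- move=> x; have -> : cst 0 x = u x ^+ 2 * (2 - 2 * cos (0 * x)) by rewrite mul0r cos0 /=; ring.
  apply: cvgMl_tmp; apply: cvgB; first exact: cvg_cst.
  apply: cvgMl_tmp; apply: continuous_cvg; first exact: continuous_cos.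
  exact: cvgMr_tmp.
- move=> n x; have /andP[c1 c2] : -1 <= cos (al n * x) <= 1 by rewrite cos_geN1 cos_le1.
  rewrite ger0_norm; last by apply: mulr_ge0; [exact: sqr_ge0|lra].
  by rewrite mulrC ler_wpM2r ?sqr_ge0//; lra.
- exact: integrableRZ.
Qed.

Let phi : R -> R := \1_(`[0, 1[%classic : set mR).

Let phi_sum n (z : R) : \sum_(0 <= k < n) (phi (z - k%:R) + phi (z + k.+1%:R)) =
  \1_(`[- n%:R, n%:R[%classic : set mR) z.
Proof.
have pE (x : R) : phi x = if 0 <= x < 1 then 1 else 0.
  by rewrite /phi indicE mem_setE in_itv/=; case: ifP.
rewrite indicE mem_setE in_itv/=; elim: n => [|n IH].
  by rewrite big_nil oppr0 leNgt; case: (z < 0).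
rewrite big_nat_recr//= IH !pE -natr1.
have n0 : 0 <= n%:R :> R by [].
move: (n%:R : R) n0 => N N0.
have -> : (- (N + 1) <= z < N + 1) = [|| - N <= z < N, 0 <= z - N < 1 | 0 <= z + (N + 1) < 1].
  apply/idP/idP.
    move=> /andP[h1 h2]; case: (ltP z (- N)) => h3.
      by apply/or3P; apply: Or33; apply/andP; split; lra.
    case: (ltP z N) => h4; first by apply/or3P; apply: Or31; apply/andP; split; lra.
    by apply/or3P; apply: Or32; apply/andP; split; lra.
  by move=> /or3P[] /andP[h1 h2]; apply/andP; split; lra.
case: (boolP (- N <= z < N)) => [/andP[h1 h2]|h1] /=.
  rewrite !ifF ?addr0//; apply/negP => /andP[h3 h4]; lra.
case: (boolP (0 <= z - N < 1)) => [/andP[h2 h3]|h2] /=.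
  by rewrite ifF ?addr0 ?add0r//; apply/negP => /andP[h4 h5]; lra.
by case: ifP => _; rewrite ?add0r ?addr0.
Qed.

Let spec_shift (c : R) u : L2per u ->
  (\int[mu]_z (phi (z + c) * spec u z)%:E = \int[mu]_z (phi z * spec u (z - c))%:E)%E.
Proof.
move=> hu; have ms := measurable_spec (L2per_integrable hu).
rewrite -(ge0_integral_shift (f := fun z => (phi (z + c) * spec u z)%:E) (- c)).
- by apply: eq_integral => z _; rewrite subrK.
- apply/measurable_EFinP; apply: measurable_funM => //.
  apply: (measurableT_comp (f := phi)); first exact: measurable_indic.
  by apply: measurable_funD.
- by move=> z; rewrite lee_fin mulr_ge0 ?spec_ge0// /phi indicE.
Qed.

(** Unfolding: integer translates of [0, 1[ tile [- n, n[, and translation moves each tile back to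
    [0, 1[. *)
Let integral_dsum n u : L2per u ->
  (\int[mu]_z (\1_(`[- n%:R, n%:R[%classic : set mR) z * spec u z)%:E = \int[mu]_z (phi z * dsum n u z)%:E)%E.
Proof.
move=> hu; have ms := measurable_spec (L2per_integrable hu).
have mphi : measurable_fun setT phi by exact: measurable_indic.
have p0 z : 0 <= phi z by rewrite /phi indicE.
have s0 := @spec_ge0 R u.
have md (c : R) : measurable_fun setT (fun z : R => z + c) by exact: measurable_funD.
have mpd (c : R) : measurable_fun setT (fun z : R => phi (z + c)) by exact: (measurableT_comp mphi).
have msd (c : R) : measurable_fun setT (fun z : R => spec u (z + c)) by exact: (measurableT_comp ms).
transitivity (\sum_(0 <= k < n) (\int[mu]_z (phi (z - k%:R) * spec u z)%:E + \int[mu]_z (phi (z + k.+1%:R) * spec u z)%:E))%E.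
  rewrite (eq_integral (fun z : mR => \sum_(0 <= k < n) ((phi (z - k%:R) * spec u z)%:E + (phi (z + k.+1%:R) * spec u z)%:E))%E); last first.
    by move=> z _; rewrite -phi_sum mulr_suml -sumEFin; apply: eq_bigr => k _; rewrite mulrDl EFinD.
  rewrite ge0_integral_sum//.
  - apply: eq_bigr => k _; rewrite ge0_integralRD => [//|||z|z]; rewrite ?mulr_ge0//.
    + by apply: measurable_funM => //; exact: mpd.
    + by apply: measurable_funM => //; exact: mpd.
  - by move=> k; apply: emeasurable_funD; apply/measurable_EFinP; apply: measurable_funM => //; exact: mpd.
  - by move=> k z _; rewrite adde_ge0 ?lee_fin ?mulr_ge0.
rewrite [RHS](eq_integral (fun z : mR => \sum_(0 <= k < n) ((phi z * spec u (z + k%:R))%:E + (phi z * spec u (z - k.+1%:R))%:E))%E); last first.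
  by move=> z _; rewrite /dsum mulr_sumr -sumEFin; apply: eq_bigr => k _; rewrite mulrDr EFinD.
rewrite ge0_integral_sum//.
- apply: eq_bigr => k _; rewrite [RHS]ge0_integralRD.
  + have e1 := spec_shift (- k%:R) hu.
    have e2 := spec_shift k.+1%:R hu.
    rewrite /=.
    rewrite e1.
    rewrite e2.
    rewrite opprK.
    reflexivity.
  + by apply: measurable_funM => //; exact: msd.
  + by apply: measurable_funM => //; exact: msd.
  + by move=> z; rewrite mulr_ge0.
  + by move=> z; rewrite mulr_ge0.
- by move=> k; apply: emeasurable_funD; apply/measurable_EFinP; apply: measurable_funM => //; exact: msd.
- by move=> k z _; rewrite adde_ge0 ?lee_fin ?mulr_ge0.
Qed.

(* Plancherel's formula forces the average of [dsum] over [0, 1] to reach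
   Bessel's upper bound, hence [dsum] nearly reaches it close to 0. *)
Let near_full (eta de : R) u : L2per u -> 0 < eta -> eta <= 1 -> 0 < de ->
  exists al, [/\ 0 <= al, al < eta & exists n, 2 * pi * sqint u - de < dsum n u al].
Proof.
move=> hu e0 e1 d0; apply/not_existsP => H.
have {}H al n : 0 <= al -> al < eta -> dsum n u al <= 2 * pi * sqint u - de.
  by move=> a0 a1; rewrite leNgt; apply/negP => h; apply: (H al); split => //; exists n.
set B := 2 * pi * sqint u in H.
have s0 := @spec_ge0 R u.
have d0' n al : 0 <= dsum n u al by apply: sumr_ge0 => k _; rewrite addr_ge0.
have B0 : 0 <= B - de by apply: le_trans (H 0 0%N (lexx _) e0).
have B1 : 0 <= B by rewrite (le_trans B0)// gerBl ltW.
have hb n : (\int[mu]_z (\1_(`[- n%:R, n%:R[%classic : set mR) z * spec u z)%:E <= (B - de * eta)%:E)%E.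
  rewrite (integral_dsum n hu).
  pose E1 : set mR := `[0, eta[%classic; pose E2 : set mR := `[eta, 1[%classic.
  have m1 : measurable E1 by exact: measurable_itv.
  have m2 : measurable E2 by exact: measurable_itv.
  apply: (@le_trans _ _ (\int[mu]_z ((B - de)%:E * (\1_E1 z)%:E + B%:E * (\1_E2 z)%:E))%E).
    apply: ge0_le_integral => //.
    - by move=> z _; rewrite lee_fin mulr_ge0// /phi indicE.
    - apply/measurable_EFinP; apply: measurable_funM; first exact: measurable_indic.
      apply: measurable_sum => k; have ms := measurable_spec (L2per_integrable hu).
      by apply: measurable_funD; apply: (measurableT_comp ms); exact: measurable_funD.
    - apply: emeasurable_funD; apply: measurable_funeM; apply/measurable_EFinP; exact: measurable_indic.
    - move=> z _; rewrite /phi !indicE !mem_setE !in_itv/= -!EFinM -EFinD lee_fin.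
      case: (boolP (0 <= z < 1)) => [/andP[z0 z1]|z01]; last first.
        by rewrite mul0r; apply: addr_ge0; apply: mulr_ge0.
      rewrite mul1r z0 z1 andbT /=; case: (ltP z eta) => ze; rewrite ?mulr1 ?mulr0 ?addr0 ?add0r.
        exact: H.
      exact: bessel_spec.
  rewrite ge0_integralD//; last 4 first.
  - by move=> z _; rewrite -EFinM lee_fin mulr_ge0// indicE.
  - by apply: measurable_funeM; apply/measurable_EFinP; exact: measurable_indic.
  - by move=> z _; rewrite -EFinM lee_fin mulr_ge0// indicE.
  - by apply: measurable_funeM; apply/measurable_EFinP; exact: measurable_indic.
  have i0 (E : set mR) z : setT z -> (0 <= (\1_E z)%:E :> \bar R)%E by rewrite lee_fin indicE.
  rewrite !ge0_integralZl//; try by apply/measurable_EFinP; exact: measurable_indic.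
  have I1 : (\int[mu]_z (\1_E1 z)%:E = eta%:E)%E.
    by rewrite integral_indic// setIT /E1/= lebesgue_measure_itv/= lte_fin e0 sube0.
  have I2 : (\int[mu]_z (\1_E2 z)%:E = (1 - eta)%:E)%E.
    rewrite integral_indic// setIT /E2/= lebesgue_measure_itv/= lte_fin; case: ifP => he //.
    have -> : eta = 1 by apply/eqP; rewrite eq_le e1 leNgt he.
    by rewrite subrr.
  by rewrite I1 I2 -!EFinM -EFinD lee_fin; lra.
have hB : (\int[mu]_z (spec u z)%:E <= (B - de * eta)%:E)%E.
  apply: (fatou_le (mu := mu) _ _ _ hb).
  - move=> n; apply/measurable_EFinP; apply: measurable_funM; first exact: measurable_indic.
    exact: measurable_spec (L2per_integrable hu).
  - by move=> n z; rewrite lee_fin mulr_ge0// indicE.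
  - move=> z; apply: cvg_near_cst; near=> n.
    have h1 : `|z| < n%:R by near: n; exact: nbhs_infty_gtr.
    rewrite indicE mem_setE in_itv/=; move: h1; rewrite ltr_norml => /andP[h1 h2].
    by rewrite (ltW h1) h2 mul1r.
have [_ _ u2] := hu.
have := plancherel (L2per_integrable hu) u2.
move=> hP; move: hB; rewrite hP -EFin_Rintegral// -EFinM lee_fin -/(sqint u) -/B.
have : 0 < de * eta by exact: mulr_gt0.
by move: (de * eta) => x; lra.
Unshelve. all: by end_near. Qed.

Lemma spec0 u : \int[mu]_x u x = 0 -> spec u 0 = 0.
Proof.
move=> u0; rewrite /spec /ftrans.
under eq_Rintegral do rewrite mul0r cos0 mulr1.
under [X in _ + X ^+ 2]eq_Rintegral do rewrite mul0r sin0 mulr0.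
by rewrite u0 Rintegral_cst// mul0r !expr0n addr0.
Qed.

(** The upper bound is Bessel's. For the lower one, [near_full] gives frequencies tending to 0 at
    which the lattice sum is nearly full, and [dsum_shift] carries this to al = 0. The frequencies k
    and - k contribute equally and the zero mode vanishes, which turns 2 pi into pi. *)
Lemma parseval_spec u : L2per u -> \int[mu]_x u x = 0 ->
  (\sum_(0 <= k <oo) (spec u k.+1%:R)%:E = pi%:E * \int[mu]_x (u x ^+ 2)%:E)%E.
Proof.
move=> hu u0; have [_ _ u2] := hu; have iu := L2per_integrable hu.
have s0 := @spec_ge0 R u.
pose S n := \sum_(0 <= k < n) spec u k.+1%:R.
have dS n : dsum n u 0 = \sum_(0 <= k < n) spec u k%:R + S n.
  rewrite /dsum big_split/=; congr (_ + _); apply: eq_bigr => k _; first by rewrite add0r.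
  by rewrite sub0r specN.
have S_up n : S n <= pi * sqint u.
  have := bessel_spec n.+1 0 hu; rewrite dS big_nat_recl//= -/(S n) (spec0 u0) add0r.
  rewrite {2}/S big_nat_recr//= -/(S n); have := s0 n.+1%:R.
  by rewrite -mulrA; move: (S n) (spec _ _) (pi * sqint u) => a b c; lra.
have S_lo n (al a : R) : 0 < a -> dsum n u al <= (1 + a) * (2 * S n) + (1 + a^-1) * (2 * pi * shift_err u al).
  move=> a0; apply: (le_trans (dsum_shift n al a0 hu)); rewrite lerD2r ler_wpM2l ?addr_ge0 ?(ltW a0)//.
  rewrite dS mulr_natl mulr2n lerD2r; case: n => [|n]; first by rewrite big_nil /S big_nil.
  by rewrite big_nat_recl//= (spec0 u0) add0r -/(S n) {2}/S big_nat_recr//= lerDl.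
rewrite -EFin_Rintegral// -EFinM -/(sqint u).
have cS : cvgn (fun n => \sum_(0 <= k < n) (spec u k.+1%:R)%:E)%E.
  by apply: is_cvg_nneseries => n _ _; rewrite lee_fin.
apply/eqP; rewrite eq_le; apply/andP; split.
  by apply: lime_le => //; apply: nearW => n; rewrite sumEFin lee_fin S_up.
set L := limn _.
have SL n : ((S n)%:E <= L)%E.
  by rewrite /S -sumEFin; apply: nneseries_lim_ge => k _ _; rewrite lee_fin.
have Lfin : L \is a fin_num.
  rewrite ge0_fin_numE; last by apply: le_trans (SL 0%N); rewrite /S big_nil.
  apply: (@le_lt_trans _ _ (pi * sqint u)%:E); last exact: ltry.
  by apply: lime_le => //; apply: nearW => n; rewrite sumEFin lee_fin S_up.
move: SL; rewrite -(fineK Lfin); move: (fine L) => l; rewrite lee_fin => SL.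
have {}SL n : S n <= l by have := SL n; rewrite lee_fin.
pose it (n : nat) : R := n.+1%:R^-1.
have it0 n : 0 < it n by rewrite invr_gt0.
have it1 n : it n <= 1 by rewrite invf_le1// ler1n.
have ex n := near_full hu (it0 n) (it1 n) (it0 n).
pose al n := sval (cid (ex n)).
have alP n : [/\ 0 <= al n, al n < it n & exists m, 2 * pi * sqint u - it n < dsum m u (al n)].
  by rewrite /al; case: (cid (ex n)).
have itc : it n @[n --> \oo] --> 0 by exact: cvg_harmonic.
have alc : al n @[n --> \oo] --> 0.
  apply: (squeeze_cvgr _ (cvg_cst 0) itc); apply: nearW => n.
  by have [-> /ltW -> _] := alP n.
have errc := shift_err_cvg hu alc.
have key (a : R) : 0 < a -> 2 * pi * sqint u <= (1 + a) * (2 * l).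
  move=> a0; set K := (1 + a^-1) * (2 * pi).
  have cv : (1 + a) * (2 * l) + K * shift_err u (al n) + it n @[n --> \oo] --> (1 + a) * (2 * l).
    have hK : K * shift_err u (al n) @[n --> \oo] --> K * 0 by exact: cvgMl_tmp.
    have hc : ((1 + a) * (2 * l) : R) @[_ --> \oo] --> (1 + a) * (2 * l) by exact: cvg_cst.
    by have h := cvgD (cvgD hc hK) itc; rewrite mulr0 !addr0 in h; exact: h.
  rewrite -(cvg_lim _ cv)//; apply: limr_ge; first by apply/cvg_ex; eexists; exact: cv.
  apply: nearW => n; have [_ _ [m hm]] := alP n.
  rewrite -lerBlDr; apply: (le_trans (ltW hm)); apply: (le_trans (S_lo m (al n) a a0)).
  rewrite /K -[(1 + a^-1) * (2 * pi) * _]mulrA lerD2r ler_wpM2l ?addr_ge0 ?(ltW a0)//.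
  by rewrite ler_wpM2l.
have cv : (1 + it n) * (2 * l) @[n --> \oo] --> 2 * l.
  rewrite -[X in _ --> X]mul1r; apply: cvgMr_tmp; rewrite -[X in _ --> X]addr0.
  by apply: cvgD => //; exact: cvg_cst.
have : 2 * pi * sqint u <= 2 * l.
  rewrite -(cvg_lim _ cv)//; apply: limr_ge; first by apply/cvg_ex; eexists; exact: cv.
  by apply: nearW => n; exact: key.
by rewrite -mulrA; move: (pi * _) => x; lra.
Qed.

End Periods.

(** * The energy of one mode *)

Section Helpers.
Variable R : realFieldType.
Implicit Types a b c d e t : R.

Lemma mul2_le_1Dsqr t : 2 * t <= 1 + t ^+ 2.
Proof. by have := sqr_ge0 (t - 1); nra. Qed.

Lemma le_normM a b c d : `|a| <= c -> `|b| <= d -> `|a * b| <= c * d.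
Proof. by move=> h1 h2; rewrite normrM ler_pM. Qed.

Lemma le_mul_norm a b c d : `|a| <= c -> `|b| <= d -> a * b <= c * d.
Proof. by move=> h1 h2; rewrite (le_trans (ler_norm _))// le_normM. Qed.

Lemma amgm a b e : 0 < e -> a * b <= e * a ^+ 2 + (4 * e)^-1 * b ^+ 2.
Proof.
move=> e0; rewrite -subr_ge0.
have -> : e * a ^+ 2 + (4 * e)^-1 * b ^+ 2 - a * b = e * (a - (2 * e)^-1 * b) ^+ 2.
  by field; rewrite gt_eqF.
by rewrite mulr_ge0 ?sqr_ge0// ltW.
Qed.

Lemma norm_mul_le_half a b c : `|a * b| <= 2^-1 * (a ^+ 2 + b ^+ 2 + c ^+ 2).
Proof.
rewrite ler_norml; have := sqr_ge0 (a - b); have := sqr_ge0 (a + b); have := sqr_ge0 c.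
by move=> h1 h2 h3; apply/andP; split; nra.
Qed.

End Helpers.

Section EnergyAlgebra.
Variable R : realType.
Variables (nu sg M K tau s : R).
Hypotheses (nu0 : 0 < nu) (nusg : nu <= sg) (M0 : 0 < M) (sgM : sg * M ^+ 2 <= 1)
  (nuM : 16 * nu * M ^+ 2 <= sg) (sg_half : sg <= 2^-1) (K1 : 1 <= K) (s0 : 0 < s) (sE : s ^+ 2 = K ^+ 2 * (1 + tau ^+ 2)).

Let P := 1 + tau ^+ 2.
Let y := P^-1.
(** The shift A keeps [G * (M / s)] below 1/8 whatever the size of M, so that the cross term stays
    small against the squares; the factor 4 is chosen for this bound. The price is an error of order
    A / P in the growth rates, integrable in time. *)
Let A := 4 * M.
Let mx := Order.max tau 0.
(** Half the logarithmic derivative of 1 + A + max(tau, 0)^2. Growth is charged only after the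
    critical time tau = 0; before it the corresponding terms have a favorable sign. *)
Let mu := mx / (1 + A + mx ^+ 2).
(** With A = 0 this is the value for which the rate 2 tau / P - G of psi^2 and the rate tau / P + G
    of rho^2 agree: both become 3 tau / (2 P), whence the power 3/2. *)
Let G := tau / (2 * (P + A)).
Let G' := (2 * (P + A))^-1 - tau ^+ 2 / (P + A) ^+ 2.
Let x := sg * M * s.
(** The denominator saturates h for large s: it keeps [h * (M / s)] below 1/4, and h (1 + x^2) = sg
    s^2 / 2 is what the dissipation of psi can pay. *)
Let h := 2^-1 * sg * s ^+ 2 / (1 + x ^+ 2).
Let h' := sg * K ^+ 2 * tau / (1 + x ^+ 2) ^+ 2.

Let sg0 : 0 < sg. Proof. exact: lt_le_trans nusg. Qed.
Let P1 : 1 <= P. Proof. by rewrite lerDl sqr_ge0. Qed.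
Let P0 : 0 < P. Proof. exact: lt_le_trans P1. Qed.
Let y0 : 0 < y. Proof. by rewrite invr_gt0. Qed.

Let K0 : 0 < K. Proof. exact: lt_le_trans K1. Qed.
Let A0 : 0 < A. Proof. by rewrite mulr_gt0. Qed.
Let x0 : 0 < x. Proof. by rewrite !mulr_gt0. Qed.
Let X0 : 0 < 1 + x ^+ 2. Proof. by rewrite ltr_pwDl ?sqr_ge0. Qed.
Let PA0 : 0 < P + A. Proof. exact: addr_gt0. Qed.

Let ssE : s ^+ 2 = K ^+ 2 * P. Proof. exact: sE. Qed.
Let KK : 1 <= K ^+ 2. Proof. by rewrite exprn_ege1. Qed.
Let ss1 : 1 <= s ^+ 2. Proof. by rewrite ssE -[1]mulr1 ler_pM. Qed.
Let s1 : 1 <= s. Proof. by rewrite -(@ler_pXn2r _ 2)// ?nnegrE ?(ltW s0)// expr1n. Qed.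

Let Ps : P <= s ^+ 2.
Proof. by rewrite ssE -[leLHS]mul1r ler_pM// ltW. Qed.
Let tP : 2 * `|tau| <= P.
Proof. by rewrite /P -(ger0_norm (sqr_ge0 tau)) normrX; exact: mul2_le_1Dsqr. Qed.
Let tt : `|tau| ^+ 2 <= P.
Proof. by rewrite -normrX ger0_norm ?sqr_ge0// lerDr. Qed.
Let Kt : K * `|tau| <= s.
Proof.
rewrite -(@ler_pXn2r _ 2)// ?nnegrE ?(ltW s0) ?mulr_ge0 ?(ltW K0)// exprMn ssE.
by rewrite ler_wpM2l ?sqr_ge0.
Qed.
Let st : s * `|tau| <= K * P.
Proof.
rewrite -(@ler_pXn2r _ 2)// ?nnegrE ?mulr_ge0 ?(ltW K0) ?(ltW s0) ?(ltW P0)// !exprMn ssE -mulrA.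
by rewrite ler_wpM2l ?sqr_ge0// [P ^+ 2]expr2 ler_wpM2l// ltW.
Qed.

Let s1V : s^-1 <= 1. Proof. by rewrite invf_le1. Qed.

Let tPA : 2 * `|tau| <= P + A. Proof. by rewrite (le_trans tP)// lerDl ltW. Qed.

Let mu_abs : 0 <= mu /\ mu <= `|tau| / P.
Proof.
have q0 t : 0 < 1 + A + t ^+ 2 by rewrite ltr_pwDl ?sqr_ge0 ?addr_gt0.
rewrite /mu /mx; case: (leP tau 0) => t0; first by rewrite mul0r divr_ge0// ltW.
rewrite (gtr0_norm t0); split; first by rewrite divr_ge0 ?(ltW t0)// ltW.
rewrite ler_pM2l// lef_pV2 ?posrE// /P addrAC lerDl; exact: ltW.
Qed.

Let tPA1 : 0 <= tau -> tau / (P + A) <= 1 /\ 2 * tau / (P + A) <= 1.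
Proof.
move=> t0; rewrite !ler_pdivrMr// !mul1r; have := tPA; rewrite (ger0_norm t0).
by split=> //; lra.
Qed.

Let tneg : tau <= 0 -> tau / P <= tau / (P + A) /\ tau / (P + A) <= 0.
Proof.
move=> t0; split; last by rewrite mulr_le0_ge0// invr_ge0 ltW.
by rewrite ler_wnM2l// lef_pV2 ?posrE// lerDl ltW.
Qed.

Let GE : G = 2^-1 * (tau / (P + A)).
Proof. by rewrite /G; field; rewrite gt_eqF. Qed.

Let muE : 0 <= tau -> mu = tau / (P + A).
Proof. by move=> t0; rewrite /mu /mx max_l//; congr (_ / _); rewrite /P; ring. Qed.

Let muN : tau <= 0 -> mu = 0.
Proof. by move=> t0; rewrite /mu /mx max_r// mul0r. Qed.

Let Ay0 : 0 <= A * y. Proof. by rewrite mulr_ge0// ltW. Qed.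

(** For tau >= 0 the left-hand side equals A y times 2 tau / (P + A), which is at most 1 times A y.
    For tau < 0, [mu] vanishes and the rest is nonpositive. *)
Let a1_le : 2 * (tau / P) - G - 3 / 2 * mu <= A * y.
Proof.
rewrite GE; have [t0|t0] := leP 0 tau.
  have -> : 2 * (tau / P) - 2^-1 * (tau / (P + A)) - 3 / 2 * mu = A * y * (2 * tau / (P + A)).
    by rewrite (muE t0) /y; field; rewrite !gt_eqF.
  by rewrite ler_piMr//; have [] := tPA1 t0.
have [h1 h2] := tneg (ltW t0); rewrite (muN (ltW t0)).
by move: Ay0 h1 h2; move: (A * y) (tau / P) (tau / (P + A)) => a b c; lra.
Qed.

Let a2_le : tau / P + G - 3 / 2 * mu <= A * y.
Proof.
rewrite GE; have [t0|t0] := leP 0 tau.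
  have -> : tau / P + 2^-1 * (tau / (P + A)) - 3 / 2 * mu = A * y * (tau / (P + A)).
    by rewrite (muE t0) /y; field; rewrite !gt_eqF.
  by rewrite ler_piMr//; have [] := tPA1 t0.
have [h1 h2] := tneg (ltW t0); rewrite (muN (ltW t0)).
by move: Ay0 h1 h2; move: (A * y) (tau / P) (tau / (P + A)) => a b c; lra.
Qed.

Let PAy : (P + A)^-1 <= y.
Proof. by rewrite lef_pV2 ?posrE// lerDl ltW. Qed.

Let tauP : `|tau / P| <= 2^-1.
Proof. by rewrite normrM normfV (gtr0_norm P0) ler_pdivrMr// mulrC ler_pdivlMr// mulrC. Qed.

Let G_abs : `|G| <= 2^-1 * (`|tau| * y).
Proof.
rewrite GE normrM gtr0_norm// ler_pM2l// normrM normfV (gtr0_norm PA0).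
by rewrite ler_wpM2l.
Qed.

Let tauy : `|tau| * y <= 2^-1.
Proof. by have := tauP; rewrite normrM normfV (gtr0_norm P0). Qed.

Let G_quarter : `|G| <= 4^-1.
Proof. apply: le_trans G_abs _; move: tauy; move: (`|tau| * y) => a; lra. Qed.

Let t2y : `|tau| * (`|tau| * y) <= 1.
Proof. by rewrite mulrA -expr2 ler_pdivrMr// mul1r. Qed.

Let G'_abs : `|G'| <= y.
Proof.
have e1 : 0 <= (2 * (P + A))^-1 by rewrite invr_ge0 mulr_ge0// ltW.
have e2 : (2 * (P + A))^-1 <= y.
  have e5 : 0 <= (P + A)^-1 by rewrite invr_ge0 ltW.
  by rewrite invfM; move: e5 PAy; move: (P + A)^-1 y => a b; lra.
have e3 : 0 <= tau ^+ 2 / (P + A) ^+ 2 by rewrite divr_ge0 ?sqr_ge0.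
have e4 : tau ^+ 2 / (P + A) ^+ 2 <= y.
  apply: le_trans PAy; rewrite ler_pdivrMr ?exprn_gt0// expr2 mulrA mulVf ?gt_eqF// mul1r.
  by rewrite /P addrAC lerDr addr_ge0// ltW.
rewrite /G'; move: (2 * (P + A))^-1 (tau ^+ 2 / _) e1 e2 e3 e4 => a b h1 h2 h3 h4.
by rewrite ler_norml; apply/andP; split; lra.
Qed.

Let mu_le : `|mu| <= `|tau| * y.
Proof. by have [h1 h2] := mu_abs; rewrite ger0_norm. Qed.

Let Ms : `|M / s| <= M.
Proof. by rewrite ger0_norm ?divr_ge0 ?(ltW M0) ?(ltW s0)// ler_piMr// ltW. Qed.

(* The part of the coefficient of [psi * rho] that is O(1 / P), hence
   integrable in time. *)
Let cY : `|(G' + 2 * (tau / P) * G - 3 * mu * G + 2 * y) * (M / s)| <= 6 * y * M.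
Proof.
apply: le_normM Ms.
have b1 : `|tau / P * G| <= 2^-1 * y.
  have e : `|tau / P| <= `|tau| * y by rewrite normrM normfV (gtr0_norm P0).
  apply: (le_trans (le_normM e G_abs)).
  have -> : `|tau| * y * (2^-1 * (`|tau| * y)) = 2^-1 * (y * (`|tau| * (`|tau| * y))) by ring.
  by rewrite ler_pM2l// ler_piMr// ltW.
have b2 : `|mu * G| <= 2^-1 * y.
  apply: (le_trans (le_normM mu_le G_abs)).
  have -> : `|tau| * y * (2^-1 * (`|tau| * y)) = 2^-1 * (y * (`|tau| * (`|tau| * y))) by ring.
  by rewrite ler_pM2l// ler_piMr// ltW.
have -> : G' + 2 * (tau / P) * G - 3 * mu * G + 2 * y = G' + 2 * (tau / P * G) - 3 * (mu * G) + 2 * y by ring.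
move: b1 b2 G'_abs (ltW y0); move: (tau / P * G) (mu * G) G' => a b c.
rewrite !ler_norml => /andP[h1 h2] /andP[h3 h4] /andP[h5 h6] h7; apply/andP; split; lra.
Qed.

Let h_ge0 : 0 <= h.
Proof. by rewrite divr_ge0 ?mulr_ge0 ?sqr_ge0// ltW. Qed.

Let h_le : h <= 2^-1 * sg * s ^+ 2.
Proof.
rewrite ler_pdivrMr// ler_peMr ?lerDl ?sqr_ge0//.
by rewrite !mulr_ge0 ?sqr_ge0// ltW.
Qed.

Let hMs : h * (M / s) <= 4^-1.
Proof.
have -> : h * (M / s) = 4^-1 * (2 * x / (1 + x ^+ 2)).
  by rewrite /h /x; field; rewrite !gt_eqF.
by rewrite ler_piMr// ler_pdivrMr// mul1r mul2_le_1Dsqr.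
Qed.

Let Ms0 : 0 <= M / s. Proof. by apply: divr_ge0; exact: ltW. Qed.

Let hMs0 : 0 <= h * (M / s). Proof. exact: mulr_ge0. Qed.

(* The part of the coefficient of [psi * rho] absorbed by the dissipation
   [sg s^2 psi^2]. *)
Let cS : `|(- h' - 2 * (tau / P) * h + 3 * mu * h - G * (sg * s ^+ 2)) * (M / s)| <= 4 * (sg * K * M).
Proof.
have sKM0 : 0 <= sg * K * M by rewrite !mulr_ge0// ltW.
have tKy : s * `|tau| * y <= K by rewrite ler_pdivrMr.
have b1 : `|h' * (M / s)| <= sg * K * M.
  have -> : h' * (M / s) = (sg * K * M) * (K * tau / s * (1 + x ^+ 2) ^- 2).
    by rewrite /h'; field; rewrite !gt_eqF.
  rewrite normrM ger0_norm// ler_piMr// normrM -[leRHS]mulr1 ler_pM//.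
    by rewrite !normrM normfV (gtr0_norm K0) (gtr0_norm s0) ler_pdivrMr// mul1r.
  by rewrite ger0_norm ?invr_ge0 ?sqr_ge0// invf_le1 ?exprn_gt0// exprn_ege1// lerDl sqr_ge0.
have hb z : `|z| <= `|tau| * y -> `|z * h * (M / s)| <= 2^-1 * (sg * K * M).
  move=> hz; rewrite -mulrA normrM [X in _ * X]ger0_norm; last exact: hMs0.
  apply: (@le_trans _ _ (`|tau| * y * (2^-1 * sg * s ^+ 2 * (M / s)))).
    apply: ler_pM => //; apply: ler_wpM2r; [exact: Ms0|exact: h_le].
  have -> : `|tau| * y * (2^-1 * sg * s ^+ 2 * (M / s)) = 2^-1 * (sg * M) * (s * `|tau| * y).
    by field; rewrite gt_eqF.
  have -> : 2^-1 * (sg * K * M) = 2^-1 * (sg * M) * K by ring.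
  by rewrite ler_wpM2l// !mulr_ge0// ltW.
have b2 := hb (tau / P); have b3 := hb mu mu_le.
have {}b2 : `|tau / P * h * (M / s)| <= 2^-1 * (sg * K * M).
  by apply: b2; rewrite normrM normfV (gtr0_norm P0).
have b4 : `|G * (sg * s ^+ 2) * (M / s)| <= 2^-1 * (sg * K * M).
  have -> : G * (sg * s ^+ 2) * (M / s) = G * (sg * M * s) by field; rewrite gt_eqF.
  rewrite normrM [X in _ * X]ger0_norm; last by rewrite !mulr_ge0// ltW.
  apply: (@le_trans _ _ (2^-1 * (`|tau| * y) * (sg * M * s))).
    by rewrite ler_wpM2r// !mulr_ge0// ltW.
  have -> : 2^-1 * (`|tau| * y) * (sg * M * s) = 2^-1 * (sg * M) * (s * `|tau| * y) by ring.
  have -> : 2^-1 * (sg * K * M) = 2^-1 * (sg * M) * K by ring.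
  by rewrite ler_wpM2l// !mulr_ge0// ltW.
have -> : (- h' - 2 * (tau / P) * h + 3 * mu * h - G * (sg * s ^+ 2)) * (M / s) =
  - (h' * (M / s)) - 2 * (tau / P * h * (M / s)) + 3 * (mu * h * (M / s)) - G * (sg * s ^+ 2) * (M / s) by ring.
move: (h' * (M / s)) (tau / P * h * (M / s)) (mu * h * (M / s)) (G * (sg * s ^+ 2) * (M / s)) (sg * K * M) sKM0 b1 b2 b3 b4.
move=> a b c d Z z0.
rewrite !ler_norml => /andP[h1 h2] /andP[h3 h4] /andP[h5 h6] /andP[h7 h8]; apply/andP; split; lra.
Qed.

Let g := G - h.

Let g_abs : `|g * (M / s)| <= 4^-1 * M + 4^-1.
Proof.
rewrite /g mulrBl; apply: le_trans (ler_normB _ _) _; apply: lerD.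
  exact: le_normM G_quarter Ms.
by rewrite ger0_norm; [exact: hMs|exact: hMs0].
Qed.

(** 1/4 comes from h and 1/8 from G. The cross term thus costs at most 3/16 of psi^2 + kap rho^2,
    against the 1/2 of the squares. *)
Let g_coercive : `|g * (M / s)| <= 3 / 8.
Proof.
rewrite /g mulrBl; apply: le_trans (ler_normB _ _) _.
have b1 : `|h * (M / s)| <= 4^-1.
  by rewrite ger0_norm; [exact: hMs|exact: hMs0].
have b2 : `|G * (M / s)| <= 8^-1.
  have b3 : `|G| <= 2^-1 * (`|tau| / (P + A)) 
    by rewrite GE normrM gtr0_norm// normrM normfV (gtr0_norm PA0).
  apply: (@le_trans _ _ (2^-1 * (`|tau| / (P + A)) * (M / s))).
    by rewrite normrM [X in _ * X]ger0_norm ?ler_wpM2r ?divr_ge0 ?(ltW M0) ?(ltW s0)//.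
  have -> : 2^-1 * (`|tau| / (P + A)) * (M / s) = 8^-1 * (A / (P + A) * (`|tau| / s)).
    by rewrite /A; field; rewrite !gt_eqF.
  rewrite ler_piMr// -[leRHS]mul1r ler_pM ?divr_ge0 ?(ltW A0) ?(ltW PA0) ?(ltW s0)//.
    by rewrite ler_pdivrMr// mul1r lerDr ltW.
  rewrite ler_pdivrMr// mul1r; apply: le_trans Kt; by rewrite ler_peMl.
by move: b1 b2; move: `|G * (M / s)| `|h * (M / s)| => a b; lra.
Qed.

(** * Absorption of the terms of the energy identity *)

Section Conclusion.
Variables (psi rho W kap Fd zeta e1 e2 e3 e4 r : R).
Let y1 : R := y.
Hypotheses (kap1 : 1 <= kap) (Fdh : `|Fd * M ^+ 2 / s ^+ 2 - kap * (2 * (tau / P))| <= 4 * pi * M ^+ 2 * y)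
  (zs : `|zeta| <= s) (r0 : 0 <= r) (r1 : r <= 1) (rnu : r <= nu * s ^+ 2).

(** The variable rho = s N / M is normalized so that [F * N ^+ 2] equals [kap * rho ^+ 2] and is of
    the size of psi^2. *)
Let N := M * rho / s.
Let F := kap * s ^+ 2 / M ^+ 2.
Let psid := 2 * (tau / P) * psi - 2 * y * (W - N) + F * N - sg * s ^+ 2 * psi + (e1 + zeta * e2).
Let Wd := - (nu * s ^+ 2) * W + nu * s ^+ 2 * N + (e3 + zeta * e4).
Let B := 2^-1 * psi ^+ 2 + 2^-1 * F * N ^+ 2 + 2^-1 * W ^+ 2 + g * psi * N.
Let Bd := psi * psid + 2^-1 * Fd * N ^+ 2 - F * N * psi + W * Wd
   + (G' - h') * psi * N + g * (psid * N - psi * psi).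
Let S := psi ^+ 2 + kap * rho ^+ 2 + W ^+ 2.
(** With the factor 5/4 of [TB], this dominates the coefficients of all terms of order S / P: 32
    from [T7], 8 M^2 from [T4] and 8 + 8 M + 2 M^2 from [Ty]. *)
Let C1 := 40 + 10 * M + 10 * M ^+ 2.
(** The value of h at s = 1, its minimum; together with the bound [H] of |g| it makes the error
    constant [Kerr] independent of s. *)
Let hmin := 2^-1 * sg / (1 + sg ^+ 2 * M ^+ 2).
Let H := 4^-1 + (2 * sg * M ^+ 2)^-1.
Let Kerr := 4 / sg + 2 / nu + 4 * (H * M) ^+ 2 / hmin.

Let rr : rho ^+ 2 <= kap * rho ^+ 2.
Proof. by rewrite ler_peMl ?sqr_ge0. Qed.

Let FN : F * N ^+ 2 = kap * rho ^+ 2.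
Proof. by rewrite /F /N; field; rewrite !gt_eqF. Qed.

Let BE : B = 2^-1 * psi ^+ 2 + 2^-1 * (kap * rho ^+ 2) + 2^-1 * W ^+ 2 + g * (M / s) * (psi * rho).
Proof. by rewrite /B -FN /N; ring. Qed.

Let cross : `|g * (M / s) * (psi * rho)| <= 3 / 16 * (psi ^+ 2 + kap * rho ^+ 2).
Proof.
rewrite normrM; apply: (@le_trans _ _ (3 / 8 * `|psi * rho|)); first by apply: ler_wpM2r.
apply: (@le_trans _ _ (3 / 8 * (2^-1 * (psi ^+ 2 + rho ^+ 2 + 0 ^+ 2)))).
  by apply: ler_wpM2l => //; exact: norm_mul_le_half.
rewrite expr0n addr0.
by move: rr; move: (psi ^+ 2) (rho ^+ 2) (kap * _) => a b c h1; lra.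
Qed.

Lemma energy_lower : 5 / 16 * S <= B.
Proof.
rewrite BE /S; move: cross (sqr_ge0 W); rewrite ler_norml.
move: (g * _ * _) (psi ^+ 2) (kap * _) (W ^+ 2) => q a b w /andP[h1 h2] w0; lra.
Qed.

Lemma energy_upper : B <= 11 / 16 * S.
Proof.
rewrite BE /S; move: cross (sqr_ge0 W); rewrite ler_norml.
move: (g * _ * _) (psi ^+ 2) (kap * _) (W ^+ 2) => q a b w /andP[h1 h2] w0; lra.
Qed.

Let x2_le : x ^+ 2 <= sg * s ^+ 2.
Proof.
have -> : x ^+ 2 = (sg * M ^+ 2) * (sg * s ^+ 2) by rewrite /x; ring.
by rewrite ler_piMl// mulr_ge0 ?sqr_ge0 ?ltW.
Qed.

Let hE : h * (1 + x ^+ 2) = 2^-1 * sg * s ^+ 2.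
Proof. by rewrite /h divfK// gt_eqF. Qed.

Let h_sg : sg <= 3 * h.
Proof.
have e : 3 * h - sg = (3 / 2 * s ^+ 2 - 1 - x ^+ 2) * sg / (1 + x ^+ 2).
  by rewrite /h; field; rewrite gt_eqF.
rewrite -subr_ge0 e divr_ge0 ?(ltW X0)// mulr_ge0 ?(ltW sg0)//.
have h1 : sg * s ^+ 2 <= 2^-1 * s ^+ 2 by rewrite ler_wpM2r ?sqr_ge0.
by move: x2_le h1 ss1; move: (x ^+ 2) (s ^+ 2) (sg * _) => a b c; lra.
Qed.

(** The dissipation that h hands to rho is still strong enough for the rate r; sg M^2 <= 1 enters
    here, through x^2 <= sg s^2. *)
Let r_h : r <= 4 * h.
Proof.
have e : 4 * h - r = (2 * (sg * s ^+ 2) - r - r * x ^+ 2) / (1 + x ^+ 2).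
  by rewrite /h; field; rewrite gt_eqF.
rewrite -subr_ge0 e divr_ge0 ?(ltW X0)//.
have h1 : nu * s ^+ 2 <= sg * s ^+ 2 by rewrite ler_wpM2r ?sqr_ge0.
have h2 : r * x ^+ 2 <= 1 * x ^+ 2 by rewrite ler_wpM2r ?sqr_ge0.
by move: x2_le h1 h2 rnu; move: (x ^+ 2) (sg * _) (nu * _) (r * _) => a b c d; lra.
Qed.

Let hmin0 : 0 < hmin.
Proof.
apply: divr_gt0; first exact: mulr_gt0.
by apply: ltr_pwDl => //; apply: mulr_ge0; exact: sqr_ge0.
Qed.

Let hmin_le : hmin <= h.
Proof.
have q0 : 0 < 1 + sg ^+ 2 * M ^+ 2 by apply: ltr_pwDl => //; apply: mulr_ge0; exact: sqr_ge0.
have sN : s != 0 by rewrite gt_eqF.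
have e : h - hmin = (s ^+ 2 - 1) * (2^-1 * sg) / ((1 + x ^+ 2) * (1 + sg ^+ 2 * M ^+ 2)).
  rewrite /h /hmin; have -> : sg ^+ 2 * M ^+ 2 = (x / s) ^+ 2 by rewrite /x; field; rewrite gt_eqF.
  move: X0; move: x => x'; move=> X0'; field.
  by rewrite sN/=; apply/andP; split; rewrite gt_eqF// ltr_pwDl ?sqr_ge0 ?exprn_gt0.
rewrite -subr_ge0 e divr_ge0 ?mulr_ge0 ?subr_ge0 ?(ltW X0) ?(ltW q0) ?(ltW sg0)//.
Qed.

Let gH : `|g| <= H.
Proof.
rewrite /g /H; apply: le_trans (ler_normB _ _) _; apply: lerD G_quarter _.
rewrite (ger0_norm h_ge0) /h ler_pdivrMr//.
have -> : (2 * sg * M ^+ 2)^-1 * (1 + x ^+ 2) = (2 * sg * M ^+ 2)^-1 + 2^-1 * sg * s ^+ 2.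
  by rewrite /x; field; rewrite !gt_eqF.
by rewrite lerDr invr_ge0 !mulr_ge0 ?sqr_ge0// ltW.
Qed.

(** The factor zeta in front of an error is no loss: it is at most s, and the dissipation carries
    s^2. *)
Let err2 a b : (a + zeta * b) ^+ 2 <= 2 * s ^+ 2 * (a ^+ 2 + b ^+ 2).
Proof.
have z2 : zeta ^+ 2 <= s ^+ 2.
  by rewrite -(ger0_norm (sqr_ge0 zeta)) normrX ler_pXn2r ?nnegrE// ltW.
apply: (@le_trans _ _ (2 * (a ^+ 2 + zeta ^+ 2 * b ^+ 2))).
  by have := sqr_ge0 (a - zeta * b); rewrite -exprMn; move: (zeta * b) => c; nra.
have -> : 2 * s ^+ 2 * (a ^+ 2 + b ^+ 2) = 2 * (s ^+ 2 * a ^+ 2 + s ^+ 2 * b ^+ 2) by ring.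
by rewrite ler_pM2l// lerD ?ler_wpM2r ?sqr_ge0// ler_peMl ?sqr_ge0.
Qed.

Let T4 : 2^-1 * (Fd * M ^+ 2 / s ^+ 2 - kap * (2 * (tau / P))) * rho ^+ 2 <= 8 * M ^+ 2 * (y * (kap * rho ^+ 2)).
Proof.
apply: (@le_trans _ _ (2^-1 * (4 * pi * M ^+ 2 * y) * rho ^+ 2)).
  by rewrite ler_wpM2r ?sqr_ge0// ler_pM2l// (le_trans (ler_norm _)).
have -> : 2^-1 * (4 * pi * M ^+ 2 * y) * rho ^+ 2 = 2 * (M ^+ 2 * (y * rho ^+ 2)) * pi by field.
have -> : 8 * M ^+ 2 * (y * (kap * rho ^+ 2)) = 2 * (M ^+ 2 * (y * (kap * rho ^+ 2))) * 4 by ring.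
have pi4 : (pi : R) <= 4 by have /andP[_] := @pihalf_02 R; rewrite ltr_pdivrMr// => /ltW; have -> : (2 * 2 = 4 :> R) by ring.
apply: ler_pM => //; last 1 first.
- by rewrite ler_pM2l// ler_wpM2l ?sqr_ge0// ler_pM2l.
- apply: mulr_ge0 => //; apply: mulr_ge0 (sqr_ge0 _) _; apply: mulr_ge0 (sqr_ge0 _); exact: ltW.
- exact: pi_ge0.
Qed.

Let T7 : ((- h' - 2 * (tau / P) * h + 3 * mu * h - G * (sg * s ^+ 2)) * (M / s)) * (psi * rho)
  <= 8^-1 * (sg * s ^+ 2 * psi ^+ 2) + 32 * (y * (kap * rho ^+ 2)).
Proof.
apply: (le_trans (le_mul_norm cS (lexx _))).
have -> : 4 * (sg * K * M) * `|psi * rho| = sg * ((s * `|psi|) * (4 * (K * M / s) * `|rho|)).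
  by rewrite normrM; field; rewrite gt_eqF.
apply: (@le_trans _ _ (sg * (8^-1 * (s * `|psi|) ^+ 2 + (4 * 8^-1)^-1 * (4 * (K * M / s) * `|rho|) ^+ 2))).
  by rewrite ler_pM2l//; apply: amgm; rewrite invr_gt0.
have -> : sg * (8^-1 * (s * `|psi|) ^+ 2 + (4 * 8^-1)^-1 * (4 * (K * M / s) * `|rho|) ^+ 2) =
   8^-1 * (sg * s ^+ 2 * `|psi| ^+ 2) + 32 * (sg * M ^+ 2) * (K ^+ 2 / s ^+ 2 * `|rho| ^+ 2).
  by field; rewrite gt_eqF.
rewrite -!normrX !(ger0_norm (sqr_ge0 _)) lerD2l.
have -> : K ^+ 2 / s ^+ 2 = y by rewrite ssE /y; field; rewrite !gt_eqF.
rewrite -mulrA ler_pM2l// mulrC; apply: (@le_trans _ _ (y * rho ^+ 2)).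
  by rewrite ler_piMr// mulr_ge0 ?sqr_ge0// ltW.
by rewrite ler_pM2l.
Qed.

(** The balance of the transfer: the part - h psi N of the cross term yields - h kap rho^2 at the
    cost of the left-hand side. By [hE] the terms in psi^2 amount to exactly half of the dissipation
    of psi. *)
Let T10 : h * psi ^+ 2 + (h * x) * (psi * rho) <= 2^-1 * (sg * s ^+ 2 * psi ^+ 2) + 2^-1 * (h * (kap * rho ^+ 2)).
Proof.
have e : (x * psi) * rho <= x ^+ 2 * psi ^+ 2 + 2^-1 * (rho ^+ 2).
  have := sqr_ge0 (x * psi - rho); have := sqr_ge0 (x * psi); rewrite -exprMn.
  by move: (x * psi) => a h1 h2; nra.
have := ler_wpM2l h_ge0 e; have := ler_wpM2l h_ge0 rr.
have -> : 2^-1 * (sg * s ^+ 2 * psi ^+ 2) = h * psi ^+ 2 + h * (x ^+ 2 * psi ^+ 2).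
  have -> : 2^-1 * (sg * s ^+ 2 * psi ^+ 2) = 2^-1 * sg * s ^+ 2 * psi ^+ 2 by ring.
  by rewrite -hE; ring.
have -> : (h * x) * (psi * rho) = h * (x * psi * rho) by ring.
rewrite (mulrDr h (x ^+ 2 * _)) mulrCA.
move: (h * (x * _ * _)) (h * (kap * _)) (h * rho ^+ 2) (h * psi ^+ 2) (h * (_ * psi ^+ 2)) => a b c d f; lra.
Qed.

(** The viscous coupling of rho to W. The hypothesis 16 nu M^2 <= sg bounds nu M^2 / 2 by sg / 32,
    and [h_sg] bounds this by 3 h / 32. *)
Let T11 : (nu * s * M) * (rho * W) <= 2^-1 * (nu * s ^+ 2 * W ^+ 2) + 3 / 32 * (h * (kap * rho ^+ 2)).
Proof.
have e : (s * W) * (M * rho) <= 2^-1 * (s ^+ 2 * W ^+ 2) + 2^-1 * (M ^+ 2 * rho ^+ 2).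
  have := sqr_ge0 (s * W - M * rho); rewrite -!exprMn.
  by move: (s * W) (M * rho) => a b h1; nra.
have := ler_wpM2l (ltW nu0) e.
have -> : nu * s * M * (rho * W) = nu * (s * W * (M * rho)) by ring.
have h1 : 2^-1 * (nu * M ^+ 2) * rho ^+ 2 <= 3 / 32 * h * (kap * rho ^+ 2).
  apply: ler_pM => //; last 1 first.
  - by move: nuM h_sg; rewrite -mulrA; move: (nu * _) => a; lra.
  - by apply: mulr_ge0 => //; apply: mulr_ge0 (ltW nu0) (sqr_ge0 _).
  - exact: sqr_ge0.
have -> : nu * (2^-1 * (s ^+ 2 * W ^+ 2) + 2^-1 * (M ^+ 2 * rho ^+ 2)) =
  2^-1 * (nu * s ^+ 2 * W ^+ 2) + 2^-1 * (nu * M ^+ 2) * rho ^+ 2 by ring.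
rewrite (mulrA (3 / 32)).
move: h1; move: (nu * (s * _ * _)) (2^-1 * (nu * _ * _)) (2^-1 * (nu * _) * _) (_ * h * _) => a b c d; lra.
Qed.

Let T12 : (e1 + zeta * e2) * psi <= 8^-1 * (sg * s ^+ 2 * psi ^+ 2) + 4 / sg * (e1 ^+ 2 + e2 ^+ 2).
Proof.
have q0 : 0 < 8^-1 * (sg * s ^+ 2) by rewrite !mulr_gt0.
rewrite mulrC; apply: (le_trans (amgm psi (e1 + zeta * e2) q0)).
rewrite -!(mulrA 8^-1) lerD2l.
apply: (@le_trans _ _ ((4 * (8^-1 * (sg * s ^+ 2)))^-1 * (2 * s ^+ 2 * (e1 ^+ 2 + e2 ^+ 2)))).
  apply: ler_wpM2l; last exact: err2.
  by rewrite invr_ge0; apply: mulr_ge0 => //; exact: ltW.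
rewrite le_eqVlt; apply/orP; left; apply/eqP; field; rewrite !gt_eqF//.
Qed.

Let T14 : (e3 + zeta * e4) * W <= 4^-1 * (nu * s ^+ 2 * W ^+ 2) + 2 / nu * (e3 ^+ 2 + e4 ^+ 2).
Proof.
have q0 : 0 < 4^-1 * (nu * s ^+ 2) by rewrite !mulr_gt0.
rewrite mulrC; apply: (le_trans (amgm W (e3 + zeta * e4) q0)).
rewrite -!(mulrA 4^-1) lerD2l.
apply: (@le_trans _ _ ((4 * (4^-1 * (nu * s ^+ 2)))^-1 * (2 * s ^+ 2 * (e3 ^+ 2 + e4 ^+ 2)))).
  apply: ler_wpM2l; last exact: err2.
  by rewrite invr_ge0; apply: mulr_ge0 => //; exact: ltW.
rewrite le_eqVlt; apply/orP; left; apply/eqP; field; rewrite !gt_eqF//.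
Qed.

Let T13 : (g * (M / s)) * ((e1 + zeta * e2) * rho) <= 8^-1 * (h * (kap * rho ^+ 2)) +
  4 * (H * M) ^+ 2 / hmin * (e1 ^+ 2 + e2 ^+ 2).
Proof.
have q0 : 0 < 8^-1 * hmin by apply: mulr_gt0 => //; exact: hmin0.
have -> : (g * (M / s)) * ((e1 + zeta * e2) * rho) = rho * (g * M * ((e1 + zeta * e2) / s)) by ring.
apply: (le_trans (amgm _ _ q0)); apply: lerD.
  rewrite -mulrA ler_pM2l//; apply: ler_pM; [exact: ltW hmin0|exact: sqr_ge0|exact: hmin_le|exact: rr].
have g2 : g ^+ 2 <= H ^+ 2.
  rewrite -(ger0_norm (sqr_ge0 g)) normrX ler_pXn2r ?nnegrE//.
  exact: le_trans gH.
have e : ((e1 + zeta * e2) / s) ^+ 2 <= 2 * (e1 ^+ 2 + e2 ^+ 2).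
  rewrite exprMn exprVn ler_pdivrMr ?exprn_gt0// mulrAC; exact: err2.
have -> : 4 * (H * M) ^+ 2 / hmin * (e1 ^+ 2 + e2 ^+ 2) = (4 * (8^-1 * hmin))^-1 * (H ^+ 2 * M ^+ 2 * (2 * (e1 ^+ 2 + e2 ^+ 2))).
  by field; rewrite gt_eqF.
apply: ler_wpM2l; first by rewrite invr_ge0; apply: mulr_ge0 => //; exact: ltW.
rewrite exprMn; apply: ler_pM => //; [exact: sqr_ge0|exact: sqr_ge0|].
by rewrite exprMn ler_wpM2r ?sqr_ge0.
Qed.

(** The right-hand side is what the other estimates leave of the dissipation: 1 - 1/2 - 1/8 - 1/8
    for psi, 1 - 1/2 - 3/32 - 1/8 for rho and 1 - 1/2 - 1/4 for W. The factor 1/12 is small enough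
    to fit. *)
Let Tr : 12^-1 * r * B <= 4^-1 * (sg * s ^+ 2 * psi ^+ 2) + 9 / 32 * (h * (kap * rho ^+ 2)) + 4^-1 * (nu * s ^+ 2 * W ^+ 2).
Proof.
apply: (@le_trans _ _ (12^-1 * r * (11 / 16 * S))).
  by rewrite ler_wpM2l ?mulr_ge0//; exact: energy_upper.
have h0 : 0 <= kap * rho ^+ 2 by rewrite mulr_ge0 ?sqr_ge0 ?(le_trans _ kap1).
have h1 : r * psi ^+ 2 <= sg * s ^+ 2 * psi ^+ 2.
  by rewrite ler_wpM2r ?sqr_ge0// (le_trans rnu)// ler_wpM2r ?sqr_ge0.
have h2 := ler_wpM2r h0 r_h; have h3 := ler_wpM2r (sqr_ge0 W) rnu.
have h4 : 0 <= r * psi ^+ 2 by rewrite mulr_ge0 ?sqr_ge0.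
have h5 : 0 <= r * (kap * rho ^+ 2) by rewrite mulr_ge0.
have h6 : 0 <= r * W ^+ 2 by rewrite mulr_ge0 ?sqr_ge0.
have -> : 12^-1 * r * (11 / 16 * S) = 11 / 192 * (r * psi ^+ 2 + r * (kap * rho ^+ 2) + r * W ^+ 2).
  by rewrite /S; field.
rewrite -mulrA in h2.
move: h1 h2 h3 h4 h5 h6; move: (r * psi ^+ 2) (r * (kap * _)) (r * W ^+ 2) (sg * _ * _) (h * (kap * _)) (nu * _ * _) => a b c d f q; lra.
Qed.

Let TB : - (4 * C1 * y * B) <= - (5 / 4 * C1 * (y * S)).
Proof.
have c0 : 0 <= C1 by rewrite /C1 !addr_ge0 ?mulr_ge0 ?(ltW M0).
have c1 : 0 <= 4 * C1 * y by apply: mulr_ge0 (ltW y0); exact: mulr_ge0.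
rewrite lerN2; have := ler_wpM2l c1 energy_lower.
by have -> : 4 * C1 * y * (5 / 16 * S) = 5 / 4 * C1 * (y * S) by field.
Qed.

(** Here the choice of G pays off: after the weight - 3 mu has removed the common growth, only
    errors of order S / P remain. *)
Let Ty :
  (2 * (tau / P) - G - 3 / 2 * mu) * psi ^+ 2
  + (tau / P + G - 3 / 2 * mu) * (kap * rho ^+ 2)
  - 3 / 2 * mu * W ^+ 2
  - 2 * y * (W * psi)
  + ((G' + 2 * (tau / P) * G - 3 * mu * G + 2 * y) * (M / s)) * (psi * rho)
  - (2 * y) * (g * (M / s)) * (W * rho)
  + (2 * y) * ((g * (M / s)) * (M / s)) * rho ^+ 2 <= (8 + 8 * M + 2 * M ^+ 2) * (y * S).
Proof.
have k0 : 0 <= kap * rho ^+ 2 by apply: le_trans rr; exact: sqr_ge0.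
have u1 := ler_wpM2r (sqr_ge0 psi) a1_le.
have u2 := ler_wpM2r k0 a2_le.
have [mu0 _] := mu_abs.
have u3 := mulr_ge0 mu0 (sqr_ge0 W).
have half (a b c : R) : `|a * b| <= 2^-1 * (a ^+ 2 + b ^+ 2 + c ^+ 2) := norm_mul_le_half a b c.
have SW : `|W * psi| <= 2^-1 * S.
  apply: (le_trans (half _ _ 0)); rewrite ler_pM2l// /S; move: k0.
  by move: (kap * _) (psi ^+ 2) (W ^+ 2) => a b c; lra.
have SP : `|psi * rho| <= 2^-1 * S.
  apply: (le_trans (half _ _ W)); rewrite ler_pM2l// /S; move: rr.
  by move: (psi ^+ 2) (W ^+ 2) (rho ^+ 2) (kap * _) => a b c d; lra.
have SR : `|W * rho| <= 2^-1 * S.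
  apply: (le_trans (half _ _ psi)); rewrite ler_pM2l// /S; move: rr.
  by move: (psi ^+ 2) (W ^+ 2) (rho ^+ 2) (kap * _) => a b c d; lra.
have u5 : - 2 * y * (W * psi) <= 2 * y * (2^-1 * S).
  by apply: le_mul_norm => //; rewrite normrM (gtr0_norm y0) normrN ger0_norm.
have u6 := le_mul_norm cY SP.
have u8 : (- 2 * y) * (g * (M / s)) * (W * rho) <= (2 * y) * (4^-1 * M + 4^-1) * (2^-1 * S).
  apply: le_mul_norm => //; apply: le_normM => //.
  by rewrite normrM (gtr0_norm y0) normrN ger0_norm.
have u9 : (2 * y) * ((g * (M / s)) * (M / s)) * rho ^+ 2 <= (2 * y) * ((4^-1 * M + 4^-1) * M) * S.
  apply: le_mul_norm; last first.
    rewrite ger0_norm ?sqr_ge0//; apply: (le_trans rr); rewrite /S; move: (sqr_ge0 psi) (sqr_ge0 W).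
    by move: (kap * _) (psi ^+ 2) (W ^+ 2) => a b c; lra.
  apply: le_normM; first by rewrite normrM (gtr0_norm y0) ger0_norm.
  exact: le_normM.
have S0 : 0 <= S.
  by apply: addr_ge0 (sqr_ge0 _); apply: addr_ge0 k0; exact: sqr_ge0.
have v1 : A * y * psi ^+ 2 + A * y * (kap * rho ^+ 2) <= 4 * M * (y * S).
  have -> : 4 * M * (y * S) = A * y * psi ^+ 2 + A * y * (kap * rho ^+ 2) + A * y * W ^+ 2.
    by rewrite /S /A; ring.
  by rewrite lerDl; apply: mulr_ge0 (sqr_ge0 _).
have YS : 0 <= y * S by apply: mulr_ge0 => //; exact: ltW.
have YM : 0 <= M * (y * S) by apply: mulr_ge0 => //; exact: ltW.
have YMM : 0 <= M ^+ 2 * (y * S) by apply: mulr_ge0 => //; exact: sqr_ge0.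
have w5 : 2 * y * (2^-1 * S) = y * S by field.
have w6 : 6 * y * M * (2^-1 * S) = 3 * (M * (y * S)) by field.
have w8 : (2 * y) * (4^-1 * M + 4^-1) * (2^-1 * S) = 4^-1 * (M * (y * S)) + 4^-1 * (y * S) by field.
have w9 : (2 * y) * ((4^-1 * M + 4^-1) * M) * S = 2^-1 * (M ^+ 2 * (y * S)) + 2^-1 * (M * (y * S)) by field.
have -> : - (2 * y * (W * psi)) = - 2 * y * (W * psi) by ring.
have -> : - (2 * y * (g * (M / s)) * (W * rho)) = - 2 * y * (g * (M / s)) * (W * rho) by ring.
have -> : - (3 / 2 * mu * W ^+ 2) = - (3 / 2) * (mu * W ^+ 2) by ring.
have -> : (8 + 8 * M + 2 * M ^+ 2) * (y * S) = 8 * (y * S) + 8 * (M * (y * S)) + 2 * (M ^+ 2 * (y * S)) by ring.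
rewrite w5 in u5; rewrite w6 in u6; rewrite w8 in u8; rewrite w9 in u9.
rewrite -(mulrA 4) in v1.
move: u1 u2 u3 u5 u6 u8 u9 v1 YS YM YMM.
move: (A * y * psi ^+ 2) (A * y * (kap * _)) => t10 t11.
move: (_ * psi ^+ 2) (_ * (kap * rho ^+ 2)) (mu * W ^+ 2) (- 2 * y * (W * psi)) => t1 t2 t3 t5.
move: (_ * (psi * rho)) (_ * (W * rho)) (_ * rho ^+ 2) => t6 t8 t9.
move: (y * S) (M * (y * S)) (M ^+ 2 * (y * S)) => q1 q2 q3.
lra.
Qed.

Lemma energy_algebra :
  Bd + (- 3 * mu + 12^-1 * r - 4 * C1 * y) * B <= Kerr * (e1 ^+ 2 + e2 ^+ 2 + e3 ^+ 2 + e4 ^+ 2).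
Proof.
have sN : s != 0 by rewrite gt_eqF.
have MN : M != 0 by rewrite gt_eqF.
(* The identity behind the estimate. Its groups are, in order: growth terms, the potential,
   couplings of order 1 / P with one coupling absorbed by viscosity among them, dissipation of psi
   with the transfer to rho, dissipation of W, cutoff errors, and the remaining parts of the
   weight. *)
have -> : Bd + (- 3 * mu + 12^-1 * r - 4 * C1 * y) * B =
  (2 * (tau / P) - G - 3 / 2 * mu) * psi ^+ 2
  + (tau / P + G - 3 / 2 * mu) * (kap * rho ^+ 2)
  - 3 / 2 * mu * W ^+ 2
  + 2^-1 * (Fd * M ^+ 2 / s ^+ 2 - kap * (2 * (tau / P))) * rho ^+ 2
  - 2 * y * (W * psi)
  + ((G' + 2 * (tau / P) * G - 3 * mu * G + 2 * y) * (M / s)) * (psi * rho)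
  + ((- h' - 2 * (tau / P) * h + 3 * mu * h - G * (sg * s ^+ 2)) * (M / s)) * (psi * rho)
  - (2 * y) * (g * (M / s)) * (W * rho)
  + (2 * y) * ((g * (M / s)) * (M / s)) * rho ^+ 2
  + (- (sg * s ^+ 2 * psi ^+ 2) + (h * psi ^+ 2 + (h * x) * (psi * rho)) - h * (kap * rho ^+ 2))
  + (- (nu * s ^+ 2 * W ^+ 2) + (nu * s * M) * (rho * W))
  + ((e1 + zeta * e2) * psi + (g * (M / s)) * ((e1 + zeta * e2) * rho) + (e3 + zeta * e4) * W)
  + (12^-1 * r * B - 4 * C1 * y * B).
  rewrite /Bd /psid /Wd /B /F /N /g /x; move: (tau / P) y G' G h' h mu C1 => tP' y' a b c d m C'.
  by field; rewrite sN MN.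
have S0 : 0 <= S.
  by apply: addr_ge0 (sqr_ge0 _); apply: addr_ge0 (sqr_ge0 _) _; apply: le_trans rr; exact: sqr_ge0.
have YS : 0 <= y * S by apply: mulr_ge0 => //; exact: ltW.
have YM : 0 <= M * (y * S) by apply: mulr_ge0 => //; exact: ltW.
have YMM : 0 <= M ^+ 2 * (y * S) by apply: mulr_ge0 => //; exact: sqr_ge0.
have YK : y * (kap * rho ^+ 2) <= y * S.
  rewrite ler_pM2l// /S; move: (sqr_ge0 psi) (sqr_ge0 W).
  by move: (psi ^+ 2) (kap * _) (W ^+ 2) => a b c; lra.
have YMK : M ^+ 2 * (y * (kap * rho ^+ 2)) <= M ^+ 2 * (y * S).
  by apply: ler_wpM2l => //; exact: sqr_ge0.
have KE : Kerr * (e1 ^+ 2 + e2 ^+ 2 + e3 ^+ 2 + e4 ^+ 2) =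
  4 / sg * (e1 ^+ 2 + e2 ^+ 2) + 2 / nu * (e3 ^+ 2 + e4 ^+ 2) +
  4 * (H * M) ^+ 2 / hmin * (e1 ^+ 2 + e2 ^+ 2) +
  (4 / sg * (e3 ^+ 2 + e4 ^+ 2) + 2 / nu * (e1 ^+ 2 + e2 ^+ 2) +
   4 * (H * M) ^+ 2 / hmin * (e3 ^+ 2 + e4 ^+ 2)) by rewrite /Kerr; ring.
have KE0 : 0 <= 4 / sg * (e3 ^+ 2 + e4 ^+ 2) + 2 / nu * (e1 ^+ 2 + e2 ^+ 2) +
   4 * (H * M) ^+ 2 / hmin * (e3 ^+ 2 + e4 ^+ 2).
  have q (a b : R) : 0 <= a ^+ 2 + b ^+ 2 by apply: addr_ge0; exact: sqr_ge0.
  apply: addr_ge0; [apply: addr_ge0|]; apply: mulr_ge0 => //; apply: divr_ge0 => //; first exact: ltW.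
    exact: ltW.
    by apply: mulr_ge0 => //; exact: sqr_ge0.
  exact: ltW hmin0.
rewrite KE; move: KE0.
have CE : 5 / 4 * C1 * (y * S) = 50 * (y * S) + 25 / 2 * (M * (y * S)) + 25 / 2 * (M ^+ 2 * (y * S)).
  by rewrite /C1; field.
have TE : (8 + 8 * M + 2 * M ^+ 2) * (y * S) = 8 * (y * S) + 8 * (M * (y * S)) + 2 * (M ^+ 2 * (y * S)) by ring.
have := TB; have := Ty; rewrite CE TE.
have := T4; rewrite -(mulrA 8); have := T7; have := T10; have := T11; have := T12; have := T13; have := T14; have := Tr.
have H0 : 0 <= h * (kap * rho ^+ 2).
  by apply: mulr_ge0 => //; apply: le_trans rr; exact: sqr_ge0.
have H1 : 0 <= sg * s ^+ 2 * psi ^+ 2.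
  by apply: mulr_ge0 (sqr_ge0 _); apply: mulr_ge0 (sqr_ge0 _); exact: ltW.
move: H0 H1 YMK YK YS YM YMM.
(* Every product becomes an atom; the claim is linear in these atoms. *)
move: (12^-1 * r * B) (4 * C1 * y * B) => t20 t21.
move: (sg * s ^+ 2 * psi ^+ 2) (nu * s ^+ 2 * W ^+ 2) (nu * s * M * _) => t22 t23 t24.
move: ((e3 + _) * W) ((e1 + _) * psi) (_ * ((e1 + _) * rho)) => t25 t26 t27.
move: (h * psi ^+ 2) (h * x * _) (h * (kap * _)) => t28 t29 t30.
move: (M ^+ 2 * (y * (kap * _))) (M ^+ 2 * (y * S)) (M * (y * S)) => t31 t32 t33.
move: (y * (kap * _)) (y * S) => t34 t35.
move: (2^-1 * (Fd * _ / _ - _) * rho ^+ 2) => t4.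
move: (_ * psi ^+ 2) (_ * (kap * rho ^+ 2)) (3 / 2 * mu * W ^+ 2) (2 * y * (W * psi)) => t1 t2 t3 t5.
move: ((G' + _ - _ + _) * _ * (psi * rho)) (_ * (psi * rho)) (_ * (W * rho)) (_ * rho ^+ 2) => t6 t7 t8 t9.
move: (4 / sg * (e1 ^+ 2 + _)) (4 / sg * (e3 ^+ 2 + _)) (2 / nu * (e1 ^+ 2 + _)) (2 / nu * (e3 ^+ 2 + _)) => t40 t41 t42 t43.
move: (_ / hmin * (e1 ^+ 2 + _)) (_ / hmin * (e3 ^+ 2 + _)) => t44 t45.
lra.
Qed.

End Conclusion.

End EnergyAlgebra.

(** * Decay of one mode *)

Section WithinContinuity.
Variables (R : realType) (D : set R).
Implicit Types f g : R -> R.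

Lemma within_continuousD f g : {within D, continuous f} -> {within D, continuous g} ->
  {within D, continuous (fun t => f t + g t)}.
Proof. by move=> hf hg x; apply: cvgD; [exact: hf|exact: hg]. Qed.

Lemma within_continuousM f g : {within D, continuous f} -> {within D, continuous g} ->
  {within D, continuous (fun t => f t * g t)}.
Proof. by move=> hf hg x; apply: cvgM; [exact: hf|exact: hg]. Qed.

Lemma within_continuousN f : {within D, continuous f} ->
  {within D, continuous (fun t => - f t)}.
Proof. by move=> hf x; apply: cvgN; exact: hf. Qed.

Lemma within_continuousX f n : {within D, continuous f} ->
  {within D, continuous (fun t => f t ^+ n)}.
Proof.
move=> hf; elim: n => [|n IH].
  by move=> x; under eq_fun do rewrite expr0; exact: cvg_cst.
have -> : (fun t => f t ^+ n.+1) = (fun t => f t * f t ^+ n) by apply/funext => t; rewrite exprS.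
exact: within_continuousM.
Qed.

Lemma derive_within_continuous f (df : R -> R) :
  (forall x, is_derive x (1 : R) f (df x)) -> {within D, continuous f}.
Proof.
move=> hf; apply: continuous_subspaceT => x; exact: der_continuous (hf x).
Qed.

End WithinContinuity.

Lemma derive_le0_le (R : realType) (f df : R -> R) (a b : R) : a <= b ->
  (forall x, x \in `]a, b[ -> is_derive x (1 : R) f (df x)) ->
  (forall x, x \in `]a, b[ -> df x <= 0) ->
  {within `[a, b], continuous f} -> f b <= f a.
Proof.
rewrite le_eqVlt => /predU1P[->//|ab] hf hd cf.
have [c cab e] := MVT ab hf cf.
by rewrite -subr_le0 e mulr_le0_ge0 ?hd// subr_ge0 ltW.
Qed.

(** Covers the derivatives that no formula gives: at the kink of max(y, 0)^2, at the flat point of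
    exp(- 1 / x), and of pairings that depend on a frequency. *)
Lemma is_derive_quadratic (R : realType) (f : R -> R) (x d C : R) :
  (forall h, `|h| <= 1 -> `|f (x + h) - f x - d * h| <= C * h ^+ 2) ->
  is_derive x (1 : R) f d.
Proof.
move=> hf.
have hcvg : h^-1 *: (f (h *: (1 : R) + x) - f x) @[h --> (0 : R)^'] --> d.
  apply/cvgrPdist_le => /= e e0; near=> h.
  have h0 : h != 0 by near: h; exact: nbhs_dnbhs_neq.
  have h1 : `|h| <= 1 by near: h; apply: dnbhs0_le.
  have h2 : `|h| <= e / (1 + `|C|) by near: h; apply: dnbhs0_le; rewrite divr_gt0// ltr_pwDl.
  have := hf h h1; rewrite /GRing.scale/= mulr1 (addrC h x) => hq.
  have -> : d - h^-1 * (f (x + h) - f x) = - (h^-1 * (f (x + h) - f x - d * h)) by field.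
  rewrite normrN normrM normfV ler_pdivrMl ?normr_gt0//; apply: (le_trans hq).
  apply: (@le_trans _ _ (`|h| * (`|h| * (1 + `|C|)))).
    rewrite mulrA -expr2 -normrX ger0_norm ?sqr_ge0// mulrC ler_wpM2l ?sqr_ge0//.
    by rewrite (le_trans (ler_norm C))// lerDr.
  by rewrite ler_wpM2l// -ler_pdivlMr// ltr_pwDl.
by split; [exact: (cvgP d hcvg)|exact: cvg_lim hcvg].
Unshelve. all: by end_near.
Qed.

Lemma der_sqr_pos_part (R : realType) (x : R) :
  is_derive x (1 : R) (fun y => Order.max y 0 ^+ 2) (2 * Order.max x 0).
Proof.
apply: (@is_derive_quadratic _ _ _ _ 1) => h _; rewrite mul1r.
rewrite ler_norml; case: (leP (x + h) 0) => h1; case: (leP x 0) => h2; apply/andP; split; nra.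
Qed.

Section ModeODE.
Variables (R : realType) (sp : species).

(** Eliminating the potential gives both species the same law [kappa]: the symbol of Poisson's
    equation is p + 4 pi M^2 for ions and p for electrons. *)
Definition screening (M : R) : R := match sp with ion => 4 * pi * M ^+ 2 | electron => 0 end.
Definition kappa (M p : R) : R := 1 + 4 * pi * M ^+ 2 / (p + screening M).

Variables (nu sg M n k xi T : R) (N Psi Om e1 e2 e3 e4 D Q : R -> R).
Hypotheses (n0 : 0 < n) (n1 : n <= 1) (nuE : nu = n ^+ 3) (nusg : nu <= sg) (M0 : 0 < M)
  (sgM : sg * M ^+ 2 <= 1) (nuM : 16 * nu * M ^+ 2 <= sg) (sg_half : sg <= 2^-1) (k1 : 1 <= `|k|).

Let zeta t := xi - k * t.
Let p t := k ^+ 2 + zeta t ^+ 2.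

Hypotheses (T0 : 0 <= T)
  (dN : forall t : R, 0 < t -> is_derive t (1 : R) N (- Psi t))
  (dPsi : forall t : R, 0 < t -> is_derive t (1 : R) Psi
    (- (2 * k * zeta t / p t) * Psi t - 2 * k ^+ 2 / p t * Om t + kappa M (p t) * p t / M ^+ 2 * N t
     - sg * p t * Psi t + (e1 t + zeta t * e2 t)))
  (dOm : forall t : R, 0 < t -> is_derive t (1 : R) Om
    (Psi t - nu * p t * Om t + (e3 t + zeta t * e4 t)))
  (cN : {within `[0, T], continuous N}) (cPsi : {within `[0, T], continuous Psi})
  (cOm : {within `[0, T], continuous Om}) (cD : {within `[0, T], continuous D})
  (D0 : D 0 = 0) (dD : forall t : R, 0 < t -> t < T -> is_derive t (1 : R) D (Q t))
  (eQ : forall t, e1 t ^+ 2 + e2 t ^+ 2 + e3 t ^+ 2 + e4 t ^+ 2 <= Q t).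

Let tau t := t - xi / k.
Let P t := 1 + tau t ^+ 2.
Let A := 4 * M.
Let G t := tau t / (2 * (P t + A)).
Let h t := 2^-1 * sg * p t / (1 + sg ^+ 2 * M ^+ 2 * p t).
Let F t := kappa M (p t) * p t / M ^+ 2.
Let B t := 2^-1 * Psi t ^+ 2 + 2^-1 * F t * N t ^+ 2 + 2^-1 * (Om t + N t) ^+ 2 + (G t - h t) * Psi t * N t.
Let C0 := 4 * (40 + 10 * M + 10 * M ^+ 2).
Let q t := 1 + A + Order.max (tau t) 0 ^+ 2.
(** The logarithm pays for the growth. The first arctangent suspends the rate n near tau = 0, where
    p is too small to supply it, and the second pays for the terms of order 1 / P. Both arctangents
    are bounded and hence cost a constant only. *)
Let w t := - (3 / 2) * ln (q t) + 12^-1 * (n * t - atan (n * tau t)) - C0 * atan (tau t).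

Let k0 : k != 0. Proof. by apply/eqP => k0; move: k1; rewrite k0 normr0 ler10. Qed.
Let kk0 : 0 < k ^+ 2. Proof. by rewrite exprn_even_gt0. Qed.
Let P0 t : 0 < P t. Proof. by rewrite ltr_pwDl ?sqr_ge0. Qed.
Let pE t : p t = k ^+ 2 * P t.
Proof. by rewrite /p /P /zeta /tau; field. Qed.
Let p0 t : 0 < p t. Proof. by rewrite pE mulr_gt0. Qed.
Let A0 : 0 < A. Proof. by rewrite mulr_gt0. Qed.
Let nu0 : 0 < nu. Proof. by rewrite nuE exprn_gt0. Qed.
Let sg0 : 0 < sg. Proof. exact: lt_le_trans nusg. Qed.
Let q0 t : 0 < q t. Proof. by rewrite ltr_pwDl ?sqr_ge0 ?addr_gt0. Qed.
Let kap_den t : 0 < p t + screening M.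
Proof.
rewrite ltr_pwDl// /screening; case: sp => //.
by apply: mulr_ge0 (sqr_ge0 _); rewrite mulr_ge0 ?pi_ge0.
Qed.
Let h_den t : 0 < 1 + sg ^+ 2 * M ^+ 2 * p t.
Proof.
by apply: ltr_pwDl => //; apply: mulr_ge0 (ltW (p0 t)); apply: mulr_ge0; exact: sqr_ge0.
Qed.
Let PA0 t : 0 < P t + A. Proof. exact: addr_gt0. Qed.

Let dtau t : is_derive t (1 : R) tau 1.
Proof. by rewrite /tau; der; ring. Qed.
Let dP t : is_derive t (1 : R) P (2 * tau t).
Proof. by have h1 := dtau t; rewrite /P; der; ring. Qed.
Let dp t : is_derive t (1 : R) p (2 * k ^+ 2 * tau t).
Proof. by rewrite /p /zeta; der; rewrite /tau; field. Qed.
Let dG t : is_derive t (1 : R) G ((2 * (P t + A))^-1 - tau t ^+ 2 / (P t + A) ^+ 2).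
Proof.
have h1 := dtau t; have h2 := dP t; rewrite /G; der; first by rewrite mulf_neq0// gt_eqF.
by field; rewrite gt_eqF.
Qed.
Let dh t : is_derive t (1 : R) h (sg * k ^+ 2 * tau t / (1 + sg ^+ 2 * M ^+ 2 * p t) ^+ 2).
Proof.
have h1 := dp t; rewrite /h; der; first by rewrite gt_eqF.
by have := h_den t; rewrite -exprMn => hd; field; rewrite gt_eqF.
Qed.

Let Fd t := (2 * k ^+ 2 * tau t * kappa M (p t)
  - p t * (4 * pi * M ^+ 2 / (p t + screening M) ^+ 2 * (2 * k ^+ 2 * tau t))) / M ^+ 2.
Let dF t : is_derive t (1 : R) F (Fd t).
Proof.
have h1 := dp t; rewrite /F /kappa; der; first by rewrite gt_eqF.
by rewrite /Fd /kappa; field; rewrite !gt_eqF.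
Qed.

Let dw t : is_derive t (1 : R) w (- 3 * (Order.max (tau t) 0 / q t) +
   12^-1 * (n - n / (1 + n ^+ 2 * tau t ^+ 2)) - C0 * (P t)^-1).
Proof.
have h1 := dtau t; have h2 : is_derive t (1 : R) (fun y => Order.max (tau y) 0 ^+ 2) (2 * Order.max (tau t) 0 * 1).
  exact: (der_comp (der_sqr_pos_part _) h1).
have dq : is_derive t (1 : R) q (2 * Order.max (tau t) 0) 
  by rewrite -[2 * _]mulr1 -[X in is_derive _ _ _ X]add0r; apply: der_add h2; exact: der_cst.
rewrite /w; der; first exact: q0.
rewrite /P; have -> : n ^+ 2 * tau t ^+ 2 = (n * tau t) ^+ 2 by ring.
have q1 := q0 t; have q2 : 0 < 1 + (n * tau t) ^+ 2 by rewrite ltr_pwDl ?sqr_ge0.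
have q3 := P0 t; rewrite /P in q3.
by move: q1 q2 q3; move: (q t) => q' q1 q2 q3; field; rewrite !gt_eqF.
Qed.

Let kap_ge1 t : 1 <= kappa M (p t).
Proof.
rewrite /kappa lerDl divr_ge0 ?(ltW (kap_den t))//.
by apply: mulr_ge0 (sqr_ge0 _); rewrite mulr_ge0 ?pi_ge0.
Qed.

(** The constant [Kerr] of the energy inequality. It is not bounded as nu tends to 0, which is
    harmless: it multiplies cutoff errors that disappear for fixed nu. *)
Definition error_factor := 4 / sg + 2 / nu + 4 * ((4^-1 + (2 * sg * M ^+ 2)^-1) * M) ^+ 2 / (2^-1 * sg / (1 + sg ^+ 2 * M ^+ 2)).

Lemma weighted_energy_derive (t : R) : 0 < t -> exists2 d, is_derive t (1 : R) (fun t => expR (w t) * B t) d &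
  d <= expR (w t) * (error_factor * (e1 t ^+ 2 + e2 t ^+ 2 + e3 t ^+ 2 + e4 t ^+ 2)).
Proof.
move=> t0; set psid := - (2 * k * zeta t / p t) * Psi t - 2 * k ^+ 2 / p t * Om t + kappa M (p t) * p t / M ^+ 2 * N t
     - sg * p t * Psi t + (e1 t + zeta t * e2 t).
set Omd := Psi t - nu * p t * Om t + (e3 t + zeta t * e4 t).
set W := Om t + N t.
pose Bd := Psi t * psid + 2^-1 * Fd t * N t ^+ 2 - F t * N t * Psi t + W * (Omd - Psi t)
   + ((2 * (P t + A))^-1 - tau t ^+ 2 / (P t + A) ^+ 2 - sg * k ^+ 2 * tau t / (1 + sg ^+ 2 * M ^+ 2 * p t) ^+ 2) * Psi t * N t
   + (G t - h t) * (psid * N t - Psi t * Psi t).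
have dB : is_derive t (1 : R) B Bd.
  have h1 := dG t; have h2 := dh t; have h3 := dF t; have h4 := dN t0; have h5 := dPsi t0; have h6 := dOm t0.
  rewrite /B; der; rewrite -/psid -/Omd /Bd /W.
  by move: (_ / (_ ^+ 2)) (sg * k ^+ 2 * _ / _) (2 * (P t + A))^-1 => a b c; field.
have hw := dw t.
exists (expR (w t) * (Bd + (- 3 * (Order.max (tau t) 0 / q t) +
   12^-1 * (n - n / (1 + n ^+ 2 * tau t ^+ 2)) - C0 * (P t)^-1) * B t)).
  by der; ring.
rewrite ler_pM2l ?expR_gt0//.
pose s := Num.sqrt (p t); have s0 : 0 < s by rewrite sqrtr_gt0.
have ss : s ^+ 2 = p t by rewrite sqr_sqrtr// ltW.
have sE : s ^+ 2 = `|k| ^+ 2 * (1 + tau t ^+ 2) by rewrite ss pE -normrX ger0_norm ?sqr_ge0.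
have pi0 := pi_ge0 R.
have dE : `|Fd t * M ^+ 2 / s ^+ 2 - kappa M (p t) * (2 * (tau t / (1 + tau t ^+ 2)))| <= 4 * pi * M ^+ 2 * (1 + tau t ^+ 2)^-1.
  have -> : Fd t * M ^+ 2 / s ^+ 2 - kappa M (p t) * (2 * (tau t / (1 + tau t ^+ 2))) =
    - (4 * pi * M ^+ 2 * (P t)^-1 * ((2 * tau t / P t) * (p t / (p t + screening M)) ^+ 2 / k ^+ 2)).
    rewrite /Fd ss -/(P t) pE; have := kap_den t; rewrite pE => hk; field.
    by rewrite k0 !gt_eqF.
  have c0 : 0 <= 4 * pi * M ^+ 2 * (P t)^-1.
    by apply: mulr_ge0; [apply: mulr_ge0 (sqr_ge0 _); exact: mulr_ge0|rewrite invr_ge0 ltW].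
  rewrite normrN normrM (ger0_norm c0) ler_piMr// normrM normfV (ger0_norm (sqr_ge0 k)).
  rewrite ler_pdivrMr// mul1r; apply: (@le_trans _ _ 1); last by rewrite -(ger0_norm (sqr_ge0 k)) normrX exprn_ege1.
  rewrite normrM -[leRHS]mulr1; apply: ler_pM => //.
    rewrite normrM normfV (gtr0_norm (P0 t)) ler_pdivrMr// mul1r normrM ger0_norm// /P.
    by rewrite -(ger0_norm (sqr_ge0 (tau t))) normrX; exact: mul2_le_1Dsqr.
  rewrite normrX; apply: exprn_ile1 => //; rewrite normrM normfV (gtr0_norm (kap_den t)) (gtr0_norm (p0 t)).
  rewrite ler_pdivrMr// mul1r lerDl /screening; case: sp => //.
  by apply: mulr_ge0 (sqr_ge0 _); rewrite mulr_ge0.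
have zs : `|zeta t| <= s.
  rewrite -(@ler_pXn2r _ 2)// ?nnegrE ?(ltW s0)// ss -normrX ger0_norm ?sqr_ge0//.
  by rewrite /p lerDr sqr_ge0.
have r0 : 0 <= n - n / (1 + n ^+ 2 * tau t ^+ 2).
  rewrite subr_ge0 ler_piMr ?(ltW n0)// invf_le1 ?lerDl -?exprMn ?sqr_ge0//.
  by rewrite ltr_pwDl ?sqr_ge0.
have n2 : 0 < 1 + n ^+ 2 * tau t ^+ 2 by rewrite -exprMn ltr_pwDl ?sqr_ge0.
have r1 : n - n / (1 + n ^+ 2 * tau t ^+ 2) <= 1.
  by apply: le_trans n1; rewrite gerBl divr_ge0 ?ltW.
(* This fixes n = nu^(1/3): the suspended rate equals n^3 tau^2 / (1 + n^2 tau^2), which is at most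
   nu p exactly because n^3 = nu. *)
have rnu : n - n / (1 + n ^+ 2 * tau t ^+ 2) <= nu * s ^+ 2.
  have -> : n - n / (1 + n ^+ 2 * tau t ^+ 2) = nu * tau t ^+ 2 / (1 + n ^+ 2 * tau t ^+ 2).
    by have n3 := n2; rewrite -exprMn in n3; rewrite nuE; field; rewrite gt_eqF.
  apply: (@le_trans _ _ (nu * tau t ^+ 2)).
    apply: ler_piMr; first by apply: mulr_ge0 (sqr_ge0 _); exact: ltW.
    by rewrite invf_le1// lerDl -exprMn sqr_ge0.
  rewrite ler_pM2l// sE; apply: (@le_trans _ _ (1 + tau t ^+ 2)); first by rewrite lerDr.
  by rewrite ler_peMl ?exprn_ege1// addr_ge0 ?sqr_ge0.
have := energy_algebra nu0 nusg M0 sgM nuM sg_half k1 s0 sE (Psi t) (s * N t / M) W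
  (e1 t) (e2 t) (e3 t) (e4 t) (kap_ge1 t) dE zs r0 r1 rnu.
have NE : M * (s * N t / M) / s = N t by field; rewrite !gt_eqF.
rewrite NE; apply: le_trans; rewrite le_eqVlt; apply/orP; left; apply/eqP.
have xE : (sg * M * s) ^+ 2 = sg ^+ 2 * M ^+ 2 * p t by rewrite -ss; ring.
rewrite xE.
have -> : `|k| ^+ 2 = k ^+ 2 by rewrite -normrX ger0_norm ?sqr_ge0.
rewrite ss.
have h1 : - (2 * k * zeta t / p t) = 2 * (tau t / (1 + tau t ^+ 2)).
  rewrite pE -/(P t); have -> : zeta t = - k * tau t by rewrite /zeta /tau; field.
  by field; rewrite k0 !gt_eqF.
have h2 : 2 * k ^+ 2 / p t = 2 * (1 + tau t ^+ 2)^-1.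
  by rewrite pE -/(P t); field; rewrite k0 !gt_eqF.
rewrite /Bd /psid /Omd /B h1 h2 /F /W /q -/(P t) /C0 -/(G t) -/(h t).
have -> : 1 + A + Order.max (tau t) 0 ^+ 2 = 1 + 4 * M + Order.max (tau t) 0 ^+ 2 by [].
move: (_ / (1 + 4 * M + _)) (n - _) => a b.
rewrite /A.
move: (tau t ^+ 2 / _) (sg * k ^+ 2 * _ / _) (2 * (_ + _))^-1 => c d f.
move: (tau t / _) => g; move: (P t)^-1 => i.
move: (zeta t) (G t) (h t) (Fd t) (kappa M _ * _ / _) => z g' h' fd kk.
move: (Psi t) (N t) (Om t) (e1 t) (e2 t) (e3 t) (e4 t) (p t) => q1 q2 q3 q4 q5 q6 q7 q8.
by field.
Qed.

Let S t := Psi t ^+ 2 + kappa M (p t) * (p t * N t ^+ 2 / M ^+ 2) + (Om t + N t) ^+ 2.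

Let B_bounds (t : R) : 5 / 16 * S t <= B t /\ B t <= 11 / 16 * S t.
Proof.
pose s := Num.sqrt (p t); have s0 : 0 < s by rewrite sqrtr_gt0.
have ss : s ^+ 2 = p t by rewrite sqr_sqrtr// ltW.
have sE : s ^+ 2 = `|k| ^+ 2 * (1 + tau t ^+ 2) by rewrite ss pE -normrX ger0_norm ?sqr_ge0.
have := energy_lower nu0 nusg M0 k1 s0 sE (Psi t) (s * N t / M) (Om t + N t) (kap_ge1 t).
have := energy_upper nu0 nusg M0 k1 s0 sE (Psi t) (s * N t / M) (Om t + N t) (kap_ge1 t).
have NE : M * (s * N t / M) / s = N t by field; rewrite !gt_eqF.
have xE : (sg * M * s) ^+ 2 = sg ^+ 2 * M ^+ 2 * p t by rewrite -ss; ring.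
have rE : (s * N t / M) ^+ 2 = p t * N t ^+ 2 / M ^+ 2 by rewrite -ss; field; rewrite gt_eqF.
by rewrite NE xE rE ss.
Qed.

Let X t := Psi t ^+ 2 + p t * N t ^+ 2 / M ^+ 2 + Om t ^+ 2.

Let N_rho (t : R) : N t ^+ 2 <= M ^+ 2 * (p t * N t ^+ 2 / M ^+ 2).
Proof.
have -> : M ^+ 2 * (p t * N t ^+ 2 / M ^+ 2) = p t * N t ^+ 2 by field; rewrite gt_eqF.
rewrite ler_peMl ?sqr_ge0// pE -[1]mulr1; apply: ler_pM => //; last by rewrite lerDl sqr_ge0.
by rewrite -(ger0_norm (sqr_ge0 k)) normrX exprn_ege1.
Qed.

Let rho_ge0 (t : R) : 0 <= p t * N t ^+ 2 / M ^+ 2.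
Proof. by apply: divr_ge0 (sqr_ge0 _); apply: mulr_ge0 (sqr_ge0 _); exact: ltW. Qed.

Let kap_le (t : R) : kappa M (p t) <= 1 + 16 * M ^+ 2.
Proof.
have pi4 : (pi : R) <= 4.
  by have /andP[_] := @pihalf_02 R; rewrite ltr_pdivrMr// => /ltW; have -> : (2 * 2 = 4 :> R) by ring.
rewrite /kappa lerD2l; apply: (@le_trans _ _ (4 * pi * M ^+ 2)).
  apply: ler_piMr; first by apply: mulr_ge0 (sqr_ge0 _); rewrite mulr_ge0 ?pi_ge0.
  rewrite invf_le1//; apply: (@le_trans _ _ (p t)).
    rewrite pE -[1]mulr1; apply: ler_pM => //; last by rewrite lerDl sqr_ge0.
    by rewrite -(ger0_norm (sqr_ge0 k)) normrX exprn_ege1.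
  rewrite lerDl /screening; case: sp => //.
  by apply: mulr_ge0 (sqr_ge0 _); rewrite mulr_ge0 ?pi_ge0.
apply: ler_wpM2r; first exact: sqr_ge0.
by move: pi4; move: (pi : R) => a; lra.
Qed.

Let X_le (t : R) : X t <= 8 * (1 + M ^+ 2) * B t.
Proof.
have [h1 _] := B_bounds t.
apply: (@le_trans _ _ ((2 + 2 * M ^+ 2) * S t)); last first.
  have -> : 8 * (1 + M ^+ 2) * B t = (2 + 2 * M ^+ 2) * (4 * B t) by ring.
  have c0 : 0 <= 2 + 2 * M ^+ 2 by apply: addr_ge0 => //; rewrite mulr_ge0 ?sqr_ge0.
  apply: ler_wpM2l => //.
  suff : 0 <= S t by move: h1; lra.
  apply: addr_ge0 (sqr_ge0 _); apply: addr_ge0 (sqr_ge0 _) _; apply: mulr_ge0 => //.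
  exact: le_trans (kap_ge1 t).
have := N_rho t; have := rho_ge0 t; have := sqr_ge0 M; have := sqr_ge0 (Psi t); have := sqr_ge0 (Om t + N t).
have h2 := ler_wpM2r (rho_ge0 t) (kap_ge1 t).
have h3 : Om t ^+ 2 <= 2 * (Om t + N t) ^+ 2 + 2 * N t ^+ 2.
  have := sqr_ge0 (Om t + 2 * N t).
  have -> : 2 * (Om t + N t) ^+ 2 + 2 * N t ^+ 2 = Om t ^+ 2 + (Om t + 2 * N t) ^+ 2 by ring.
  by rewrite lerDl.
move: h2 h3; rewrite /X /S mul1r.
move: (M ^+ 2) (N t ^+ 2) (Om t ^+ 2) ((Om t + N t) ^+ 2) (Psi t ^+ 2) (p t * _ / _) (kappa _ _ * _)  => m f e d c b a.
by move=> *; nra.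
Qed.

Let B_le (t : R) : B t <= 13 * (1 + M ^+ 2) * X t.
Proof.
have [_ h1] := B_bounds t; apply: (le_trans h1).
apply: (@le_trans _ _ (11 / 16 * ((3 + 18 * M ^+ 2) * X t))); last first.
  have X0 : 0 <= X t by apply: addr_ge0 (sqr_ge0 _); apply: addr_ge0 (sqr_ge0 _) _.
  rewrite mulrA; apply: ler_wpM2r => //; have := sqr_ge0 M; move: (M ^+ 2) => m; lra.
rewrite ler_pM2l//.
have h3 : (Om t + N t) ^+ 2 <= 2 * Om t ^+ 2 + 2 * N t ^+ 2.
  have := sqr_ge0 (Om t - N t).
  have -> : 2 * Om t ^+ 2 + 2 * N t ^+ 2 = (Om t + N t) ^+ 2 + (Om t - N t) ^+ 2 by ring.
  by rewrite lerDl.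
have h2 := ler_wpM2r (rho_ge0 t) (kap_le t).
have := N_rho t; have := rho_ge0 t; have := sqr_ge0 M; have := sqr_ge0 (Psi t); have := sqr_ge0 (Om t).
move: h2 h3; rewrite /X /S.
move: (M ^+ 2) (N t ^+ 2) (Om t ^+ 2) ((Om t + N t) ^+ 2) (Psi t ^+ 2) (p t * _ / _) (kappa _ _ * _)  => m f e d c b a.
by move=> *; nra.
Qed.

Let mx_le : Order.max (tau T) 0 <= Order.max (tau 0) 0 + T.
Proof. 
have h1 : tau 0 <= Order.max (tau 0) 0 by rewrite le_max lexx.
have h2 : 0 <= Order.max (tau 0) 0 by rewrite le_max lexx orbT.
rewrite ge_max; apply/andP; split; last exact: addr_ge0.
have -> : tau T = tau 0 + T by rewrite /tau; ring.
by rewrite lerD2r.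
 Qed.

Let qT_le : q T <= (2 + 2 * T ^+ 2) * q 0.
Proof.
rewrite /q; have := mx_le; have : 0 <= Order.max (tau 0) 0 by rewrite le_max lexx orbT.
have : 0 <= Order.max (tau T) 0 by rewrite le_max lexx orbT.
move: (Order.max _ _) (Order.max (tau 0) _) => a b a0 b0 h1.
have h2 : a ^+ 2 <= 2 * b ^+ 2 + 2 * T ^+ 2.
  apply: (@le_trans _ _ ((b + T) ^+ 2)); first by rewrite ler_pXn2r ?nnegrE ?addr_ge0.
  have := sqr_ge0 (b - T); nra.
have := sqr_ge0 b; have := sqr_ge0 T; have := A0; move: (a ^+ 2) (b ^+ 2) (T ^+ 2) A h2 => a2 b2 t2 aa *; nra.
Qed.

(** An alternative to [qT_le] whose factor P T is given back by the division by p. *)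
Let qT_leP : q T <= P T * q 0.
Proof.
rewrite /q /P.
have h1 : Order.max (tau T) 0 ^+ 2 <= tau T ^+ 2.
  by case: (leP (tau T) 0) => h1; rewrite ?expr0n ?sqr_ge0.
have := sqr_ge0 (Order.max (tau 0) 0); have := A0.
have := sqr_ge0 (tau T).
by move: (_ ^+ 2) (Order.max (tau 0) 0 ^+ 2) (tau T ^+ 2) A h1 => a b c d *; nra.
Qed.

Let w_le (t : R) : 0 <= t -> w t <= - (3 / 2) * ln (q 0) + (12^-1 * (n * t) + (12^-1 + C0) * (pi / 2)).
Proof.
move=> t0; rewrite /w.
have h1 : ln (q 0) <= ln (q t).
  have m0 u : 0 <= Order.max (tau u) 0 by rewrite le_max lexx orbT.
  rewrite ler_ln ?posrE// /q lerD2l ler_pXn2r ?nnegrE//.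
  rewrite ge_max m0 andbT; apply: (@le_trans _ _ (tau t)); last by rewrite le_max lexx.
  by rewrite /tau lerD2r.
have h3 := ltW (atan_gtNpi2 (n * tau t)); have h4 := ltW (atan_gtNpi2 (tau t)).
have c0 : 0 <= C0 by rewrite /C0 mulr_ge0// !addr_ge0 ?mulr_ge0 ?sqr_ge0// ltW.
have h5 := ler_wpM2l c0 h4.
rewrite (mulrDl 12^-1 C0) mulrN in h5 *.
move: h1 h3 h5; move: (ln _) (ln (q t)) (n * t) (atan _) (C0 * atan _) (C0 * (pi / 2)) (pi / 2) => *; lra.
Qed.

Let w_ge : - (3 / 2) * ln (q T) + 12^-1 * (n * T) - (12^-1 + C0) * (pi / 2) <= w T.
Proof.
rewrite /w; have h3 := ltW (atan_ltpi2 (n * tau T)); have h4 := ltW (atan_ltpi2 (tau T)).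
have c0 : 0 <= C0 by rewrite /C0 mulr_ge0// !addr_ge0 ?mulr_ge0 ?sqr_ge0// ltW.
have h5 := ler_wpM2l c0 h4.
rewrite (mulrDl 12^-1 C0).
move: h3 h5; move: (ln _) (n * T) (atan _) (C0 * atan _) (C0 * (pi / 2)) (pi / 2) => *; lra.
Qed.

Let wB : {within `[0, T], continuous B}.
Proof.
have cc c : {within `[0, T], continuous (fun _ : R => c : R)} by apply: continuous_subspaceT => x; exact: cvg_cst.
have c1 := derive_within_continuous (D := `[0, T]) dF; have c2 := derive_within_continuous (D := `[0, T]) dG.
have c3 := derive_within_continuous (D := `[0, T]) dh.
have d2 := within_continuousX (n := 2) cPsi; have d3 := within_continuousX (n := 2) cN.
have d4 := within_continuousX (n := 2) (within_continuousD cOm cN).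
have d5 := within_continuousM (cc 2^-1) d2.
have d6 := within_continuousM (within_continuousM (cc 2^-1) c1) d3.
have d7 := within_continuousM (cc 2^-1) d4.
have d8 := within_continuousM (within_continuousM (within_continuousD c2 (within_continuousN c3)) cPsi) cN.
exact: (within_continuousD (within_continuousD (within_continuousD d5 d6) d7) d8).
Qed.

Let error_factor_ge0 : 0 <= error_factor.
Proof.
apply: addr_ge0; [apply: addr_ge0|]; apply: divr_ge0 => //; try exact: ltW.
  by apply: mulr_ge0 => //; exact: sqr_ge0.
apply: divr_ge0; first by apply: mulr_ge0 => //; exact: ltW.
by apply: addr_ge0 => //; apply: mulr_ge0; exact: sqr_ge0.
Qed.

Let Q_ge0 t : 0 <= Q t.
Proof. by apply: le_trans (eQ t); do 3 (apply: addr_ge0; last exact: sqr_ge0); exact: sqr_ge0. Qed.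

Let D_ge0 : 0 <= D T.
Proof.
have hN : {within `[0, T], continuous (fun t => - D t)} by exact: within_continuousN.
have := @derive_le0_le _ (fun t => - D t) (fun t => - Q t) 0 T T0 _ _ hN.
rewrite D0 oppr0 oppr_le0; apply.
- by move=> x; rewrite in_itv/= => /andP[x0 xT]; have := dD x0 xT => dDx; der.
- by move=> x _; rewrite oppr_le0.
Qed.

Let B_ge0 t : 0 <= B t.
Proof.
have [h1 _] := B_bounds t; apply: le_trans h1; apply: mulr_ge0 => //.
apply: addr_ge0 (sqr_ge0 _); apply: addr_ge0 (sqr_ge0 _) _; apply: mulr_ge0 => //.
exact: le_trans (kap_ge1 t).
Qed.

Let B_decay : B T <= expR ((12^-1 + C0) * pi) * expR (3 / 2 * (ln (q T) - ln (q 0))) *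
  (expR (- (n * T / 12)) * B 0 + error_factor * D T).
Proof.
(* A bound of the weight valid on all of [0, T], since the logarithm is nondecreasing in time; with
   it the errors enter through their unweighted primitive D. *)
pose v := expR (- (3 / 2) * ln (q 0) + (12^-1 * (n * T) + (12^-1 + C0) * (pi / 2))).
have v0 : 0 <= v := expR_ge0 _.
have key : expR (w T) * B T - v * error_factor * D T <= expR (w 0) * B 0 - v * error_factor * D 0.
  have [d hd] : exists d : R -> R, forall t : R, 0 < t -> is_derive t (1 : R) (fun t => expR (w t) * B t) (d t) /\
      d t <= expR (w t) * (error_factor * (e1 t ^+ 2 + e2 t ^+ 2 + e3 t ^+ 2 + e4 t ^+ 2)).
    have h1 (t : R) : exists d, 0 < t -> is_derive t (1 : R) (fun t => expR (w t) * B t) d /\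
      d <= expR (w t) * (error_factor * (e1 t ^+ 2 + e2 t ^+ 2 + e3 t ^+ 2 + e4 t ^+ 2)).
      have [t0|t0] := ltP 0 t; last by exists 0.
      by have [d h1 h2] := weighted_energy_derive t0; exists d.
    by have [d hd] := choice h1; exists d.
  apply: (@derive_le0_le _ (fun t => expR (w t) * B t - v * error_factor * D t)
    (fun t => d t - v * error_factor * Q t) 0 T T0).
  - move=> x; rewrite in_itv/= => /andP[x0 xT]; have [h1 _] := hd x x0; have h2 := dD x0 xT.
    have h3 : is_derive x (1 : R) (fun t => v * error_factor * D t) (v * error_factor * Q x) by der; ring.
    exact: (der_add h1 (der_opp h3)).
  - move=> x; rewrite in_itv/= => /andP[x0 xT]; have [_ h1] := hd x x0.
    rewrite subr_le0; apply: (le_trans h1); rewrite -mulrA; apply: ler_pM.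
    + exact: expR_ge0.
    + by apply: mulr_ge0 => //; do 3 (apply: addr_ge0; last exact: sqr_ge0); exact: sqr_ge0.
    + rewrite ler_expR; apply: (le_trans (w_le (ltW x0))); rewrite lerD2l lerD2r ler_pM2l// ler_pM2l//; exact: ltW.
    + exact: ler_wpM2l.
  - apply: within_continuousD.
      apply: within_continuousM wB; apply: (@derive_within_continuous _ _ _ (fun t => expR (w t) * (- 3 * (Order.max (tau t) 0 / q t) +
        12^-1 * (n - n / (1 + n ^+ 2 * tau t ^+ 2)) - C0 * (P t)^-1))) => x.
      exact: der_expR (dw x).
    apply: within_continuousN; apply: within_continuousM cD.
    by apply: continuous_subspaceT => x; exact: cvg_cst.
rewrite D0 mulr0 subr0 lerBlDr in key.
have e0 : expR (w 0) * expR (- w T) <= expR ((12^-1 + C0) * pi) * expR (3 / 2 * (ln (q T) - ln (q 0))) * expR (- (n * T / 12)).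
  rewrite -!expRD ler_expR; have := w_le (lexx 0); have := w_ge; rewrite mulr0.
  have -> : (12^-1 + C0) * pi = (12^-1 + C0) * (pi / 2) + (12^-1 + C0) * (pi / 2) by field.
  move: (_ * (pi / 2)) (w T) (w 0) (ln _) (ln (q 0)) (n * T) => *; lra.
have e1' : v * expR (- w T) <= expR ((12^-1 + C0) * pi) * expR (3 / 2 * (ln (q T) - ln (q 0))).
  rewrite -!expRD ler_expR; have := w_ge.
  have -> : (12^-1 + C0) * pi = (12^-1 + C0) * (pi / 2) + (12^-1 + C0) * (pi / 2) by field.
  move: (_ * (pi / 2)) (w T) (ln _) (ln (q 0)) (n * T) => *; lra.
have -> : B T = expR (- w T) * (expR (w T) * B T) by rewrite mulrA -expRD addNr expR0 mul1r.
apply: (@le_trans _ _ (expR (- w T) * (expR (w 0) * B 0 + v * error_factor * D T))).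
  by apply: ler_wpM2l; rewrite ?expR_ge0.
move: e0 e1' (B_ge0 0) (mulr_ge0 error_factor_ge0 D_ge0); rewrite -(mulrA v).
move: (expR (w 0)) (expR (- w T)) (expR ((_ + _) * pi)) (expR (3 / 2 * _)) (expR (- (n * T / 12))) (B 0) (error_factor * D T).
move=> a b c d f i j h1 h2 i0 j0.
have -> : b * (a * i + v * j) = a * b * i + v * b * j by ring.
have -> : c * d * (f * i + j) = c * d * f * i + c * d * j by ring.
by apply: lerD; apply: ler_wpM2r.
Qed.

(** 104 = 8 * 13 comes from comparing the energy with the plain sum of squares at both ends of the
    interval; the exponential contains pi, the oscillation of an arctangent. *)
Definition mode_const := 104 * (1 + M ^+ 2) ^+ 2 * expR ((12^-1 + 4 * (40 + 10 * M + 10 * M ^+ 2)) * pi).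

Let X_decay : X T <= mode_const * expR (3 / 2 * (ln (q T) - ln (q 0))) *
  (expR (- (n * T / 12)) * X 0 + error_factor * D T).
Proof.
have m1 : 1 <= 1 + M ^+ 2 by rewrite lerDl sqr_ge0.
have m0 : 0 <= 1 + M ^+ 2 by apply: le_trans m1.
have ED0 : 0 <= error_factor * D T by apply: mulr_ge0.
apply: (le_trans (X_le T)).
have h1 := ler_wpM2l (mulr_ge0 (ler0n _ 8) m0) B_decay.
apply: (le_trans h1).
have -> : mode_const * expR (3 / 2 * (ln (q T) - ln (q 0))) * (expR (- (n * T / 12)) * X 0 + error_factor * D T)
 = 8 * (1 + M ^+ 2) * (expR ((12^-1 + C0) * pi) * expR (3 / 2 * (ln (q T) - ln (q 0))) *
   (13 * (1 + M ^+ 2) * (expR (- (n * T / 12)) * X 0 + error_factor * D T))).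
  by rewrite /mode_const -/C0; ring.
apply: ler_wpM2l; first by apply: mulr_ge0.
apply: ler_wpM2l; first by apply: mulr_ge0; exact: expR_ge0.
rewrite [leRHS]mulrDr; apply: lerD.
  by rewrite [leRHS]mulrCA; apply: ler_wpM2l; [exact: expR_ge0|exact: B_le].
by apply: ler_peMl => //; move: m1; lra.
Qed.

Let X_ge0 (t : R) : 0 <= X t.
Proof. by apply: addr_ge0 (sqr_ge0 _); apply: addr_ge0 (sqr_ge0 _) _. Qed.

Let mode_const_ge0 : 0 <= mode_const.
Proof. by rewrite /mode_const mulr_ge0 ?expR_ge0// mulr_ge0// sqr_ge0. Qed.

Let bracket_ge0 : 0 <= expR (- (n * T / 12)) * X 0 + error_factor * D T.
Proof. by apply: addr_ge0; apply: mulr_ge0 => //; exact: expR_ge0. Qed.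

Let T20 : 0 < 2 + 2 * T ^+ 2.
Proof. by rewrite ltr_pwDl// mulr_ge0 ?sqr_ge0. Qed.

Let ln_q : ln (q T) - ln (q 0) <= ln (2 + 2 * T ^+ 2).
Proof. by rewrite lerBlDr -lnM ?posrE// ler_ln ?posrE// mulr_gt0. Qed.

Let ln_qP : ln (q T) - ln (q 0) <= ln (P T).
Proof. by rewrite lerBlDr -lnM ?posrE// ler_ln ?posrE// mulr_gt0. Qed.

Lemma mode_decay :
  Psi T ^+ 2 + p T * N T ^+ 2 / M ^+ 2 + Om T ^+ 2 <=
  mode_const * expR (3 / 2 * ln (2 + 2 * T ^+ 2)) *
  (expR (- (n * T / 12)) * (Psi 0 ^+ 2 + p 0 * N 0 ^+ 2 / M ^+ 2 + Om 0 ^+ 2) + error_factor * D T).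
Proof.
apply: (le_trans X_decay); apply: ler_wpM2r => //; apply: ler_wpM2l => //.
by rewrite ler_expR ler_pM2l.
Qed.

Lemma mode_decay_div :
  (Psi T ^+ 2 + p T * N T ^+ 2 / M ^+ 2 + Om T ^+ 2) / p T <=
  mode_const * expR (2^-1 * ln (2 + 2 * T ^+ 2)) *
  (expR (- (n * T / 12)) * (Psi 0 ^+ 2 + p 0 * N 0 ^+ 2 / M ^+ 2 + Om 0 ^+ 2) + error_factor * D T).
Proof.
rewrite ler_pdivrMr//; apply: (le_trans X_decay).
rewrite [leRHS]mulrAC; apply: ler_wpM2r => //; rewrite -[leRHS]mulrA; apply: ler_wpM2l => //.
(* Of the exponent 3/2 a full power of q T / q 0 is bounded by P T <= p T and cancels the division;
   1/2 is left. *)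
have -> : 3 / 2 * (ln (q T) - ln (q 0)) = 2^-1 * (ln (q T) - ln (q 0)) + (ln (q T) - ln (q 0)) by field.
rewrite expRD; apply: ler_pM; rewrite ?expR_ge0//; first by rewrite ler_expR ler_pM2l.
apply: (@le_trans _ _ (P T)).
  by rewrite -[leRHS](@lnK _ (P T)) ?posrE// ler_expR.
by rewrite pE ler_peMl ?(ltW (P0 T))// -(ger0_norm (sqr_ge0 k)) normrX exprn_ege1.
Qed.

End ModeODE.

(** * Cutoff functions *)

Section SmoothFunctions.
Variable R : realType.
Implicit Types (g : R -> R) (x y : R).

(* [x^-j exp(-1/x)], extended by [0]: its derivatives stay in the family. *)
Definition flat_exp (j : nat) x : R := if 0 < x then x ^- j * expR (- x^-1) else 0.

Lemma flat_exp_ge0 j x : 0 <= flat_exp j x.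
Proof. by rewrite /flat_exp; case: ifP => // x0; rewrite mulr_ge0 ?expR_ge0// invr_ge0 exprn_ge0// ltW. Qed.

(** With z = 1 / x, the bound z^j <= j! exp(z) is one term of the exponential series. *)
Lemma flat_exp_le j x : flat_exp j x <= j`!%:R.
Proof.
rewrite /flat_exp; case: ifPn => [x0|_]; last by rewrite ler0n.
rewrite expRN -exprVn ler_pdivrMr ?expR_gt0//.
case: j => [|j]; first by rewrite expr0 mul1r -expR0 ler_expR invr_ge0 ltW.
have := @expR_ge1Dxn _ x^-1 j; rewrite invr_ge0 => /(_ (ltW x0)) h.
rewrite mulrC -ler_pdivrMr ?ltr0n ?fact_gt0//; apply: le_trans h.
by rewrite lerDr.
Qed.

Lemma der_flat_exp j x : is_derive x (1 : R) (flat_exp j) (- j%:R * flat_exp j.+1 x + flat_exp j.+2 x).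
Proof.
have [x0|x0|->] := ltgtP x 0.
- have -> : - j%:R * flat_exp j.+1 x + flat_exp j.+2 x = 0.
    by rewrite /flat_exp !(lt_gtF x0) mulr0 addr0.
  apply: (@near_eq_is_derive _ _ _ (fun _ => 0)).
  near=> y; rewrite /flat_exp lt_gtF//; near: y; exact: lt_nbhsl.
- rewrite /flat_exp x0; apply: (@near_eq_is_derive _ _ _ (fun y => y ^- j * expR (- y^-1))).
    by near=> y; rewrite ifT//; near: y; exact: lt_nbhsr.
  der; rewrite ?expf_neq0 ?gt_eqF//.
  case: j => [|j]; first by rewrite /= !expr0 expr2; field; rewrite gt_eqF.
  by rewrite /= !exprS; field; rewrite ?expf_neq0 gt_eqF.
- have -> : - j%:R * flat_exp j.+1 0 + flat_exp j.+2 0 = 0 by rewrite /flat_exp ltxx mulr0 addr0.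
  apply: (@is_derive_quadratic _ _ _ _ (j.+2)`!%:R) => h _.
  rewrite add0r mul0r subr0 {2}/flat_exp ltxx subr0 ger0_norm ?flat_exp_ge0//.
  have [h0|h0] := ltP 0 h; last by rewrite /flat_exp ltNge h0/= mulr_ge0 ?sqr_ge0.
  (* Two more powers of 1 / h remain bounded, so the function is O(h^2) at 0. *)
  have -> : flat_exp j h = flat_exp j.+2 h * h ^+ 2.
    by rewrite /flat_exp h0 !exprS; field; rewrite ?expf_neq0 gt_eqF.
  by rewrite ler_wpM2r ?sqr_ge0 ?flat_exp_le.
Unshelve. all: by end_near.
Qed.

(** A syntactic class closed under differentiation. [smooth] speaks of all iterated derivatives, so
    closure of a class yields by induction what would otherwise need a formula for each order. *)
Inductive smooth1 : (R -> R) -> Prop :=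
| smooth1_cst c : smooth1 (fun _ => c)
| smooth1_id : smooth1 (fun y => y)
| smooth1_flat j : smooth1 (fun y => flat_exp j (1 - y ^+ 2))
| smooth1_dil r g : smooth1 g -> smooth1 (fun y => g (r * y))
| smooth1_add f g : smooth1 f -> smooth1 g -> smooth1 (fun y => f y + g y)
| smooth1_mul f g : smooth1 f -> smooth1 g -> smooth1 (fun y => f y * g y).

Lemma smooth1_der g : smooth1 g -> exists2 g', smooth1 g' & forall y, is_derive y (1 : R) g (g' y).
Proof.
elim=> {g} [c||j|r g _ [g' sg' dg]|f g sf [f' sf' df] sg [g' sg' dg]|f g sf [f' sf' df] sg [g' sg' dg]].
- by exists (fun _ => 0) => [|y]; [exact: smooth1_cst|exact: der_cst].
- by exists (fun _ => 1) => [|y]; [exact: smooth1_cst|exact: der_id].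
- exists (fun y => (- j%:R * flat_exp j.+1 (1 - y ^+ 2) + flat_exp j.+2 (1 - y ^+ 2)) * (- 2 * y)).
    apply: smooth1_mul; last by apply: smooth1_mul; [exact: smooth1_cst|exact: smooth1_id].
    apply: smooth1_add; last exact: smooth1_flat.
    by apply: smooth1_mul; [exact: smooth1_cst|exact: smooth1_flat].
  move=> y; apply: (der_comp (der_flat_exp j _)); der; ring.
- exists (fun y => g' (r * y) * r).
    by apply: smooth1_mul; [exact: smooth1_dil|exact: smooth1_cst].
  move=> y; have h : is_derive y (1 : R) (fun y => r * y) r by der; ring.
  exact: (der_comp (dg _) h).
- exists (fun y => f' y + g' y) => [|y]; first exact: smooth1_add.
  exact: der_add.
- exists (fun y => f' y * g y + f y * g' y) => [|y]; last exact: der_mul.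
  by apply: smooth1_add; exact: smooth1_mul.
Qed.

Lemma smooth1_continuous g : smooth1 g -> continuous g.
Proof. by move=> /smooth1_der[g' _ dg] y; exact: der_continuous (dg y). Qed.

Lemma der_zero_outside g g' (A : R) : (forall y, is_derive y (1 : R) g (g' y)) ->
  (forall y, A < `|y| -> g y = 0) -> forall y, A < `|y| -> g' y = 0.
Proof.
move=> dg g0 y Ay; rewrite -(der_derive1 (dg y)); apply: der_derive1.
apply: (@near_eq_is_derive _ _ _ (fun _ => 0)).
have : \forall z \near y, A < `|z| by have := @norm_continuous _ _ y; move/cvgr_gt; apply.
by apply: filterS => z /g0.
Qed.

Lemma continuous_bounded_support g (A : R) : continuous g -> (forall y, A < `|y| -> g y = 0) ->
  exists2 B, 0 <= B & forall y, `|g y| <= B.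
Proof.
move=> cg g0; have A0 : - `|A| <= `|A| by apply: (@le_trans _ _ 0); rewrite ?oppr_le0.
have [c _ hc] : exists2 c, c \in `[- `|A|, `|A|] & forall t, t \in `[- `|A|, `|A|] -> `|g t| <= `|g c|.
  apply: EVT_max => //; apply: continuous_subspaceT => x.
  by apply: (continuous_comp (cg x)); exact: norm_continuous.
exists `|g c| => // y; have [yA|yA] := leP `|y| `|A|.
  by apply: hc; rewrite in_itv/= -ler_norml.
by rewrite g0 ?normr0// (le_lt_trans (ler_norm _) yA).
Qed.

Definition bump y := (flat_exp 0 1)^-1 * flat_exp 0 (1 - y ^+ 2).

(** The class gives each member a derivative inside the class; iterating a choice function produces
    all derivatives of the bump at once. *)
Lemma bump_jet : exists b : nat -> R -> R, [/\ b 0%N = bump, forall j, smooth1 (b j) &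
  forall j y, is_derive y (1 : R) (b j) (b j.+1 y)].
Proof.
have sb : smooth1 bump by apply: smooth1_mul; [exact: smooth1_cst|exact: smooth1_flat].
pose S := {g | smooth1 g}.
have /choice[d hd] : forall g : S, exists g' : S, forall y, is_derive y (1 : R) (sval g) (sval g' y).
  by move=> [g sg]; have [g' sg' dg] := smooth1_der sg; exists (exist _ g' sg').
exists (fun j => sval (iter j d (exist _ bump sb))); split=> //= j; exact: svalP.
Qed.

Lemma flat_exp0_1 : 0 < flat_exp 0 1.
Proof. by rewrite /flat_exp ltr01 mulr_gt0 ?expR_gt0// invr_gt0 expr0. Qed.

Lemma bump_support y : 1 < `|y| -> bump y = 0.
Proof.
move=> y1; rewrite /bump /flat_exp; have -> : (0 < 1 - y ^+ 2) = false; last by rewrite mulr0.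
apply/negbTE; rewrite -leNgt subr_le0.
by rewrite -(ger0_norm (sqr_ge0 y)) normrX exprn_ege1// ltW.
Qed.

Lemma bump0 : bump 0 = 1.
Proof. by rewrite /bump expr0n subr0 mulVf// gt_eqF// flat_exp0_1. Qed.

Lemma bump_le1 y : 0 <= bump y <= 1.
Proof.
have f0 := flat_exp0_1; rewrite mulr_ge0 ?flat_exp_ge0 ?invr_ge0 ?(ltW f0)//=.
rewrite ler_pdivrMl// mulr1 /flat_exp ltr01; case: ifPn => [y0|_]; last by rewrite mulr_ge0 ?expR_ge0// invr_ge0 expr0.
by rewrite !expr0 invr1 !mul1r ler_expR lerN2 -[leLHS]invr1 lef_pV2 ?posrE// gerBl sqr_ge0.
Qed.

Section Jet.
Variables (b : nat -> R -> R).
Hypotheses (b0 : b 0%N = bump) (sb : forall j, smooth1 (b j))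
  (db : forall j y, is_derive y (1 : R) (b j) (b j.+1 y)).

(* The [j]-th derivative of the dilated bump [y |-> bump (r * y)]. *)
Definition cutoff r j y := r ^+ j * b j (r * y).

Lemma smooth1_cutoff r j : smooth1 (cutoff r j).
Proof. by apply: smooth1_mul; [exact: smooth1_cst|exact: smooth1_dil]. Qed.

Lemma der_cutoff r j y : is_derive y (1 : R) (cutoff r j) (cutoff r j.+1 y).
Proof.
have h : is_derive y (1 : R) (fun y => b j (r * y)) (b j.+1 (r * y) * r).
  have h1 : is_derive y (1 : R) (fun y => r * y) r by der; ring.
  exact: (der_comp (db j _) h1).
by rewrite /cutoff; der; rewrite exprS; ring.
Qed.

Lemma jet_support j y : 1 < `|y| -> b j y = 0.
Proof.
elim: j y => [y|j IH]; first by rewrite b0; exact: bump_support.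
exact: der_zero_outside (db j) IH.
Qed.

Lemma cutoff_support r j y : 0 < r -> r^-1 < `|y| -> cutoff r j y = 0.
Proof.
move=> r0 ry; rewrite /cutoff jet_support ?mulr0// normrM (gtr0_norm r0).
by rewrite -ltr_pdivrMl// mulr1.
Qed.

Lemma jet_bounded j : exists2 B, 0 <= B & forall y, `|b j y| <= B.
Proof. by apply: (@continuous_bounded_support _ 1); [exact: smooth1_continuous|exact: jet_support]. Qed.

End Jet.

(** Cosines with a free phase suffice: differentiation shifts the phase by pi / 2, so that sines
    need no constructor of their own. *)
Inductive smooth2 : (R * R -> R) -> Prop :=
| smooth2_y (g : R -> R) : smooth1 g -> smooth2 (fun z => g z.2)
| smooth2_cos k zeta d : smooth2 (fun z => cos (k * z.1 + zeta * z.2 + d))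
| smooth2_add (f g : R * R -> R) : smooth2 f -> smooth2 g -> smooth2 (fun z => f z + g z)
| smooth2_mul (f g : R * R -> R) : smooth2 f -> smooth2 g -> smooth2 (fun z => f z * g z).

Lemma smooth2_der (f : R * R -> R) : smooth2 f -> continuous f /\ exists fx fy, [/\ smooth2 fx, smooth2 fy &
  forall x y, is_derive x (1 : R) (fun x' => f (x', y)) (fx (x, y)) /\
              is_derive y (1 : R) (fun y' => f (x, y')) (fy (x, y))].
Proof.
have s2c c : smooth2 (fun _ => c) := smooth2_y (smooth1_cst c).
elim=> {f} [g sg|k ze d|f g sf [cf [fx [fy [sfx sfy df]]]] sg [cg [gx [gy [sgx sgy dg]]]]|
  f g sf [cf [fx [fy [sfx sfy df]]]] sg [cg [gx [gy [sgx sgy dg]]]]].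
- split; first by move=> z; apply: (continuous_comp cvg_snd); exact: smooth1_continuous.
  have [g' sg' dg] := smooth1_der sg; exists (fun _ => 0), (fun z => g' z.2); split=> //.
    exact: smooth2_y.
  by move=> x y /=; split; [exact: der_cst|exact: dg].
- split.
    move=> z; apply: (@continuous_comp _ _ _ (fun z : R * R => k * z.1 + ze * z.2 + d) cos); last exact: continuous_cos.
    by apply: cvgD; [apply: cvgD; apply: cvgMr; [exact: cvg_fst|exact: cvg_snd]|exact: cvg_cst].
  exists (fun z => k * cos (k * z.1 + ze * z.2 + (d + pi / 2))), (fun z => ze * cos (k * z.1 + ze * z.2 + (d + pi / 2))).
  split; [by apply: smooth2_mul => //; exact: smooth2_cos|by apply: smooth2_mul => //; exact: smooth2_cos|].
  move=> x y /=; rewrite addrA cosDpihalf.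
  by split; der; ring.
- split; first by move=> z; apply: cvgD; [exact: cf|exact: cg].
  exists (fun z => fx z + gx z), (fun z => fy z + gy z); split; [exact: smooth2_add|exact: smooth2_add|].
  by move=> x y; have [h1 h2] := df x y; have [h3 h4] := dg x y; split; exact: der_add.
- split; first by move=> z; apply: cvgM; [exact: cf|exact: cg].
  exists (fun z => fx z * g z + f z * gx z), (fun z => fy z * g z + f z * gy z).
  split; [by apply: smooth2_add; exact: smooth2_mul|by apply: smooth2_add; exact: smooth2_mul|].
  by move=> x y; have [h1 h2] := df x y; have [h3 h4] := dg x y; split; exact: der_mul.
Qed.

Lemma smooth2_smooth (f : R * R -> R) : smooth2 f -> smooth f.
Proof.
move=> sf w.
suff sw : smooth2 (pd_word w f).
  have [cw [wx [wy [_ _ dw]]]] := smooth2_der sw.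
  split; [exact: cw|move=> x y; have [h _] := dw x y; by case: h|move=> x y; have [_ h] := dw x y; by case: h].
elim: w => [//|[] w IH] /=.
- have [_ [wx [wy [swx _ dw]]]] := smooth2_der IH.
  have -> : pdx (pd_word w f) = wx; last exact: swx.
  by apply/funext => -[x y]; have [h _] := dw x y; exact: der_derive1 h.
- have [_ [wx [wy [_ swy dw]]]] := smooth2_der IH.
  have -> : pdy (pd_word w f) = wy; last exact: swy.
  by apply/funext => -[x y]; have [_ h] := dw x y; exact: der_derive1 h.
Qed.

End SmoothFunctions.

(** * Modes in x *)

Import HBNNSimple.

Section AlmostEverywhere.
Context d (T : measurableType d) (R : realType) (m : {measure set T -> \bar R}).

Lemma ae_imp (P Q : T -> Prop) : {ae m, forall x, P x} -> (forall x, P x -> Q x) -> {ae m, forall x, Q x}.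
Proof. by move=> hP h; apply: filterS hP. Qed.

Lemma ae_imp2 (P Q S : T -> Prop) : {ae m, forall x, P x} -> {ae m, forall x, Q x} ->
  (forall x, P x -> Q x -> S x) -> {ae m, forall x, S x}.
Proof. by move=> hP hQ h; apply: filterS2 hP hQ. Qed.

End AlmostEverywhere.

Section Torus.
Variable R : realType.
Local Notation mu := (@lebesgue_measure R).
Local Notation mR := (measurableTypeR R).
Local Notation per := (@period R).
Local Notation torus := (@torus R).
Local Notation cyl := (@cylinder R).

Lemma L1loc_measurable (f : R * R -> R) : in_L1loc f -> measurable_fun setT (f : mR * mR -> mR).
Proof. by case. Qed.

Definition L2fun (f : R * R -> R) := measurable_fun setT (f : mR * mR -> mR) /\
  cyl.-integrable setT (EFin \o (fun z => f z ^+ 2)).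

Lemma in_L2_L2fun (f : R * R -> R) : in_L2 f -> L2fun f.
Proof.
move=> [_ fL]; split; first by move: fL; rewrite inE => /andP[/[!inE]].
exact: Lfun2_integrable_sqr fL.
Qed.

Lemma sintegral_torus (g : mR -> R) : sintegral torus g = sintegral mu (g \_ per).
Proof.
apply: eq_fsbigr => x _.
have [->|x0] := eqVneq x 0; first by rewrite !mul0e.
congr (_ * mu _)%E; apply/seteqP; split => y /=; rewrite patchE.
  by move=> [gy py]; rewrite mem_set.
by case: ifPn => [/set_mem py <-//|_ y0]; move: x0; rewrite -y0 eqxx.
Qed.

(** [torus] is the Lebesgue measure restricted to a period. The two integrals are identified on
    simple functions and then by monotone convergence. *)
Lemma ge0_integral_torus (h : mR -> \bar R) : measurable_fun setT h -> (forall x, 0 <= h x)%E ->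
  (\int[torus]_x h x = \int[mu]_(x in per) h x)%E.
Proof.
move=> mh h0; have mper := @measurable_period R.
have [g [nd_g cg]] := approximation measurableT mh (fun x _ => h0 x).
have gh x : (h x = limn (fun n => (g n x)%:E)) by apply/esym/cvg_lim => //; exact: cg.
have mg n : measurable_fun setT (fun x => (g n x)%:E) by apply/measurable_EFinP.
have -> : (\int[torus]_x h x = \int[torus]_x limn (fun n => (g n x)%:E))%E.
  by apply: eq_integral => x _; exact: gh.
have -> : (\int[mu]_(x in per) h x = \int[mu]_(x in per) limn (fun n => (g n x)%:E))%E.
  by apply: eq_integral => x _; exact: gh.
have g0 n x : (0 <= (g n x)%:E)%E by rewrite lee_fin.
have gnd x (m n : nat) : (m <= n)%N -> ((g m x)%:E <= (g n x)%:E)%E.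
  by move=> mn; rewrite lee_fin; move/lefP: (nd_g _ _ mn).
have e1 := @monotone_convergence _ _ _ torus setT measurableT _ mg (fun n x _ => g0 n x) (fun x _ => gnd x).
have mg' n : measurable_fun per (fun x => (g n x)%:E) by apply: measurable_funTS.
have e2 := @monotone_convergence _ _ _ mu per mper _ mg' (fun n x _ => g0 n x) (fun x _ => gnd x).
rewrite e1 e2; congr (limn _); apply/funext => n.
rewrite [in LHS]integral_nnsfun// [in RHS]integral_nnsfun// sintegral_torus.
by congr sintegral; apply/funext => x; rewrite !patchE in_setT.
Qed.

Lemma Rintegral_torus (f : mR -> R) : measurable_fun setT f ->
  \int[torus]_x f x = \int[mu]_x (\1_per x * f x).
Proof.
move=> mf; have mper := @measurable_period R.
rewrite /Rintegral; congr fine; rewrite [in LHS]integralE [in RHS]integralE; congr (_ - _)%E.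
- rewrite ge0_integral_torus//; last by apply: measurable_funepos; exact/measurable_EFinP.
  rewrite [in LHS]integral_mkcond; apply: eq_integral => x _; rewrite patchE !funeposE /= indicE.
  by case: (x \in per) => /=; rewrite ?mul1r// mul0r maxxx.
- rewrite ge0_integral_torus//; last by apply: measurable_funeneg; exact/measurable_EFinP.
  rewrite [in LHS]integral_mkcond; apply: eq_integral => x _; rewrite patchE !funenegE /= indicE.
  by case: (x \in per) => /=; rewrite ?mul1r// mul0r oppr0 maxxx.
Qed.

Definition mode (h : R -> R) (k : R) (f : R * R -> R) (y : R) : R :=
  \int[torus]_x (f (x, y) * h (k * x)).

Lemma measurable_wave_fst h k : unit_wave h -> measurable_fun setT (fun z : mR * mR => h (k * z.1) : mR).
Proof.
move=> [ch _]; apply: (measurableT_comp (f := h)); first exact: continuous_measurable_fun.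
by apply: measurable_funM => //; exact: measurable_fst.
Qed.

(** Positive and negative parts are integrated separately, as measurability of partial integrals is
    available for nonnegative functions and f is not assumed integrable. *)
Lemma measurable_mode h k f : unit_wave h -> measurable_fun setT (f : mR * mR -> mR) ->
  measurable_fun setT (mode h k f : mR -> mR).
Proof.
move=> uh mf; set g := (fun z : mR * mR => f z * h (k * z.1)).
have mg : measurable_fun setT (EFin \o g).
  by apply/measurable_EFinP; apply: measurable_funM => //; exact: measurable_wave_fst.
have m1 := measurable_fun_fubini_tonelli_G (m1 := torus) _ (measurable_funepos mg) (fun z => funepos_ge0 _ z).
have m2 := measurable_fun_fubini_tonelli_G (m1 := torus) _ (measurable_funeneg mg) (fun z => funeneg_ge0 _ z).
have -> : mode h k f = fun y => fine (fubini_G torus (fun z => (EFin \o g)^\+ z)%E y - fubini_G torus (fun z => (EFin \o g)^\- z)%E y)%E.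
  apply/funext => y; rewrite /mode /Rintegral [in LHS]integralE; congr (fine (_ - _)%E).
    by apply: eq_integral => x _; rewrite !funeposE.
  by apply: eq_integral => x _; rewrite !funenegE.
apply: (measurableT_comp (f := fine)) => //.
exact: emeasurable_funB.
Qed.

Lemma measurable_slice f y : measurable_fun setT (f : mR * mR -> mR) ->
  measurable_fun setT (fun x : mR => f (x, y) : mR).
Proof. by move=> mf; exact: measurableT_comp mf (measurable_pair2 y). Qed.

(** Cut to one period and extended by 0, the shape required by [L2per] and by the transform on the
    line. *)
Definition slice (f : R * R -> R) (y x : R) : R := \1_per x * f (x, y).

Lemma mode_slice h k f y : unit_wave h -> measurable_fun setT (f : mR * mR -> mR) ->
  mode h k f y = ftrans h (slice f y) k.
Proof.
move=> uh mf; rewrite /mode /ftrans Rintegral_torus.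
  by apply: eq_Rintegral => x _; rewrite /slice mulrA.
apply: measurable_funM; first exact: measurable_slice.
exact: measurableT_comp (measurable_wave_fst k uh) (measurable_pair2 y).
Qed.

(** The squared modulus of the Fourier coefficient in x of frequency k, at height y. *)
Definition amp (k : R) (f : R * R -> R) (y : R) : R := mode cos k f y ^+ 2 + mode sin k f y ^+ 2.

Lemma amp_ge0 k f y : 0 <= amp k f y.
Proof. by rewrite addr_ge0 ?sqr_ge0. Qed.

Lemma amp_slice k f y : measurable_fun setT (f : mR * mR -> mR) -> amp k f y = spec (slice f y) k.
Proof. by move=> mf; rewrite /amp !mode_slice//; [exact: unit_wave_sin|exact: unit_wave_cos]. Qed.

Lemma measurable_amp k f : measurable_fun setT (f : mR * mR -> mR) -> measurable_fun setT (amp k f : mR -> mR).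
Proof.
move=> mf; apply: measurable_funD; apply: measurable_funX; apply: measurable_mode => //.
  exact: unit_wave_cos.
exact: unit_wave_sin.
Qed.

Definition energy (f : R * R -> R) : \bar R := (\int[cyl]_z (f z ^+ 2)%:E)%E.
Definition slice_energy (f : R * R -> R) (y : R) : \bar R := (\int[torus]_x (f (x, y) ^+ 2)%:E)%E.

Lemma measurable_sqr (f : R * R -> R) : measurable_fun setT (f : mR * mR -> mR) ->
  measurable_fun setT (fun z : mR * mR => (f z ^+ 2)%:E).
Proof. by move=> mf; apply/measurable_EFinP; exact: measurable_funX. Qed.

Lemma measurable_slice_energy f : measurable_fun setT (f : mR * mR -> mR) ->
  measurable_fun setT (slice_energy f : mR -> \bar R).
Proof.
move=> mf; apply: (measurable_fun_fubini_tonelli_G (m1 := torus) _ (measurable_sqr mf)) => z.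
by rewrite lee_fin sqr_ge0.
Qed.

Lemma slice_energy_ge0 f y : (0 <= slice_energy f y)%E.
Proof. by apply: integral_ge0 => x _; rewrite lee_fin sqr_ge0. Qed.

Lemma energy_slices f : measurable_fun setT (f : mR * mR -> mR) -> energy f = (\int[mu]_y slice_energy f y)%E.
Proof.
move=> mf; apply: (fubini_tonelli2 (m1 := torus) (m2 := mu) _ (measurable_sqr mf)) => z.
by rewrite lee_fin sqr_ge0.
Qed.

Lemma L2fun_energy f : L2fun f -> (energy f < +oo)%E.
Proof.
move=> [mf /integrableP[_]]; apply: le_lt_trans; rewrite le_eqVlt; apply/orP; left; apply/eqP.
by apply: eq_integral => z _; rewrite /= ger0_norm ?sqr_ge0.
Qed.

Lemma L2fun_slice_ae f : L2fun f -> {ae mu, forall y, (slice_energy f y < +oo)%E}.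
Proof.
move=> f2; have mf := f2.1.
have i : mu.-integrable setT (slice_energy f : mR -> \bar R).
  apply/integrableP; split; first exact: measurable_slice_energy.
  have := L2fun_energy f2; rewrite energy_slices//; apply: le_lt_trans; rewrite le_eqVlt; apply/orP; left; apply/eqP.
  by apply: eq_integral => y _; rewrite gee0_abs// slice_energy_ge0.
have := integrable_ae measurableT i; apply: filterS => y /(_ I).
by rewrite fin_numElt => /andP[].
Qed.

Lemma slice_sqr f y : measurable_fun setT (f : mR * mR -> mR) ->
  (\int[mu]_x (slice f y x ^+ 2)%:E = slice_energy f y)%E.
Proof.
move=> mf; rewrite /slice_energy ge0_integral_torus//.
- rewrite [in RHS]integral_mkcond; apply: eq_integral => x _; rewrite patchE /slice indicE.
  by case: (x \in per) => /=; rewrite ?mul1r// mul0r expr0n.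
- by apply/measurable_EFinP; apply: measurable_funX; exact: measurable_slice.
- by move=> x; rewrite lee_fin sqr_ge0.
Qed.

Lemma L2per_slice f y : measurable_fun setT (f : mR * mR -> mR) -> (slice_energy f y < +oo)%E -> L2per (slice f y).
Proof.
move=> mf fy.
have ms : measurable_fun setT (slice f y : mR -> mR).
  by apply: measurable_funM; [exact: measurable_indic (@measurable_period R)|exact: measurable_slice].
split=> //.
- by move=> x nx; rewrite /slice indicE memNset// mul0r.
- apply: ge0_fin_integrable; [exact: measurable_funX|by move=> x; exact: sqr_ge0|by rewrite slice_sqr].
Qed.

Lemma amp_le k f y : measurable_fun setT (f : mR * mR -> mR) -> ((amp k f y)%:E <= (2 * pi)%:E * slice_energy f y)%E.
Proof.
move=> mf; have pi0 : 0 < 2 * pi :> R by rewrite mulr_gt0 ?pi_gt0.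
have [fy|] := ltP (slice_energy f y) +oo%E; last first.
  by rewrite leye_eq => /eqP ->; rewrite gt0_muley ?lte_fin// leey.
have u2 := L2per_slice mf fy; have [_ _ iu2] := u2.
have := bessel_spec 1 k u2; rewrite /dsum big_nat1 addr0 amp_slice// -slice_sqr// => h.
rewrite -(EFin_Rintegral iu2) -EFinM lee_fin; apply: le_trans h.
by rewrite lerDl spec_ge0.
Qed.

Definition modesq (b : R -> R) (k : R) (f : R * R -> R) : \bar R := (\int[mu]_y (b y ^+ 2 * amp k f y)%:E)%E.

Lemma modesq1_le k f : measurable_fun setT (f : mR * mR -> mR) ->
  (modesq (fun _ => 1%R) k f <= (2 * pi)%:E * energy f)%E.
Proof.
move=> mf; rewrite energy_slices// -ge0_integralZl//=.
- apply: ge0_le_integral => //=.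
  + by move=> y _; rewrite lee_fin mulr_ge0 ?sqr_ge0 ?amp_ge0.
  + by apply/measurable_EFinP; apply: measurable_funM => //; exact: measurable_amp.
  + by apply: measurable_funeM; exact: measurable_slice_energy.
  + by move=> y _; rewrite expr1n mul1r; exact: amp_le.
- exact: measurable_slice_energy.
- by move=> y _; exact: slice_energy_ge0.
- by rewrite lee_fin mulr_ge0 ?pi_ge0.
Qed.

(** Parseval's formula on almost every slice, and monotone exchange of the sum over k with the
    integral in y. *)
Lemma parseval_cylinder f : L2fun f -> {ae mu, forall y, \int[torus]_x f (x, y) = 0} ->
  (\sum_(0 <= k <oo) modesq (fun _ => 1%R) k.+1%:R f = pi%:E * energy f)%E.
Proof.
move=> f2 f0; have mf := f2.1.
have -> : (\sum_(0 <= k <oo) modesq (fun _ => 1%R) k.+1%:R f = \int[mu]_y \sum_(0 <= k <oo) (amp k.+1%:R f y)%:E)%E.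
  rewrite integral_nneseries//.
  - by apply: eq_eseriesr => k _; apply: eq_integral => y _; rewrite expr1n mul1r.
  - by move=> k; apply/measurable_EFinP; exact: measurable_amp.
  - by move=> k y _; rewrite lee_fin amp_ge0.
rewrite energy_slices// -ge0_integralZl//=; last 3 first.
- exact: measurable_slice_energy.
- by move=> y _; exact: slice_energy_ge0.
- by rewrite lee_fin pi_ge0.
apply: ae_eq_integral => //.
- apply: ge0_emeasurable_sum => [k y _ _|k _]; first by rewrite lee_fin amp_ge0.
  by apply/measurable_EFinP; exact: measurable_amp.
- by apply: measurable_funeM; exact: measurable_slice_energy.
apply: (ae_imp2 (L2fun_slice_ae f2) f0) => y fy f0y _.
have u2 := L2per_slice mf fy.
have e0 : \int[mu]_x slice f y x = 0 by rewrite -f0y Rintegral_torus//; exact: measurable_slice.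
rewrite -slice_sqr// -(parseval_spec u2 e0).
by apply: eq_eseriesr => k _; rewrite amp_slice.
Qed.

Lemma xavgE f x y : xavg f (x, y) = (2 * pi)^-1 * \int[torus]_x f (x, y).
Proof. by []. Qed.

Lemma Rintegral_torus_cst (c : R) : \int[torus]_x c = 2 * pi * c.
Proof.
rewrite Rintegral_torus// -Rintegral_period1.
have i1 : mu.-integrable setT (EFin \o (fun x : mR => \1_per x * 1)).
  by under eq_fun do rewrite mulr1; exact: integrable_period_indic.
rewrite mulrC -(RintegralZl c measurableT i1); apply: eq_Rintegral => x _.
by rewrite mulr1 mulrC.
Qed.

Lemma integrable_slice f y : measurable_fun setT (f : mR * mR -> mR) -> (slice_energy f y < +oo)%E ->
  torus.-integrable setT (EFin \o (fun x => f (x, y))).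
Proof.
move=> mf fy; have ms := measurable_slice y mf.
have i2 : torus.-integrable setT (EFin \o (fun x => f (x, y) ^+ 2)).
  by apply: ge0_fin_integrable; [exact: measurable_funX|by move=> x; exact: sqr_ge0|].
have i1 : torus.-integrable setT (EFin \o (fun _ => 1 : R)) by exact: finite_measure_integrable_cst.
apply: (le_integrable measurableT _ _ (integrableRD i1 i2)); first exact/measurable_EFinP.
move=> x _ /=; rewrite lee_fin [leRHS]ger0_norm ?addr_ge0 ?sqr_ge0//.
rewrite -(ger0_norm (sqr_ge0 (f (x, y)))) normrX.
by have := sqr_ge0 (`|f (x, y)| - 1); have := normr_ge0 (f (x, y)); move: `|f (x, y)| => a; clear; nra.
Qed.

Lemma integrable_slice_wave h k f y : unit_wave h -> measurable_fun setT (f : mR * mR -> mR) -> (slice_energy f y < +oo)%E ->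
  torus.-integrable setT (EFin \o (fun x => f (x, y) * h (k * x))).
Proof.
move=> uh mf fy; apply: (integrableM_bounded (c := 1)) (integrable_slice mf fy).
  exact: measurableT_comp (measurable_wave_fst k uh) (measurable_pair2 y).
by move=> x; exact: uh.2.
Qed.

Lemma mode_nonzero_modes h k f y : unit_wave h -> measurable_fun setT (f : mR * mR -> mR) -> (slice_energy f y < +oo)%E ->
  \int[torus]_x h (k * x) = 0 -> mode h k (nonzero_modes f) y = mode h k f y.
Proof.
move=> uh mf fy h0; have i1 := integrable_slice_wave k uh mf fy.
have mh : measurable_fun setT (fun x : mR => h (k * x) : mR).
  exact: measurableT_comp (measurable_wave_fst k uh) (measurable_pair2 y).
have i0 : torus.-integrable setT (EFin \o (fun x => h (k * x))).
  have i1' : torus.-integrable setT (EFin \o (fun _ => 1 : R)) by exact: finite_measure_integrable_cst.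
  have := integrableM_bounded mh (fun x => uh.2 (k * x)) i1'.
  by under eq_fun do rewrite mul1r.
have i2 := integrableRZ (xavg f (0, y)) i0.
have := RintegralB measurableT i1 i2; rewrite (RintegralZl _ measurableT i0) h0 mulr0 subr0 => e; rewrite [RHS]/mode -e.
by apply: eq_Rintegral => x _; rewrite -mulrBl.
Qed.

Lemma L2funB f g : L2fun f -> L2fun g -> L2fun (f - g).
Proof.
move=> [mf f2] [mg g2]; have m : measurable_fun setT (f - g : mR * mR -> mR) by exact: measurable_funB.
split=> //; have h := integrableRD (integrableRZ 2 f2) (integrableRZ 2 g2).
apply: (le_integrable measurableT _ _ h); first by apply/measurable_EFinP; exact: measurable_funX.
have h0 z : 0 <= 2 * f z ^+ 2 + 2 * g z ^+ 2 by apply: addr_ge0; apply: mulr_ge0 => //; exact: sqr_ge0.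
move=> z _; rewrite /= lee_fin (ger0_norm (sqr_ge0 _)) (ger0_norm (h0 z)).
rewrite -[(f - g) z]/(f z - g z).
by have := sqr_ge0 (f z + g z); move: (f z) (g z) => a b; clear; nra.
Qed.

Lemma measurable_xavg f : measurable_fun setT (f : mR * mR -> mR) -> measurable_fun setT (xavg f : mR * mR -> mR).
Proof.
move=> mf; apply: measurable_funM => //.
have -> : (fun z : mR * mR => \int[torus]_x f (x, z.2)) = (fun z => mode cos 0 f z.2).
  by apply/funext => z; apply: eq_Rintegral => x _; rewrite mul0r cos0 mulr1.
exact: measurableT_comp (measurable_mode 0 (unit_wave_cos R) mf) measurable_snd.
Qed.

(** The average is the cosine mode of frequency 0, so [amp_le] at k = 0 applies. *)
Lemma energy_xavg_le f : measurable_fun setT (f : mR * mR -> mR) -> (energy (xavg f) <= energy f)%E.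
Proof.
move=> mf; rewrite !energy_slices//; last exact: measurable_xavg.
apply: ge0_le_integral => //=.
- by move=> y _; exact: slice_energy_ge0.
- by apply: measurable_slice_energy; exact: measurable_xavg.
- exact: measurable_slice_energy.
move=> y _; have [fy|] := ltP (slice_energy f y) +oo%E; last by rewrite leye_eq => /eqP ->; rewrite leey.
have ef : slice_energy (xavg f) y = ((2 * pi)^-1 * (mode cos 0 f y) ^+ 2)%:E.
  rewrite /slice_energy; have i2 : torus.-integrable setT (EFin \o (fun _ => xavg f (0, y) ^+ 2)) by exact: finite_measure_integrable_cst.
  have -> : (\int[torus]_x (xavg f (x, y) ^+ 2)%:E = \int[torus]_x (xavg f (0, y) ^+ 2)%:E)%E by apply: eq_integral.
  rewrite -(EFin_Rintegral i2) Rintegral_torus_cst xavgE; congr (_%:E).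
  have -> : \int[torus]_x f (x, y) = mode cos 0 f y by apply: eq_Rintegral => x _; rewrite mul0r cos0 mulr1.
  have p0 : (pi : R) != 0 by rewrite gt_eqF ?pi_gt0.
  by move: p0; move: (pi : R) (mode _ _ _ _) => p m p0; field.
have := amp_le 0 y mf; rewrite ef; have u2 := L2per_slice mf fy; have [_ _ iu2] := u2.
rewrite -slice_sqr// -(EFin_Rintegral iu2) -EFinM !lee_fin => h.
rewrite ler_pdivrMl ?mulr_gt0 ?pi_gt0//; apply: le_trans h.
by rewrite /amp lerDl sqr_ge0.
Qed.

Lemma energy_L2fun f : measurable_fun setT (f : mR * mR -> mR) -> (energy f < +oo)%E -> L2fun f.
Proof. by move=> mf ef; split=> //; apply: ge0_fin_integrable => //; [exact: measurable_funX|move=> z; exact: sqr_ge0]. Qed.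

Lemma L2fun_nonzero_modes f : L2fun f -> L2fun (nonzero_modes f).
Proof.
move=> f2; apply: L2funB => //; have mf := f2.1.
by apply: energy_L2fun; [exact: measurable_xavg|exact: le_lt_trans (energy_xavg_le mf) (L2fun_energy f2)].
Qed.

End Torus.

(** * Wave packets *)

Section Taylor.
Variable R : realType.
Implicit Types (a u x y : R).

Lemma mean_value_le (F dF : R -> R) x y (L : R) : (forall v, is_derive v (1 : R) F (dF v)) ->
  (forall v, `|v - x| <= `|y - x| -> `|dF v| <= L) -> `|F y - F x| <= L * `|y - x|.
Proof.
move=> hF hL.
have cF a b : {within `[a, b], continuous F} by exact: derive_within_continuous hF.
have [xy|yx|<-] := ltgtP x y; last by rewrite !subrr normr0 mulr0.
- have [c /andP[]] := MVT xy (fun v _ => hF v) (cF _ _).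
  rewrite !bnd_simp => xc cy ->; rewrite normrM ler_wpM2r// hL// ger0_norm ?subr_ge0 ?(ltW xc)//.
  by rewrite ger0_norm ?subr_ge0 ?(ltW xy)// lerD2r ltW.
- have [c /andP[]] := MVT yx (fun v _ => hF v) (cF _ _).
  rewrite !bnd_simp => yc cx; rewrite distrC => ->; rewrite normrM (distrC y x) ler_wpM2r// hL//.
  rewrite distrC (distrC y x) ger0_norm ?subr_ge0 ?(ltW cx)//.
  by rewrite ger0_norm ?subr_ge0 ?(ltW yx)// lerD2l lerN2 ltW.
Qed.

Lemma sin_lipschitz x y : `|sin y - sin x| <= `|y - x|.
Proof.
have h v : is_derive v (1 : R) (fun v => sin v) (cos v) by der; ring.
by have := mean_value_le h (fun v _ => (unit_wave_cos R).2 v) (x := x) (y := y); rewrite mul1r.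
Qed.

Lemma cos_taylor a u : `|cos (a + u) - cos a + u * sin a| <= u ^+ 2.
Proof.
have h v : is_derive v (1 : R) (fun v => cos (a + v) + v * sin a) (sin a - sin (a + v)) by der; ring.
have hL v : `|v - 0| <= `|u - 0| -> `|sin a - sin (a + v)| <= `|u|.
  rewrite !subr0; apply: le_trans; apply: le_trans (sin_lipschitz _ _) _.
  by rewrite opprD addrA subrr add0r normrN.
have := mean_value_le h hL; rewrite subr0 addr0 mul0r addr0 -expr2 -normrX (ger0_norm (sqr_ge0 u)).
by have -> : cos (a + u) + u * sin a - cos a = cos (a + u) - cos a + u * sin a by ring.
Qed.

Lemma sin_taylor a u : `|sin (a + u) - sin a - u * cos a| <= u ^+ 2.
Proof.
have h x : sin x = - cos (x + pi / 2) by rewrite cosDpihalf opprK.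
have := cos_taylor (a + pi / 2) u; rewrite sinDpihalf -normrN !h (addrAC a).
by have -> : - (cos (a + u + pi / 2) - cos (a + pi / 2) + u * cos a) = - cos (a + u + pi / 2) - - cos (a + pi / 2) - u * cos a by ring.
Qed.

End Taylor.

Lemma RintegralN d (T : measurableType d) (R : realType) (m : {measure set T -> \bar R}) (g : T -> R) :
  \int[m]_x (- g x) = - \int[m]_x g x.
Proof.
rewrite /Rintegral [in LHS]integralE [in RHS]integralE.
have -> : (\int[m]_x (fun x => (- g x)%:E)^\+ x = \int[m]_x (fun x => (g x)%:E)^\- x)%E.
  by apply: eq_integral => x _; rewrite funeposE funenegE.
have -> : (\int[m]_x (fun x => (- g x)%:E)^\- x = \int[m]_x (fun x => (g x)%:E)^\+ x)%E.
  by apply: eq_integral => x _; rewrite funeposE funenegE EFinN oppeK.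
have : (0 <= \int[m]_x (fun x => (g x)%:E)^\+ x)%E by apply: integral_ge0 => x _; exact: funepos_ge0.
have : (0 <= \int[m]_x (fun x => (g x)%:E)^\- x)%E by apply: integral_ge0 => x _; exact: funeneg_ge0.
case: integral => [a| |]//; case: integral => [c| |]//=; rewrite ?oppr0// => _ _.
by rewrite opprB.
Qed.

Section WavePackets.
Variable R : realType.
Local Notation mu := (@lebesgue_measure R).
Local Notation mR := (measurableTypeR R).
Local Notation per := (@period R).
Local Notation torus := (@torus R).
Local Notation cyl := (@cylinder R).
Implicit Types (f g : R * R -> R) (b w : R -> R) (A B : R).

(** A real substitute for b(y) exp(i (k x + zeta y)): d = 0 gives the real part and d = pi / 2 minus
    the imaginary part. *)
Definition wavepacket b (k zeta d : R) : R * R -> R := fun z => b z.2 * cos (k * z.1 + zeta * z.2 + d).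

Definition pr f b (k zeta d : R) : R := distr_of f (wavepacket b k zeta d).

Record bounded_support A B b : Prop := BoundedSupport {
  bs_measurable : measurable_fun setT (b : mR -> mR) ;
  bs_ge0 : 0 <= A ;
  bs_bounded : forall y, `|b y| <= B ;
  bs_support : forall y, A < `|y| -> b y = 0 }.

Lemma bs_bound_ge0 A B b : bounded_support A B b -> 0 <= B.
Proof. by move=> hb; apply: le_trans (bs_bounded hb 0). Qed.

Lemma integrable_strip A (c : R) : 0 <= A -> cyl.-integrable setT (EFin \o (fun z : mR * mR => \1_(`[- A, A] : set mR) z.2 * c)).
Proof.
move=> A0; have mitv : measurable (`[- A, A] : set mR) by exact: measurable_itv.
have i1 : cyl.-integrable setT (EFin \o (fun z : mR * mR => \1_(`[- A, A] : set mR) z.2)).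
  apply: ge0_fin_integrable.
  - have -> : (fun z : mR * mR => \1_(`[- A, A] : set mR) z.2 : R) = \1_(setT `*` (`[- A, A] : set mR)).
      by apply/funext => -[x y]; rewrite !indicE in_setX in_setT.
    by apply: measurable_indic; exact: measurableX.
  - by move=> z; rewrite indicE.
  have -> : (\int[cyl]_z (\1_(`[- A, A] : set mR) z.2)%:E = \int[cyl]_z (\1_(setT `*` (`[- A, A] : set mR)) z)%:E)%E.
    by apply: eq_integral => -[x y] _; rewrite !indicE in_setX in_setT.
  rewrite integral_indic//; last exact: measurableX.
  pose I := (`[- A, A]%classic : set mR).
  suff h : ((torus \x mu) (setT `*` I) < +oo)%E by rewrite setIT; exact: h.
  have -> := product_measure1E torus mu measurableT mitv.
  have t1 : (torus setT < +oo)%E by have := fin_num_measure torus setT measurableT; rewrite fin_numElt => /andP[].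
  apply: lte_mul_pinfty => //; first by rewrite fin_num_measure.
  by rewrite /I/= lebesgue_measure_itv/=; case: ifP; rewrite ?ltry.
by have := integrableRZ c i1; under eq_fun do rewrite mulrC.
Qed.

Lemma integrable_bounded_support f A B (w : R * R -> R) : L2fun f -> 0 <= A ->
  measurable_fun setT (w : mR * mR -> mR) -> (forall z, `|w z| <= B) -> (forall z, A < `|z.2| -> w z = 0) ->
  cyl.-integrable setT (EFin \o (fun z => f z * w z)).
Proof.
move=> [mf f2] A0 mw wB w0.
apply: (le_integrable measurableT _ _ (integrableRD f2 (integrable_strip (B ^+ 2) A0))).
  by apply/measurable_EFinP; exact: measurable_funM.
move=> z _ /=; rewrite lee_fin indicE.
have [zA|zA] := leP `|z.2| A; last first.
  by rewrite w0// mulr0 normr0 normr_ge0.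
rewrite mem_set /=; last by rewrite in_itv/= -ler_norml.
rewrite mul1r [leRHS]ger0_norm ?addr_ge0 ?sqr_ge0// normrM.
have := wB z; have := normr_ge0 (w z); have := normr_ge0 (f z).
rewrite -(ger0_norm (sqr_ge0 (f z))) normrX.
move: `|f z| `|w z| => a c a0 c0 cB; apply: (@le_trans _ _ (a * B)); first exact: ler_wpM2l.
by have := sqr_ge0 (a - B); have := mulr_ge0 a0 (le_trans c0 cB); clear; nra.
Qed.

Lemma measurable_wave_arg (k zeta d : R) : measurable_fun setT (fun z : mR * mR => cos (k * z.1 + zeta * z.2 + d) : mR).
Proof.
apply: (measurableT_comp (f := cos)).
  by apply: continuous_measurable_fun; exact: continuous_cos.
apply: measurable_funD => //; apply: measurable_funD; apply: measurable_funM => //.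
Qed.

Lemma measurable_wavepacket b k zeta d : measurable_fun setT (b : mR -> mR) ->
  measurable_fun setT (wavepacket b k zeta d : mR * mR -> mR).
Proof.
move=> mb; apply: measurable_funM; last exact: measurable_wave_arg.
exact: measurableT_comp mb measurable_snd.
Qed.

Lemma wavepacket_le A B b k zeta d z : bounded_support A B b -> `|wavepacket b k zeta d z| <= B.
Proof.
move=> hb; rewrite /wavepacket normrM; apply: le_trans (bs_bounded hb z.2).
by rewrite ler_piMr//; exact: (unit_wave_cos R).2.
Qed.

Lemma integrable_wavepacket f A B b k zeta d : L2fun f -> bounded_support A B b ->
  cyl.-integrable setT (EFin \o (fun z => f z * wavepacket b k zeta d z)).
Proof.
move=> f2 hb; apply: (integrable_bounded_support (A := A) (B := B)) => //.
- exact: bs_ge0 hb.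
- by apply: measurable_wavepacket; exact: bs_measurable hb.
- by move=> z; exact: wavepacket_le hb.
- by move=> z zA; rewrite /wavepacket (bs_support hb)// mul0r.
Qed.

Lemma prB f g A B b k zeta d : L2fun f -> L2fun g -> bounded_support A B b ->
  pr (f - g) b k zeta d = pr f b k zeta d - pr g b k zeta d.
Proof.
move=> f2 g2 hb; have i1 := integrable_wavepacket k zeta d f2 hb; have i2 := integrable_wavepacket k zeta d g2 hb.
have := RintegralB measurableT i1 i2; rewrite /pr /distr_of => <-.
by apply: eq_Rintegral => z _; rewrite -mulrBl.
Qed.

Lemma pr_modes f A B b k zeta d : L2fun f -> bounded_support A B b ->
  pr f b k zeta d = \int[mu]_y (mode cos k f y * (b y * cos (zeta * y + d)) - mode sin k f y * (b y * sin (zeta * y + d))).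
Proof.
move=> f2 hb; have mf := f2.1; have iw := integrable_wavepacket k zeta d f2 hb.
have [_ [_ e]] := Rfubini (m1 := torus) (m2 := mu) iw.
rewrite /pr /distr_of -e /Rintegral; congr fine.
have mb := bs_measurable hb.
have mwave (h : R -> R) : unit_wave h -> measurable_fun setT (fun y : mR => b y * h (zeta * y + d) : mR).
  move=> uh; apply: measurable_funM => //; apply: (measurableT_comp (f := h)).
    by apply: continuous_measurable_fun; exact: uh.1.
  by apply: measurable_funD => //; exact: measurable_funM.
apply: ae_eq_integral => //.
- have [_ [/integrableP[m _] _]] := Rfubini (m1 := torus) (m2 := mu) iw; exact: m.
- apply/measurable_EFinP; apply: measurable_funB; apply: measurable_funM.
  + by apply: measurable_mode => //; exact: unit_wave_cos.
  + by apply: mwave; exact: unit_wave_cos.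
  + by apply: measurable_mode => //; exact: unit_wave_sin.
  + by apply: mwave; exact: unit_wave_sin.
apply: (ae_imp (L2fun_slice_ae f2)) => y fy _; congr (_%:E).
have i1 := integrable_slice_wave k (unit_wave_cos R) mf fy.
have i2 := integrable_slice_wave k (unit_wave_sin R) mf fy.
rewrite -/(Rintegral _ _ _) (mulrC (mode cos k f y)) (mulrC (mode sin k f y)) /mode.
rewrite -(RintegralZl _ measurableT i1) -(RintegralZl _ measurableT i2).
rewrite -(RintegralB measurableT (integrableRZ _ i1) (integrableRZ _ i2)).
apply: eq_Rintegral => x _; rewrite /wavepacket /= -addrA cosD; ring.
Qed.

Lemma integrable_amp f k : L2fun f -> mu.-integrable setT (EFin \o amp k f).
Proof.
move=> f2; have mf := f2.1; apply: ge0_fin_integrable; [exact: measurable_amp|by move=> y; exact: amp_ge0|].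
apply: (@le_lt_trans _ _ ((2 * pi)%:E * energy f)%E).
  apply: le_trans (modesq1_le k mf); rewrite le_eqVlt; apply/orP; left; apply/eqP.
  by apply: eq_integral => y _; rewrite expr1n mul1r.
by rewrite lte_mul_pinfty ?lee_fin ?mulr_ge0 ?pi_ge0 ?fin_numE ?L2fun_energy.
Qed.

Lemma Rintegral_strip A (c : R) : 0 <= A ->
  mu.-integrable setT (EFin \o (fun y : mR => \1_(`[- A, A] : set mR) y * c)) /\
  \int[mu]_y (\1_(`[- A, A] : set mR) y * c) = 2 * A * c.
Proof.
move=> A0; have mitv : measurable (`[- A, A] : set mR) by exact: measurable_itv.
have e1 : (\int[mu]_y (\1_(`[- A, A] : set mR) y)%:E = (2 * A)%:E)%E.
  rewrite integral_indic// setIT/= lebesgue_measure_itv/= lte_fin.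
  have [_|] := ltP (- A) A; first by rewrite -EFinD; congr EFin; ring.
  move=> h; have -> : A = 0 by lra.
  by rewrite mulr0.
have i1 : mu.-integrable setT (EFin \o (\1_(`[- A, A] : set mR) : mR -> R)).
  by apply: ge0_fin_integrable; [exact: measurable_indic|move=> z; rewrite indicE|rewrite e1 ltry].
have e : (fun y : mR => \1_(`[- A, A] : set mR) y * c) = (fun y => c * \1_(`[- A, A] : set mR) y) by apply/funext => y; exact: mulrC.
rewrite e; split; first exact: integrableRZ.
by rewrite (RintegralZl _ measurableT i1) /Rintegral e1/= mulrC.
Qed.

(** A linear form of Cauchy-Schwarz: |a| <= c / 2 + a^2 / (2 c) on the strip. The free c lets the
    pairing tend to 0 together with the energy of the mode, see [bound_cvg0]. *)
Lemma mode_pairing A W f k (w1 w2 : R -> R) : L2fun f ->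
  bounded_support A W w1 -> bounded_support A W w2 ->
  mu.-integrable setT (EFin \o (fun y => mode cos k f y * w1 y - mode sin k f y * w2 y)) /\
  forall c M, 0 < c -> \int[mu]_y amp k f y <= M ->
  `|\int[mu]_y (mode cos k f y * w1 y - mode sin k f y * w2 y)| <= W * (2 * A * c + M / (2 * c)).
Proof.
move=> f2 h1 h2; have mf := f2.1.
have A0 := bs_ge0 h1; have W0 := bs_bound_ge0 h1; have ia := integrable_amp k f2.
have bound c y : 0 < c -> `|mode cos k f y * w1 y - mode sin k f y * w2 y| <=
    W * (\1_(`[- A, A] : set mR) y * c + (2 * c)^-1 * amp k f y).
  move=> c0; rewrite indicE; have [zA|zA] := leP `|y| A; last first.
    rewrite (bs_support h1)// (bs_support h2)// !mulr0 subrr normr0 mulr_ge0//.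
    rewrite addr_ge0//; first by rewrite mulr_ge0// ltW.
    by rewrite mulr_ge0 ?amp_ge0// invr_ge0 mulr_ge0// ltW.
  rewrite mem_set /=; last by rewrite in_itv/= -ler_norml.
  rewrite mul1r /amp; move: (mode cos k f y) (mode sin k f y) => a b.
  apply: (@le_trans _ _ (`|a| * W + `|b| * W)).
    apply: (le_trans (ler_normB _ _)); rewrite !normrM; apply: lerD; apply: ler_wpM2l => //; [exact: bs_bounded h1 y|exact: bs_bounded h2 y].
  rewrite -mulrDl mulrC; apply: ler_wpM2l => //.
  have q (x : R) : `|x| <= c / 2 + (2 * c)^-1 * x ^+ 2.
    rewrite -subr_ge0 -(ger0_norm (sqr_ge0 x)) normrX; move: `|x| => x'.
    have -> : c / 2 + (2 * c)^-1 * x' ^+ 2 - x' = (x' - c) ^+ 2 / (2 * c) by field; rewrite gt_eqF.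
    by rewrite divr_ge0 ?sqr_ge0// mulr_ge0// ltW.
  by have := q a; have := q b; move: (2 * c)^-1 => i; rewrite mulrDr; move: (i * _) (i * _) => u v; lra.
have maj c : mu.-integrable setT (EFin \o (fun y => W * (\1_(`[- A, A] : set mR) y * c + (2 * c)^-1 * amp k f y))).
  by apply: integrableRZ; apply: integrableRD (integrableRZ _ ia); exact: (Rintegral_strip c A0).1.
have m : measurable_fun setT (fun y : mR => mode cos k f y * w1 y - mode sin k f y * w2 y : mR).
  apply: measurable_funB; apply: measurable_funM.
  - by apply: measurable_mode => //; exact: unit_wave_cos.
  - exact: bs_measurable h1.
  - by apply: measurable_mode => //; exact: unit_wave_sin.
  - exact: bs_measurable h2.
have i : mu.-integrable setT (EFin \o (fun y => mode cos k f y * w1 y - mode sin k f y * w2 y)).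
  apply: (le_integrable measurableT _ _ (maj 1)); first exact/measurable_EFinP.
  by move=> y _ /=; rewrite lee_fin (le_trans (bound 1 y ltr01))// ler_norm.
split=> // c M c0 aM.
apply: (le_trans (le_normr_Rintegral measurableT i)).
apply: (@le_trans _ _ (\int[mu]_y (W * (\1_(`[- A, A] : set mR) y * c + (2 * c)^-1 * amp k f y)))).
  by apply: le_Rintegral => //; [exact: integrable_norm|move=> y _; exact: bound].
have [i1 e1] := Rintegral_strip c A0; have i3 := integrableRZ (2 * c)^-1 ia.
rewrite (RintegralZl _ measurableT (integrableRD i1 i3)) (RintegralD measurableT i1 i3) e1 (RintegralZl _ measurableT ia).
apply: ler_wpM2l => //; rewrite lerD2l mulrC; apply: ler_wpM2r => //; rewrite invr_ge0 mulr_ge0//; exact: ltW.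
Qed.

Lemma bounded_supportM A B C b h : bounded_support A B b -> measurable_fun setT (h : mR -> mR) ->
  (forall y, `|y| <= A -> `|h y| <= C) -> bounded_support A (B * C) (fun y => b y * h y).
Proof.
move=> hb mh hC; have B0 := bs_bound_ge0 hb; have A0 := bs_ge0 hb; split=> //.
- by apply: measurable_funM => //; exact: bs_measurable hb.
- move=> y; have [yA|yA] := leP `|y| A; last first.
    rewrite (bs_support hb)// mul0r normr0 mulr_ge0//; apply: le_trans (normr_ge0 (h 0)) _.
    by apply: hC; rewrite normr0.
  by rewrite normrM ler_pM//; [exact: bs_bounded hb _|exact: hC].
- by move=> y yA; rewrite (bs_support hb)// mul0r.
Qed.

Lemma measurable_wave1 (h : R -> R) zeta d : unit_wave h -> measurable_fun setT (fun y : mR => h (zeta * y + d) : mR).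
Proof.
move=> uh; apply: (measurableT_comp (f := h)).
  by apply: continuous_measurable_fun; exact: uh.1.
by apply: measurable_funD => //; exact: measurable_funM.
Qed.

Lemma bounded_support_wave A B b h zeta d : bounded_support A B b -> unit_wave h ->
  bounded_support A B (fun y => b y * h (zeta * y + d)).
Proof.
move=> hb uh; rewrite -[B]mulr1; apply: bounded_supportM => //; first exact: measurable_wave1.
by move=> y _; exact: uh.2.
Qed.

Lemma bounded_support_id A B b : bounded_support A B b -> bounded_support A (B * A) (fun y => b y * y).
Proof. by move=> hb; apply: bounded_supportM => //; exact: measurable_id. Qed.

Lemma pr_le f A B b k zeta d c M : L2fun f -> bounded_support A B b -> 0 < c ->
  \int[mu]_y amp k f y <= M -> `|pr f b k zeta d| <= B * (2 * A * c + M / (2 * c)).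
Proof.
move=> f2 hb c0 aM; rewrite (pr_modes _ _ _ f2 hb).
have [_ h] := mode_pairing k f2 (bounded_support_wave zeta d hb (unit_wave_cos R)) (bounded_support_wave zeta d hb (unit_wave_sin R)).
exact: h.
Qed.

(** The constant depends on f only through the energy of its mode. The expansion can thus be applied
    to differences of a field at two times with a remainder that is uniform in time, as a moving
    frequency requires. *)
Lemma pr_taylor f A B b k zeta d u M : L2fun f -> bounded_support A B b -> \int[mu]_y amp k f y <= M ->
  `|pr f b k (zeta + u) d - pr f b k zeta d - u * pr f (fun y => b y * y) k zeta (d + pi / 2)|
    <= B * A ^+ 2 * (2 * A + M / 2) * u ^+ 2.
Proof.
move=> f2 hb aM; have hb' := bounded_support_id hb; have A0 := bs_ge0 hb.
rewrite !(pr_modes _ _ _ f2 hb) (pr_modes _ _ _ f2 hb').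
have i1 := (mode_pairing k f2 (bounded_support_wave (zeta + u) d hb (unit_wave_cos R)) (bounded_support_wave (zeta + u) d hb (unit_wave_sin R))).1.
have i2 := (mode_pairing k f2 (bounded_support_wave zeta d hb (unit_wave_cos R)) (bounded_support_wave zeta d hb (unit_wave_sin R))).1.
have i3 := (mode_pairing k f2 (bounded_support_wave zeta (d + pi / 2) hb' (unit_wave_cos R)) (bounded_support_wave zeta (d + pi / 2) hb' (unit_wave_sin R))).1.
rewrite -(RintegralZl u measurableT i3) -(RintegralB measurableT i1 i2) -(RintegralB measurableT (integrableRB i1 i2) (integrableRZ u i3)).
pose h1 y := cos ((zeta * y + d) + u * y) - cos (zeta * y + d) + u * y * sin (zeta * y + d).
pose h2 y := sin ((zeta * y + d) + u * y) - sin (zeta * y + d) - u * y * cos (zeta * y + d).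
have marg (h : R -> R) : unit_wave h -> measurable_fun setT (fun y : mR => h (zeta * y + d + u * y) : mR).
  move=> uh; have := measurable_wave1 (zeta + u) d uh; apply: eq_measurable_fun => y _; congr h; ring.
have uy y : `|y| <= A -> (u * y) ^+ 2 <= A ^+ 2 * u ^+ 2.
  move=> yA; rewrite exprMn mulrC ler_wpM2r ?sqr_ge0//.
  by rewrite -(ger0_norm (sqr_ge0 y)) normrX ler_pXn2r// nnegrE.
have mu1 : measurable_fun setT (fun y : mR => u * y : mR) by exact: measurable_funM.
have b1 : bounded_support A (B * (A ^+ 2 * u ^+ 2)) (fun y => b y * h1 y).
  apply: bounded_supportM => //; last by move=> y yA; apply: le_trans (uy y yA); exact: cos_taylor.
  apply: measurable_funD; last by apply: measurable_funM => //; exact: measurable_wave1 (unit_wave_sin R).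
  by apply: measurable_funB; [exact: marg (unit_wave_cos R)|exact: measurable_wave1 (unit_wave_cos R)].
have b2 : bounded_support A (B * (A ^+ 2 * u ^+ 2)) (fun y => b y * h2 y).
  apply: bounded_supportM => //; last by move=> y yA; apply: le_trans (uy y yA); exact: sin_taylor.
  apply: measurable_funB; last by apply: measurable_funM => //; exact: measurable_wave1 (unit_wave_cos R).
  by apply: measurable_funB; [exact: marg (unit_wave_sin R)|exact: measurable_wave1 (unit_wave_sin R)].
have [_ h] := mode_pairing k f2 b1 b2; have := h 1 M ltr01 aM.
have -> : B * (A ^+ 2 * u ^+ 2) * (2 * A * 1 + M / (2 * 1)) = B * A ^+ 2 * (2 * A + M / 2) * u ^+ 2.
  by rewrite !mulr1; ring.
apply: le_trans; rewrite le_eqVlt; apply/orP; left; apply/eqP; congr (`|_|).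
apply: eq_Rintegral => y _; rewrite /h1 /h2 addrA cosDpihalf sinDpihalf.
have -> : (zeta + u) * y + d = zeta * y + d + u * y by ring.
ring.
Qed.

Lemma continuous_pr f A B b k d : L2fun f -> bounded_support A B b -> continuous (fun zeta => pr f b k zeta d).
Proof.
move=> f2 hb zeta.
have hd : is_derive zeta (1 : R) (fun zeta => pr f b k zeta d) (pr f (fun y => b y * y) k zeta (d + pi / 2)).
  apply: (@is_derive_quadratic _ _ _ _ (B * A ^+ 2 * (2 * A + (\int[mu]_y amp k f y) / 2))) => u _.
  by rewrite (mulrC _ u); exact: pr_taylor.
exact: der_continuous hd.
Qed.

Definition wavesq f b (k d : R) : \bar R := (\int[mu]_zeta (pr f b k zeta d ^+ 2)%:E)%E.

Lemma pr_oppk f A B b k zeta d : L2fun f -> bounded_support A B b ->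
  pr f b (- k) zeta d = \int[mu]_y (mode cos k f y * (b y * cos (zeta * y + d)) + mode sin k f y * (b y * sin (zeta * y + d))).
Proof.
move=> f2 hb; rewrite (pr_modes _ _ _ f2 hb); apply: eq_Rintegral => y _.
have -> : mode cos (- k) f y = mode cos k f y by apply: eq_Rintegral => x _; rewrite mulNr cosN.
have -> : mode sin (- k) f y = - mode sin k f y; last by rewrite mulNr opprK.
by rewrite /mode -RintegralN; apply: eq_Rintegral => x _; rewrite mulNr sinN mulrN.
Qed.

Lemma bounded_support0 A : 0 <= A -> bounded_support A 0 (fun _ => 0).
Proof. by move=> A0; split=> // y; rewrite normr0. Qed.

(** With [g1] and [g2] the modes multiplied by b, the four pairings are, up to sign, the real and
    imaginary parts of the transforms of g1 + i g2 and g1 - i g2. Mixed terms cancel in the sum of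
    squares, which is 2 (spec g1 + spec g2), and Plancherel's formula gives 4 pi. *)
Lemma wavesq_total f A B b k : L2fun f -> bounded_support A B b ->
  (wavesq f b k 0 + wavesq f b k (pi / 2) + wavesq f b (- k) 0 + wavesq f b (- k) (pi / 2)
   = (4 * pi)%:E * modesq b k f)%E.
Proof.
move=> f2 hb; have mf := f2.1; have A0 := bs_ge0 hb; have b0 := bounded_support0 A0.
have uc := unit_wave_cos R; have us := unit_wave_sin R; have mb := bs_measurable hb.
pose g1 y := b y * mode cos k f y; pose g2 y := b y * mode sin k f y.
have mg1 : measurable_fun setT (g1 : mR -> mR) by apply: measurable_funM => //; exact: measurable_mode.
have mg2 : measurable_fun setT (g2 : mR -> mR) by apply: measurable_funM => //; exact: measurable_mode.
have i1 : mu.-integrable setT (EFin \o g1).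
  have := (mode_pairing k f2 (bounded_support_wave 0 0 hb uc) (bounded_support_wave 0 0 hb us)).1.
  by apply: eq_integrable => // y _ /=; rewrite /g1 mul0r addr0 cos0 sin0 !mulr0 mulr1 subr0 mulrC.
have i2 : mu.-integrable setT (EFin \o g2).
  have := (mode_pairing k f2 (bounded_support_wave 0 (pi / 2) hb uc) (bounded_support_wave 0 (- (pi / 2)) hb us)).1.
  by apply: eq_integrable => // y _ /=; rewrite /g2 mul0r !add0r cos_pihalf sinN sin_pihalf !mulr0 sub0r mulrN1 mulrN opprK mulrC.
have sqi (h : R -> R) : unit_wave h -> (forall y, mode h k f y ^+ 2 <= amp k f y) ->
    mu.-integrable setT (EFin \o (fun y => (b y * mode h k f y) ^+ 2)).
  move=> uh hle; have := integrableRZ (B ^+ 2) (integrable_amp k f2).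
  apply: (le_integrable measurableT).
    by apply/measurable_EFinP; apply: measurable_funX; apply: measurable_funM => //; exact: measurable_mode.
  move=> y _ /=; rewrite lee_fin (ger0_norm (sqr_ge0 _)) (ger0_norm (mulr_ge0 (sqr_ge0 B) (amp_ge0 k f y))).
  have hB : b y ^+ 2 <= B ^+ 2.
    rewrite -(ger0_norm (sqr_ge0 (b y))) normrX.
    by apply: lerXn2r; rewrite ?nnegrE ?normr_ge0 ?(bs_bound_ge0 hb)//; exact: bs_bounded hb y.
  by rewrite exprMn; apply: ler_pM (hle y) => //; exact: sqr_ge0.
have q1 : mu.-integrable setT (EFin \o (fun y => g1 y ^+ 2)) by apply: sqi => // y; rewrite lerDl sqr_ge0.
have q2 : mu.-integrable setT (EFin \o (fun y => g2 y ^+ 2)) by apply: sqi => // y; rewrite lerDr sqr_ge0.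
have e1 zeta : pr f b k zeta 0 = ftrans cos g1 zeta - ftrans sin g2 zeta.
  rewrite (pr_modes _ _ _ f2 hb) -(RintegralB measurableT (integrable_wave zeta uc i1) (integrable_wave zeta us i2)).
  by apply: eq_Rintegral => y _; rewrite addr0 /g1 /g2; ring.
have e2 zeta : pr f b k zeta (pi / 2) = - ftrans sin g1 zeta - ftrans cos g2 zeta.
  rewrite (pr_modes _ _ _ f2 hb) -opprD -(RintegralD measurableT (integrable_wave zeta us i1) (integrable_wave zeta uc i2)).
  rewrite -mulN1r -(RintegralZl _ measurableT (integrableRD (integrable_wave zeta us i1) (integrable_wave zeta uc i2))).
  by apply: eq_Rintegral => y _; rewrite cosDpihalf sinDpihalf /g1 /g2; ring.
have e3 zeta : pr f b (- k) zeta 0 = ftrans cos g1 zeta + ftrans sin g2 zeta.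
  rewrite (pr_oppk _ _ _ f2 hb) -(RintegralD measurableT (integrable_wave zeta uc i1) (integrable_wave zeta us i2)).
  by apply: eq_Rintegral => y _; rewrite addr0 /g1 /g2; ring.
have e4 zeta : pr f b (- k) zeta (pi / 2) = ftrans cos g2 zeta - ftrans sin g1 zeta.
  rewrite (pr_oppk _ _ _ f2 hb) -(RintegralB measurableT (integrable_wave zeta uc i2) (integrable_wave zeta us i1)).
  by apply: eq_Rintegral => y _; rewrite cosDpihalf sinDpihalf /g1 /g2; ring.
have mp k' d : measurable_fun setT (fun zeta : mR => pr f b k' zeta d ^+ 2 : mR).
  apply: measurable_funX.
  by apply: continuous_measurable_fun; exact: continuous_pr hb.
have p0 k' d zeta : 0 <= pr f b k' zeta d ^+ 2 by exact: sqr_ge0.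
have m2 k1 d1 k2 d2 : measurable_fun setT (fun zeta : mR => pr f b k1 zeta d1 ^+ 2 + pr f b k2 zeta d2 ^+ 2 : mR) by apply: measurable_funD; exact: mp.
have m3 k1 d1 k2 d2 k3 d3 : measurable_fun setT (fun zeta : mR => pr f b k1 zeta d1 ^+ 2 + pr f b k2 zeta d2 ^+ 2 + pr f b k3 zeta d3 ^+ 2 : mR) by apply: measurable_funD; [exact: m2|exact: mp].
have add (u v : mR -> R) : measurable_fun setT u -> measurable_fun setT v -> (forall y, 0 <= u y) -> (forall y, 0 <= v y) ->
    (\int[mu]_y (u y)%:E + \int[mu]_y (v y)%:E = \int[mu]_y (u y + v y)%:E)%E.
  by move=> hu hv u0 v0; rewrite -ge0_integralRD//; apply: eq_integral => y _; rewrite EFinD.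
rewrite /wavesq (add _ _ (mp k 0) (mp k (pi / 2)) (p0 k 0) (p0 k (pi / 2))).
rewrite (add _ _ (m2 k 0 k (pi / 2)) (mp (- k) 0) (fun z => addr_ge0 (p0 _ _ z) (p0 _ _ z)) (p0 _ _)).
rewrite (add _ _ (m3 k 0 k (pi / 2) (- k) 0) (mp (- k) (pi / 2)) (fun z => addr_ge0 (addr_ge0 (p0 _ _ z) (p0 _ _ z)) (p0 _ _ z)) (p0 _ _)).
have ms1 := measurable_spec i1; have ms2 := measurable_spec i2.
have pl1 := plancherel i1 q1; have pl2 := plancherel i2 q2.
have es zeta : pr f b k zeta 0 ^+ 2 + pr f b k zeta (pi / 2) ^+ 2 + pr f b (- k) zeta 0 ^+ 2 + pr f b (- k) zeta (pi / 2) ^+ 2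
  = (spec g1 zeta + spec g1 zeta) + (spec g2 zeta + spec g2 zeta).
  rewrite e1 e2 e3 e4 /spec; move: (ftrans cos g1 zeta) (ftrans sin g1 zeta) (ftrans cos g2 zeta) (ftrans sin g2 zeta) => q3 q4 q5 q6.
  by ring.
have -> : modesq b k f = (\int[mu]_y (g1 y ^+ 2)%:E + \int[mu]_y (g2 y ^+ 2)%:E)%E.
  have n1 : measurable_fun setT (fun y : mR => g1 y ^+ 2 : mR) by exact: measurable_funX.
  have n2 : measurable_fun setT (fun y : mR => g2 y ^+ 2 : mR) by exact: measurable_funX.
  rewrite (add _ _ n1 n2 (fun y => sqr_ge0 _) (fun y => sqr_ge0 _)).
  by apply: eq_integral => y _; congr (_%:E); rewrite /g1 /g2 /amp; ring.
have [r1 er1] : exists r, (\int[mu]_y (g1 y ^+ 2)%:E)%E = r%:E.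
  by exists (\int[mu]_y (g1 y ^+ 2)); rewrite EFin_Rintegral.
have [r2 er2] : exists r, (\int[mu]_y (g2 y ^+ 2)%:E)%E = r%:E.
  by exists (\int[mu]_y (g2 y ^+ 2)); rewrite EFin_Rintegral.
rewrite er1 in pl1 *; rewrite er2 in pl2 *.
move: (spec_ge0 g1) (spec_ge0 g2) ms1 ms2 pl1 pl2 es; move: (spec g1) (spec g2) => s1 s2 s10 s20 ms1 ms2 pl1 pl2 es.
have -> : (\int[mu]_zeta (pr f b k zeta 0 ^+ 2 + pr f b k zeta (pi / 2) ^+ 2 + pr f b (- k) zeta 0 ^+ 2 + pr f b (- k) zeta (pi / 2) ^+ 2)%:E
  = \int[mu]_zeta ((s1 zeta + s1 zeta) + (s2 zeta + s2 zeta))%:E)%E.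
  by apply: eq_integral => zeta _; rewrite es.
have ms11 : measurable_fun setT (fun zeta : mR => s1 zeta + s1 zeta : mR) by apply: measurable_funD; exact: ms1.
have ms22 : measurable_fun setT (fun zeta : mR => s2 zeta + s2 zeta : mR) by apply: measurable_funD; exact: ms2.
rewrite -(add _ _ ms11 ms22 (fun z => addr_ge0 (s10 z) (s10 z)) (fun z => addr_ge0 (s20 z) (s20 z))).
rewrite -(add _ _ ms1 ms1 s10 s10) -(add _ _ ms2 ms2 s20 s20) pl1 pl2.
transitivity ((2 * pi * r1 + 2 * pi * r1 + (2 * pi * r2 + 2 * pi * r2))%:E); first by [].
transitivity ((4 * pi * (r1 + r2))%:E); last by [].
by congr (_%:E); move: (pi : R) => p; ring.
Qed.

End WavePackets.

(** * Equations satisfied by the wave packets *)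

Section WavePacketCalculus.
Variable R : realType.
Local Notation mu := (@lebesgue_measure R).
Local Notation mR := (measurableTypeR R).
Local Notation torus := (@torus R).
Local Notation cyl := (@cylinder R).
Implicit Types (f g : R * R -> R) (b : R -> R) (A B k zeta d : R).

Definition integer_mode k := mode2pi k /\ k != 0.

Record cut A B b : Prop := Cut { cut_smooth : smooth1 b ; cut_bs : bounded_support A B b }.

Lemma smooth2_wavepacket b k zeta d : smooth1 b -> smooth2 (wavepacket b k zeta d).
Proof. by move=> sb; apply: smooth2_mul; [exact: smooth2_y|exact: smooth2_cos]. Qed.

Lemma smooth2_scale (c : R) f : smooth2 f -> smooth2 (fun z => c * f z).
Proof. by move=> sf; apply: smooth2_mul => //; exact: (smooth2_y (smooth1_cst c)). Qed.

Lemma periodic_wavepacket b k zeta d : mode2pi k -> Defs.periodic (wavepacket b k zeta d).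
Proof.
move=> [s0 c1] x y; rewrite /wavepacket /=; congr (_ * _).
have -> : k * (x + 2 * pi) + zeta * y + d = (k * x + zeta * y + d) + 2 * pi * k by ring.
by rewrite cosD s0 c1 mulr0 subr0 mulr1.
Qed.

Lemma test_wavepacket A B b k zeta d : mode2pi k -> cut A B b -> test_fun (wavepacket b k zeta d).
Proof.
move=> hk [sb hb]; split; [exact: periodic_wavepacket|exact: smooth2_smooth (smooth2_wavepacket _ _ _ sb)|].
by exists A => x y yA; rewrite /wavepacket (bs_support hb)// mul0r.
Qed.

Lemma test_add f g : test_fun f -> test_fun g -> smooth2 f -> smooth2 g -> test_fun (fun z => f z + g z).
Proof.
move=> [pf _ [A1 hA1]] [pg _ [A2 hA2]] sf sg; split.
- by move=> x y; rewrite pf pg.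
- by apply: smooth2_smooth; exact: smooth2_add.
- exists (Order.max A1 A2) => x y; rewrite gt_max => /andP[h1 h2].
  by rewrite hA1// hA2// addr0.
Qed.

Lemma test_scale (c : R) f : test_fun f -> smooth2 f -> test_fun (fun z => c * f z).
Proof.
move=> [pf _ [A1 hA1]] sf; split.
- by move=> x y; rewrite pf.
- by apply: smooth2_smooth; exact: smooth2_scale.
- by exists A1 => x y /hA1 ->; rewrite mulr0.
Qed.

Lemma pdx_wavepacket b k zeta d : pdx (wavepacket b k zeta d) = (fun z => k * wavepacket b k zeta (d + pi / 2) z).
Proof.
apply/funext => -[x y]; apply: der_derive1; rewrite /wavepacket /=.
by der; rewrite addrA cosDpihalf; ring.
Qed.

Lemma pdy_wavepacket b b' k zeta d : (forall y, is_derive y (1 : R) b (b' y)) ->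
  pdy (wavepacket b k zeta d) = (fun z => wavepacket b' k zeta d z + zeta * wavepacket b k zeta (d + pi / 2) z).
Proof.
move=> db; apply/funext => -[x y]; apply: der_derive1; rewrite /wavepacket /=.
by have h := db y; der; rewrite (addrA _ d) cosDpihalf; ring.
Qed.

Lemma pdx_scale_wavepacket (c : R) b k zeta d :
  pdx (fun z => c * wavepacket b k zeta d z) = (fun z => c * k * wavepacket b k zeta (d + pi / 2) z).
Proof.
apply/funext => -[x y]; apply: der_derive1; rewrite /wavepacket /=.
by der; rewrite addrA cosDpihalf; ring.
Qed.

Lemma wavepacket_shift_pi b k zeta d z : wavepacket b k zeta (d + pi / 2 + pi / 2) z = - wavepacket b k zeta d z.
Proof. by rewrite /wavepacket !addrA cosDpihalf sinDpihalf mulrN. Qed.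

Lemma pdxx_wavepacket b k zeta d : pdx (pdx (wavepacket b k zeta d)) = (fun z => - k ^+ 2 * wavepacket b k zeta d z).
Proof.
rewrite pdx_wavepacket pdx_scale_wavepacket; apply/funext => z.
by rewrite wavepacket_shift_pi; ring.
Qed.

Lemma pdyy_wavepacket b b' b'' k zeta d : (forall y, is_derive y (1 : R) b (b' y)) -> (forall y, is_derive y (1 : R) b' (b'' y)) ->
  pdy (pdy (wavepacket b k zeta d)) = (fun z => wavepacket b'' k zeta d z + (2 * zeta * wavepacket b' k zeta (d + pi / 2) z
    - zeta ^+ 2 * wavepacket b k zeta d z)).
Proof.
move=> db db'; rewrite (pdy_wavepacket _ _ _ db); apply/funext => -[x y]; apply: der_derive1; rewrite /wavepacket /=.
by have h := db y; have h' := db' y; der; rewrite !addrA cosDpihalf sinDpihalf; ring.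
Qed.

Lemma pdx_ymul_wavepacket b k zeta d : pdx (fun z => z.2 * wavepacket b k zeta d z) =
  (fun z => k * wavepacket (fun y => b y * y) k zeta (d + pi / 2) z).
Proof.
apply/funext => -[x y]; apply: der_derive1; rewrite /wavepacket /=.
by der; rewrite addrA cosDpihalf; ring.
Qed.

(** All that the calculus with wave packets needs of a field. It covers both the L2 fields and the
    velocity and potential, which are only locally integrable because of their unrestricted zero
    modes. *)
Definition locint f := forall A B b k zeta d, bounded_support A B b ->
  cyl.-integrable setT (EFin \o (fun z => f z * wavepacket b k zeta d z)).

Lemma L2fun_locint f : L2fun f -> locint f.
Proof. by move=> f2 A B b k zeta d hb; exact: integrable_wavepacket hb. Qed.

Lemma L1loc_locint f : in_L1loc f -> locint f.
Proof.
move=> [_ mf iF] A B b k zeta d hb.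
pose S := (setT `*` `[- A, A]%classic : set (mR * mR)).
have mS : measurable S by apply: measurableX => //; exact: measurable_itv.
have i1 : cyl.-integrable setT (EFin \o (fun z => f z * \1_S z)).
  have := iF A; rewrite integrable_mkcond//; apply: eq_integrable => // z _.
  by rewrite patchE /= indicE; case: (z \in S) => /=; rewrite ?mulr1// mulr0.
have := integrableM_bounded (measurable_wavepacket k zeta d (bs_measurable hb)) (fun z => wavepacket_le k zeta d z hb) i1.
apply: eq_integrable => // -[x y] _ /=; congr (_%:E); rewrite indicE.
have [yA|yA] := leP `|y| A; last by rewrite /wavepacket (bs_support hb)// mul0r !mulr0.
by rewrite mem_set ?mulr1//; split => //=; rewrite in_itv/= -ler_norml.
Qed.

Section Linear.
Variables (f : R * R -> R) (A B : R).
Hypothesis lf : locint f.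

Lemma pr_scale (c : R) b k zeta d : bounded_support A B b ->
  distr_of f (fun z => c * wavepacket b k zeta d z) = c * pr f b k zeta d.
Proof.
move=> hb; rewrite /pr /distr_of -(RintegralZl c measurableT (lf k zeta d hb)).
by apply: eq_Rintegral => z _; ring.
Qed.

Lemma pr_shift_pi b k zeta d : pr f b k zeta (d + pi / 2 + pi / 2) = - pr f b k zeta d.
Proof.
rewrite /pr /distr_of -RintegralN; apply: eq_Rintegral => z _.
by rewrite wavepacket_shift_pi mulrN.
Qed.

Lemma pr_add (g : R * R -> R) b k zeta d : bounded_support A B b ->
  cyl.-integrable setT (EFin \o (fun z => f z * g z)) ->
  distr_of f (fun z => wavepacket b k zeta d z + g z) = pr f b k zeta d + distr_of f g.
Proof.
move=> hb ig; rewrite /pr /distr_of -(RintegralD measurableT (lf k zeta d hb) ig).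
by apply: eq_Rintegral => z _; ring.
Qed.

Lemma integrable_scale_wavepacket (c : R) b k zeta d : bounded_support A B b ->
  cyl.-integrable setT (EFin \o (fun z => f z * (c * wavepacket b k zeta d z))).
Proof.
move=> hb; have := integrableRZ c (lf k zeta d hb).
by apply: eq_integrable => // z _ /=; congr (_%:E); ring.
Qed.

End Linear.

Lemma pr_scale_add f A B A' B' (c c' : R) b b' k zeta d d' : locint f -> bounded_support A B b -> bounded_support A' B' b' ->
  distr_of f (fun z => c * wavepacket b k zeta d z + c' * wavepacket b' k zeta d' z) = c * pr f b k zeta d + c' * pr f b' k zeta d'.
Proof.
move=> lf hb hb'; rewrite -(pr_scale lf c k zeta d hb) -(pr_scale lf c' k zeta d' hb') /distr_of.
rewrite -(RintegralD measurableT (integrable_scale_wavepacket lf c k zeta d hb) (integrable_scale_wavepacket lf c' k zeta d' hb')).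
by apply: eq_Rintegral => z _; ring.
Qed.

Lemma integrable_torus_bounded (h : R -> R) (u : R -> R) : measurable_fun setT (fun x : mR => h (u x) : mR) ->
  (forall x, `|h x| <= 1) -> torus.-integrable setT (EFin \o (fun x : mR => h (u x))).
Proof.
move=> mh h1; have i1 : torus.-integrable setT (EFin \o (fun _ => 1 : R)) by exact: finite_measure_integrable_cst.
by have := integrableM_bounded mh (fun x => h1 (u x)) i1; under eq_fun do rewrite mul1r.
Qed.

Lemma torus_wave k : mode2pi k -> k != 0 -> \int[torus]_x cos (k * x) = 0 /\ \int[torus]_x sin (k * x) = 0.
Proof.
move=> hk k0; have m (h : R -> R) : unit_wave h -> measurable_fun setT (fun x : mR => h (k * x) : mR).
  by move=> uh; have := measurable_wave1 k 0 uh; under eq_fun do rewrite addr0.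
split; rewrite Rintegral_torus.
- exact: Rintegral_period_cos.
- exact: m (unit_wave_cos R).
- exact: Rintegral_period_sin.
- exact: m (unit_wave_sin R).
Qed.

Lemma torus_cos k c : mode2pi k -> k != 0 -> \int[torus]_x cos (k * x + c) = 0.
Proof.
move=> hk k0; have [c0 s0] := torus_wave hk k0.
have m (h : R -> R) : unit_wave h -> measurable_fun setT (fun x : mR => h (k * x) : mR).
  by move=> uh; have := measurable_wave1 k 0 uh; under eq_fun do rewrite addr0.
have ic := integrable_torus_bounded (m _ (unit_wave_cos R)) (unit_wave_cos R).2.
have si := integrable_torus_bounded (m _ (unit_wave_sin R)) (unit_wave_sin R).2.
have := RintegralB measurableT (integrableRZ (cos c) ic) (integrableRZ (sin c) si).
rewrite (RintegralZl _ measurableT ic) (RintegralZl _ measurableT si) c0 s0 !mulr0 subr0 => <-.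
by apply: eq_Rintegral => x _; rewrite cosD; ring.
Qed.

(** The x-average is constant in x, so its pairing vanishes slice by slice. This moves the equations
    from u and phi to their nonzero modes, which are in L2. *)
Lemma pr_nonzero_modes f A B b k zeta d : locint f -> L2fun (nonzero_modes f) -> integer_mode k -> bounded_support A B b ->
  pr (nonzero_modes f) b k zeta d = pr f b k zeta d.
Proof.
move=> lf nf2 [hk k0] hb; have ln := L2fun_locint nf2.
have i1 := lf _ _ _ k zeta d hb; have i2 := ln _ _ _ k zeta d hb.
have ix : cyl.-integrable setT (EFin \o (fun z => xavg f z * wavepacket b k zeta d z)).
  have := integrableRB i1 i2; apply: eq_integrable => // z _ /=; congr (_%:E).
  by rewrite /nonzero_modes -[(f - xavg f) z]/(f z - xavg f z); ring.
have x0 : \int[cyl]_z (xavg f z * wavepacket b k zeta d z) = 0.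
  have [_ [_ <-]] := Rfubini (m1 := torus) (m2 := mu) ix.
  rewrite -[RHS](_ : \int[mu]_y 0 = 0); last by rewrite Rintegral_cst// mul0r.
  apply: eq_Rintegral => y _ /=; have := torus_cos (zeta * y + d) hk k0.
  have ic : torus.-integrable setT (EFin \o (fun x : mR => cos (k * x + (zeta * y + d)))).
    by apply: integrable_torus_bounded (unit_wave_cos R).2 => //; exact: measurable_wave1 (unit_wave_cos R).
  move=> c0; have := RintegralZl (xavg f (0, y) * b y) measurableT ic; rewrite c0 mulr0 => <-.
  by apply: eq_Rintegral => x _; rewrite /wavepacket /= addrA mulrA.
have := RintegralB measurableT i1 ix; rewrite x0 subr0 => e; rewrite [RHS]/pr /distr_of -e.
by apply: eq_Rintegral => z _; rewrite -mulrBl.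
Qed.

Lemma LapE (T : distr R) (chi : R * R -> R) : Lap T chi = T (pdx (pdx chi)) + T (pdy (pdy chi)).
Proof.
have h (a b : R) : - - a + - - b = a + b by rewrite !opprK.
exact: h.
Qed.

(** Besides the symbol - (k^2 + zeta^2) it contains the terms in which derivatives fall on the
    cutoff; these become errors. *)
Definition lap_pr f b b' b'' k zeta d : R :=
  - (k ^+ 2 + zeta ^+ 2) * pr f b k zeta d + pr f b'' k zeta d + 2 * zeta * pr f b' k zeta (d + pi / 2).

Section Jets.
Variables (A B B' B'' : R) (b b' b'' : R -> R).
Hypotheses (cb : cut A B b) (cb' : cut A B' b') (cb'' : cut A B'' b'')
  (db : forall y, is_derive y (1 : R) b (b' y)) (db' : forall y, is_derive y (1 : R) b' (b'' y)).

Lemma distr_pdx f k zeta d : locint f ->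
  distr_of f (pdx (wavepacket b k zeta d)) = k * pr f b k zeta (d + pi / 2).
Proof. by move=> lf; rewrite pdx_wavepacket (pr_scale lf _ _ _ _ (cut_bs cb)). Qed.

Lemma distr_pdy f k zeta d : locint f ->
  distr_of f (pdy (wavepacket b k zeta d)) = pr f b' k zeta d + zeta * pr f b k zeta (d + pi / 2).
Proof.
move=> lf; rewrite (pdy_wavepacket _ _ _ db).
have := pr_scale_add 1 zeta k zeta d (d + pi / 2) lf (cut_bs cb') (cut_bs cb); rewrite mul1r => <-.
by congr distr_of; apply/funext => z; rewrite mul1r.
Qed.

Lemma distr_ymul f k zeta d : locint f ->
  ymul (Dx (distr_of f)) (wavepacket b k zeta d) = - (k * pr f (fun y => b y * y) k zeta (d + pi / 2)).
Proof.
by move=> lf; rewrite /ymul /Dx pdx_ymul_wavepacket (pr_scale lf _ _ _ _ (bounded_support_id (cut_bs cb))).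
Qed.

Lemma distr_lap f k zeta d : locint f ->
  Lap (distr_of f) (wavepacket b k zeta d) = lap_pr f b b' b'' k zeta d.
Proof.
move=> lf.
rewrite LapE.
rewrite pdxx_wavepacket (pdyy_wavepacket _ _ _ db db') (pr_scale lf _ _ _ _ (cut_bs cb)).
have i2 : cyl.-integrable setT (EFin \o (fun z => f z * (2 * zeta * wavepacket b' k zeta (d + pi / 2) z - zeta ^+ 2 * wavepacket b k zeta d z))).
  have := integrableRB (integrable_scale_wavepacket lf (2 * zeta) k zeta (d + pi / 2) (cut_bs cb')) (integrable_scale_wavepacket lf (zeta ^+ 2) k zeta d (cut_bs cb)).
  by apply: eq_integrable => // z _ /=; congr (_%:E); ring.
rewrite (pr_add lf k zeta d (cut_bs cb'') i2).
have -> : (fun z => 2 * zeta * wavepacket b' k zeta (d + pi / 2) z - zeta ^+ 2 * wavepacket b k zeta d z) =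
   (fun z => 2 * zeta * wavepacket b' k zeta (d + pi / 2) z + (- zeta ^+ 2) * wavepacket b k zeta d z).
  by apply/funext => z; rewrite mulNr.
by rewrite (pr_scale_add _ _ _ _ _ _ lf (cut_bs cb') (cut_bs cb)) /lap_pr; move: (pr f b'' _ _ _) (pr f b' _ _ _) (pr f b _ _ _) => q1 q2 q3; ring.
Qed.

End Jets.

End WavePacketCalculus.

Section SolutionModes.
Variables (R : realType) (sp : species) (nu lambda M : R).
Variables (eta ux uy phi psi omega : R -> R * R -> R).
Hypothesis sol : is_solution sp nu lambda M eta ux uy phi psi omega.
Variables (k : R) (hk : integer_mode k).

Let X t := nonzero_modes (ux t).
Let Y t := nonzero_modes (uy t).
Let hk1 := hk.1.

Lemma sol_eta_L2 t : 0 <= t -> L2fun (eta t).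
Proof. by move=> t0; have [e _] := sol_eta sol t0; exact: in_L2_L2fun. Qed.

Lemma sol_psi_L2 t : 0 <= t -> L2fun (psi t).
Proof. by move=> t0; exact: in_L2_L2fun (sol_psi sol t0). Qed.

Lemma sol_omega_L2 t : 0 <= t -> L2fun (omega t).
Proof. by move=> t0; exact: in_L2_L2fun (sol_omega sol t0). Qed.

Lemma sol_ux_L2 t : 0 <= t -> L2fun (X t).
Proof. by move=> t0; have [_ _ h _] := sol_u sol t0; exact: in_L2_L2fun. Qed.

Lemma sol_uy_L2 t : 0 <= t -> L2fun (Y t).
Proof. by move=> t0; have [_ _ _ h] := sol_u sol t0; exact: in_L2_L2fun. Qed.

(** The divergence of the electric force is a multiple of the Laplacian of phi. For electrons
    Poisson's equation expresses it by eta alone, and phi disappears; for ions it brings back phi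
    itself, which then has to be estimated. The value 0 lets both species share the same errors. *)
Definition potential (t : R) : R * R -> R := match sp with ion => nonzero_modes (phi t) | electron => fun _ => 0 end.

Lemma sol_potential_L2 t : 0 <= t -> L2fun (potential t).
Proof.
move=> t0; rewrite /potential; case: sp.
  by have [_ h] := sol_phi sol t0; exact: in_L2_L2fun.
split; first exact: measurable_cst.
by under eq_fun do rewrite expr0n; exact: integrable0.
Qed.

Let luX t : 0 <= t -> locint (ux t).
Proof. by move=> t0; have [h _ _ _] := sol_u sol t0; exact: L1loc_locint. Qed.
Let luY t : 0 <= t -> locint (uy t).
Proof. by move=> t0; have [_ h _ _] := sol_u sol t0; exact: L1loc_locint. Qed.
Let lphi t : 0 <= t -> locint (phi t).
Proof. by move=> t0; have [h _] := sol_phi sol t0; exact: L1loc_locint. Qed.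
Let leta t : 0 <= t -> locint (eta t).
Proof. by move=> t0; apply: L2fun_locint; exact: sol_eta_L2. Qed.
Let lpsi t : 0 <= t -> locint (psi t).
Proof. by move=> t0; apply: L2fun_locint; exact: sol_psi_L2. Qed.

Lemma pr_ux t A B b zeta d : 0 <= t -> bounded_support A B b -> pr (ux t) b k zeta d = pr (X t) b k zeta d.
Proof. by move=> t0 hb; have [h1 _ h2 _] := sol_u sol t0; rewrite (pr_nonzero_modes _ _ (L1loc_locint h1) (in_L2_L2fun h2) hk hb). Qed.

Lemma pr_uy t A B b zeta d : 0 <= t -> bounded_support A B b -> pr (uy t) b k zeta d = pr (Y t) b k zeta d.
Proof. by move=> t0 hb; have [_ h1 _ h2] := sol_u sol t0; rewrite (pr_nonzero_modes _ _ (L1loc_locint h1) (in_L2_L2fun h2) hk hb). Qed.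

Section Equations.
Variables (A B B' B'' : R) (b b' b'' : R -> R).
Hypotheses (cb : cut A B b) (cb' : cut A B' b') (cb'' : cut A B'' b'')
  (db : forall y, is_derive y (1 : R) b (b' y)) (db' : forall y, is_derive y (1 : R) b' (b'' y)).

Let test zeta d : test_fun (wavepacket b k zeta d) := test_wavepacket zeta d hk1 cb.

Lemma mode_div t zeta d : 0 <= t ->
  pr (psi t) b k zeta d = - k * pr (X t) b k zeta (d + pi / 2) - pr (Y t) b' k zeta d - zeta * pr (Y t) b k zeta (d + pi / 2).
Proof.
move=> t0; rewrite [LHS](sol_div sol t0 (test zeta d)) -[LHS]/(- distr_of (ux t) (pdx (wavepacket b k zeta d)) + - distr_of (uy t) (pdy (wavepacket b k zeta d))).
rewrite (distr_pdx cb _ _ _ (luX t0)) (distr_pdy cb cb' db _ _ _ (luY t0)).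
rewrite (pr_ux zeta (d + pi / 2) t0 (cut_bs cb)) (pr_uy zeta (d + pi / 2) t0 (cut_bs cb)) (pr_uy zeta d t0 (cut_bs cb')).
move: (pr (X t) b k zeta (d + pi / 2)) (pr (Y t) b' k zeta d) (pr (Y t) b k zeta (d + pi / 2)) => q1 q2 q3; ring.
Qed.

Lemma mode_curl t zeta d : 0 <= t ->
  pr (omega t) b k zeta d = pr (X t) b' k zeta d + zeta * pr (X t) b k zeta (d + pi / 2) - k * pr (Y t) b k zeta (d + pi / 2).
Proof.
move=> t0; rewrite [LHS](sol_curl sol t0 (test zeta d)) -[LHS]/(- - distr_of (ux t) (pdy (wavepacket b k zeta d)) + - distr_of (uy t) (pdx (wavepacket b k zeta d))).
rewrite (distr_pdx cb _ _ _ (luY t0)) (distr_pdy cb cb' db _ _ _ (luX t0)).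
rewrite (pr_ux zeta (d + pi / 2) t0 (cut_bs cb)) (pr_uy zeta (d + pi / 2) t0 (cut_bs cb)) (pr_ux zeta d t0 (cut_bs cb')).
move: (pr (X t) b k zeta (d + pi / 2)) (pr (X t) b' k zeta d) (pr (Y t) b k zeta (d + pi / 2)) => q1 q2 q3; ring.
Qed.

Definition source (t zeta d : R) : R := match sp with ion => 4 * pi * (M ^+ 2 * pr (potential t) b k zeta d - pr (eta t) b k zeta d)
  | electron => 4 * pi * pr (eta t) b k zeta d end.

Let pr_phi t A' B1 b1 zeta d : sp = ion -> 0 <= t -> bounded_support A' B1 b1 -> pr (phi t) b1 k zeta d = pr (potential t) b1 k zeta d.
Proof.
move=> e t0 hb; have [h1 h2] := sol_phi sol t0.
by rewrite /potential e (pr_nonzero_modes _ _ (L1loc_locint h1) (in_L2_L2fun h2) hk hb).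
Qed.

Lemma mode_lap_phi t zeta d : 0 <= t -> lap_pr (phi t) b b' b'' k zeta d = source t zeta d.
Proof.
move=> t0; rewrite -(distr_lap cb cb' cb'' db db' _ _ _ (lphi t0)) (sol_poisson sol t0 (test zeta d)).
rewrite /source; case e : sp.
  by rewrite -(pr_phi _ _ e t0 (cut_bs cb)).
by [].
Qed.

Lemma mode_potential t zeta d : sp = ion -> 0 <= t ->
  (k ^+ 2 + zeta ^+ 2 + 4 * pi * M ^+ 2) * pr (potential t) b k zeta d =
  4 * pi * pr (eta t) b k zeta d + pr (potential t) b'' k zeta d + 2 * zeta * pr (potential t) b' k zeta (d + pi / 2).
Proof.
move=> e t0; have := mode_lap_phi zeta d t0; rewrite /source /lap_pr [in X in _ = X]e.
rewrite (pr_phi zeta d e t0 (cut_bs cb)) (pr_phi zeta (d + pi / 2) e t0 (cut_bs cb')) (pr_phi zeta d e t0 (cut_bs cb'')) => h.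
by move: h; lra.
Qed.

Let Dx_apply f zeta d : locint f ->
  Dx (distr_of f) (wavepacket b k zeta d) = - (k * pr f b k zeta (d + pi / 2)).
Proof. by move=> lf; rewrite -(distr_pdx cb _ _ _ lf). Qed.

Let Dy_apply f zeta d : locint f ->
  Dy (distr_of f) (wavepacket b k zeta d) = - (pr f b' k zeta d + zeta * pr f b k zeta (d + pi / 2)).
Proof. by move=> lf; rewrite -(distr_pdy cb cb' db _ _ _ lf). Qed.

Let Dx_div t zeta d : 0 <= t ->
  Dx (Div (distr_of (ux t)) (distr_of (uy t))) (wavepacket b k zeta d) = - (k * pr (psi t) b k zeta (d + pi / 2)).
Proof.
move=> t0; have tp : test_fun (pdx (wavepacket b k zeta d)).
  by rewrite pdx_wavepacket; apply: test_scale (smooth2_wavepacket _ _ _ (cut_smooth cb)); exact: test_wavepacket cb.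
by rewrite -(distr_pdx cb _ _ _ (lpsi t0)) (sol_div sol t0 tp).
Qed.

Let Dy_div t zeta d : 0 <= t ->
  Dy (Div (distr_of (ux t)) (distr_of (uy t))) (wavepacket b k zeta d) = - (pr (psi t) b' k zeta d + zeta * pr (psi t) b k zeta (d + pi / 2)).
Proof.
move=> t0; have s1 := smooth2_wavepacket k zeta d (cut_smooth cb').
have s2 := smooth2_wavepacket k zeta (d + pi / 2) (cut_smooth cb).
have tp : test_fun (pdy (wavepacket b k zeta d)).
  rewrite (pdy_wavepacket _ _ _ db); apply: test_add => //; [exact: test_wavepacket cb'| |exact: smooth2_scale].
  by apply: test_scale => //; exact: test_wavepacket cb.
by rewrite -(distr_pdy cb cb' db _ _ _ (lpsi t0)) (sol_div sol t0 tp).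
Qed.

Let derive_near (F G : R -> R) (t v : R) : 0 < t -> (forall s, 0 <= s -> F s = G s) ->
  is_derive t (1 : R) F v -> is_derive t (1 : R) G v.
Proof.
move=> t0 e; apply: near_eq_is_derive; near=> s; apply: e; apply: ltW; near: s; exact: lt_nbhsr.
Unshelve. all: by end_near.
Qed.

Let combine4 (T1 T2 : distr R) chi : (- T1 - T2) chi = - T1 chi - T2 chi. Proof. by []. Qed.
Let combine_x (T1 T2 T3 T4 T5 T6 : distr R) (a c e f : R) chi :
  (- T1 - T2 - a *: T3 - c *: T4 + e *: T5 + f *: T6) chi = - T1 chi - T2 chi - a * T3 chi - c * T4 chi + e * T5 chi + f * T6 chi.
Proof. by []. Qed.
Let combine_y (T1 T3 T4 T5 T6 : distr R) (a c e f : R) chi :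
  (- T1 - a *: T3 - c *: T4 + e *: T5 + f *: T6) chi = - T1 chi - a * T3 chi - c * T4 chi + e * T5 chi + f * T6 chi.
Proof. by []. Qed.

(** The first term is the transport by the shear, which acts on a packet as a derivative in zeta;
    [moving_derive] produces the same term with the opposite sign. *)
Lemma mode_dt_eta (t zeta d : R) : 0 < t -> is_derive t (1 : R) (fun s => pr (eta s) b k zeta d)
  (k * pr (eta t) (fun y => b y * y) k zeta (d + pi / 2) - pr (psi t) b k zeta d).
Proof.
move=> t0; have := sol_mass sol t0 (test zeta d); rewrite combine4 (distr_ymul cb _ _ _ (leta (ltW t0))).
by rewrite -(sol_div sol (ltW t0) (test zeta d)) (opprK (k * _)).
Qed.

Definition dt_ux t zeta d : R := k * pr (X t) (fun y => b y * y) k zeta (d + pi / 2)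
  - pr (Y t) b k zeta d + (M ^+ 2)^-1 * (k * pr (eta t) b k zeta (d + pi / 2))
  + field_sign R sp * (k * pr (phi t) b k zeta (d + pi / 2))
  + nu * lap_pr (X t) b b' b'' k zeta d - lambda * (k * pr (psi t) b k zeta (d + pi / 2)).

Definition dt_uy t zeta d : R := k * pr (Y t) (fun y => b y * y) k zeta (d + pi / 2)
  + (M ^+ 2)^-1 * (pr (eta t) b' k zeta d + zeta * pr (eta t) b k zeta (d + pi / 2))
  + field_sign R sp * (pr (phi t) b' k zeta d + zeta * pr (phi t) b k zeta (d + pi / 2))
  + nu * lap_pr (Y t) b b' b'' k zeta d - lambda * (pr (psi t) b' k zeta d + zeta * pr (psi t) b k zeta (d + pi / 2)).

Lemma mode_dt_ux (t zeta d : R) : 0 < t -> is_derive t (1 : R) (fun s => pr (X s) b k zeta d) (dt_ux t zeta d).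
Proof.
move=> t0; have t0' := ltW t0; apply: (@derive_near (fun s => pr (ux s) b k zeta d)) => //.
  by move=> s s0; exact: (pr_ux zeta d s0 (cut_bs cb)).
have := sol_momentum_x sol t0 (test zeta d); rewrite combine_x.
rewrite (distr_ymul cb _ _ _ (luX t0')) (Dx_apply _ _ (leta t0')) (Dx_apply _ _ (lphi t0')) (Dx_div _ _ t0').
rewrite (distr_lap cb cb' cb'' db db' _ _ _ (luX t0')) /lap_pr -/(pr (uy t) b k zeta d).
rewrite (pr_ux zeta (d + pi / 2) t0' (bounded_support_id (cut_bs cb))) (pr_uy zeta d t0' (cut_bs cb)).
rewrite (pr_ux zeta d t0' (cut_bs cb)) (pr_ux zeta d t0' (cut_bs cb'')) (pr_ux zeta (d + pi / 2) t0' (cut_bs cb')).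
move=> h; apply: (derE h); rewrite /dt_ux /lap_pr.
move: (pr (X t) (fun y => b y * y) _ _ _) (pr (Y t) b k zeta d) (pr (eta t) b _ _ _) (pr (phi t) b _ _ _) (pr (psi t) b _ _ _) => q1 q2 q3 q4 q5.
by move: (pr (X t) b'' _ _ _) (pr (X t) b' _ _ _) (pr (X t) b _ _ _) (M ^- 2) => q6 q7 q8 q9; ring.
Qed.

Lemma mode_dt_uy (t zeta d : R) : 0 < t -> is_derive t (1 : R) (fun s => pr (Y s) b k zeta d) (dt_uy t zeta d).
Proof.
move=> t0; have t0' := ltW t0; apply: (@derive_near (fun s => pr (uy s) b k zeta d)) => //.
  by move=> s s0; exact: (pr_uy zeta d s0 (cut_bs cb)).
have := sol_momentum_y sol t0 (test zeta d); rewrite combine_y.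
rewrite (distr_ymul cb _ _ _ (luY t0')) (Dy_apply _ _ (leta t0')) (Dy_apply _ _ (lphi t0')) (Dy_div _ _ t0').
rewrite (distr_lap cb cb' cb'' db db' _ _ _ (luY t0')) /lap_pr.
rewrite (pr_uy zeta (d + pi / 2) t0' (bounded_support_id (cut_bs cb))).
rewrite (pr_uy zeta d t0' (cut_bs cb)) (pr_uy zeta d t0' (cut_bs cb'')) (pr_uy zeta (d + pi / 2) t0' (cut_bs cb')).
move=> h; apply: (derE h); rewrite /dt_uy /lap_pr.
move: (pr (Y t) (fun y => b y * y) _ _ _) (pr (eta t) b _ _ _) (pr (phi t) b _ _ _) (pr (psi t) b _ _ _) => q1 q3 q4 q5.
move: (pr (eta t) b' _ _ _) (pr (phi t) b' _ _ _) (pr (psi t) b' _ _ _) => q10 q11 q12.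
by move: (pr (Y t) b'' _ _ _) (pr (Y t) b' _ _ _) (pr (Y t) b _ _ _) (M ^- 2) => q6 q7 q8 q9; ring.
Qed.

End Equations.

End SolutionModes.

(** * Elliptic estimates *)

Lemma parallelogram_le (R : realFieldType) (a b c e : R) :
  (a + b) ^+ 2 + (c - e) ^+ 2 <= 2 * (a ^+ 2 + c ^+ 2) + 2 * (b ^+ 2 + e ^+ 2).
Proof. have := sqr_ge0 (a - b); have := sqr_ge0 (c + e); nra. Qed.

Lemma le_Rintegral_sum d (T : measurableType d) (R : realType) (m : {measure set T -> \bar R}) (u1 u2 u3 u4 u5 u6 : T -> R) :
  m.-integrable setT (EFin \o u1) -> m.-integrable setT (EFin \o u2) -> m.-integrable setT (EFin \o u3) ->
  m.-integrable setT (EFin \o u4) -> m.-integrable setT (EFin \o u5) -> m.-integrable setT (EFin \o u6) ->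
  (forall z, u1 z + u2 z <= 2 * (u3 z + u4 z) + 2 * (u5 z + u6 z)) ->
  \int[m]_z u1 z + \int[m]_z u2 z <= 2 * (\int[m]_z u3 z + \int[m]_z u4 z) + 2 * (\int[m]_z u5 z + \int[m]_z u6 z).
Proof.
move=> i1 i2 i3 i4 i5 i6 h; have j1 := integrableRD i3 i4; have j2 := integrableRD i5 i6.
rewrite -(RintegralD measurableT i1 i2) -(RintegralD measurableT i3 i4) -(RintegralD measurableT i5 i6).
rewrite -(RintegralZl 2 measurableT j1) -(RintegralZl 2 measurableT j2).
rewrite -(RintegralD measurableT (integrableRZ 2 j1) (integrableRZ 2 j2)).
by apply: le_Rintegral => //; [exact: integrableRD|exact: integrableRD (integrableRZ 2 j1) (integrableRZ 2 j2)].
Qed.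

Lemma le_Rintegral_sum4 d (T : measurableType d) (R : realType) (m : {measure set T -> \bar R}) (u1 u2 u3 u4 : T -> R) (c2 c3 c4 : R) :
  m.-integrable setT (EFin \o u1) -> m.-integrable setT (EFin \o u2) -> m.-integrable setT (EFin \o u3) ->
  m.-integrable setT (EFin \o u4) -> (forall z, u1 z <= c2 * u2 z + c3 * u3 z + c4 * u4 z) ->
  \int[m]_z u1 z <= c2 * \int[m]_z u2 z + c3 * \int[m]_z u3 z + c4 * \int[m]_z u4 z.
Proof.
move=> i1 i2 i3 i4 h; have j2 := integrableRZ c2 i2; have j3 := integrableRZ c3 i3; have j4 := integrableRZ c4 i4.
rewrite -(RintegralZl c2 measurableT i2) -(RintegralZl c3 measurableT i3) -(RintegralZl c4 measurableT i4).
rewrite -(RintegralD measurableT j2 j3) -(RintegralD measurableT (integrableRD j2 j3) j4).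
by apply: le_Rintegral => //; exact: integrableRD (integrableRD j2 j3) j4.
Qed.

Section RealEnergies.
Variable R : realType.
Local Notation mu := (@lebesgue_measure R).
Local Notation mR := (measurableTypeR R).
Implicit Types (f g : R * R -> R) (b : R -> R) (A B k zeta d : R).

Definition rwave f b k d : R := \int[mu]_zeta (pr f b k zeta d ^+ 2).
Definition rmsq b k f : R := \int[mu]_y (b y ^+ 2 * amp k f y).
(** The L2 energy in y of one mode, without cutoff: the limit of [rmsq] as the cutoff opens. *)
Definition ramp k f : R := \int[mu]_y amp k f y.

Lemma integrable_bs_amp f A B b k : L2fun f -> bounded_support A B b ->
  mu.-integrable setT (EFin \o (fun y => b y ^+ 2 * amp k f y)).
Proof.
move=> f2 hb; have i := integrable_amp k f2.
have mb : measurable_fun setT (fun y : mR => b y ^+ 2 : mR) by apply: measurable_funX; exact: bs_measurable hb.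
have := integrableM_bounded mb (c := B ^+ 2) _ i.
have hB y : `|b y ^+ 2| <= B ^+ 2.
  by rewrite normrX; apply: lerXn2r; rewrite ?nnegrE ?normr_ge0 ?(bs_bound_ge0 hb)//; exact: bs_bounded hb y.
by move=> /(_ hB); apply: eq_integrable => // y _ /=; rewrite mulrC.
Qed.

Lemma ramp_ge0 k f : 0 <= ramp k f.
Proof. by apply: Rintegral_ge0 => y _; exact: amp_ge0. Qed.

Lemma rmsq_le f A B b k (C : R) : L2fun f -> bounded_support A B b -> (forall y, `|b y| <= C) ->
  rmsq b k f <= C ^+ 2 * ramp k f.
Proof.
move=> f2 hb bC; have i := integrable_amp k f2.
rewrite /ramp -(RintegralZl _ measurableT i); apply: le_Rintegral => //.
- exact: integrable_bs_amp hb.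
- exact: integrableRZ.
move=> y _; apply: ler_wpM2r; first exact: amp_ge0.
rewrite -(ger0_norm (sqr_ge0 (b y))) normrX; apply: lerXn2r; rewrite ?nnegrE ?normr_ge0//.
exact: le_trans (bC 0).
Qed.

Lemma modesqE f A B b k : L2fun f -> bounded_support A B b -> modesq b k f = (rmsq b k f)%:E.
Proof. by move=> f2 hb; rewrite /rmsq EFin_Rintegral//; exact: integrable_bs_amp hb. Qed.

Lemma wavesq_ge0 f b k d : (0 <= wavesq f b k d)%E.
Proof. by apply: integral_ge0 => y _; rewrite lee_fin sqr_ge0. Qed.

Lemma wavesq_lty f A B b k d : L2fun f -> bounded_support A B b -> (d = 0 \/ d = pi / 2) -> (wavesq f b k d < +oo)%E.
Proof.
move=> f2 hb hd; have := wavesq_total k f2 hb; rewrite (modesqE k f2 hb).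
have := wavesq_ge0 f b (- k) 0; have := wavesq_ge0 f b (- k) (pi / 2).
have := wavesq_ge0 f b k 0; have := wavesq_ge0 f b k (pi / 2).
have key (x y z t : \bar R) (r : R) : (0 <= x)%E -> (0 <= y)%E -> (0 <= z)%E -> (0 <= t)%E ->
    (x + y + z + t = r%:E)%E -> (x < +oo)%E /\ (y < +oo)%E.
  by move: x y z t => [x| |] [y| |] [z| |] [t| |] //; rewrite !ltry.
move=> h1 h2 h3 h4 e.
have [l1 l2] := key _ _ _ _ (4 * pi * rmsq b k f) h2 h1 h4 h3 e.
by case: hd => ->.
Qed.

Lemma pr_sqr_shift f b k zeta d : pr f b k zeta (d + pi / 2 + pi / 2) ^+ 2 = pr f b k zeta d ^+ 2.
Proof. by rewrite pr_shift_pi sqrrN. Qed.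

Lemma pr_sqr_shift0 f b k zeta : pr f b k zeta (pi / 2 + pi / 2) ^+ 2 = pr f b k zeta 0 ^+ 2.
Proof. by have := pr_sqr_shift f b k zeta 0; rewrite add0r. Qed.

(** The phases that occur: 0 and pi / 2, and these shifted by pi / 2 through a derivative, in the
    unreduced form in which they arise. *)
Definition phase d := d = 0 \/ d = pi / 2 \/ d = 0 + pi / 2 \/ d = pi / 2 + pi / 2.

Lemma integrable_pr_sqr f A B b k d : L2fun f -> bounded_support A B b -> phase d ->
  mu.-integrable setT (EFin \o (fun zeta => pr f b k zeta d ^+ 2)).
Proof.
move=> f2 hb hd.
have main d' : d' = 0 \/ d' = pi / 2 -> mu.-integrable setT (EFin \o (fun zeta => pr f b k zeta d' ^+ 2)).
  move=> hd'; apply: ge0_fin_integrable; last exact: wavesq_lty hb hd'.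
    by apply: measurable_funX; apply: continuous_measurable_fun; exact: continuous_pr hb.
  by move=> z; exact: sqr_ge0.
case: hd => [->|[->|[->|->]]]; [exact: main (or_introl erefl)|exact: main (or_intror erefl)|by rewrite add0r; exact: main (or_intror erefl)|].
have := main 0 (or_introl erefl); apply: eq_integrable => // z _ /=.
by rewrite pr_sqr_shift0.
Qed.

Lemma rwave_shift f b k d : rwave f b k (d + pi / 2 + pi / 2) = rwave f b k d.
Proof. by apply: eq_Rintegral => z _; rewrite pr_sqr_shift. Qed.

Lemma rwave_ge0 f b k d : 0 <= rwave f b k d.
Proof. by apply: Rintegral_ge0 => y _; rewrite sqr_ge0. Qed.

(* The two phases and the two signs of [k] together replace the squared modulus of a complex
   Fourier coefficient. *)
Definition total (F : R -> R -> R) k : R := F k 0 + F k (pi / 2) + F (- k) 0 + F (- k) (pi / 2).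

Lemma rwave_total f A B b k : L2fun f -> bounded_support A B b ->
  total (rwave f b) k = 4 * pi * rmsq b k f.
Proof.
move=> f2 hb; have h k' d' : d' = 0 \/ d' = pi / 2 -> wavesq f b k' d' = (rwave f b k' d')%:E.
  by move=> hd'; rewrite /rwave EFin_Rintegral//; apply: integrable_pr_sqr hb _ => //; case: hd'; [left|right; left].
have l := or_introl erefl; have r := or_intror erefl.
have := wavesq_total k f2 hb; rewrite (modesqE k f2 hb).
rewrite (h k 0 (or_introl erefl)) (h k (pi / 2) (or_intror erefl)) (h (- k) 0 (or_introl erefl)) (h (- k) (pi / 2) (or_intror erefl)).
by move=> e; apply: EFin_inj; exact: e.
Qed.

Lemma total_shift f b k : total (fun k d => rwave f b k (d + pi / 2)) k = total (rwave f b) k.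
Proof.
rewrite /total !add0r; have h k' : rwave f b k' (pi / 2 + pi / 2) = rwave f b k' 0.
  by have := rwave_shift f b k' 0; rewrite add0r.
by rewrite !h; move: (rwave _ _ _ _) (rwave _ _ _ _) (rwave _ _ _ _) (rwave _ _ _ _) => p q s t; ring.
Qed.

Lemma total_le_sum (F1 F2 G1 G2 G3 G4 : R -> R -> R) k : (forall k' d, k' = k \/ k' = - k -> d = 0 \/ d = pi / 2 ->
    F1 k' d + F2 k' d <= 2 * (G1 k' d + G2 k' d) + 2 * (G3 k' d + G4 k' d)) ->
  total F1 k + total F2 k <= 2 * (total G1 k + total G2 k) + 2 * (total G3 k + total G4 k).
Proof.
move=> h; have := h k 0 (or_introl erefl) (or_introl erefl); have := h k (pi / 2) (or_introl erefl) (or_intror erefl).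
have := h (- k) 0 (or_intror erefl) (or_introl erefl); have := h (- k) (pi / 2) (or_intror erefl) (or_intror erefl).
by rewrite /total; lra.
Qed.

Lemma rescale_le (c t1 t2 t3 t4 t5 t6 q1 q2 q3 q4 q5 q6 : R) : 0 < c -> t1 = c * q1 -> t2 = c * q2 -> t3 = c * q3 ->
  t4 = c * q4 -> t5 = c * q5 -> t6 = c * q6 -> t1 + t2 <= 2 * (t3 + t4) + 2 * (t5 + t6) ->
  q1 + q2 <= 2 * (q3 + q4) + 2 * (q5 + q6).
Proof. by move=> c0 -> -> -> -> -> -> h; rewrite -(ler_pM2l c0); move: h; lra. Qed.

Lemma errors_le (x y p w q1 q2 q3 q4 C i : R) : x <= C * q2 * i -> y <= C * q1 * i -> w <= q4 -> p <= q3 ->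
  2 * (p + w) + 2 * (y + x) <= 2 * (q3 + q4) + 2 * (C * q1 + C * q2) * i.
Proof. by move: (C * q1) (C * q2) => a b; lra. Qed.

Lemma errors_le4 (q C1 C2 x y r s i : R) : 0 <= q -> x <= C1 * i -> y <= C2 * i -> r <= s ->
  48 * q * r + 3 * x + 12 * y <= 48 * q * s + (3 * C1 + 12 * C2) * i.
Proof. by move=> q0 h1 h2 h3; have := ler_wpM2l q0 h3; rewrite (mulrDl _ _ i) -!mulrA; move: (q * r) (q * s) (C1 * i) (C2 * i) h1 h2 => *; lra. Qed.

Lemma rescale_le4 (c t1 t2 t3 t4 q1 q2 q3 q4 c2 c3 c4 : R) : 0 < c -> t1 = c * q1 -> t2 = c * q2 -> t3 = c * q3 ->
  t4 = c * q4 -> t1 <= c2 * t2 + c3 * t3 + c4 * t4 -> q1 <= c2 * q2 + c3 * q3 + c4 * q4.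
Proof.
move=> c0 -> -> -> -> h; rewrite -(ler_pM2l c0); apply: (le_trans h).
by rewrite le_eqVlt; apply/orP; left; apply/eqP; ring.
Qed.

Lemma total_le_sum4 (F1 F2 F3 F4 : R -> R -> R) (c2 c3 c4 : R) k : (forall k' d, k' = k \/ k' = - k -> d = 0 \/ d = pi / 2 ->
    F1 k' d <= c2 * F2 k' d + c3 * F3 k' d + c4 * F4 k' d) ->
  total F1 k <= c2 * total F2 k + c3 * total F3 k + c4 * total F4 k.
Proof.
move=> h; have := h k 0 (or_introl erefl) (or_introl erefl); have := h k (pi / 2) (or_introl erefl) (or_intror erefl).
have := h (- k) 0 (or_intror erefl) (or_introl erefl); have := h (- k) (pi / 2) (or_intror erefl) (or_intror erefl).
by rewrite /total; lra.
Qed.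

(** The square of three terms brings a factor 3, whence 48 = 3 * 16 and 12 = 3 * 4. The factor zeta
    is divided out because zeta^2 <= p^2. *)
Lemma potential_pointwise (K zeta a q0 qe q2 q1 : R) : 0 <= a -> 1 <= K ->
  (K + zeta ^+ 2 + a) * q0 = 4 * pi * qe + q2 + 2 * zeta * q1 ->
  q0 ^+ 2 <= 48 * pi ^+ 2 * qe ^+ 2 + 3 * q2 ^+ 2 + 12 * q1 ^+ 2.
Proof.
move=> a0 K1 h; set p := K + zeta ^+ 2 + a.
have p0 : 1 <= p by rewrite /p; have := sqr_ge0 zeta; lra.
have p0' : 0 < p by exact: lt_le_trans p0.
have zp : zeta ^+ 2 <= p ^+ 2.
  by have := sqr_ge0 zeta; move: p0; rewrite /p => p1 z0; rewrite expr2; nra.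
have h2 : p ^+ 2 * q0 ^+ 2 <= p ^+ 2 * (48 * pi ^+ 2 * qe ^+ 2 + 3 * q2 ^+ 2 + 12 * q1 ^+ 2).
  rewrite -exprMn h; apply: (@le_trans _ _ (3 * ((4 * pi * qe) ^+ 2 + q2 ^+ 2 + (2 * zeta * q1) ^+ 2))).
    move: (4 * pi * qe) (2 * zeta * q1) => u v.
    by have := sqr_ge0 (u - q2); have := sqr_ge0 (u - v); have := sqr_ge0 (q2 - v); nra.
  have -> : 3 * ((4 * pi * qe) ^+ 2 + q2 ^+ 2 + (2 * zeta * q1) ^+ 2) =
    48 * pi ^+ 2 * qe ^+ 2 + 3 * q2 ^+ 2 + 12 * (zeta ^+ 2 * q1 ^+ 2) by ring.
  have pp : 1 <= p ^+ 2 by rewrite exprn_ege1.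
  have := ler_wpM2r (sqr_ge0 q1) zp; have := sqr_ge0 q2.
  have : 0 <= 48 * pi ^+ 2 * qe ^+ 2 by rewrite mulr_ge0 ?sqr_ge0// mulr_ge0 ?sqr_ge0.
  move: (48 * pi ^+ 2 * qe ^+ 2) (q2 ^+ 2) (q1 ^+ 2) (p ^+ 2) (zeta ^+ 2) pp => u v w P z *; nra.
by move: h2; rewrite ler_pM2l// exprn_gt0.
Qed.

Lemma cvg_le_bound (u : nat -> R) (a c e : R) : u n @[n --> \oo] --> a ->
  (forall n, u n <= c + e / n.+1%:R) -> a <= c.
Proof.
move=> ua uc; have h : (c + e / n.+1%:R) @[n --> \oo] --> c + e * 0.
  by apply: cvgD; [exact: cvg_cst|apply: cvgMr; exact: cvg_harmonic].
rewrite mulr0 addr0 in h.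
by apply: (ler_cvg_to ua h); exact: nearW.
Qed.

Lemma cutoff_bs (bj : nat -> R -> R) r j : bj 0%N = @bump R -> (forall j, smooth1 (bj j)) ->
  (forall j y, is_derive y (1 : R) (bj j) (bj j.+1 y)) -> 0 < r ->
  forall B, (forall y, `|bj j y| <= B) -> cut r^-1 (r ^+ j * B) (cutoff bj r j).
Proof.
move=> b0 sb db r0 B hB; have s1 := smooth1_cutoff sb r j; split=> //; split.
- by apply: continuous_measurable_fun; exact: smooth1_continuous.
- by rewrite invr_ge0 ltW.
- by move=> y; rewrite /cutoff normrM ger0_norm ?exprn_ge0 ?(ltW r0)// ler_wpM2l ?exprn_ge0 ?(ltW r0).
- by move=> y; exact: cutoff_support.
Qed.

Section CutoffFamily.
Variables (bj : nat -> R -> R) (BJ : nat -> R).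
Hypotheses (b0 : bj 0%N = @bump R) (sb : forall j, smooth1 (bj j))
  (db : forall j y, is_derive y (1 : R) (bj j) (bj j.+1 y)) (hB : forall j y, `|bj j y| <= BJ j).

Definition scale_ (n : nat) : R := n.+1%:R^-1.
Definition cut_ n j := cutoff bj (scale_ n) j.

Lemma scale_gt0 n : 0 < scale_ n.
Proof. by rewrite invr_gt0. Qed.

Lemma scale_le1 n : scale_ n <= 1.
Proof. by rewrite invf_le1// ler1n. Qed.

Lemma cut_cut n j : cut (scale_ n)^-1 (scale_ n ^+ j * BJ j) (cut_ n j).
Proof. by apply: cutoff_bs => //; exact: scale_gt0. Qed.

Lemma der_cut n j y : is_derive y (1 : R) (cut_ n j) (cut_ n j.+1 y).
Proof. exact: der_cutoff. Qed.

Lemma cut_le n j y : `|cut_ n j.+1 y| <= scale_ n * BJ j.+1.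
Proof.
have B0 : 0 <= BJ j.+1 by apply: le_trans (hB j.+1 0).
apply: (le_trans (bs_bounded (cut_bs (cut_cut n j.+1)) y)); apply: ler_wpM2r => //.
by rewrite exprS ler_piMr ?(ltW (scale_gt0 n))// exprn_ile1 ?(ltW (scale_gt0 n))// scale_le1.
Qed.

Lemma cut0_le1 n y : `|cut_ n 0 y| <= 1.
Proof.
rewrite /cut_ /cutoff expr0 mul1r b0; have /andP[h1 h2] := bump_le1 (scale_ n * y).
by rewrite ger0_norm.
Qed.

Lemma rmsq_cut0_le n k f : L2fun f -> rmsq (cut_ n 0) k f <= ramp k f.
Proof.
by move=> f2; have := rmsq_le k f2 (cut_bs (cut_cut n 0)) (cut0_le1 n); rewrite expr1n mul1r.
Qed.

(** Each derivative of the cutoff gains a factor 1 / (n + 1); this is the only source of smallness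
    of the errors. *)
Lemma rmsq_cutS_le n j k f : L2fun f -> rmsq (cut_ n j.+1) k f <= BJ j.+1 ^+ 2 * ramp k f / n.+1%:R.
Proof.
move=> f2; apply: (le_trans (rmsq_le k f2 (cut_bs (cut_cut n j.+1)) (cut_le n j))).
have -> : (scale_ n * BJ j.+1) ^+ 2 * ramp k f = BJ j.+1 ^+ 2 * ramp k f * scale_ n ^+ 2 by ring.
apply: ler_wpM2l; first by apply: mulr_ge0 (sqr_ge0 _) (ramp_ge0 k f).
by rewrite expr2 ler_piMl ?(ltW (scale_gt0 n)) ?scale_le1.
Qed.

Lemma cvg_rmsq_cut k f : L2fun f -> rmsq (cut_ n 0) k f @[n --> \oo] --> ramp k f.
Proof.
move=> f2; have ia := integrable_amp k f2; have mf := f2.1.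
apply: (@Rdominated_cvg _ _ _ mu (fun n y => cut_ n 0 y ^+ 2 * amp k f y) (amp k f) (amp k f)) => //.
- by move=> n; have /integrableP[m _] := integrable_bs_amp k f2 (cut_bs (cut_cut n 0)); exact/measurable_EFinP.
- exact: measurable_amp.
- move=> y; rewrite -[X in _ --> X]mul1r; apply: cvgMl.
  have h : (fun n => cut_ n 0 y ^+ 2) @ \oo --> (bump 0 ^+ 2 : R).
    have cb : {for 0, continuous (fun x : R => bump x ^+ 2)}.
      have s2 : smooth1 (fun x : R => bump x * bump x) by apply: smooth1_mul; rewrite -b0.
      have -> : (fun x : R => bump x ^+ 2) = (fun x => bump x * bump x) by apply/funext => x; rewrite expr2.
      exact: smooth1_continuous.
    have hs : scale_ n * y @[n --> \oo] --> 0.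
      by rewrite -(mul0r y); apply: cvgMl; exact: cvg_harmonic.
    have -> : (fun n => cut_ n 0 y ^+ 2) = (fun n => bump (scale_ n * y) ^+ 2).
      by apply/funext => n; rewrite /cut_ /cutoff expr0 mul1r b0.
    exact: (continuous_cvg _ cb hs).
  by rewrite bump0 expr1n in h.
- move=> n y; rewrite (ger0_norm (mulr_ge0 (sqr_ge0 _) (amp_ge0 _ _ _))); apply: ler_piMl; first exact: amp_ge0.
  by rewrite -(ger0_norm (sqr_ge0 _)) normrX exprn_ile1// cut0_le1.
Qed.

Section Elliptic.
Variable k : R.
Hypothesis k1 : 1 <= `|k|.

(** The equation p = div (x, y) as seen by wave packets. Being linear, it also holds for differences
    of the solution at two times; both signs of k are included because [total] combines them. *)
Definition div_rel (p x y : R * R -> R) := forall A B B' b b' k' zeta d, k' = k \/ k' = - k ->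
  cut A B b -> cut A B' b' -> (forall y, is_derive y (1 : R) b (b' y)) ->
  pr p b k' zeta d = - k' * pr x b k' zeta (d + pi / 2) - pr y b' k' zeta d - zeta * pr y b k' zeta (d + pi / 2).

Definition curl_rel (w x y : R * R -> R) := forall A B B' b b' k' zeta d, k' = k \/ k' = - k ->
  cut A B b -> cut A B' b' -> (forall y, is_derive y (1 : R) b (b' y)) ->
  pr w b k' zeta d = pr x b' k' zeta d + zeta * pr x b k' zeta (d + pi / 2) - k' * pr y b k' zeta (d + pi / 2).

Let kk1 k' : k' = k \/ k' = - k -> 1 <= k' ^+ 2.
Proof. by move=> hk'; rewrite -(ger0_norm (sqr_ge0 k')) normrX exprn_ege1//; case: hk' => ->; rewrite ?normrN. Qed.

(** Up to cutoff terms this is |psi|^2 + |omega|^2 = p |u|^2: the symbols of divergence and curl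
    together form a rotation scaled by the root of p. *)
Lemma velocity_pointwise p w x y n k' zeta d : div_rel p x y -> curl_rel w x y -> k' = k \/ k' = - k ->
  (k' ^+ 2 + zeta ^+ 2) * (pr x (cut_ n 0) k' zeta (d + pi / 2) ^+ 2 + pr y (cut_ n 0) k' zeta (d + pi / 2) ^+ 2) <=
  2 * (pr p (cut_ n 0) k' zeta d ^+ 2 + pr w (cut_ n 0) k' zeta d ^+ 2)
  + 2 * (pr y (cut_ n 1) k' zeta d ^+ 2 + pr x (cut_ n 1) k' zeta d ^+ 2).
Proof.
move=> hp hw hk'; have := hp _ _ _ _ _ k' zeta d hk' (cut_cut n 0) (cut_cut n 1) (der_cut n 0).
have := hw _ _ _ _ _ k' zeta d hk' (cut_cut n 0) (cut_cut n 1) (der_cut n 0).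
move: (pr p _ _ _ _) (pr w _ _ _ _) (pr x (cut_ n 0) _ _ _) (pr y (cut_ n 0) _ _ _) (pr x (cut_ n 1) _ _ _) (pr y (cut_ n 1) _ _ _).
move=> P W X Y X' Y' hW hP.
have -> : (k' ^+ 2 + zeta ^+ 2) * (X ^+ 2 + Y ^+ 2) = (P + Y') ^+ 2 + (W - X') ^+ 2 by rewrite hP hW; ring.
exact: parallelogram_le.
Qed.

Lemma ipr f n j k' d : L2fun f -> phase d -> mu.-integrable setT (EFin \o (fun zeta => pr f (cut_ n j) k' zeta d ^+ 2)).
Proof. by move=> f2; exact: integrable_pr_sqr (cut_bs (cut_cut n j)). Qed.

(** Since p >= k^2 >= 1, the pointwise estimate can be integrated in zeta without its weight; the
    cutoff terms vanish in the limit. *)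
Lemma elliptic_velocity p w x y : L2fun p -> L2fun w -> L2fun x -> L2fun y -> div_rel p x y -> curl_rel w x y ->
  ramp k x + ramp k y <= 2 * (ramp k p + ramp k w).
Proof.
move=> p2 w2 x2 y2 hp hw.
have step n : rmsq (cut_ n 0) k x + rmsq (cut_ n 0) k y <=
    2 * (rmsq (cut_ n 0) k p + rmsq (cut_ n 0) k w) + 2 * (rmsq (cut_ n 1) k y + rmsq (cut_ n 1) k x).
  have h : total (fun k d => rwave x (cut_ n 0) k (d + pi / 2)) k + total (fun k d => rwave y (cut_ n 0) k (d + pi / 2)) k <=
      2 * (total (rwave p (cut_ n 0)) k + total (rwave w (cut_ n 0)) k) + 2 * (total (rwave y (cut_ n 1)) k + total (rwave x (cut_ n 1)) k).
    apply: total_le_sum => k' d hk' hd.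
    have ph : phase d by case: hd => ->; [left|right; left].
    have ph' : phase (d + pi / 2) by case: hd => ->; [right; right; left|right; right; right].
    have i1 := ipr n 0 k' x2 ph'; have i2 := ipr n 0 k' y2 ph'; have i3 := ipr n 0 k' p2 ph; have i4 := ipr n 0 k' w2 ph.
    have i5 := ipr n 1 k' y2 ph; have i6 := ipr n 1 k' x2 ph.
    apply: (le_Rintegral_sum i1 i2 i3 i4 i5 i6) => zeta; apply: le_trans (velocity_pointwise n zeta d hp hw hk').
    rewrite ler_peMl ?addr_ge0 ?sqr_ge0//; apply: le_trans (kk1 hk') _.
    by rewrite lerDl sqr_ge0.
  have p4 : 0 < 4 * pi :> R by rewrite mulr_gt0 ?pi_gt0.
  have t f j (f2 : L2fun f) := rwave_total k f2 (cut_bs (cut_cut n j)).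
  have hx := etrans (total_shift x (cut_ n 0) k) (t x 0%N x2); have hy := etrans (total_shift y (cut_ n 0) k) (t y 0%N y2).
  exact: (rescale_le p4 hx hy (t p 0%N p2) (t w 0%N w2) (t y 1%N y2) (t x 1%N x2) h).
have cxy : (fun n => rmsq (cut_ n 0) k x + rmsq (cut_ n 0) k y) @ \oo --> ramp k x + ramp k y.
  by apply: cvgD; exact: cvg_rmsq_cut.
apply: (cvg_le_bound cxy (e := 2 * (BJ 1 ^+ 2 * ramp k y + BJ 1 ^+ 2 * ramp k x))) => n.
apply: (le_trans (step n)).
have := rmsq_cut0_le n k p2; have := rmsq_cut0_le n k w2; have := rmsq_cutS_le n 0 k y2; have := rmsq_cutS_le n 0 k x2.
exact: errors_le.
Qed.

Definition potential_rel (a : R) (p e : R * R -> R) := forall A B B' B'' b b' b'' k' zeta d, k' = k \/ k' = - k ->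
  cut A B b -> cut A B' b' -> cut A B'' b'' -> (forall y, is_derive y (1 : R) b (b' y)) ->
  (forall y, is_derive y (1 : R) b' (b'' y)) ->
  (k' ^+ 2 + zeta ^+ 2 + a) * pr p b k' zeta d =
  4 * pi * pr e b k' zeta d + pr p b'' k' zeta d + 2 * zeta * pr p b' k' zeta (d + pi / 2).

(** The same scheme as for the velocity: pointwise division by p + a >= 1, integration in zeta,
    removal of the cutoff. The constant is uniform in a. *)
Lemma elliptic_potential a p e : 0 <= a -> L2fun p -> L2fun e -> potential_rel a p e ->
  ramp k p <= 48 * pi ^+ 2 * ramp k e.
Proof.
move=> a0 p2 e2 hp.
have step n : rmsq (cut_ n 0) k p <= 48 * pi ^+ 2 * rmsq (cut_ n 0) k e + 3 * rmsq (cut_ n 2) k p + 12 * rmsq (cut_ n 1) k p.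
  have p4 : 0 < 4 * pi :> R by rewrite mulr_gt0 ?pi_gt0.
  have t f j (f2 : L2fun f) := rwave_total k f2 (cut_bs (cut_cut n j)).
  have hx := etrans (total_shift p (cut_ n 1) k) (t p 1%N p2).
  apply: (rescale_le4 p4 (t p 0%N p2) (t e 0%N e2) (t p 2%N p2) hx).
  apply: total_le_sum4 => k' d hk' hd.
  have ph : phase d by case: hd => ->; [left|right; left].
  have ph' : phase (d + pi / 2) by case: hd => ->; [right; right; left|right; right; right].
  apply: (le_Rintegral_sum4 (ipr n 0 k' p2 ph) (ipr n 0 k' e2 ph) (ipr n 2 k' p2 ph) (ipr n 1 k' p2 ph')) => zeta.
  have h := hp _ _ _ _ _ _ _ k' zeta d hk' (cut_cut n 0) (cut_cut n 1) (cut_cut n 2) (der_cut n 0) (der_cut n 1).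
  exact: (potential_pointwise a0 (kk1 hk') h).
have cp : (fun n => rmsq (cut_ n 0) k p) @ \oo --> ramp k p by exact: cvg_rmsq_cut.
apply: (cvg_le_bound cp (e := 3 * (BJ 2 ^+ 2 * ramp k p) + 12 * (BJ 1 ^+ 2 * ramp k p))) => n.
apply: (le_trans (step n)).
have := rmsq_cut0_le n k e2; have := rmsq_cutS_le n 0 k p2; have := rmsq_cutS_le n 1 k p2.
exact: errors_le4 (sqr_ge0 _).
Qed.

End Elliptic.

End CutoffFamily.

End RealEnergies.

(** * Continuity in time and the moving frame *)

Section TimeContinuity.
Variable R : realType.
Local Notation mu := (@lebesgue_measure R).
Local Notation mR := (measurableTypeR R).
Implicit Types (f : R -> R * R -> R) (g : R * R -> R) (b : R -> R) (A B k zeta d : R).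

(* Fields are composed with [pos] so that continuity in time holds on the whole line. *)
Definition pos (s : R) : R := Order.max s 0.

Lemma pos_ge0 s : 0 <= pos s.
Proof. by rewrite /pos le_max lexx orbT. Qed.

Lemma pos_id s : 0 <= s -> pos s = s.
Proof. by move=> s0; rewrite /pos max_l. Qed.

Lemma continuous_pos : continuous pos.
Proof. by move=> s; apply: continuous_max => //; exact: cvg_cst. Qed.

(** Strong continuity of one mode. For eta, psi and omega it follows from that of the solution; for
    u and phi, from elliptic estimates. *)
Definition tcont k f := (forall t, 0 <= t -> L2fun (f t)) /\
  forall s0 : R, ramp k (f (pos s) - f (pos s0)) @[s --> s0] --> 0.

Lemma cvg_pos (F : R -> R) (s0 l : R) : F s @[s --> within [set s | 0 <= s] (nbhs (pos s0))] --> l ->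
  F (pos s) @[s --> s0] --> l.
Proof.
move=> h; apply: (@cvg_comp _ _ _ pos F _ (within [set s | 0 <= s] (nbhs (pos s0))) _ _ h).
move=> U hU; have h2 : \forall s \near s0, 0 <= pos s -> U (pos s) by exact: (@continuous_pos s0 _ hU).
have h3 : nbhs s0 (pos @^-1` U) by apply: filterS h2 => s hs; exact: hs (pos_ge0 s).
exact: h3.
Qed.

Lemma energy_ge0 g : (0 <= energy g)%E.
Proof. by apply: integral_ge0 => z _; rewrite lee_fin sqr_ge0. Qed.

Lemma L2normE g : measurable_fun setT (g : mR * mR -> mR) -> L2norm g = (energy g `^ 2^-1)%E.
Proof.
move=> mg; rewrite /L2norm unlock /energy; congr (_ `^ _)%E; apply: eq_integral => z _.
by rewrite /= powR_mulrn// -normrX ger0_norm ?sqr_ge0.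
Qed.

Lemma L2norm_fin g : L2fun g -> L2norm g = (Num.sqrt (fine (energy g)))%:E.
Proof.
move=> g2; rewrite (L2normE g2.1); have := L2fun_energy g2; have := energy_ge0 g.
by case: (energy g) => [r| |] // r0 _; rewrite poweR_EFin powR12_sqrt.
Qed.

Lemma ramp_le k g : L2fun g -> ramp k g <= 2 * pi * fine (energy g).
Proof.
move=> g2; have := modesq1_le k g2.1.
have -> : modesq (fun _ => 1) k g = (ramp k g)%:E.
  rewrite /ramp EFin_Rintegral; last exact: integrable_amp.
  by apply: eq_integral => y _; rewrite expr1n mul1r.
by have := L2fun_energy g2; have := energy_ge0 g; case: (energy g) => [r| |] // _ _; rewrite -EFinM lee_fin.
Qed.

Lemma tcont_strong k f : (forall t, 0 <= t -> L2fun (f t)) -> strongly_continuous (@L2norm R) f -> tcont k f.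
Proof.
move=> f2 fc; split=> // s0; apply: (cvg_pos (F := fun s => ramp k (f s - f (pos s0)))).
have /fine_cvgP[_ h] := fc _ (pos_ge0 s0).
have h2 : 2 * pi * (fine (L2norm (f s - f (pos s0))) * fine (L2norm (f s - f (pos s0)))) @[s --> within [set s | 0 <= s] (nbhs (pos s0))] --> 2 * pi * (0 * 0).
  by apply: cvgMr; apply: cvgM; exact: h.
rewrite !mulr0 in h2; apply: (squeeze_cvgr _ (cvg_cst 0) h2).
rewrite near_withinE; near=> s => s0'; rewrite ramp_ge0/=.
have g2 := L2funB (f2 _ s0') (f2 _ (pos_ge0 s0)).
apply: le_trans (ramp_le k g2) _; rewrite (L2norm_fin g2)/= -expr2 sqr_sqrtr//.
by apply: fine_ge0; exact: energy_ge0.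
Unshelve. all: by end_near.
Qed.

Lemma strongly_continuous_le (N1 N2 : (R * R -> R) -> \bar R) f : (forall g, (0 <= N1 g)%E) -> (forall g, (N1 g <= N2 g)%E) ->
  strongly_continuous N2 f -> strongly_continuous N1 f.
Proof.
move=> h0 h12 h t t0; apply: (squeeze_cvge _ (cvg_cst 0%E) (h t t0)).
by near=> s; rewrite h0 h12.
Unshelve. all: by end_near.
Qed.

Lemma L2norm_ge0 g : (0 <= L2norm g)%E.
Proof. exact: Lnorm_ge0. Qed.

Lemma L2norm_grad_ge0 g : (0 <= L2norm_grad g)%E.
Proof. by apply: le_ereal_inf_tmp => _ [gx [gy [_ ->]]]; exact: L2norm_ge0. Qed.

Lemma tcont_le k f p q (C : R) : (forall t, 0 <= t -> L2fun (f t)) -> tcont k p -> tcont k q ->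
  (forall s t, 0 <= s -> 0 <= t -> ramp k (f s - f t) <= C * (ramp k (p s - p t) + ramp k (q s - q t))) -> tcont k f.
Proof.
move=> f2 [_ hp] [_ hq] h; split; [exact: f2|move=> s0].
have h2 : C * (ramp k (p (pos s) - p (pos s0)) + ramp k (q (pos s) - q (pos s0))) @[s --> s0] --> C * (0 + 0).
  by apply: cvgMr; apply: cvgD; [exact: hp|exact: hq].
rewrite addr0 mulr0 in h2; apply: (squeeze_cvgr _ (cvg_cst 0) h2).
by near=> s; rewrite ramp_ge0/= h ?pos_ge0.
Unshelve. all: by end_near.
Qed.

(** First c is fixed, small in terms of e, then u is made small compared with c. *)
Lemma bound_cvg0 (T : Type) (F : set_system T) (FF : Filter F) (u v : T -> R) (C D : R) : 0 <= C -> 0 <= D ->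
  (forall x, 0 <= u x) -> u x @[x --> F] --> 0 ->
  (forall x c, 0 < c -> `|v x| <= C * (2 * D * c + u x / (2 * c))) -> v x @[x --> F] --> 0.
Proof.
move=> C0 D0 u0 uF h; apply/cvgr0Pnorm_le => e e0.
pose c := e / (4 * (C + 1) * (D + 1)).
have c1 : 0 < C + 1 by rewrite ltr_wpDl.
have q0 : 0 < (C + 1) * (D + 1) by rewrite mulr_gt0// ltr_wpDl.
have c0 : 0 < c by rewrite /c divr_gt0// -mulrA mulr_gt0.
have ce : 0 < c * e / (C + 1) by apply: divr_gt0 => //; exact: mulr_gt0.
near=> x.
have ux : u x <= c * e / (C + 1).
  have h1 : `|u x| <= c * e / (C + 1) by near: x; exact: ((cvgr0Pnorm_le _).1 uF _ ce).
  by rewrite (le_trans (ler_norm _)).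
apply: (le_trans (h x c c0)).
have h1 : C * (2 * D * c) <= e / 2.
  have -> : C * (2 * D * c) = e / 2 * ((C * D) / ((C + 1) * (D + 1))).
    by rewrite /c; field; rewrite !gt_eqF// ltr_wpDl.
  rewrite ler_piMr ?divr_ge0 ?(ltW e0)// ler_pdivrMr// mul1r ler_pM// ?lerDl//.
have h2 : C * (u x / (2 * c)) <= e / 2.
  apply: (@le_trans _ _ (C * ((c * e / (C + 1)) / (2 * c)))).
    by apply: ler_wpM2l => //; apply: ler_wpM2r => //; rewrite invr_ge0 mulr_ge0// ltW.
  have -> : C * (c * e / (C + 1) / (2 * c)) = e / 2 * (C / (C + 1)) by field; rewrite !gt_eqF// ltr_wpDl.
  by rewrite ler_piMr ?divr_ge0 ?(ltW e0)// ?ler_pdivrMr ?mul1r ?lerDl// ltr_wpDl.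
by rewrite mulrDr; lra.
Unshelve. all: by end_near.
Qed.

Section Moving.
Variables (k : R) (f : R -> R * R -> R).
Hypothesis fk : tcont k f.

Let f2 t : 0 <= t -> L2fun (f t). Proof. exact: fk.1. Qed.

Lemma cvg_pr_sub A B b d (zeta : R -> R -> R) s0 xi0 : bounded_support A B b ->
  (fun z : R * R => pr (f (pos z.1) - f (pos s0)) b k (zeta z.1 z.2) d) @ ((s0, xi0) : R * R) --> (0 : R).
Proof.
move=> hb; have B0 := bs_bound_ge0 hb; have A0 := bs_ge0 hb.
apply: (@bound_cvg0 _ _ _ (fun z => ramp k (f (pos z.1) - f (pos s0))) _ B A) => //.
- by move=> z; exact: ramp_ge0.
- have h := fk.2 s0; apply: (@cvg_comp _ _ _ fst (fun s => ramp k (f (pos s) - f (pos s0))) _ _ _ _ h).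
  exact: (@cvg_fst _ _ (nbhs s0) (nbhs xi0) _).
- move=> z c c0; apply: pr_le => //; exact: L2funB (f2 (pos_ge0 _)) (f2 (pos_ge0 _)).
Qed.

(** The change of the field in time is small uniformly in the frequency, and at a fixed time the
    pairing is continuous in the frequency. *)
Lemma continuous_moving A B b d : bounded_support A B b ->
  continuous (fun z : R * R => pr (f (pos z.1)) b k (z.2 - k * z.1) d).
Proof.
move=> hb [s0 xi0].
have e : (fun z : R * R => pr (f (pos z.1)) b k (z.2 - k * z.1) d) =
   (fun z => pr (f (pos z.1) - f (pos s0)) b k (z.2 - k * z.1) d + pr (f (pos s0)) b k (z.2 - k * z.1) d).
  by apply/funext => z; rewrite (prB _ _ _ (f2 (pos_ge0 _)) (f2 (pos_ge0 _)) hb) subrK.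
rewrite e /continuous_at /= (prB _ _ _ (f2 (pos_ge0 _)) (f2 (pos_ge0 _)) hb) subrr.
apply: cvgD; first exact: (cvg_pr_sub d (fun s xi => xi - k * s) s0 xi0 hb).
apply: (@cvg_comp _ _ _ (fun z : R * R => z.2 - k * z.1) (fun zeta => pr (f (pos s0)) b k zeta d) _ (nbhs (xi0 - k * s0))).
  by apply: cvgB; [exact: (@cvg_snd _ _ (nbhs s0) (nbhs xi0) _)|apply: cvgMr; exact: (@cvg_fst _ _ (nbhs s0) (nbhs xi0) _)].
have cc := @continuous_pr R (f (pos s0)) A B b k d (f2 (pos_ge0 s0)) hb (xi0 - k * s0).
exact: cc.
Qed.

Let ramp_shift (t : R) : ramp k (f (pos (t + h)) - f (pos t)) @[h --> (0 : R)^'] --> 0.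
Proof.
have ht : t + h @[h --> (0 : R)^'] --> nbhs t.
  have h1 : t + h @[h --> (0 : R)] --> t + 0 by apply: cvgD; [exact: cvg_cst|exact: cvg_id].
  rewrite addr0 in h1; apply: (cvg_trans _ h1); apply: cvg_app; exact: nbhs_dnbhs.
exact: (@cvg_comp _ _ _ (fun h => t + h) (fun s => ramp k (f (pos s) - f (pos t))) _ _ _ ht (fk.2 t)).
Qed.

Lemma cvg_pr_shift A B b d zeta (t : R) : bounded_support A B b ->
  pr (f (pos (t + h))) b k zeta d @[h --> (0 : R)^'] --> pr (f (pos t)) b k zeta d.
Proof.
move=> hb; have B0 := bs_bound_ge0 hb; have A0 := bs_ge0 hb.
have e : (fun h => pr (f (pos (t + h))) b k zeta d) =
    (fun h => pr (f (pos (t + h)) - f (pos t)) b k zeta d + pr (f (pos t)) b k zeta d).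
  by apply/funext => h; rewrite (prB _ _ _ (f2 (pos_ge0 _)) (f2 (pos_ge0 _)) hb) subrK.
rewrite e -[X in _ --> X]add0r; apply: cvgD; last exact: cvg_cst.
apply: (@bound_cvg0 _ _ _ (fun h => ramp k (f (pos (t + h)) - f (pos t))) _ B A) => //.
- by move=> h; exact: ramp_ge0.
- by move=> h c c0; apply: pr_le => //; exact: L2funB (f2 (pos_ge0 _)) (f2 (pos_ge0 _)).
Qed.

Definition pr_rem b d zeta g u := pr g b k (zeta + u) d - pr g b k zeta d - u * pr g (fun y => b y * y) k zeta (d + pi / 2).

Lemma cvg_pr_rem A B b d zeta (t : R) : bounded_support A B b ->
  h^-1 * pr_rem b d zeta (f (pos (t + h))) (- k * h) @[h --> (0 : R)^'] --> 0.
Proof.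
move=> hb; have hb' := bounded_support_id hb; have B0 := bs_bound_ge0 hb; have A0 := bs_ge0 hb.
pose C := B * A ^+ 2; have C0 : 0 <= C by apply: mulr_ge0 (sqr_ge0 _).
pose r := ramp k (f (pos t)).
pose U h := ramp k (f (pos (t + h)) - f (pos t)).
pose bd (h : R) := C * k ^+ 2 * (4 * A + r / 2 + U h / 2) * `|h|.
have hbd : bd h @[h --> (0 : R)^'] --> C * k ^+ 2 * (4 * A + r / 2 + 0 / 2) * `|0 : R|.
  apply: cvgM.
    by apply: cvgMr; apply: cvgD; [exact: cvg_cst|apply: cvgMl; exact: ramp_shift].
  apply: cvg_norm; exact: nbhs_dnbhs.
rewrite normr0 mulr0 in hbd.
apply/cvgr0Pnorm_le => e e0; near=> h.
have h0 : h != 0 by near: h; exact: nbhs_dnbhs_neq.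
apply: (@le_trans _ _ (bd h)); last first.
  rewrite (le_trans (ler_norm _))//; near: h; exact: ((cvgr0Pnorm_le _).1 hbd _ e0).
have L1 := L2funB (f2 (pos_ge0 (t + h))) (f2 (pos_ge0 t)); have L2 := f2 (pos_ge0 t).
have e1 : pr_rem b d zeta (f (pos (t + h))) (- k * h) =
    pr_rem b d zeta (f (pos (t + h)) - f (pos t)) (- k * h) + pr_rem b d zeta (f (pos t)) (- k * h).
  rewrite /pr_rem !(prB _ _ _ (f2 (pos_ge0 (t + h))) L2 hb) !(prB _ _ _ (f2 (pos_ge0 (t + h))) L2 hb').
  move: (pr _ _ _ _ _) (pr _ _ _ _ _) (pr _ _ _ _ _) (pr _ _ _ _ _) (pr _ _ _ _ _) (pr _ _ _ _ _) => *; ring.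
have t1 : `|pr_rem b d zeta (f (pos (t + h)) - f (pos t)) (- k * h)| <= C * (2 * A + U h / 2) * (- k * h) ^+ 2.
  exact: pr_taylor.
have t2 : `|pr_rem b d zeta (f (pos t)) (- k * h)| <= C * (2 * A + r / 2) * (- k * h) ^+ 2 by exact: pr_taylor.
rewrite normrM normfV ler_pdivrMl ?normr_gt0// e1; apply: (le_trans (ler_normD _ _)).
apply: (le_trans (lerD t1 t2)).
have -> : (- k * h) ^+ 2 = k ^+ 2 * `|h| ^+ 2 by rewrite -normrX ger0_norm ?sqr_ge0//; ring.
by rewrite le_eqVlt; apply/orP; left; apply/eqP; rewrite /bd; field.
Unshelve. all: by end_near.
Qed.

Lemma derive_cvg (F : R -> R) (t v : R) : is_derive t (1 : R) F v <->
  h^-1 * (F (t + h) - F t) @[h --> (0 : R)^'] --> v.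
Proof.
have e : (fun h : R => h^-1 *: (F (h *: (1 : R) + t) - F t)) = (fun h => h^-1 * (F (t + h) - F t)).
  by apply/funext => h; rewrite -[h%:A]/(h * 1) mulr1 (addrC h).
split=> [[/cvg_ex[l hl] hv]|hv].
  rewrite e in hl; suff <- : l = v by exact: hl.
  by rewrite -hv /derive e; apply/esym/cvg_lim.
by split; [rewrite /derivable e; exact: (cvgP v hv)|rewrite /derive e; exact: cvg_lim hv].
Qed.

Lemma is_derive_pos (F : R -> R) (t v : R) : 0 < t -> is_derive t (1 : R) (fun s => F (pos s)) v <-> is_derive t (1 : R) F v.
Proof.
move=> t0; have h : \forall s \near t, F (pos s) = F s.
  by near=> s; rewrite pos_id//; apply: ltW; near: s; exact: lt_nbhsr.
split; apply: near_eq_is_derive => //.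
by apply: filterS h => s ->.
Unshelve. all: by end_near.
Qed.

(** The increment splits into the time difference at the fixed frequency, a Taylor remainder in the
    frequency taken at the later time, and the first-order term in the frequency. The remainder is
    o(h) uniformly by [cvg_pr_rem], and strong continuity brings the last term back to time t. *)
Lemma moving_derive A B b xi d (t v : R) : bounded_support A B b -> 0 < t ->
  is_derive t (1 : R) (fun s => pr (f s) b k (xi - k * t) d) v ->
  is_derive t (1 : R) (fun s => pr (f s) b k (xi - k * s) d)
    (v - k * pr (f t) (fun y => b y * y) k (xi - k * t) (d + pi / 2)).
Proof.
move=> hb t0 hv; have t0' := ltW t0; have hb' := bounded_support_id hb.
set z0 := xi - k * t in hv *.
have h1 := (derive_cvg _ _ _).1 ((is_derive_pos (fun s => pr (f s) b k z0 d) v t0).2 hv).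
have h2 := cvg_pr_rem d z0 t hb; have h3 := @cvg_pr_shift _ _ _ (d + pi / 2) z0 t hb'.
have h4 := cvgD (cvgD h1 h2) (cvgMr (a := - k) h3).
rewrite addr0 mulNr (pos_id t0') in h4.
have h5 : (fun h => h^-1 * (pr (f (pos (t + h))) b k z0 d - pr (f (pos t)) b k z0 d) +
    h^-1 * pr_rem b d z0 (f (pos (t + h))) (- k * h) +
    (- k) * pr (f (pos (t + h))) (fun y => b y * y) k z0 (d + pi / 2)) @ (0 : R)^' -->
    v - k * pr (f t) (fun y => b y * y) k z0 (d + pi / 2).
  rewrite (pos_id t0'); exact: h4.
apply: (is_derive_pos (fun s => pr (f s) b k (xi - k * s) d) _ t0).1; apply: (derive_cvg _ _ _).2.
apply: (cvg_trans _ h5); apply: near_eq_cvg; near=> h.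
have h0 : h != 0 by near: h; exact: nbhs_dnbhs_neq.
have th : 0 <= t + h.
  have ht : `|h| < t by near: h; exact: dnbhs0_lt.
  by move: ht; rewrite ltr_norml => /andP[? _]; lra.
have -> : xi - k * pos (t + h) = z0 + - k * h by rewrite (pos_id th) /z0; ring.
rewrite (pos_id t0') -/z0 /= /pr_rem.
move: (pr _ _ _ _ _) (pr _ _ _ _ _) (pr _ _ _ _ _) (pr _ _ _ _ _) => p1 p2 p3 p4.
by field.
Unshelve. all: by end_near.
Qed.

End Moving.

End TimeContinuity.

(** * Time primitives integrated over the frequency *)

Section TimeIntegrals.
Variable R : realType.
Local Notation mu := (@lebesgue_measure R).
Local Notation mR := (measurableTypeR R).

Lemma cvg_pair_at (X : Type) (N : set_system X) (FN : Filter N) (F G : X -> R) (a b : R) : F z @[z --> N] --> a -> G z @[z --> N] --> b ->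
  (fun z => (F z, G z)) @ N --> ((a, b) : R * R).
Proof. exact: cvg_pair. Qed.

(** Freezing the first variable at multiples of 1 / (m + 1) gives functions measurable for the
    product structure, their preimages being countable unions of strips; they converge pointwise by
    continuity. *)
Lemma continuous2_measurable (g : R * R -> R) : continuous g -> measurable_fun setT (g : mR * mR -> mR).
Proof.
move=> cg; pose h (m : nat) (z : R * R) := g ((Num.floor (m.+1%:R * z.1))%:~R / m.+1%:R, z.2).
apply: (@measurable_fun_cvg _ _ R setT h) => [m|z _].
- move=> _ Y mY; rewrite setTI.
  have -> : h m @^-1` Y = \bigcup_(j : int) (`[j%:~R / m.+1%:R, (j + 1)%:~R / m.+1%:R[%classic `*`
      ((fun xi : R => g (j%:~R / m.+1%:R, xi)) @^-1` Y)).
    have m0 : 0 < m.+1%:R :> R by [].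
    apply/seteqP; split=> -[s xi] /=.
      move=> hY; exists (Num.floor (m.+1%:R * s)) => //=; split=> //=.
      by rewrite in_itv /= ler_pdivrMr// ltr_pdivlMr// !(mulrC s) floor_le floorD1_gt.
    move=> [j _ /= [+ hY]]; rewrite in_itv /= ler_pdivrMr// ltr_pdivlMr// !(mulrC s) => /andP[h1 h2].
    by rewrite /h /= (_ : Num.floor _ = j)//; apply: floor_def; rewrite h1.
  apply: countable_bigcupT_measurable => [|j]; first exact: countableP.
  apply: measurableX; first exact: measurable_itv.
  have cj : continuous (fun xi : R => g (j%:~R / m.+1%:R, xi)).
    move=> xi; apply: (@cvg_comp _ _ _ (fun xi => (j%:~R / m.+1%:R, xi)) g _ _ _ _ (cg _)).
    by apply: cvg_pair_at; [exact: cvg_cst|exact: cvg_id].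
  by have := continuous_measurable_fun cj measurableT mY; rewrite setTI.
case: z => s xi; rewrite /h /=.
apply: (@cvg_comp _ _ _ (fun n : nat => ((Num.floor (n.+1%:R * s))%:~R / n.+1%:R, xi)) g _ _ _ _ (cg (s, xi))).
apply: cvg_pair_at; last exact: cvg_cst.
have lo : (s - n.+1%:R^-1) @[n --> \oo] --> s.
  rewrite -[X in _ --> X]subr0; apply: cvgB; [exact: cvg_cst|exact: cvg_harmonic].
apply: (squeeze_cvgr _ lo (cvg_cst s)); near=> n.
have n0 : 0 < n.+1%:R :> R by [].
rewrite ler_pdivlMr// ler_pdivrMr// mulrBl mulVf ?gt_eqF// !(mulrC s) floor_le andbT.
by rewrite lerBlDr -(intrD _ _ 1) ltW// floorD1_gt.
Unshelve. all: by end_near.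
Qed.

Lemma cont_slice' (g : R * R -> R) (xi : R) : continuous g -> continuous (fun s => g (s, xi)).
Proof.
move=> cg s; apply: (@cvg_comp _ _ _ (fun s => (s, xi)) g _ _ _ _ (cg _)).
by apply: cvg_pair_at; [exact: cvg_id|exact: cvg_cst].
Qed.

Section Primitive.
Variables (q : R -> R) (T : R).
Hypothesis cq : continuous q.

Lemma integrable_segment : mu.-integrable `[0, T] (EFin \o q).
Proof. by apply: continuous_compact_integrable; [exact: segment_compact|exact: continuous_subspaceT]. Qed.

Definition primitive (t : R) : R := \int[mu]_(s in `[0, t]) q s.

Lemma primitive0 : primitive 0 = 0.
Proof. by rewrite /primitive set_itv1 Rintegral_set1. Qed.

Lemma primitive_derive (t : R) : 0 < t -> t < T -> is_derive t (1 : R) primitive (q t).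
Proof.
move=> t0 tT; have ct : {for t, continuous q} := @cq t.
have [d e] := @continuous_FTC1_closed _ q 0 t T tT integrable_segment t0 ct.
by split; [exact: d|rewrite -derive1E; exact: e].
Qed.

Lemma primitive_continuous : 0 <= T -> {within `[0, T], continuous primitive}.
Proof. move=> T0; exact: (parameterized_integral_continuous T0 integrable_segment). Qed.

End Primitive.

(** Tonelli exchanges time and frequency, so a bound at each time becomes a bound of the time
    integral with the factor T. *)
Lemma integral_primitive (Q : R * R -> R) (T C : R) : 0 <= T -> continuous Q -> (forall z, 0 <= Q z) ->
  (forall s, 0 <= s <= T -> (\int[mu]_xi (Q (s, xi))%:E <= C%:E)%E) ->
  mu.-integrable setT (EFin \o (fun xi => primitive (fun s => Q (s, xi)) T)) /\
  \int[mu]_xi primitive (fun s => Q (s, xi)) T <= C * T.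
Proof.
move=> T0 cQ Q0 h.
pose F (z : mR * mR) : \bar R := ((\1_(`[0, T]%classic : set mR) z.1)%:E * (Q z)%:E)%E.
have mQ := continuous2_measurable cQ.
have mF : measurable_fun setT F.
  apply/measurable_EFinP; apply: measurable_funM => //.
  have m1 : measurable_fun setT (\1_(`[0, T]%classic : set mR) : mR -> mR) by exact: measurable_indic.
  exact: (measurableT_comp m1 measurable_fst).
have F0 z : (0 <= F z)%E by rewrite /F -EFinM lee_fin mulr_ge0 ?Q0// indicE ler0n.
have e xi : ((primitive (fun s => Q (s, xi)) T)%:E = \int[mu]_s F (s, xi))%E.
  rewrite /primitive /Rintegral fineK; last first.
    have i := integrable_segment T (@cont_slice' Q xi cQ).
    by apply: integrable_fin_num => //; exact: i.
  rewrite integral_mkcond; apply: eq_integral => s _; rewrite /F patchE /= indicE.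
  by case: (s \in _); rewrite ?mul1e ?mul0e.
have bd : (\int[mu]_xi (primitive (fun s => Q (s, xi)) T)%:E <= (C * T)%:E)%E.
  have -> : (\int[mu]_xi (primitive (fun s => Q (s, xi)) T)%:E = \int[mu]_s \int[mu]_xi F (s, xi))%E.
    transitivity (\int[mu]_xi \int[mu]_s F (s, xi))%E; first by apply: eq_integral => xi _; exact: e.
    rewrite -(fubini_tonelli2 (m1 := mu) (m2 := mu) _ mF F0).
    exact: (fubini_tonelli1 (m1 := mu) (m2 := mu) _ mF F0).
  have C0 : 0 <= C.
    by rewrite -lee_fin; apply: le_trans (h 0 _); [apply: integral_ge0 => xi _; rewrite lee_fin|rewrite lexx].
  apply: (@le_trans _ _ (\int[mu]_s ((\1_(`[0, T]%classic : set mR) s)%:E * C%:E))%E).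
    apply: ge0_le_integral => //.
    - by move=> s _; apply: integral_ge0 => xi _; exact: F0.
    - exact: (measurable_fun_fubini_tonelli_F (m2 := mu) _ mF F0).
    - by apply/measurable_EFinP; apply: measurable_funM => //; exact: measurable_indic.
    move=> s _; rewrite /F indicE; have [sT|sT] := boolP (s \in `[0, T]%classic).
      rewrite mul1e; under eq_integral do rewrite mul1e.
      by apply: h; move: sT; rewrite inE /= in_itv.
    by rewrite mul0e; under eq_integral do rewrite mul0e; rewrite integral0.
  rewrite ge0_integralZr//; last by apply/measurable_EFinP; exact: measurable_indic.
  have hI : (\int[mu]_x (\1_(`[0, T]%classic : set mR) x)%:E = T%:E)%E.
    rewrite integral_indic// setIT; transitivity (if (0 < T)%R then T%:E else 0 : \bar R)%E.
      by have := lebesgue_measure_itv `[0, T]; rewrite /= lte_fin oppr0 adde0.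
    by case: ltP => // T0'; congr (_%:E); apply/eqP; rewrite eq_le T0 T0'.
  by rewrite hI muleC -EFinM.
have mp : measurable_fun setT (fun xi : mR => primitive (fun s => Q (s, xi)) T : mR).
  apply/measurable_EFinP; apply: (eq_measurable_fun (fun xi => \int[mu]_s F (s, xi))%E).
    by move=> xi _; rewrite -e.
  exact: (measurable_fun_fubini_tonelli_G (m1 := mu) _ mF F0).
have p0 xi : 0 <= primitive (fun s => Q (s, xi)) T by apply: Rintegral_ge0 => s _.
have ip := ge0_fin_integrable mp p0 (le_lt_trans bd (ltry _)).
by split => //; rewrite -lee_fin (EFin_Rintegral ip).
Qed.

End TimeIntegrals.

Section Boundedness.
Variable R : realType.
Local Notation mu := (@lebesgue_measure R).
Variables (bj : nat -> R -> R) (BJ : nat -> R).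
Hypotheses (b0 : bj 0%N = @bump R) (sb : forall j, smooth1 (bj j))
  (db : forall j y, is_derive y (1 : R) (bj j) (bj j.+1 y)) (hB : forall j y, `|bj j y| <= BJ j).
Local Notation cut_ n j := (cut_ bj n j).
Let cut_bs n j := cut_bs (cut_cut b0 sb db hB n j).

Lemma phase0 d : d = 0 \/ d = pi / 2 -> @phase R d.
Proof. by case=> ->; [left|right; left]. Qed.

Lemma phase1 d : d = 0 \/ d = pi / 2 -> @phase R (d + pi / 2).
Proof. by case=> ->; [right; right; left|right; right; right]. Qed.

(** Modes are additive only on slices of finite energy, while pairings with packets are additive for
    all L2 fields. The inequality is therefore proved for pairings and transferred by opening the
    cutoff. *)
Lemma ramp_leD (k : R) (f g : R * R -> R) : L2fun f -> L2fun g -> ramp k f <= 2 * ramp k (f - g) + 2 * ramp k g.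
Proof.
move=> f2 g2; have h2 := L2funB f2 g2.
have step n : rmsq (cut_ n 0) k f <= 2 * rmsq (cut_ n 0) k (f - g) + 2 * rmsq (cut_ n 0) k g + 0 * rmsq (cut_ n 0) k g.
  have p4 : 0 < 4 * pi :> R by rewrite mulr_gt0 ?pi_gt0.
  have t u (u2 : L2fun u) := rwave_total k u2 (cut_bs n 0).
  apply: (rescale_le4 p4 (t _ f2) (t _ h2) (t _ g2) (t _ g2)).
  apply: total_le_sum4 => k' d hk' hd; have ph := phase0 hd.
  have i u (u2 : L2fun u) := integrable_pr_sqr k' u2 (cut_bs n 0) ph.
  apply: (le_Rintegral_sum4 (i _ f2) (i _ h2) (i _ g2) (i _ g2)) => z.
  rewrite (prB k' z d f2 g2 (cut_bs n 0)); move: (pr f _ _ _ _) (pr g _ _ _ _) => a b.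
  by have := sqr_ge0 (a - 2 * b); nra.
have cf := cvg_rmsq_cut b0 sb db hB f2 (k := k).
apply: (@cvg_le_bound R (fun n => rmsq (cut_ n 0) k f) _ _ 0 cf) => n; rewrite mul0r addr0; apply: (le_trans (step n)).
have := rmsq_cut0_le b0 sb db hB n k h2; have := rmsq_cut0_le b0 sb db hB n k g2.
by move: (rmsq _ k g) (rmsq _ k (f - g)) (ramp k (f - g)) (ramp k g) => a b c d; rewrite mul0r addr0; lra.
Qed.

(** Small increments make the energy of the mode locally bounded, and compactness of [0, T] makes
    the bound uniform. *)
Lemma tcont_bounded (k T : R) f : tcont k f -> exists2 C, 0 <= C & forall s, 0 <= s <= T -> ramp k (f (pos s)) <= C.
Proof.
move=> [f2 fc]; have cK : compact `[0, T]%classic by exact: segment_compact.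
have nc : \forall M \near (+oo : set_system R), `[0, T]%classic `<=` (fun s => ramp k (f (pos s)) <= M).
  apply: ((compact_near_coveringP _).1 cK R (+oo : set_system R) (fun M s => ramp k (f (pos s)) <= M)) => s0 _.
  have h1 : \forall s \near s0, ramp k (f (pos s) - f (pos s0)) <= 1.
    near=> s; apply: (le_trans (ler_norm _)); near: s; exact: ((cvgr0Pnorm_le _).1 (fc s0) 1 ltr01).
  have h2 : \forall M \near +oo, 2 * 1 + 2 * ramp k (f (pos s0)) <= M by exact: nbhs_pinfty_ge (num_real _).
  exists ([set s | ramp k (f (pos s) - f (pos s0)) <= 1], [set M | 2 * 1 + 2 * ramp k (f (pos s0)) <= M]); first by split.
  move=> -[s M] [/= hs hM]; apply: le_trans hM; apply: (le_trans (ramp_leD k (f2 _ (pos_ge0 s)) (f2 _ (pos_ge0 s0)))).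
  by rewrite lerD2r ler_wpM2l.
have [M [M0 hM]] : exists M, 0 <= M /\ (`[0, T]%classic `<=` (fun s => ramp k (f (pos s)) <= M)).
  near (+oo : set_system R) => M; exists M; split; near: M => //; exact: nbhs_pinfty_ge (num_real _).
exists M => // s hs; apply: hM; by rewrite /= in_itv.
Unshelve. all: by end_near.
Qed.

Lemma rwave_le (k k' d : R) f n j : L2fun f -> k' = k \/ k' = - k -> phase d ->
  rwave f (cut_ n j) k' d <= 4 * pi * rmsq (cut_ n j) k f.
Proof.
move=> f2 hk' hd; rewrite -(rwave_total k f2 (cut_bs n j)) /total.
have r0 k'' d' := rwave_ge0 f (cut_ n j) k'' d'.
have e k'' : rwave f (cut_ n j) k'' (pi / 2 + pi / 2) = rwave f (cut_ n j) k'' 0.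
  by have := rwave_shift f (cut_ n j) k'' 0; rewrite add0r.
have := r0 k 0; have := r0 k (pi / 2); have := r0 (- k) 0; have := r0 (- k) (pi / 2).
have key (a b c e' x : R) : x = a \/ x = b \/ x = c \/ x = e' -> 0 <= e' -> 0 <= c -> 0 <= b -> 0 <= a -> x <= a + b + c + e'.
  by case=> [->|[->|[->|->]]]; lra.
move=> h4 h3 h2 h1; apply: key h4 h3 h2 h1.
have hx : rwave f (cut_ n j) k' d = rwave f (cut_ n j) k' 0 \/ rwave f (cut_ n j) k' d = rwave f (cut_ n j) k' (pi / 2).
  by case: hd => [->|[->|[->|->]]]; [left|right|right; rewrite add0r|left; exact: e].
by case: hk' hx => -> [->|->]; [left|right; left|right; right; left|right; right; right].
Qed.

Lemma rwave_cutS_le (k k' d : R) f n j (C : R) : L2fun f -> k' = k \/ k' = - k -> phase d -> ramp k f <= C ->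
  rwave f (cut_ n j.+1) k' d <= 4 * pi * (BJ j.+1 ^+ 2 * C) / n.+1%:R.
Proof.
move=> f2 hk' hd hC; apply: (le_trans (rwave_le n j.+1 f2 hk' hd)).
have p4 : 0 <= 4 * pi :> R by rewrite mulr_ge0 ?pi_ge0.
rewrite -(mulrA (4 * pi)); apply: ler_wpM2l => //; apply: (le_trans (rmsq_cutS_le b0 sb db hB n j k f2)).
by apply: ler_wpM2r => //; apply: ler_wpM2l; rewrite ?sqr_ge0.
Qed.

End Boundedness.

(** * The mode equations *)

Section FieldContinuity.
Variables (R : realType) (sp : species) (nu lambda M : R).
Variables (eta ux uy phi psi omega : R -> R * R -> R).
Hypothesis sol : is_solution sp nu lambda M eta ux uy phi psi omega.
Variables (bj : nat -> R -> R) (BJ : nat -> R).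
Hypotheses (b0 : bj 0%N = @bump R) (sb : forall j, smooth1 (bj j))
  (db : forall j y, is_derive y (1 : R) (bj j) (bj j.+1 y)) (hB : forall j y, `|bj j y| <= BJ j).
Variables (k : R) (hk : integer_mode k) (k1 : 1 <= `|k|).

Local Notation X := (fun t => nonzero_modes (ux t)).
Local Notation Y := (fun t => nonzero_modes (uy t)).
Local Notation P := (potential sp phi).

Lemma integer_modeN (l : R) : integer_mode l -> integer_mode (- l).
Proof. by move=> [[s c] l0]; split; [rewrite /mode2pi mulrN sinN cosN s oppr0|rewrite oppr_eq0]. Qed.

Lemma integer_mode_pm (l : R) : l = k \/ l = - k -> integer_mode l.
Proof. by case=> ->; [|exact: integer_modeN]. Qed.

Lemma tcont_eta l : tcont l eta.
Proof.
apply: (tcont_strong l (sol_eta_L2 sol)).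
refine (@strongly_continuous_le _ _ (fun f => L2norm f + L2norm_grad f)%E _ _ _ (sol_eta_continuous sol)) => g.
  exact: L2norm_ge0.
by rewrite leeDl// L2norm_grad_ge0.
Qed.

Lemma tcont_psi l : tcont l psi.
Proof. exact: tcont_strong (sol_psi_L2 sol) (sol_psi_continuous sol). Qed.

Lemma tcont_omega l : tcont l omega.
Proof. exact: tcont_strong (sol_omega_L2 sol) (sol_omega_continuous sol). Qed.

Let X2 t (t0 : 0 <= t) := sol_ux_L2 sol t0.
Let Y2 t (t0 : 0 <= t) := sol_uy_L2 sol t0.

Lemma velocity_diff_le s t : 0 <= s -> 0 <= t -> ramp k (X s - X t) + ramp k (Y s - Y t) <=
  2 * (ramp k (psi s - psi t) + ramp k (omega s - omega t)).
Proof.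
move=> s0 t0; have p2 u (u0 : 0 <= u) := sol_psi_L2 sol u0; have w2 u (u0 : 0 <= u) := sol_omega_L2 sol u0.
apply: (elliptic_velocity b0 sb db hB k1 (L2funB (p2 _ s0) (p2 _ t0)) (L2funB (w2 _ s0) (w2 _ t0)) (L2funB (X2 s0) (X2 t0)) (L2funB (Y2 s0) (Y2 t0))).
- move=> A B B' b b' k' zeta d hk' cb cb' dbb; have hm := integer_mode_pm hk'.
  rewrite (prB _ _ _ (p2 _ s0) (p2 _ t0) (cut_bs cb)) (prB _ _ _ (X2 s0) (X2 t0) (cut_bs cb)).
  rewrite (prB _ _ _ (Y2 s0) (Y2 t0) (cut_bs cb')) (prB _ _ _ (Y2 s0) (Y2 t0) (cut_bs cb)).
  rewrite (mode_div sol hm cb cb' dbb zeta d s0) (mode_div sol hm cb cb' dbb zeta d t0).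
  move: (pr (X s) _ _ _ _) (pr (X t) _ _ _ _) (pr (Y s) _ _ _ _) (pr (Y t) _ _ _ _) (pr (Y s) b' _ _ _) (pr (Y t) b' _ _ _) => q1 q2 q3 q4 q5 q6; ring.
- move=> A B B' b b' k' zeta d hk' cb cb' dbb; have hm := integer_mode_pm hk'.
  rewrite (prB _ _ _ (w2 _ s0) (w2 _ t0) (cut_bs cb)) (prB _ _ _ (Y2 s0) (Y2 t0) (cut_bs cb)).
  rewrite (prB _ _ _ (X2 s0) (X2 t0) (cut_bs cb')) (prB _ _ _ (X2 s0) (X2 t0) (cut_bs cb)).
  rewrite (mode_curl sol hm cb cb' dbb zeta d s0) (mode_curl sol hm cb cb' dbb zeta d t0).
  move: (pr (Y s) _ _ _ _) (pr (Y t) _ _ _ _) (pr (X s) _ _ _ _) (pr (X t) _ _ _ _) (pr (X s) b' _ _ _) (pr (X t) b' _ _ _) => q1 q2 q3 q4 q5 q6; ring.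
Qed.

Lemma tcont_ux : tcont k X.
Proof.
apply: (tcont_le (C := 2) (fun t t0 => X2 t0) (tcont_psi k) (tcont_omega k)) => s t s0 t0.
by apply: le_trans (velocity_diff_le s0 t0); rewrite lerDl ramp_ge0.
Qed.

Lemma tcont_uy : tcont k Y.
Proof.
apply: (tcont_le (C := 2) (fun t t0 => Y2 t0) (tcont_psi k) (tcont_omega k)) => s t s0 t0.
by apply: le_trans (velocity_diff_le s0 t0); rewrite lerDr ramp_ge0.
Qed.

Lemma tcont_potential : tcont k P.
Proof.
have e2 u (u0 : 0 <= u) := sol_eta_L2 sol u0; have p2 u (u0 : 0 <= u) := sol_potential_L2 sol u0.
apply: (tcont_le (C := 48 * pi ^+ 2) p2 (tcont_eta k) (tcont_eta k)) => s t s0 t0.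
have h : ramp k (P s - P t) <= 48 * pi ^+ 2 * ramp k (eta s - eta t).
  case esp : sp; last first.
    have -> : potential electron phi s - potential electron phi t = fun _ => 0 by apply/funext => z; rewrite /potential -[LHS]/(0 - 0 : R) subrr.
    have -> : ramp k (fun _ => 0) = 0 :> R.
      have -> : ramp k (fun _ => 0) = \int[@lebesgue_measure R]_y 0.
        apply: eq_Rintegral => y _; rewrite /amp /mode.
        have h0 (h : R -> R) : \int[@torus R]_x (0 * h (k * x)) = 0.
          have -> : (fun x => 0 * h (k * x)) = (fun _ => 0) by apply/funext => x; rewrite mul0r.
          by rewrite Rintegral_torus_cst mulr0.
        by rewrite !h0 expr0n addr0.
      by rewrite Rintegral_cst// mul0r.
    by apply: mulr_ge0 (ramp_ge0 _ _); rewrite mulr_ge0 ?sqr_ge0.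
  rewrite -esp; have a0 : 0 <= 4 * pi * M ^+ 2 by rewrite mulr_ge0 ?sqr_ge0// mulr_ge0 ?pi_ge0.
  apply: (elliptic_potential b0 sb db hB k1 a0 (L2funB (p2 _ s0) (p2 _ t0)) (L2funB (e2 _ s0) (e2 _ t0))).
  move=> A B B' B'' b b' b'' k' zeta d hk' cb cb' cb'' dbb dbb'; have hm := integer_mode_pm hk'.
  have := mode_potential sol hm cb cb' cb'' dbb dbb' zeta d esp s0.
  have := mode_potential sol hm cb cb' cb'' dbb dbb' zeta d esp t0.
  rewrite (prB _ _ _ (p2 _ s0) (p2 _ t0) (cut_bs cb)) (prB _ _ _ (p2 _ s0) (p2 _ t0) (cut_bs cb')).
  rewrite (prB _ _ _ (p2 _ s0) (p2 _ t0) (cut_bs cb'')) (prB _ _ _ (e2 _ s0) (e2 _ t0) (cut_bs cb)).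
  move: (pr (P s) b _ _ _) (pr (P t) b _ _ _) (pr (eta s) _ _ _ _) (pr (eta t) _ _ _ _) (pr (P s) b' _ _ _) (pr (P t) b' _ _ _) (pr (P s) b'' _ _ _) (pr (P t) b'' _ _ _) => q1 q2 q3 q4 q5 q6 q7 q8 h1 h2.
  by rewrite mulrBr h1 h2; ring.
apply: (le_trans h); apply: ler_wpM2l; first by rewrite mulr_ge0 ?sqr_ge0.
by rewrite lerDl ramp_ge0.
Qed.

End FieldContinuity.

(** * Algebra of the mode equations *)

Section ModeAlgebra.
Variable R : realType.

(** The mode of psi is written through u, so that its derivative comes from the momentum equations.
    The last term [k * H t] is due to the moving factor xi - k s. *)
Lemma der_psi_combination (F G H : R -> R) (k xi t f g h : R) :
  is_derive t (1 : R) F f -> is_derive t (1 : R) G g -> is_derive t (1 : R) H h ->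
  is_derive t (1 : R) (fun s => - k * F s - G s - (xi - k * s) * H s) (- k * f - g - (xi - k * t) * h + k * H t).
Proof. by move=> hF hG hH; der; ring. Qed.

Lemma der_omega_combination (F G H : R -> R) (k xi t f g h : R) :
  is_derive t (1 : R) F f -> is_derive t (1 : R) G g -> is_derive t (1 : R) H h ->
  is_derive t (1 : R) (fun s => G s + (xi - k * s) * F s - k * H s) (g + (xi - k * t) * f - k * F t - k * h).
Proof. by move=> hF hG hH; der; ring. Qed.

(** A digit in a name counts the derivatives on the cutoff: digit 0 belongs to the equation of the
    mode, the others to the error. The shear contributes 2 k Y0, and p Y0 = - z s0 - k w0 + k X1 - z
    Y1 expresses it by psi and omega up to terms with one derivative on the cutoff. *)
Lemma psi_algebra sp (k z nu lam M X0 X1 X2 Y0 Y1 Y2 Y3 e0 e1 e2 f0 f1 f2 P0 P1 P2 s0 s1 s2 w0 : R) :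
  0 < M -> k != 0 ->
  let p := k ^+ 2 + z ^+ 2 in let a := screening sp M in let fs := field_sign R sp in let m := (M ^+ 2)^-1 in
  s0 = - k * X0 - Y1 - z * Y0 -> w0 = X1 + z * X0 - k * Y0 ->
  s1 = k * X1 - Y2 + z * Y1 -> s2 = - k * X2 - Y3 - z * Y2 ->
  - p * f0 + f2 + 2 * z * f1 = match sp with ion => 4 * pi * (M ^+ 2 * P0 - e0) | electron => 4 * pi * e0 end ->
  (sp = ion -> (p + 4 * pi * M ^+ 2) * P0 = 4 * pi * e0 + P2 + 2 * z * P1) ->
  - k * (- Y0 + m * (k * (- e0)) + fs * (k * (- f0)) + nu * (- p * X0 + X2 + 2 * z * (- X1)) - lam * (k * (- s0)))
  - (m * (e2 + z * e1) + fs * (f2 + z * f1) + nu * (- p * Y1 + Y3 + 2 * z * Y2) - lam * (s2 + z * s1))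
  - z * (m * (e1 + z * (- e0)) + fs * (f1 + z * (- f0)) + nu * (- p * Y0 + Y2 + 2 * z * (- Y1)) - lam * (s1 + z * (- s0)))
  + k * Y0 =
  - (2 * k * z / p) * s0 - 2 * k ^+ 2 / p * w0 + kappa sp M p * p / M ^+ 2 * e0 - (nu + lam) * p * s0
  + ((2 * k / p * k * X1 + - (2 * k / p * z) * Y1 + - m * e2 + (nu + lam) * s2 + - (a / (p + a)) * P2)
     + z * (- (2 * m) * e1 + 2 * (nu + lam) * s1 + - (2 * (a / (p + a))) * P1)).
Proof.
move=> M0 k0 p a fs m hs0 hw0 hs1 hs2 hf hP.
have p0 : 0 < p by rewrite /p ltr_wpDr ?sqr_ge0// exprn_even_gt0.
have pi0 := pi_gt0 R; have M2 : 0 < M ^+ 2 by exact: exprn_gt0.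
have pa : p + 4 * pi * M ^+ 2 != 0 by rewrite gt_eqF// addr_gt0// !mulr_gt0.
have pn : p != 0 by rewrite gt_eqF.
have Mn : M != 0 by rewrite gt_eqF.
(* The force enters only through - p f0 + f2 + 2 z f1, the Laplacian of phi, which Poisson's
   equation replaces. *)
have -> : f2 = match sp with ion => 4 * pi * (M ^+ 2 * P0 - e0) | electron => 4 * pi * e0 end + p * f0 - 2 * z * f1.
  by rewrite -hf; ring.
rewrite /a /m /fs /kappa /screening /field_sign; case: sp hf hP {a m fs} => hf hP.
  (* For ions the Laplacian contains phi again; solving for it produces the screened factor of
     [kappa] and errors from [P1] and [P2]. *)
  have -> : P0 = (4 * pi * e0 + P2 + 2 * z * P1) / (p + 4 * pi * M ^+ 2) by rewrite -(hP erefl) mulrC mulKf.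
  rewrite hs0 hw0 hs1 hs2; move: pa pn; rewrite /p; move: (pi : R) => q pa pn; field.
  by rewrite pa pn Mn.
by rewrite hs0 hw0 hs1 hs2; move: pn; rewrite /p !addr0; move: (pi : R) => q pn; field; rewrite pn Mn.
Qed.

(** Pressure, electric force and bulk viscosity are gradients and cancel exactly in the curl. Errors
    come only from the viscosity, and psi appears through the background shear. *)
Lemma omega_algebra (fs m k z nu lam X0 X1 X2 X3 Y0 Y1 Y2 e0 e1 f0 f1 s0 s1 w0 w1 w2 : R) :
  let p := k ^+ 2 + z ^+ 2 in
  s0 = - k * X0 - Y1 - z * Y0 -> w0 = X1 + z * X0 - k * Y0 ->
  w1 = X2 - z * X1 + k * Y1 -> w2 = X3 + z * X2 - k * Y2 ->
  (- Y1 + m * (k * e1) + fs * (k * f1) + nu * (- p * X1 + X3 + 2 * z * X2) - lam * (k * s1))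
  + z * (- Y0 + m * (k * (- e0)) + fs * (k * (- f0)) + nu * (- p * X0 + X2 + 2 * z * (- X1)) - lam * (k * (- s0)))
  - k * X0
  - k * (m * (e1 + z * (- e0)) + fs * (f1 + z * (- f0)) + nu * (- p * Y0 + Y2 + 2 * z * (- Y1)) - lam * (s1 + z * (- s0))) =
  s0 - nu * p * w0 + (nu * w2 + z * (2 * nu * w1)).
Proof. by move=> p -> -> -> ->; rewrite /p; ring. Qed.

Lemma sqr_sum3_le (c c1 c2 c3 a1 a2 a3 : R) : `|c1| <= c -> `|c2| <= c -> `|c3| <= c ->
  (c1 * a1 + c2 * a2 + c3 * a3) ^+ 2 <= 5 * c ^+ 2 * (a1 ^+ 2 + a2 ^+ 2 + a3 ^+ 2).
Proof.
have h (u v : R) : `|u| <= c -> (u * v) ^+ 2 <= c ^+ 2 * v ^+ 2.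
  by move=> uc; rewrite exprMn ler_wpM2r ?sqr_ge0// -(ger0_norm (sqr_ge0 u)) normrX lerXn2r ?nnegrE// (le_trans _ uc).
move=> h1 h2 h3; have := h _ a1 h1; have := h _ a2 h2; have := h _ a3 h3.
rewrite -mulrA !mulrDr; move: (c ^+ 2 * _) (c ^+ 2 * _) (c ^+ 2 * _) (c1 * a1) (c2 * a2) (c3 * a3) => A B C u v w *.
by have := sqr_ge0 (u - v); have := sqr_ge0 (u - w); have := sqr_ge0 (v - w); have := sqr_ge0 u; have := sqr_ge0 v; have := sqr_ge0 w; nra.
Qed.

Lemma sqr_sum5_le (c c1 c2 c3 c4 c5 a1 a2 a3 a4 a5 : R) : `|c1| <= c -> `|c2| <= c -> `|c3| <= c -> `|c4| <= c -> `|c5| <= c ->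
  (c1 * a1 + c2 * a2 + c3 * a3 + c4 * a4 + c5 * a5) ^+ 2 <= 5 * c ^+ 2 * (a1 ^+ 2 + a2 ^+ 2 + a3 ^+ 2 + a4 ^+ 2 + a5 ^+ 2).
Proof.
have h (u v : R) : `|u| <= c -> (u * v) ^+ 2 <= c ^+ 2 * v ^+ 2.
  by move=> uc; rewrite exprMn ler_wpM2r ?sqr_ge0// -(ger0_norm (sqr_ge0 u)) normrX lerXn2r ?nnegrE// (le_trans _ uc).
move=> h1 h2 h3 h4 h5; have := h _ a1 h1; have := h _ a2 h2; have := h _ a3 h3; have := h _ a4 h4; have := h _ a5 h5.
rewrite -mulrA !mulrDr; move: (c ^+ 2 * _) (c ^+ 2 * _) (c ^+ 2 * _) (c ^+ 2 * _) (c ^+ 2 * _) (c1 * a1) (c2 * a2) (c3 * a3) (c4 * a4) (c5 * a5).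
move=> A B C D E u v w x y i1 i2 i3 i4 i5.
have key : (u + v + w + x + y) ^+ 2 + ((u - v) ^+ 2 + (u - w) ^+ 2 + (u - x) ^+ 2 + (u - y) ^+ 2 + (v - w) ^+ 2 + (v - x) ^+ 2
   + (v - y) ^+ 2 + (w - x) ^+ 2 + (w - y) ^+ 2 + (x - y) ^+ 2) = 5 * (u ^+ 2 + v ^+ 2 + w ^+ 2 + x ^+ 2 + y ^+ 2) by ring.
have k0 : 0 <= (u - v) ^+ 2 + (u - w) ^+ 2 + (u - x) ^+ 2 + (u - y) ^+ 2 + (v - w) ^+ 2 + (v - x) ^+ 2
   + (v - y) ^+ 2 + (w - x) ^+ 2 + (w - y) ^+ 2 + (x - y) ^+ 2 by rewrite !addr_ge0 ?sqr_ge0.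
by move: key k0; lra.
Qed.

Definition error_bound (nu lam M : R) : R := 2 + 2 * (M ^+ 2)^-1 + 2 * (nu + lam) + 2 * nu.

(** Every coefficient is bounded by [error_bound] uniformly in z; in particular |2 k z| <= p and a /
    (p + a) <= 1. The factor 5 is Cauchy-Schwarz for the longest sum. *)
Lemma mode_errors_le sp (k z nu lam M X1 Y1 e1 e2 P1 P2 s1 s2 w1 w2 : R) : 0 < M -> k != 0 -> 0 <= nu -> 0 <= lam ->
  forall p a m, p = k ^+ 2 + z ^+ 2 -> a = screening sp M -> m = (M ^+ 2)^-1 ->
  (2 * k / p * k * X1 + - (2 * k / p * z) * Y1 + - m * e2 + (nu + lam) * s2 + - (a / (p + a)) * P2) ^+ 2
  + (- (2 * m) * e1 + 2 * (nu + lam) * s1 + - (2 * (a / (p + a))) * P1) ^+ 2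
  + (nu * w2) ^+ 2 + (2 * nu * w1) ^+ 2 <=
  5 * error_bound nu lam M ^+ 2 * (X1 ^+ 2 + Y1 ^+ 2 + e2 ^+ 2 + s2 ^+ 2 + P2 ^+ 2 + (e1 ^+ 2 + s1 ^+ 2 + P1 ^+ 2) + w2 ^+ 2 + w1 ^+ 2).
Proof.
move=> M0 k0 nu0 lam0 p a m pE aE mE; set c := error_bound nu lam M.
have m0 : 0 <= m by rewrite mE invr_ge0 sqr_ge0.
have a0 : 0 <= a by rewrite aE /screening; case: (sp) => //; rewrite mulr_ge0 ?sqr_ge0// mulr_ge0 ?pi_ge0.
have p0 : 0 < p by rewrite pE ltr_wpDr ?sqr_ge0// exprn_even_gt0.
have pa : 0 < p + a by rewrite ltr_wpDr.
have q0 : 0 <= a / (p + a) by rewrite divr_ge0// ltW.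
have q1 : a / (p + a) <= 1 by rewrite ler_pdivrMr// mul1r lerDr ltW.
have c2 : 2 <= c by rewrite /c /error_bound -mE; lra.
have cm : 2 * m <= c by rewrite /c /error_bound -mE; lra.
have cs : 2 * (nu + lam) <= c by rewrite /c /error_bound -mE; lra.
have cn : 2 * nu <= c by rewrite /c /error_bound -mE; lra.
have n1 : `|2 * k / p * k| <= c.
  apply: le_trans c2; have -> : 2 * k / p * k = 2 * (k ^+ 2 / p) by ring.
  rewrite ger0_norm; last by apply: mulr_ge0 => //; apply: divr_ge0 (sqr_ge0 _) (ltW p0).
  by rewrite ler_piMr// ler_pdivrMr// mul1r pE lerDl sqr_ge0.
have n2 : `|- (2 * k / p * z)| <= c.
  apply: le_trans c2; rewrite normrN; have -> : 2 * k / p * z = (2 * (k * z)) / p by ring.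
  rewrite normrM normfV (gtr0_norm p0) ler_pdivrMr// ler_norml pE.
  by have := sqr_ge0 (k - z); have := sqr_ge0 (k + z); have := sqr_ge0 k; have := sqr_ge0 z; rewrite sqrrB sqrrD -(mulr_natr _ 2); move=> *; apply/andP; split; lra.
have n3 : `|- m| <= c by rewrite normrN ger0_norm//; lra.
have n4 : `|nu + lam| <= c by rewrite ger0_norm ?addr_ge0//; lra.
have n5 : `|- (a / (p + a))| <= c by rewrite normrN ger0_norm//; lra.
have n6 : `|- (2 * m)| <= c by rewrite normrN ger0_norm ?mulr_ge0.
have n7 : `|2 * (nu + lam)| <= c by rewrite ger0_norm ?mulr_ge0 ?addr_ge0.
have n8 : `|- (2 * (a / (p + a)))| <= c by rewrite normrN ger0_norm; [lra|exact: mulr_ge0].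
have n9 : `|nu| <= c by rewrite ger0_norm//; lra.
have n10 : `|2 * nu| <= c by rewrite ger0_norm ?mulr_ge0.
have z0 : `|0 : R| <= c by rewrite normr0; lra.
have h3 (u v : R) : `|u| <= c -> (u * v) ^+ 2 <= 5 * c ^+ 2 * v ^+ 2.
  by move=> uc; have := sqr_sum3_le v 0 0 uc uc uc; rewrite !mulr0 !addr0 expr0n !addr0.
have i1 := sqr_sum5_le X1 Y1 e2 s2 P2 n1 n2 n3 n4 n5; have i2 := sqr_sum3_le e1 s1 P1 n6 n7 n8.
have i3 := h3 _ w2 n9; have i4 := h3 _ w1 n10.
by rewrite !(mulrDr (5 * c ^+ 2) (_ + _ + _ + _ + _ + (_ + _ + _) + _)) !(mulrDr (5 * c ^+ 2) (_ + _ + _ + _ + _ + (_ + _ + _))) (mulrDr (5 * c ^+ 2) (_ + _ + _ + _ + _)) !lerD.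
Qed.

End ModeAlgebra.

Section ModeODE.
Variables (R : realType) (sp : species) (nu lambda M : R).
Variables (eta ux uy phi psi omega : R -> R * R -> R).
Hypothesis sol : is_solution sp nu lambda M eta ux uy phi psi omega.
Variables (bj : nat -> R -> R) (BJ : nat -> R).
Hypotheses (b0 : bj 0%N = @bump R) (sb : forall j, smooth1 (bj j))
  (db : forall j y, is_derive y (1 : R) (bj j) (bj j.+1 y)) (hB : forall j y, `|bj j y| <= BJ j).
Variables (k : R) (hk : integer_mode k) (k1 : 1 <= `|k|) (M0 : 0 < M).

Local Notation X := (fun t => nonzero_modes (ux t)).
Local Notation Y := (fun t => nonzero_modes (uy t)).
Local Notation P := (potential sp phi).
Variables (n : nat).
Local Notation c j := (cut_ bj n j).
Let cc j := cut_cut b0 sb db hB n j.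
Let dc j y : is_derive y (1 : R) (c j) (c j.+1 y) := der_cut db n j y.

Let tX := tcont_ux sol b0 sb db hB hk k1.
Let tY := tcont_uy sol b0 sb db hB hk k1.

Section Moving.
Variables (t xi : R) (t0 : 0 < t).
Local Notation z := (xi - k * t).
Local Notation m := ((M ^+ 2)^-1).
Local Notation fs := (field_sign R sp).

Let cancel_transport (q p' : R) : q - p' - q = - p'. Proof. ring. Qed.

Lemma moving_eta j d : is_derive t (1 : R) (fun s => pr (eta s) (c j) k (xi - k * s) d) (- pr (psi t) (c j) k z d).
Proof.
have h := moving_derive (tcont_eta sol k) (cut_bs (cc j)) t0 (mode_dt_eta sol hk (cc j) z d t0).
by apply: (derE h); exact: cancel_transport.
Qed.

Let cancel_ux (q u a b c0 e : R) : q - u + a + b + c0 - e - q = - u + a + b + c0 - e. Proof. ring. Qed.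
Let cancel_uy (q a b c0 e : R) : q + a + b + c0 - e - q = a + b + c0 - e. Proof. ring. Qed.

Lemma moving_ux j d : is_derive t (1 : R) (fun s => pr (X s) (c j) k (xi - k * s) d)
  (- pr (Y t) (c j) k z d + m * (k * pr (eta t) (c j) k z (d + pi / 2)) + fs * (k * pr (phi t) (c j) k z (d + pi / 2))
   + nu * lap_pr (X t) (c j) (c j.+1) (c j.+2) k z d - lambda * (k * pr (psi t) (c j) k z (d + pi / 2))).
Proof.
have h := moving_derive tX (cut_bs (cc j)) t0 (mode_dt_ux sol hk (cc j) (cc j.+1) (cc j.+2) (dc j) (dc j.+1) z d t0).
by apply: (derE h); exact: cancel_ux.
Qed.

Lemma moving_uy j d : is_derive t (1 : R) (fun s => pr (Y s) (c j) k (xi - k * s) d)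
  (m * (pr (eta t) (c j.+1) k z d + z * pr (eta t) (c j) k z (d + pi / 2))
   + fs * (pr (phi t) (c j.+1) k z d + z * pr (phi t) (c j) k z (d + pi / 2))
   + nu * lap_pr (Y t) (c j) (c j.+1) (c j.+2) k z d
   - lambda * (pr (psi t) (c j.+1) k z d + z * pr (psi t) (c j) k z (d + pi / 2))).
Proof.
have h := moving_derive tY (cut_bs (cc j)) t0 (mode_dt_uy sol hk (cc j) (cc j.+1) (cc j.+2) (dc j) (dc j.+1) z d t0).
by apply: (derE h); exact: cancel_uy.
Qed.

Let nearby (F G : R -> R) v : (forall s, 0 <= s -> F s = G s) -> is_derive t (1 : R) F v -> is_derive t (1 : R) G v.
Proof.
move=> e; apply: near_eq_is_derive; near=> s; apply: e; apply: ltW; near: s; exact: lt_nbhsr.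
Unshelve. all: by end_near.
Qed.

Let sh f j d : pr f (c j) k z (d + pi / 2 + pi / 2) = - pr f (c j) k z d := pr_shift_pi f (c j) k z d.

Definition err1 (t xi d : R) : R := let p := k ^+ 2 + (xi - k * t) ^+ 2 in
  2 * k / p * k * pr (X t) (c 1) k (xi - k * t) d + - (2 * k / p * (xi - k * t)) * pr (Y t) (c 1) k (xi - k * t) d
  + - (M ^+ 2)^-1 * pr (eta t) (c 2) k (xi - k * t) d + (nu + lambda) * pr (psi t) (c 2) k (xi - k * t) d
  + - (screening sp M / (p + screening sp M)) * pr (P t) (c 2) k (xi - k * t) d.

Definition err2 (t xi d : R) : R := let p := k ^+ 2 + (xi - k * t) ^+ 2 in
  - (2 * (M ^+ 2)^-1) * pr (eta t) (c 1) k (xi - k * t) (d + pi / 2)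
  + 2 * (nu + lambda) * pr (psi t) (c 1) k (xi - k * t) (d + pi / 2)
  + - (2 * (screening sp M / (p + screening sp M))) * pr (P t) (c 1) k (xi - k * t) (d + pi / 2).

Let k0 : k != 0 := hk.2.

Lemma moving_psi d : is_derive t (1 : R) (fun s => pr (psi s) (c 0) k (xi - k * s) d)
  (- (2 * k * z / (k ^+ 2 + z ^+ 2)) * pr (psi t) (c 0) k z d - 2 * k ^+ 2 / (k ^+ 2 + z ^+ 2) * pr (omega t) (c 0) k z d
   + kappa sp M (k ^+ 2 + z ^+ 2) * (k ^+ 2 + z ^+ 2) / M ^+ 2 * pr (eta t) (c 0) k z d
   - (nu + lambda) * (k ^+ 2 + z ^+ 2) * pr (psi t) (c 0) k z d + (err1 t xi d + z * err2 t xi d)).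
Proof.
have t0' := ltW t0.
apply: (nearby (F := fun s => - k * pr (X s) (c 0) k (xi - k * s) (d + pi / 2) - pr (Y s) (c 1) k (xi - k * s) d
    - (xi - k * s) * pr (Y s) (c 0) k (xi - k * s) (d + pi / 2))).
  by move=> s s0; exact/esym/(mode_div sol hk (cc 0) (cc 1) (dc 0) _ _ s0).
have h := der_psi_combination k xi (moving_ux 0 (d + pi / 2)) (moving_uy 1 d) (moving_uy 0 (d + pi / 2)).
apply: (derE h); rewrite /lap_pr !(sh (eta t)) !(sh (phi t)) !(sh (psi t)) !(sh (X t)) !(sh (Y t)).
have hs0 := mode_div sol hk (cc 0) (cc 1) (dc 0) z d t0'.
have hs1 := mode_div sol hk (cc 1) (cc 2) (dc 1) z (d + pi / 2) t0'.
have hs2 := mode_div sol hk (cc 2) (cc 3) (dc 2) z d t0'.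
have hw0 := mode_curl sol hk (cc 0) (cc 1) (dc 0) z d t0'.
have hf := mode_lap_phi sol hk (cc 0) (cc 1) (cc 2) (dc 0) (dc 1) z d t0'.
have hP : sp = ion -> _ := fun e => mode_potential sol hk (cc 0) (cc 1) (cc 2) (dc 0) (dc 1) z d e t0'.
rewrite (sh (X t)) (sh (Y t)) in hs1.
have hs1' : pr (psi t) (c 1) k z (d + pi / 2) = k * pr (X t) (c 1) k z d - pr (Y t) (c 2) k z (d + pi / 2) + z * pr (Y t) (c 1) k z d.
  by rewrite hs1; move: (pr (X t) _ _ _ _) (pr (Y t) (c 1) _ _ _) (pr (Y t) (c 2) _ _ _) => *; ring.
exact: (psi_algebra nu lambda _ _ M0 k0 hs0 hw0 hs1' hs2 hf hP).
Qed.

Lemma moving_omega d : is_derive t (1 : R) (fun s => pr (omega s) (c 0) k (xi - k * s) d)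
  (pr (psi t) (c 0) k z d - nu * (k ^+ 2 + z ^+ 2) * pr (omega t) (c 0) k z d
   + (nu * pr (omega t) (c 2) k z d + z * (2 * nu * pr (omega t) (c 1) k z (d + pi / 2)))).
Proof.
have t0' := ltW t0.
apply: (nearby (F := fun s => pr (X s) (c 1) k (xi - k * s) d + (xi - k * s) * pr (X s) (c 0) k (xi - k * s) (d + pi / 2)
    - k * pr (Y s) (c 0) k (xi - k * s) (d + pi / 2))).
  by move=> s s0; exact/esym/(mode_curl sol hk (cc 0) (cc 1) (dc 0) _ _ s0).
have h := der_omega_combination k xi (moving_ux 0 (d + pi / 2)) (moving_ux 1 d) (moving_uy 0 (d + pi / 2)).
apply: (derE h); rewrite /lap_pr !(sh (eta t)) !(sh (phi t)) !(sh (psi t)) !(sh (X t)) !(sh (Y t)).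
have hs0 := mode_div sol hk (cc 0) (cc 1) (dc 0) z d t0'.
have hw0 := mode_curl sol hk (cc 0) (cc 1) (dc 0) z d t0'.
have hw1 := mode_curl sol hk (cc 1) (cc 2) (dc 1) z (d + pi / 2) t0'.
have hw2 := mode_curl sol hk (cc 2) (cc 3) (dc 2) z d t0'.
rewrite (sh (X t)) (sh (Y t)) in hw1.
have hw1' : pr (omega t) (c 1) k z (d + pi / 2) = pr (X t) (c 2) k z (d + pi / 2) - z * pr (X t) (c 1) k z d + k * pr (Y t) (c 1) k z d.
  by rewrite hw1; move: (pr (Y t) _ _ _ _) (pr (X t) (c 1) _ _ _) (pr (X t) (c 2) _ _ _) => *; ring.
exact: (omega_algebra fs m nu lambda _ _ _ _ _ hs0 hw0 hw1' hw2).
Qed.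

End Moving.

(** Time is composed with [pos] in the frequency as well, so that the function is continuous on the
    whole plane. *)
Definition wave (F : R -> R * R -> R) j e (z : R * R) : R := pr (F (pos z.1)) (c j) k (z.2 - k * pos z.1) e.

Lemma continuous_wave F j e : tcont k F -> continuous (wave F j e).
Proof.
move=> tF z; have cm := continuous_moving tF (d := e) (cut_bs (cc j)).
have h : (fun y : R * R => (pos y.1, y.2)) @ nbhs z --> ((pos z.1, z.2) : R * R).
  case: z => s xi; apply: (@cvg_pair_at R _ _ _ (fun y : R * R => pos y.1) (fun y => y.2)); last exact: (@cvg_snd _ _ (nbhs s) (nbhs xi) _).
  apply: (@cvg_comp _ _ _ fst (@pos R) _ (nbhs s)); [exact: (@cvg_fst _ _ (nbhs s) (nbhs xi) _)|exact: continuous_pos].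
have := cvg_comp _ _ h (cm (pos z.1, z.2)).
rewrite /wave /= (pos_id (pos_ge0 _)).
have -> : ((fun z0 : R * R => pr (F (pos z0.1)) (c j) k (z0.2 - k * z0.1) e) \o (fun y : R * R => (pos y.1, y.2))) = wave F j e.
  by apply/funext => y /=; rewrite /wave (pos_id (pos_ge0 _)).
exact.
Qed.

(** A majorant of the four squared errors that is jointly continuous, hence has a primitive in time
    and can be integrated in (s, xi). *)
Definition forcing d (z : R * R) : R := 5 * error_bound nu lambda M ^+ 2 *
  (wave X 1 d z ^+ 2 + wave Y 1 d z ^+ 2 + wave eta 2 d z ^+ 2 + wave psi 2 d z ^+ 2 + wave P 2 d z ^+ 2
   + (wave eta 1 (d + pi / 2) z ^+ 2 + wave psi 1 (d + pi / 2) z ^+ 2 + wave P 1 (d + pi / 2) z ^+ 2)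
   + wave omega 2 d z ^+ 2 + wave omega 1 (d + pi / 2) z ^+ 2).

Let c2 : 0 <= 5 * error_bound nu lambda M ^+ 2. Proof. by apply: mulr_ge0 (sqr_ge0 _). Qed.

Lemma forcing_ge0 d z : 0 <= forcing d z.
Proof. by apply: mulr_ge0 c2 _; rewrite !addr_ge0 ?sqr_ge0. Qed.

Let tP := tcont_potential sol b0 sb db hB hk k1.

Lemma continuous_forcing d : continuous (forcing d).
Proof.
have tE := tcont_eta sol k; have tS := tcont_psi sol k; have tW := tcont_omega sol k.
have h F j e : tcont k F -> forall z, wave F j e y ^+ 2 @[y --> z] --> wave F j e z ^+ 2.
  by move=> tF z; rewrite expr2; under eq_fun do rewrite expr2; apply: cvgM; exact: continuous_wave.
move=> z; rewrite /continuous_at /forcing; apply: cvgMr.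
apply: cvgD; last exact: h. apply: cvgD; last exact: h.
apply: cvgD; last by apply: cvgD; [apply: cvgD; exact: h|exact: h].
by apply: cvgD; last exact: h; apply: cvgD; last exact: h; apply: cvgD; last exact: h; apply: cvgD; exact: h.
Qed.

Definition mode_energy t xi d : R := pr (psi t) (c 0) k (xi - k * t) d ^+ 2
  + (k ^+ 2 + (xi - k * t) ^+ 2) * pr (eta t) (c 0) k (xi - k * t) d ^+ 2 / M ^+ 2 + pr (omega t) (c 0) k (xi - k * t) d ^+ 2.

Section Decay.
Variable r : R.
Hypotheses (r0 : 0 < r) (r1 : r <= 1) (nuE : nu = r ^+ 3) (lam0 : 0 <= lambda) (sgM : (nu + lambda) * M ^+ 2 <= 1)
  (nuM : 16 * nu * M ^+ 2 <= nu + lambda) (sg_half : nu + lambda <= 2^-1).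
Variables (T xi d : R) (T0 : 0 <= T).

Let N s := wave eta 0 d (s, xi).
Let Psi s := wave psi 0 d (s, xi).
Let Om s := wave omega 0 d (s, xi).
Let D := primitive (fun s => forcing d (s, xi)).
Let e1 s := err1 (pos s) xi d.
Let e2 s := err2 (pos s) xi d.
Let e3 s := nu * wave omega 2 d (s, xi).
Let e4 s := 2 * nu * wave omega 1 (d + pi / 2) (s, xi).
Let nu0 : 0 <= nu. Proof. by rewrite nuE exprn_ge0// ltW. Qed.
Let k0 : k != 0 := hk.2.

Let nusg : nu <= nu + lambda. Proof. by rewrite lerDl. Qed.

Let wcont F j e : tcont k F -> {within `[0, T], continuous (fun s => wave F j e (s, xi))}.
Proof. by move=> tF; apply: continuous_subspaceT; apply: cont_slice'; exact: continuous_wave. Qed.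

Let NE t : 0 <= t -> N t = pr (eta t) (c 0) k (xi - k * t) d.
Proof. by move=> t0; rewrite /N /wave /= (pos_id t0). Qed.
Let PsiE t : 0 <= t -> Psi t = pr (psi t) (c 0) k (xi - k * t) d.
Proof. by move=> t0; rewrite /Psi /wave /= (pos_id t0). Qed.
Let OmE t : 0 <= t -> Om t = pr (omega t) (c 0) k (xi - k * t) d.
Proof. by move=> t0; rewrite /Om /wave /= (pos_id t0). Qed.

Let dN (t : R) : 0 < t -> is_derive t (1 : R) N (- Psi t).
Proof.
move=> t0; rewrite (PsiE (ltW t0)).
exact: ((is_derive_pos (fun s => pr (eta s) (c 0) k (xi - k * s) d) _ t0).2 (moving_eta xi t0 0 d)).
Qed.

Let dPsi (t : R) : 0 < t -> is_derive t (1 : R) Psi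
  (- (2 * k * (xi - k * t) / (k ^+ 2 + (xi - k * t) ^+ 2)) * Psi t - 2 * k ^+ 2 / (k ^+ 2 + (xi - k * t) ^+ 2) * Om t
   + kappa sp M (k ^+ 2 + (xi - k * t) ^+ 2) * (k ^+ 2 + (xi - k * t) ^+ 2) / M ^+ 2 * N t
   - (nu + lambda) * (k ^+ 2 + (xi - k * t) ^+ 2) * Psi t + (e1 t + (xi - k * t) * e2 t)).
Proof.
move=> t0; rewrite (NE (ltW t0)) (OmE (ltW t0)) (PsiE (ltW t0)) /e1 /e2 (pos_id (ltW t0)).
exact: ((is_derive_pos (fun s => pr (psi s) (c 0) k (xi - k * s) d) _ t0).2 (moving_psi xi t0 d)).
Qed.

Let dOm (t : R) : 0 < t -> is_derive t (1 : R) Om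
  (Psi t - nu * (k ^+ 2 + (xi - k * t) ^+ 2) * Om t + (e3 t + (xi - k * t) * e4 t)).
Proof.
move=> t0; rewrite (PsiE (ltW t0)) (OmE (ltW t0)) /e3 /e4 /wave /= (pos_id (ltW t0)).
exact: ((is_derive_pos (fun s => pr (omega s) (c 0) k (xi - k * s) d) _ t0).2 (moving_omega xi t0 d)).
Qed.

Let eQ t : e1 t ^+ 2 + e2 t ^+ 2 + e3 t ^+ 2 + e4 t ^+ 2 <= forcing d (t, xi).
Proof. exact: (mode_errors_le _ _ _ _ _ _ _ _ _ _ M0 k0 nu0 lam0 erefl erefl erefl). Qed.

Let cf : continuous (fun s => forcing d (s, xi)) := @cont_slice' _ _ xi (@continuous_forcing d).
Let cD : {within `[0, T], continuous D} := primitive_continuous cf T0.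
Let dD (t : R) : 0 < t -> t < T -> is_derive t (1 : R) D (forcing d (t, xi)).
Proof. exact: primitive_derive. Qed.

Let energy_pos t : 0 <= t -> Psi t ^+ 2 + (k ^+ 2 + (xi - k * t) ^+ 2) * N t ^+ 2 / M ^+ 2 + Om t ^+ 2 = mode_energy t xi d.
Proof. by move=> t0; rewrite (PsiE t0) (NE t0) (OmE t0). Qed.

Lemma mode_energy_decay : mode_energy T xi d <= mode_const M * expR (3 / 2 * ln (2 + 2 * T ^+ 2)) *
  (expR (- (r * T / 12)) * mode_energy 0 xi d + error_factor nu (nu + lambda) M * D T).
Proof.
have := mode_decay r0 r1 nuE nusg M0 sgM nuM sg_half k1 T0 dN dPsi dOm (wcont (tcont_eta sol k)) (wcont (tcont_psi sol k)) (wcont (tcont_omega sol k)) cD (primitive0 _) dD eQ.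
by cbv beta; rewrite (energy_pos T0) (energy_pos (lexx 0)).
Qed.

Lemma mode_energy_decay_div : mode_energy T xi d / (k ^+ 2 + (xi - k * T) ^+ 2) <= mode_const M * expR (2^-1 * ln (2 + 2 * T ^+ 2)) *
  (expR (- (r * T / 12)) * mode_energy 0 xi d + error_factor nu (nu + lambda) M * D T).
Proof.
have := mode_decay_div r0 r1 nuE nusg M0 sgM nuM sg_half k1 T0 dN dPsi dOm (wcont (tcont_eta sol k)) (wcont (tcont_psi sol k)) (wcont (tcont_omega sol k)) cD (primitive0 _) dD eQ.
by cbv beta; rewrite (energy_pos T0) (energy_pos (lexx 0)).
Qed.

End Decay.

End ModeODE.

(** * Integrated mode estimates *)

Section IntegralSums.
Variables (d : measure_display) (T : measurableType d) (R : realType) (m : {measure set T -> \bar R}).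

Lemma integral_sum_le (s : seq (T -> R)) (e : R) :
  foldr (fun f Q => (m.-integrable setT (EFin \o f) /\ \int[m]_x f x <= e) /\ Q) True s ->
  m.-integrable setT (EFin \o (fun x => foldr (fun f a => f x + a) 0 s)) /\
  \int[m]_x foldr (fun f a => f x + a) 0 s <= (size s)%:R * e.
Proof.
elim: s => [|f s IH] /=.
  by move=> _; split; [exact: integrable0|rewrite mul0r /Rintegral integral0].
move=> [[fi fe] /IH[si se]]; split; first exact: integrableRD.
by rewrite (RintegralD measurableT fi si) -natr1 mulrDl mul1r addrC lerD.
Qed.

Lemma le_Rintegral_mode (u1 u2 u3 u4 v1 v2 v3 v4 e : T -> R) (a K b : R) :
  m.-integrable setT (EFin \o u1) -> m.-integrable setT (EFin \o u2) -> m.-integrable setT (EFin \o u3) ->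
  m.-integrable setT (EFin \o u4) -> m.-integrable setT (EFin \o v1) -> m.-integrable setT (EFin \o v2) ->
  m.-integrable setT (EFin \o v3) -> m.-integrable setT (EFin \o v4) -> m.-integrable setT (EFin \o e) ->
  (forall x, u1 x + a * (u2 x + u3 x) + u4 x <= K * (v1 x + b * (v2 x + v3 x) + v4 x) + e x) ->
  \int[m]_x u1 x + a * (\int[m]_x u2 x + \int[m]_x u3 x) + \int[m]_x u4 x <=
  K * (\int[m]_x v1 x + b * (\int[m]_x v2 x + \int[m]_x v3 x) + \int[m]_x v4 x) + \int[m]_x e x.
Proof.
move=> i1 i2 i3 i4 j1 j2 j3 j4 ie h.
have i23 := integrableRD i2 i3; have j23 := integrableRD j2 j3.
have ia := integrableRZ a i23; have jb := integrableRZ b j23.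
have i5 := integrableRD i1 ia; have i6 := integrableRD i5 i4.
have j5 := integrableRD j1 jb; have j6 := integrableRD j5 j4; have jK := integrableRZ K j6.
rewrite -(RintegralD measurableT i2 i3) -(RintegralD measurableT j2 j3) -(RintegralZl a measurableT i23) -(RintegralZl b measurableT j23).
rewrite -(RintegralD measurableT i1 ia) -(RintegralD measurableT i5 i4) -(RintegralD measurableT j1 jb) -(RintegralD measurableT j5 j4).
rewrite -(RintegralZl K measurableT j6) -(RintegralD measurableT jK ie).
by apply: le_Rintegral => //; exact: integrableRD jK ie.
Qed.

End IntegralSums.

Section ShiftedWaves.
Variable R : realType.
Local Notation mu := (@lebesgue_measure R).
Local Notation mR := (measurableTypeR R).

Lemma integral_pr_sqr_shift (f : R * R -> R) (A B : R) b (k d c : R) : L2fun f -> bounded_support A B b -> phase d ->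
  mu.-integrable setT (EFin \o (fun xi => pr f b k (xi - c) d ^+ 2)) /\
  \int[mu]_xi (pr f b k (xi - c) d ^+ 2) = rwave f b k d.
Proof.
move=> f2 hb hd; have i := integrable_pr_sqr k f2 hb hd.
have cp := @continuous_pr R f A B b k d f2 hb.
have mp : measurable_fun setT (fun z : mR => pr f b k z d ^+ 2 : mR).
  by apply: measurable_funX; exact: continuous_measurable_fun cp.
have ms : measurable_fun setT (fun z : mR => pr f b k (z - c) d ^+ 2 : mR).
  apply: (measurableT_comp mp); apply: continuous_measurable_fun => z; dcont.
have e : (\int[mu]_xi (pr f b k (xi - c) d ^+ 2)%:E = \int[mu]_xi (pr f b k xi d ^+ 2)%:E)%E.
  apply: (ge0_integral_shift (f := fun xi => (pr f b k xi d ^+ 2)%:E) (- c)); first exact/measurable_EFinP.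
  by move=> z; rewrite lee_fin sqr_ge0.
split; last by rewrite /rwave /Rintegral e.
apply: (ge0_fin_integrable ms (fun z => sqr_ge0 _)).
by rewrite e -(EFin_Rintegral i) ltry.
Qed.

Definition grad_rel k (f gx gy : R * R -> R) := forall A B B' b b' k' zeta d, k' = k \/ k' = - k ->
  cut A B b -> cut A B' b' -> (forall y, is_derive y (1 : R) b (b' y)) ->
  pr gx b k' zeta d = - (k' * pr f b k' zeta (d + pi / 2)) /\
  pr gy b k' zeta d = - (pr f b' k' zeta d + zeta * pr f b k' zeta (d + pi / 2)).

Lemma weak_grad_rel k f gx gy : integer_mode k -> locint f -> weak_grad f gx gy -> grad_rel k f gx gy.
Proof.
move=> hk lf [_ _ hx hy] A B B' b b' k' zeta d hk' cb cb' dbb.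
have tw := test_wavepacket zeta d (integer_mode_pm hk hk').1 cb.
split.
  by rewrite -(distr_pdx cb k' zeta d lf); exact/esym/(hx _ tw).
by rewrite -(distr_pdy cb cb' dbb k' zeta d lf); exact/esym/(hy _ tw).
Qed.

Lemma grad_rel_congr k f f' gx gy : (forall A B b k' zeta d, k' = k \/ k' = - k -> bounded_support A B b -> pr f b k' zeta d = pr f' b k' zeta d) ->
  grad_rel k f gx gy -> grad_rel k f' gx gy.
Proof.
move=> e h A B B' b b' k' zeta d hk' cb cb' dbb; have [h1 h2] := h _ _ _ _ _ k' zeta d hk' cb cb' dbb.
rewrite -(e _ _ _ k' zeta (d + pi / 2) hk' (cut_bs cb)) -(e _ _ _ k' zeta d hk' (cut_bs cb')).
by split; [exact: h1|exact: h2].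
Qed.

(** Up to the cutoff term q1, p |N|^2 is |grad eta|^2. The first inequality serves the final time,
    the second the initial time. *)
Lemma grad_bounds (k z q q1 gx gy : R) : gx = k * q -> gy = z * q - q1 ->
  2^-1 * (gx ^+ 2 + gy ^+ 2) <= (k ^+ 2 + z ^+ 2) * q ^+ 2 + q1 ^+ 2 /\
  (k ^+ 2 + z ^+ 2) * q ^+ 2 <= 2 * (gx ^+ 2 + gy ^+ 2) + 2 * q1 ^+ 2.
Proof.
move=> -> ->.
have e : (k ^+ 2 + z ^+ 2) * q ^+ 2 = (k * q) ^+ 2 + (z * q) ^+ 2 by ring.
rewrite e; move: (k * q) (z * q) => u v; have := sqr_ge0 (q1 + v); have := sqr_ge0 (v - 2 * q1); have := sqr_ge0 u; have := sqr_ge0 q1.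
have := sqr_ge0 (v - q1).
by move=> *; split; nra.
Qed.

End ShiftedWaves.

Section ForcingIntegral.
Variables (R : realType) (sp : species) (nu lambda M : R).
Variables (eta ux uy phi psi omega : R -> R * R -> R).
Hypothesis sol : is_solution sp nu lambda M eta ux uy phi psi omega.
Variables (bj : nat -> R -> R) (BJ : nat -> R).
Hypotheses (b0 : bj 0%N = @bump R) (sb : forall j, smooth1 (bj j))
  (db : forall j y, is_derive y (1 : R) (bj j) (bj j.+1 y)) (hB : forall j y, `|bj j y| <= BJ j).
Variables (k : R) (hk : integer_mode k) (k1 : 1 <= `|k|).
Local Notation mu := (@lebesgue_measure R).
Local Notation X := (fun t => nonzero_modes (ux t)).
Local Notation Y := (fun t => nonzero_modes (uy t)).
Local Notation P := (potential sp phi).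
Let cbs n j := cut_bs (cut_cut b0 sb db hB n j).

Lemma wave_integral F n j e (s C : R) : tcont k F -> phase e -> (j = 0 \/ j = 1)%N -> ramp k (F (pos s)) <= C ->
  mu.-integrable setT (EFin \o (fun xi => wave bj k n F j.+1 e (s, xi) ^+ 2)) /\
  \int[mu]_xi wave bj k n F j.+1 e (s, xi) ^+ 2 <= 4 * pi * ((BJ 1 ^+ 2 + BJ 2 ^+ 2) * C) / n.+1%:R.
Proof.
move=> tF he hj hC; have F2 := tF.1 _ (pos_ge0 s).
have [i ie] := integral_pr_sqr_shift k (k * pos s) F2 (cbs n j.+1) he.
split; first exact: i.
rewrite ie; apply: (le_trans (rwave_cutS_le b0 sb db hB n j F2 (or_introl erefl) he hC)).
have C0 : 0 <= C by exact: le_trans (ramp_ge0 k (F (pos s))) hC.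
have key (a a' m : R) : 0 <= m -> a <= a' -> 4 * pi * (a * C) * m <= 4 * pi * (a' * C) * m.
  move=> m0 aa; apply: ler_wpM2r; first exact: m0.
  apply: ler_wpM2l; first by rewrite mulr_ge0 ?pi_ge0.
  by apply: ler_wpM2r; [exact: C0|exact: aa].
have n0 : 0 <= n.+1%:R^-1 :> R by rewrite invr_ge0.
apply: (key _ _ _ n0); case: hj => ->; first by rewrite lerDl sqr_ge0.
by rewrite lerDr sqr_ge0.
Qed.

(** Each term of the forcing carries a derivative of the cutoff and a field whose mode is bounded on
    [0, T]; ten such terms are added. *)
Lemma forcing_integral (T d : R) : 0 <= T -> d = 0 \/ d = pi / 2 -> exists2 E, 0 <= E & forall n s, 0 <= s <= T ->
  (\int[mu]_xi (forcing sp nu lambda M eta ux uy phi psi omega bj k n d (s, xi))%:E <= (E / n.+1%:R)%:E)%E.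
Proof.
move=> T0 hd.
have tX := tcont_ux sol b0 sb db hB hk k1; have tY := tcont_uy sol b0 sb db hB hk k1.
have tP := tcont_potential sol b0 sb db hB hk k1.
have tE := tcont_eta sol k; have tS := tcont_psi sol k; have tW := tcont_omega sol k.
have [CX X0 hX] := tcont_bounded b0 sb db hB T tX; have [CY Y0 hY] := tcont_bounded b0 sb db hB T tY.
have [CP P0 hP] := tcont_bounded b0 sb db hB T tP; have [CE E0 hE] := tcont_bounded b0 sb db hB T tE.
have [CS S0 hS] := tcont_bounded b0 sb db hB T tS; have [CW W0 hW] := tcont_bounded b0 sb db hB T tW.
have key6 (a1 a2 a3 a4 a5 a6 : R) : 0 <= a1 -> 0 <= a2 -> 0 <= a3 -> 0 <= a4 -> 0 <= a5 -> 0 <= a6 ->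
    let s := a1 + a2 + a3 + a4 + a5 + a6 in [/\ a1 <= s, a2 <= s, a3 <= s & [/\ a4 <= s, a5 <= s & a6 <= s]].
  by move=> h1 h2 h3 h4 h5 h6 s; rewrite /s; do !split; lra.
have [cX cY cP [cE cS cW]] := key6 _ _ _ _ _ _ X0 Y0 P0 E0 S0 W0.
pose C := CX + CY + CP + CE + CS + CW; pose E1 := 4 * pi * ((BJ 1 ^+ 2 + BJ 2 ^+ 2) * C).
have C0 : 0 <= C by rewrite !addr_ge0.
have E10 : 0 <= E1 by rewrite !mulr_ge0 ?pi_ge0 ?addr_ge0 ?sqr_ge0.
pose c := 5 * error_bound nu lambda M ^+ 2.
have c0 : 0 <= c by apply: mulr_ge0 (sqr_ge0 _).
exists (c * (10%:R * E1)); first by apply: mulr_ge0 c0 _; exact: mulr_ge0 _ E10.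
move=> n s hs; have ph := phase0 hd; have ph' := phase1 hd.
have l F CF e j : tcont k F -> phase e -> (j = 0 \/ j = 1)%N -> (forall s, 0 <= s <= T -> ramp k (F (pos s)) <= CF) -> CF <= C ->
    mu.-integrable setT (EFin \o (fun xi => wave bj k n F j.+1 e (s, xi) ^+ 2)) /\
    \int[mu]_xi wave bj k n F j.+1 e (s, xi) ^+ 2 <= E1 / n.+1%:R.
  by move=> tF he hj hF FC; apply: wave_integral => //; apply: le_trans (hF s hs) FC.
have h1 := l X CX d 0%N tX ph (or_introl erefl) hX; have h2 := l Y CY d 0%N tY ph (or_introl erefl) hY.
have h3 := l eta CE d 1%N tE ph (or_intror erefl) hE; have h4 := l psi CS d 1%N tS ph (or_intror erefl) hS.
have h5 := l P CP d 1%N tP ph (or_intror erefl) hP; have h6 := l eta CE (d + pi / 2) 0%N tE ph' (or_introl erefl) hE.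
have h7 := l psi CS (d + pi / 2) 0%N tS ph' (or_introl erefl) hS; have h8 := l P CP (d + pi / 2) 0%N tP ph' (or_introl erefl) hP.
have h9 := l omega CW d 1%N tW ph (or_intror erefl) hW; have h10 := l omega CW (d + pi / 2) 0%N tW ph' (or_introl erefl) hW.
have [si se] := @integral_sum_le _ _ R mu [:: _; _; _; _; _; _; _; _; _; _] _
  (conj (h1 cX) (conj (h2 cY) (conj (h3 cE) (conj (h4 cS) (conj (h5 cP) (conj (h6 cE) (conj (h7 cS) (conj (h8 cP) (conj (h9 cW) (conj (h10 cW) I)))))))))).
have ic := integrableRZ c si; have := RintegralZl c measurableT si => ec.
have fe xi : forcing sp nu lambda M eta ux uy phi psi omega bj k n d (s, xi) = c * foldr (fun f a => f xi + a) 0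
   [:: (fun xi => wave bj k n X 1 d (s, xi) ^+ 2); (fun xi => wave bj k n Y 1 d (s, xi) ^+ 2); (fun xi => wave bj k n eta 2 d (s, xi) ^+ 2);
      (fun xi => wave bj k n psi 2 d (s, xi) ^+ 2); (fun xi => wave bj k n P 2 d (s, xi) ^+ 2); (fun xi => wave bj k n eta 1 (d + pi / 2) (s, xi) ^+ 2);
      (fun xi => wave bj k n psi 1 (d + pi / 2) (s, xi) ^+ 2); (fun xi => wave bj k n P 1 (d + pi / 2) (s, xi) ^+ 2);
      (fun xi => wave bj k n omega 2 d (s, xi) ^+ 2); (fun xi => wave bj k n omega 1 (d + pi / 2) (s, xi) ^+ 2)].
  by rewrite /forcing -/c /= addr0 !addrA.
have eI := eq_integral (mu := mu) (D := setT) _ (fun xi => (forcing sp nu lambda M eta ux uy phi psi omega bj k n d (s, xi))%:E)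
  (fun xi _ => congr1 EFin (fe xi)).
rewrite eI -(EFin_Rintegral ic) ec lee_fin.
have key (a e' q : R) : a <= 10%:R * e' -> q = c * (10%:R * e') -> c * a <= q by move=> h ->; exact: ler_wpM2l c0 _ _ h.
by apply: (key _ (E1 / n.+1%:R) _ se); rewrite !mulrA.
Qed.

End ForcingIntegral.

Section ModeSteps.
Variable R : realType.

Lemma decay_step (A B W A0 B0 W0 G G0 q q0 K dec ef D M : R) : 0 <= K -> 0 <= dec ->
  A + B / M ^+ 2 + W <= K * (dec * (A0 + B0 / M ^+ 2 + W0) + ef * D) ->
  2^-1 * G <= B + q -> B0 <= 2 * G0 + 2 * q0 ->
  A + (M ^+ 2)^-1 / 2 * G + W <= K * dec * (A0 + 2 * (M ^+ 2)^-1 * G0 + W0)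
    + (K * dec * (2 * (M ^+ 2)^-1) * q0 + K * ef * D + (M ^+ 2)^-1 * q).
Proof.
move=> K0 d0; have m0 : 0 <= (M ^+ 2)^-1 by rewrite invr_ge0 sqr_ge0.
move: (_^-1) m0 => m m0 h hG hB; have Kd : 0 <= K * dec by exact: mulr_ge0.
have h1 := ler_wpM2l m0 hG; have h2 := ler_wpM2l Kd (ler_wpM2l m0 hB).
apply: (le_trans (y := A + B * m + W + m * q)); first by move: h1; lra.
apply: (le_trans (lerD h (lexx (m * q)))).
have -> : K * (dec * (A0 + B0 * m + W0) + ef * D) + m * q = K * dec * A0 + K * dec * (m * B0) + K * dec * W0 + K * ef * D + m * q by ring.
have -> : K * dec * (A0 + 2 * m * G0 + W0) + (K * dec * (2 * m) * q0 + K * ef * D + m * q) =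
   K * dec * A0 + K * dec * (m * (2 * G0 + 2 * q0)) + K * dec * W0 + K * ef * D + m * q by ring.
by rewrite !lerD.
Qed.

(** The factor 3 is 2 for the velocity, by the elliptic estimate, plus 1 for the density, whose
    factor p the division cancels. *)
Lemma decay_div_step (A f W X Y A0 B0 W0 G0 q q0 p K dec ef D M : R) : 0 <= K -> 0 <= dec -> 1 <= p -> 0 <= A -> 0 <= W -> 0 <= q ->
  (A + p * f / M ^+ 2 + W) / p <= K * (dec * (A0 + B0 / M ^+ 2 + W0) + ef * D) ->
  0 <= f -> p * (X + Y) <= 2 * (A + W) + 2 * q -> B0 <= 2 * G0 + 2 * q0 ->
  X + (M ^+ 2)^-1 / 2 * (f + f) + Y <= 3 * K * dec * (A0 + 2 * (M ^+ 2)^-1 * G0 + W0)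
    + (3 * K * dec * (2 * (M ^+ 2)^-1) * q0 + 3 * K * ef * D + 2 * q).
Proof.
move=> K0 d0 p1; have m0 : 0 <= (M ^+ 2)^-1 by rewrite invr_ge0 sqr_ge0.
move: (_^-1) m0 => m m0 A0' W0' q0' h f0 hX hB; have Kd : 0 <= K * dec by exact: mulr_ge0.
have p0 : 0 < p by exact: lt_le_trans p1.
have h2 := ler_wpM2l Kd (ler_wpM2l m0 hB).
set S := K * (dec * (A0 + B0 * m + W0) + ef * D) in h.
have hS : A + p * f * m + W <= p * S by move: h; rewrite ler_pdivrMr// (mulrC S).
have hx : X + Y <= 2 * S + 2 * q.
  rewrite -(ler_pM2l p0); apply: (le_trans hX); have : 0 <= p * f * m by rewrite !mulr_ge0// ltW.
  by have := ler_wpM2r q0' p1; rewrite mul1r; move: hS; lra.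
have hf : m * f <= S.
  have e : p * (m * f) = p * f * m by ring.
  by rewrite -(ler_pM2l p0) e; move: hS A0' W0'; lra.
have -> : X + m / 2 * (f + f) + Y = (X + Y) + m * f by field.
apply: (le_trans (lerD hx hf)).
have -> : 3 * K * dec * (A0 + 2 * m * G0 + W0) + (3 * K * dec * (2 * m) * q0 + 3 * K * ef * D + 2 * q) =
  3 * (K * dec * A0 + K * dec * (m * (2 * G0 + 2 * q0)) + K * dec * W0 + K * ef * D) + 2 * q by ring.
have -> : 2 * S + 2 * q + S = 3 * (K * dec * A0 + K * dec * (m * B0) + K * dec * W0 + K * ef * D) + 2 * q by rewrite /S; ring.
by rewrite lerD2r ler_wpM2l// !lerD.
Qed.

Lemma total_mode (F1 F2 F3 F4 G1 G2 G3 G4 E : R -> R -> R) (a K b k i : R) :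
  (forall k' d, k' = k \/ k' = - k -> d = 0 \/ d = pi / 2 ->
    F1 k' d + a * (F2 k' d + F3 k' d) + F4 k' d <= K * (G1 k' d + b * (G2 k' d + G3 k' d) + G4 k' d) + E k' d * i) ->
  total F1 k + a * (total F2 k + total F3 k) + total F4 k <=
  K * (total G1 k + b * (total G2 k + total G3 k) + total G4 k) + total E k * i.
Proof.
move=> h; have := h k 0 (or_introl erefl) (or_introl erefl); have := h k (pi / 2) (or_introl erefl) (or_intror erefl).
have := h (- k) 0 (or_intror erefl) (or_introl erefl); have := h (- k) (pi / 2) (or_intror erefl) (or_intror erefl).
by rewrite /total; move=> {h}; lra.
Qed.

Lemma rescale_mode (c t1 t2 t3 t4 s1 s2 s3 s4 q1 q2 q3 q4 p1 p2 p3 p4 a K b E : R) : 0 < c ->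
  t1 = c * q1 -> t2 = c * q2 -> t3 = c * q3 -> t4 = c * q4 -> s1 = c * p1 -> s2 = c * p2 -> s3 = c * p3 -> s4 = c * p4 ->
  t1 + a * (t2 + t3) + t4 <= K * (s1 + b * (s2 + s3) + s4) + E ->
  q1 + a * (q2 + q3) + q4 <= K * (p1 + b * (p2 + p3) + p4) + E / c.
Proof.
move=> c0 -> -> -> -> -> -> -> -> h; rewrite -(ler_pM2l c0).
have -> : c * (q1 + a * (q2 + q3) + q4) = c * q1 + a * (c * q2 + c * q3) + c * q4 by ring.
apply: (le_trans h); rewrite le_eqVlt; apply/orP; left; apply/eqP; field; by rewrite gt_eqF.
Qed.

Lemma grad_relN (k : R) (f gx gy : R * R -> R) : grad_rel k f gx gy -> grad_rel (- k) f gx gy.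
Proof.
move=> h A B B' b b' k' zeta d hk'; apply: h; rewrite opprK in hk'.
by case: hk'; [right|left].
Qed.

Section LinearError.
Variables (d : measure_display) (T : measurableType d) (m : {measure set T -> \bar R}).

Lemma integral_error_le (u v w : T -> R) (a b c e1 e2 e3 : R) : 0 <= a -> 0 <= b -> 0 <= c ->
  m.-integrable setT (EFin \o u) -> m.-integrable setT (EFin \o v) -> m.-integrable setT (EFin \o w) ->
  \int[m]_x u x <= e1 -> \int[m]_x v x <= e2 -> \int[m]_x w x <= e3 ->
  m.-integrable setT (EFin \o (fun x => a * u x + b * v x + c * w x)) /\
  \int[m]_x (a * u x + b * v x + c * w x) <= a * e1 + b * e2 + c * e3.
Proof.
move=> a0 b0 c0 iu iv iw h1 h2 h3.
have ia := integrableRZ a iu; have ib := integrableRZ b iv; have ic := integrableRZ c iw.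
have iab := integrableRD ia ib; split; first exact: integrableRD iab ic.
rewrite (RintegralD measurableT iab ic) (RintegralD measurableT ia ib).
rewrite (RintegralZl a measurableT iu) (RintegralZl b measurableT iv) (RintegralZl c measurableT iw).
by rewrite !lerD// ler_wpM2l.
Qed.

End LinearError.

End ModeSteps.

Section ErrorSums.
Variable R : realType.

Lemma split_error (Z x y z s : R) : 0 * Z + 1 * (x * s) + 2 * (y * s + z * s) <= (x + 2 * (y + z)) * s.
Proof. by rewrite le_eqVlt; apply/orP; left; apply/eqP; ring. Qed.

Lemma insert_error (S Z q0 D qT w a b : R) : S + (a * q0 + b * D + 2 * w) <= S + (0 * Z + 1 * (a * q0 + b * D + 0 * qT) + 2 * w).
Proof. by rewrite le_eqVlt; apply/orP; left; apply/eqP; ring. Qed.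

Lemma combine_errors (a b a' p f t q s : R) : 0 <= a -> 0 <= b -> 0 <= a' -> 0 <= p -> 0 <= f * t -> 0 <= q -> 0 <= s ->
  a * (p * s) + b * (f * s * t) + a' * (q * s) <= (a + b + a') * (p + f * t + q) * s.
Proof.
move=> a0 b0 a'0 p0 v0 q0 s0; have -> : a * (p * s) + b * (f * s * t) + a' * (q * s) = (a * p + b * (f * t) + a' * q) * s by ring.
apply: ler_wpM2r s0 _ _ _; move: (f * t) v0 => v v0.
have -> : (a + b + a') * (p + v + q) = a * p + b * v + a' * q + (a * (v + q) + b * (p + q) + a' * (p + v)) by ring.
by rewrite lerDl !addr_ge0 ?mulr_ge0 ?addr_ge0.
Qed.

End ErrorSums.

Section IntegratedDecay.
Variables (R : realType) (sp : species) (nu lambda M : R).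
Variables (eta ux uy phi psi omega : R -> R * R -> R).
Hypothesis sol : is_solution sp nu lambda M eta ux uy phi psi omega.
Variables (bj : nat -> R -> R) (BJ : nat -> R).
Hypotheses (b0 : bj 0%N = @bump R) (sb : forall j, smooth1 (bj j))
  (db : forall j y, is_derive y (1 : R) (bj j) (bj j.+1 y)) (hB : forall j y, `|bj j y| <= BJ j).
Variable r : R.
Hypotheses (M0 : 0 < M) (r0 : 0 < r) (r1 : r <= 1) (nuE : nu = r ^+ 3) (lam0 : 0 <= lambda) (sgM : (nu + lambda) * M ^+ 2 <= 1)
  (nuM : 16 * nu * M ^+ 2 <= nu + lambda) (sg_half : nu + lambda <= 2^-1).
Variables (T : R) (T0 : 0 <= T) (gx gy hx hy : R * R -> R).
Hypotheses (gx2 : L2fun gx) (gy2 : L2fun gy) (hx2 : L2fun hx) (hy2 : L2fun hy).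
Local Notation mu := (@lebesgue_measure R).
Local Notation X := (fun t => nonzero_modes (ux t)).
Local Notation Y := (fun t => nonzero_modes (uy t)).
Local Notation c n j := (cut_ bj n j).
Let cc n j := cut_cut b0 sb db hB n j.
Let cbs n j := cut_bs (cc n j).
Let dc n j y : is_derive y (1 : R) (c n j) (c n j.+1 y) := der_cut db n j y.
Let m0 : 0 <= (M ^+ 2)^-1. Proof. by rewrite invr_ge0 sqr_ge0. Qed.

Definition growth : R := mode_const M * expR (3 / 2 * ln (2 + 2 * T ^+ 2)).
Definition growth_div : R := mode_const M * expR (2^-1 * ln (2 + 2 * T ^+ 2)).
Definition damping : R := expR (- (r * T / 12)).
Let ef : R := error_factor nu (nu + lambda) M.

Let mc0 : 0 <= mode_const M.
Proof. by rewrite /mode_const mulr_ge0 ?expR_ge0// mulr_ge0 ?sqr_ge0. Qed.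
Let K10 : 0 <= growth. Proof. by rewrite mulr_ge0 ?expR_ge0. Qed.
Let K20 : 0 <= growth_div. Proof. by rewrite mulr_ge0 ?expR_ge0. Qed.
Let dec0 : 0 <= damping. Proof. exact: expR_ge0. Qed.
Let nu0 : 0 < nu. Proof. by rewrite nuE exprn_gt0. Qed.
Let sg0 : 0 < nu + lambda. Proof. by rewrite ltr_wpDr. Qed.
Let ef0 : 0 <= ef.
Proof.
rewrite /ef /error_factor; have sg := ltW sg0; have n0 := ltW nu0.
apply: addr_ge0; first by apply: addr_ge0; apply: divr_ge0.
apply: divr_ge0; first by apply: mulr_ge0 (sqr_ge0 _).
apply: divr_ge0; first by apply: mulr_ge0 _ sg.
by apply: addr_ge0 => //; apply: mulr_ge0; exact: sqr_ge0.
Qed.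

Section OneMode.
Variables (k : R) (hk : integer_mode k) (k1 : 1 <= `|k|).
Hypotheses (gT : grad_rel k (eta T) gx gy) (g0 : grad_rel k (eta 0) hx hy).
Variable d : R.
Hypothesis hd : d = 0 \/ d = pi / 2.
Local Notation d' := (d + pi / 2).
Let ph := phase0 hd.
Let ph' := phase1 hd.

Let e2 t (t0 : 0 <= t) := sol_eta_L2 sol t0.
Let p2 t (t0 : 0 <= t) := sol_psi_L2 sol t0.
Let w2 t (t0 : 0 <= t) := sol_omega_L2 sol t0.
Let x2 := sol_ux_L2 sol T0.
Let y2 := sol_uy_L2 sol T0.

Let grad_pointwise n t (ux' uy' : R * R -> R) xi : grad_rel k (eta t) ux' uy' ->
  2^-1 * (pr ux' (c n 0) k (xi - k * t) d' ^+ 2 + pr uy' (c n 0) k (xi - k * t) d' ^+ 2) <=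
    (k ^+ 2 + (xi - k * t) ^+ 2) * pr (eta t) (c n 0) k (xi - k * t) d ^+ 2 + pr (eta t) (c n 1) k (xi - k * t) d' ^+ 2 /\
  (k ^+ 2 + (xi - k * t) ^+ 2) * pr (eta t) (c n 0) k (xi - k * t) d ^+ 2 <=
    2 * (pr ux' (c n 0) k (xi - k * t) d' ^+ 2 + pr uy' (c n 0) k (xi - k * t) d' ^+ 2) + 2 * pr (eta t) (c n 1) k (xi - k * t) d' ^+ 2.
Proof.
move=> h; have [h1 h2] := h _ _ _ _ _ k (xi - k * t) d' (or_introl erefl) (cc n 0) (cc n 1) (dc n 0).
rewrite (pr_shift_pi (eta t) (c n 0) k (xi - k * t) d) mulrN opprK in h1.
rewrite (pr_shift_pi (eta t) (c n 0) k (xi - k * t) d) mulrN opprB in h2.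
exact: grad_bounds h1 h2.
Qed.

(** E is chosen before the coefficients a, b and a', so that the same integrals serve both decay
    estimates. *)
Lemma error_integrals : exists2 E, 0 <= E & forall n (a b a' : R), 0 <= a -> 0 <= b -> 0 <= a' ->
  let e := fun xi => a * pr (eta 0) (c n 1) k (xi - k * 0) d' ^+ 2
    + b * primitive (fun s => forcing sp nu lambda M eta ux uy phi psi omega bj k n d (s, xi)) T
    + a' * pr (eta T) (c n 1) k (xi - k * T) d' ^+ 2 in
  mu.-integrable setT (EFin \o e) /\ \int[mu]_xi e xi <= (a + b + a') * E / n.+1%:R.
Proof.
have [F F0 hF] := forcing_integral sol b0 sb db hB hk k1 T0 hd.
pose E0 := 4 * pi * (BJ 1 ^+ 2 * ramp k (eta 0)); pose ET := 4 * pi * (BJ 1 ^+ 2 * ramp k (eta T)).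
have pos4 (q : R) : 0 <= q -> 0 <= 4 * pi * (BJ 1 ^+ 2 * q).
  by move=> q0; apply: mulr_ge0; [rewrite mulr_ge0 ?pi_ge0|exact: mulr_ge0 (sqr_ge0 _) q0].
have E00 : 0 <= E0 := pos4 _ (ramp_ge0 _ _); have ET0 : 0 <= ET := pos4 _ (ramp_ge0 _ _).
have FT : 0 <= F * T by exact: mulr_ge0.
exists (E0 + F * T + ET); first exact: addr_ge0 (addr_ge0 E00 FT) ET0.
move=> n a b a' a0 b0' a'0 e.
have [i1 j1] := integral_pr_sqr_shift k (k * 0) (e2 (lexx 0)) (cbs n 1) ph'.
have [i3 j3] := integral_pr_sqr_shift k (k * T) (e2 T0) (cbs n 1) ph'.
have cF : continuous (forcing sp nu lambda M eta ux uy phi psi omega bj k n d) by exact: (continuous_forcing sol b0 sb db hB hk k1).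
have F0' z : 0 <= forcing sp nu lambda M eta ux uy phi psi omega bj k n d z by exact: forcing_ge0.
have [i2 j2] := integral_primitive T0 cF F0' (hF n).
have b1 := rwave_cutS_le b0 sb db hB n 0 (e2 (lexx 0)) (or_introl (erefl k)) ph' (lexx _).
have b3 := rwave_cutS_le b0 sb db hB n 0 (e2 T0) (or_introl (erefl k)) ph' (lexx _).
rewrite -j1 in b1; rewrite -j3 in b3.
have [i j] := integral_error_le a0 b0' a'0 i1 i2 i3 b1 j2 b3.
split; first exact: i.
apply: (le_trans j); have n0 : 0 <= n.+1%:R^-1 :> R by rewrite invr_ge0.
exact: (combine_errors a0 b0' a'0 E00 FT ET0 n0).
Qed.

Lemma mode_decay_wave : exists E, forall n,
  rwave (psi T) (c n 0) k d + (M ^+ 2)^-1 / 2 * (rwave gx (c n 0) k d' + rwave gy (c n 0) k d') + rwave (omega T) (c n 0) k d <=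
  growth * damping * (rwave (psi 0) (c n 0) k d + 2 * (M ^+ 2)^-1 * (rwave hx (c n 0) k d' + rwave hy (c n 0) k d') + rwave (omega 0) (c n 0) k d)
  + E / n.+1%:R.
Proof.
have [E E0 hE] := error_integrals.
set a := growth * damping * (2 * (M ^+ 2)^-1); set b := growth * ef; set a' := (M ^+ 2)^-1.
have a0 : 0 <= a by apply: mulr_ge0 (mulr_ge0 K10 dec0) _; exact: mulr_ge0.
have b0' : 0 <= b by exact: mulr_ge0.
exists ((a + b + a') * E) => n; have [ie je] := hE n a b a' a0 b0' m0.
have sh f d'' t (f2 : L2fun f) (h : phase d'') := integral_pr_sqr_shift k (k * t) f2 (cbs n 0) h.
have [i1 <-] := sh _ _ T (p2 T0) ph; have [i2 <-] := sh _ _ T gx2 ph'; have [i3 <-] := sh _ _ T gy2 ph'; have [i4 <-] := sh _ _ T (w2 T0) ph.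
have [j1 <-] := sh _ _ 0 (p2 (lexx 0)) ph; have [j2 <-] := sh _ _ 0 hx2 ph'; have [j3 <-] := sh _ _ 0 hy2 ph'; have [j4 <-] := sh _ _ 0 (w2 (lexx 0)) ph.
apply: le_trans (lerD (lexx _) je).
apply: (le_Rintegral_mode i1 i2 i3 i4 j1 j2 j3 j4 ie) => xi.
have h := mode_energy_decay sol b0 sb db hB hk k1 M0 n r0 r1 nuE lam0 sgM nuM sg_half xi d T0.
exact: (decay_step K10 dec0 h (grad_pointwise n xi gT).1 (grad_pointwise n xi g0).2).
Qed.

(** The density is entered twice, in place of the two components of a gradient, so that both
    estimates share one shape and one passage to the limit. *)
Lemma mode_decay_velocity_wave : exists E, forall n,
  rwave (X T) (c n 0) k d' + (M ^+ 2)^-1 / 2 * (rwave (eta T) (c n 0) k d + rwave (eta T) (c n 0) k d) + rwave (Y T) (c n 0) k d' <=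
  3 * growth_div * damping * (rwave (psi 0) (c n 0) k d + 2 * (M ^+ 2)^-1 * (rwave hx (c n 0) k d' + rwave hy (c n 0) k d') + rwave (omega 0) (c n 0) k d)
  + E / n.+1%:R.
Proof.
have [E E0 hE] := error_integrals.
set a := 3 * growth_div * damping * (2 * (M ^+ 2)^-1); set b := 3 * growth_div * ef.
have K30 : 0 <= 3 * growth_div by exact: mulr_ge0.
have a0 : 0 <= a by apply: mulr_ge0 (mulr_ge0 K30 dec0) _; exact: mulr_ge0.
have b0' : 0 <= b by exact: mulr_ge0.
have p1 xi : 1 <= k ^+ 2 + (xi - k * T) ^+ 2.
  have h : 1 <= k ^+ 2 by rewrite -(ger0_norm (sqr_ge0 k)) normrX exprn_ege1.
  by apply: (le_trans h); rewrite lerDl sqr_ge0.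
have hd1 : div_rel k (psi T) (X T) (Y T).
  by move=> A B B' b1 b1' k' zeta d1 hk' cb cb' dbb; exact: (mode_div sol (integer_mode_pm hk hk') cb cb' dbb zeta d1 T0).
have hc1 : curl_rel k (omega T) (X T) (Y T).
  by move=> A B B' b1 b1' k' zeta d1 hk' cb cb' dbb; exact: (mode_curl sol (integer_mode_pm hk hk') cb cb' dbb zeta d1 T0).
pose C := 4 * pi * (BJ 1 ^+ 2 * ramp k (Y T)) + 4 * pi * (BJ 1 ^+ 2 * ramp k (X T)).
exists ((a + b + 0) * E + 2 * C) => n; have [ie je] := hE n a b 0 a0 b0' (lexx 0).
have sh f d'' t (f2 : L2fun f) (h : phase d'') := integral_pr_sqr_shift k (k * t) f2 (cbs n 0) h.
have [i1 <-] := sh _ _ T x2 ph'; have [i2 <-] := sh _ _ T (e2 T0) ph; have [i4 <-] := sh _ _ T y2 ph'.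
have [j1 <-] := sh _ _ 0 (p2 (lexx 0)) ph; have [j2 <-] := sh _ _ 0 hx2 ph'; have [j3 <-] := sh _ _ 0 hy2 ph'; have [j4 <-] := sh _ _ 0 (w2 (lexx 0)) ph.
have [q1 q1E] := integral_pr_sqr_shift k (k * T) y2 (cbs n 1) ph; have [q2 q2E] := integral_pr_sqr_shift k (k * T) x2 (cbs n 1) ph.
have b1 := rwave_cutS_le b0 sb db hB n 0 y2 (or_introl (erefl k)) ph (lexx _).
have b2 := rwave_cutS_le b0 sb db hB n 0 x2 (or_introl (erefl k)) ph (lexx _).
rewrite -q1E in b1; rewrite -q2E in b2.
have qi := integrableRD q1 q2; have qE := RintegralD measurableT q1 q2.
have qb := lerD b1 b2; rewrite -qE in qb.
have [ei ej] := integral_error_le (lexx 0) ler01 (ler0n _ 2) ie ie qi (lexx _) je qb.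
apply: le_trans (lerD (lexx _) (le_trans ej _)); last first.
  exact: split_error.
apply: (le_Rintegral_mode i1 i2 i2 i4 j1 j2 j3 j4 ei) => xi.
have h := mode_energy_decay_div sol b0 sb db hB hk k1 M0 n r0 r1 nuE lam0 sgM nuM sg_half xi d T0.
have v := velocity_pointwise b0 sb db hB n (xi - k * T) d hd1 hc1 (or_introl erefl).
have s := decay_div_step K20 dec0 (p1 xi) (sqr_ge0 _) (sqr_ge0 _) (addr_ge0 (sqr_ge0 _) (sqr_ge0 _)) h (sqr_ge0 _) v (grad_pointwise n xi g0).2.
apply: (le_trans s); exact: insert_error.
Qed.

End OneMode.

Section BothSigns.
Variables (k : R) (hk : integer_mode k) (k1 : 1 <= `|k|).
Hypotheses (gT : grad_rel k (eta T) gx gy) (g0 : grad_rel k (eta 0) hx hy).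

(** The error constants depend on sign and phase; [total] needs them as one function of the two. *)
Let both (F : R -> R -> R -> Prop) : (forall k', k' = k \/ k' = - k -> integer_mode k' -> 1 <= `|k'| -> grad_rel k' (eta T) gx gy ->
    grad_rel k' (eta 0) hx hy -> forall d, d = 0 \/ d = pi / 2 -> exists E, F k' d E) ->
  exists E : R -> R -> R, forall k' d, k' = k \/ k' = - k -> d = 0 \/ d = pi / 2 -> F k' d (E k' d).
Proof.
move=> h; have h' (p : R * R) : exists E, (p.1 = k \/ p.1 = - k) -> (p.2 = 0 \/ p.2 = pi / 2) -> F p.1 p.2 E.
  have [hk'|hk'] := pselect (p.1 = k \/ p.1 = - k); last by exists 0 => /hk'.
  have [hd|hd] := pselect (p.2 = 0 \/ p.2 = pi / 2); last by exists 0 => _ /hd.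
  have kk1 : 1 <= `|p.1| by case: hk' => ->; rewrite ?normrN.
  have gT' : grad_rel p.1 (eta T) gx gy by case: (hk') => ->; [exact: gT|exact: grad_relN].
  have g0' : grad_rel p.1 (eta 0) hx hy by case: (hk') => ->; [exact: g0|exact: grad_relN].
  by have [E hE] := h _ hk' (integer_mode_pm hk hk') kk1 gT' g0' _ hd; exists E.
have [E hE] := choice h'.
by exists (fun k' d => E (k', d)) => k' d hk' hd; exact: (hE (k', d)).
Qed.

Let p4 : 0 < 4 * pi :> R. Proof. by rewrite mulr_gt0 ?pi_gt0. Qed.
Let tw n f (f2 : L2fun f) := rwave_total k f2 (cbs n 0).
Let tws n f (f2 : L2fun f) := etrans (total_shift f (c n 0) k) (tw n f2).
Let cvgr f (f2 : L2fun f) : (fun n => rmsq (c n 0) k f) @ \oo --> ramp k f.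
Proof. exact: (cvg_rmsq_cut b0 sb db hB f2 (k := k)). Qed.

(** The cutoff opens at fixed mode and time, and the error E / (n + 1) disappears. Only the explicit
    growth and damping factors remain, which do not depend on k and can be summed. *)
Let limit_le (f1 f2 f3 f4 g1 g2 g3 g4 : R * R -> R) (a K b E : R) : L2fun f1 -> L2fun f2 -> L2fun f3 -> L2fun f4 ->
  L2fun g1 -> L2fun g2 -> L2fun g3 -> L2fun g4 -> 0 <= K -> 0 <= b ->
  (forall n, rmsq (c n 0) k f1 + a * (rmsq (c n 0) k f2 + rmsq (c n 0) k f3) + rmsq (c n 0) k f4 <=
    K * (rmsq (c n 0) k g1 + b * (rmsq (c n 0) k g2 + rmsq (c n 0) k g3) + rmsq (c n 0) k g4) + E / n.+1%:R) ->
  ramp k f1 + a * (ramp k f2 + ramp k f3) + ramp k f4 <= K * (ramp k g1 + b * (ramp k g2 + ramp k g3) + ramp k g4).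
Proof.
move=> l1 l2 l3 l4 m1 m2 m3 m4 K0 bb0 h.
have cv : (fun n => rmsq (c n 0) k f1 + a * (rmsq (c n 0) k f2 + rmsq (c n 0) k f3) + rmsq (c n 0) k f4) @ \oo -->
    ramp k f1 + a * (ramp k f2 + ramp k f3) + ramp k f4.
  by apply: cvgD; [apply: cvgD; [exact: cvgr|apply: cvgMr; apply: cvgD; exact: cvgr]|exact: cvgr].
apply: (cvg_le_bound cv (e := E)) => n; apply: (le_trans (h n)); rewrite lerD2r.
have q g (g2' : L2fun g) := rmsq_cut0_le b0 sb db hB n k g2'.
apply: ler_wpM2l K0 _ _ _; apply: lerD; last exact: q.
by apply: lerD; [exact: q|apply: ler_wpM2l bb0 _ _ _; apply: lerD; exact: q].
Qed.

Let p2 t (t0 : 0 <= t) := sol_psi_L2 sol t0.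
Let w2 t (t0 : 0 <= t) := sol_omega_L2 sol t0.

Lemma mode_decay_ramp :
  ramp k (psi T) + (M ^+ 2)^-1 / 2 * (ramp k gx + ramp k gy) + ramp k (omega T) <=
  growth * damping * (ramp k (psi 0) + 2 * (M ^+ 2)^-1 * (ramp k hx + ramp k hy) + ramp k (omega 0)).
Proof.
have [E hE] := both (fun k' hk' i k1' gT' g0' d hd => mode_decay_wave i k1' gT' g0' hd).
apply: (@limit_le _ _ _ _ _ _ _ _ _ _ _ (total E k / (4 * pi)) (p2 T0) gx2 gy2 (w2 T0) (p2 (lexx 0)) hx2 hy2 (w2 (lexx 0))) => [||n].
- exact: mulr_ge0.
- exact: mulr_ge0.
have h := @total_mode R (rwave (psi T) (c n 0)) (fun k d => rwave gx (c n 0) k (d + pi / 2)) (fun k d => rwave gy (c n 0) k (d + pi / 2))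
  (rwave (omega T) (c n 0)) (rwave (psi 0) (c n 0)) (fun k d => rwave hx (c n 0) k (d + pi / 2)) (fun k d => rwave hy (c n 0) k (d + pi / 2))
  (rwave (omega 0) (c n 0)) E _ _ _ k (n.+1%:R^-1) (fun k' d hk' hd => hE k' d hk' hd n).
have := rescale_mode p4 (tw n (p2 T0)) (tws n gx2) (tws n gy2) (tw n (w2 T0)) (tw n (p2 (lexx 0))) (tws n hx2) (tws n hy2) (tw n (w2 (lexx 0))) h.
by rewrite (mulrAC (total E k)).
Qed.

Lemma mode_decay_velocity_ramp :
  ramp k (X T) + (M ^+ 2)^-1 / 2 * (ramp k (eta T) + ramp k (eta T)) + ramp k (Y T) <=
  3 * growth_div * damping * (ramp k (psi 0) + 2 * (M ^+ 2)^-1 * (ramp k hx + ramp k hy) + ramp k (omega 0)).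
Proof.
have [E hE] := both (fun k' hk' i k1' gT' g0' d hd => mode_decay_velocity_wave i k1' g0' hd).
have x2 := sol_ux_L2 sol T0; have y2 := sol_uy_L2 sol T0; have e2 := sol_eta_L2 sol T0.
apply: (@limit_le _ _ _ _ _ _ _ _ _ _ _ (total E k / (4 * pi)) x2 e2 e2 y2 (p2 (lexx 0)) hx2 hy2 (w2 (lexx 0))) => [||n].
- by apply: mulr_ge0 dec0; exact: mulr_ge0.
- exact: mulr_ge0.
have h := @total_mode R (fun k d => rwave (X T) (c n 0) k (d + pi / 2)) (rwave (eta T) (c n 0)) (rwave (eta T) (c n 0))
  (fun k d => rwave (Y T) (c n 0) k (d + pi / 2)) (rwave (psi 0) (c n 0)) (fun k d => rwave hx (c n 0) k (d + pi / 2)) (fun k d => rwave hy (c n 0) k (d + pi / 2))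
  (rwave (omega 0) (c n 0)) E _ _ _ k (n.+1%:R^-1) (fun k' d hk' hd => hE k' d hk' hd n).
have := rescale_mode p4 (tws n x2) (tw n e2) (tw n e2) (tws n y2) (tw n (p2 (lexx 0))) (tws n hx2) (tws n hy2) (tw n (w2 (lexx 0))) h.
by rewrite (mulrAC (total E k)).
Qed.

End BothSigns.

End IntegratedDecay.

(** * Weak gradients and summation over the modes *)

Section TestFunctions.
Variable R : realType.
Local Notation mu := (@lebesgue_measure R).
Local Notation mR := (measurableTypeR R).
Local Notation torus := (@torus R).
Local Notation cyl := (@cylinder R).
Local Notation per := (@period R).
Implicit Types (f g chi : R * R -> R).

Lemma bounded_on_rectangle g (a b : R) : continuous g ->
  exists2 C, 0 <= C & forall x y, 0 <= x <= 2 * pi -> a <= y <= b -> `|g (x, y)| <= C.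
Proof.
move=> cg; have cK : compact (`[0, 2 * pi]%classic `*` `[a, b]%classic : set (R * R)).
  by apply: compact_setX; exact: segment_compact.
have := compact_bounded (continuous_compact (continuous_subspaceT cg) cK).
rewrite /= => -[C [_ hC]]; exists (Order.max 0 (C + 1)); first by rewrite le_max lexx.
move=> x y hx hy; have h : C < Order.max 0 (C + 1) by rewrite lt_max ltrDl ltr01 orbT.
by apply: (hC _ h); exists (x, y) => //; split; rewrite /= in_itv.
Qed.

Section Average.
Variable g : R * R -> R.
Hypotheses (cg : continuous g) (cdg : continuous (pdy g)) (dg : forall x y, derivable (fun y' : R => g (x, y')) y 1).

Let is_derive_slice x (y : R) : is_derive y (1 : R) (fun y' => g (x, y')) (pdy g (x, y)).
Proof. by split; [exact: dg|rewrite /pdy derive1E]. Qed.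

Let integrable_slice_near y0 y : y0 - 1 <= y <= y0 + 1 ->
  mu.-integrable setT (EFin \o (fun x : mR => \1_per x * g (x, y))).
Proof.
move=> hy; have [C C0 hC] := bounded_on_rectangle (y0 - 1) (y0 + 1) cg.
have mg : measurable_fun setT (fun x : mR => g (x, y) : mR) by apply: continuous_measurable_fun; exact: cont_slice'.
apply: (le_integrable measurableT _ _ (integrableRZ C (integrable_period_indic R))).
  by apply/measurable_EFinP; apply: measurable_funM => //; exact: measurable_indic (@measurable_period R).
move=> x _ /=; rewrite lee_fin indicE; have [xp|_] := boolP (x \in per); last by rewrite mul0r mulr0.
rewrite mul1r mulr1 (ger0_norm C0); apply: hC => //.
by move: xp; rewrite inE periodP => /andP[-> /ltW ->].
Qed.

(** Differentiation under the integral; near y0 the derivative is dominated by its maximum on a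
    compact rectangle. *)
Lemma average_derive y0 : is_derive y0 (1 : R) (fun y => \int[torus]_x g (x, y)) (\int[torus]_x pdy g (x, y0)).
Proof.
have [C C0 hC] := bounded_on_rectangle (y0 - 1) (y0 + 1) cdg.
have e (h : R * R -> R) y : continuous h -> \int[torus]_x h (x, y) = \int[mu]_x (\1_per x * h (x, y)).
  by move=> ch; apply: Rintegral_torus; apply: continuous_measurable_fun; exact: cont_slice'.
pose f (y : R) (x : mR) := \1_per x * g (x, y).
have d1 y x : is_derive y (1 : R) (f^~ x) (\1_per x * pdy g (x, y)).
  have h := der_mul (der_cst (\1_per x : R) y) (is_derive_slice x y).
  by apply: (derE h); rewrite mul0r add0r.
have I0 : `]y0 - 1, y0 + 1[%classic y0 by rewrite /= in_itv /= ltrBlDr !ltrDl ltr01.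
have iG : mu.-integrable setT (EFin \o (fun x : mR => C * \1_per x)) := integrableRZ C (integrable_period_indic R).
have h1 y : `]y0 - 1, y0 + 1[%classic y -> mu.-integrable setT (EFin \o f y).
  by rewrite /= in_itv /= => /andP[a b]; apply: (@integrable_slice_near y0); rewrite !ltW.
have h2 y x : `]y0 - 1, y0 + 1[%classic y -> setT x -> derivable (f^~ x) y 1 by move=> _ _; have [] := d1 y x.
have h3 (x : mR) : 0 <= C * \1_per x by rewrite mulr_ge0// indicE.
have h4 y x : `]y0 - 1, y0 + 1[%classic y -> setT x -> `|partial1of2 f y x| <= C * \1_per x.
  rewrite /= in_itv /= => /andP[a b] _; rewrite /partial1of2 (der_derive1 (d1 y x)) indicE.
  have [xp|_] := boolP (x \in per); last by rewrite mul0r mulr0 normr0.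
  rewrite mul1r mulr1; apply: hC; last by rewrite !ltW.
  by move: xp; rewrite inE periodP => /andP[-> /ltW ->].
have D := derivable_under_integral measurableT I0 h1 h2 h3 iG h4.
have V := differentiation_under_integral measurableT I0 h1 h2 h3 iG h4.
have -> : (fun y => \int[torus]_x g (x, y)) = (fun y => \int[mu]_x f y x) by apply/funext => y; exact: e.
split; first exact: D.
rewrite -derive1E V (e _ _ cdg); apply: eq_Rintegral => x _.
by rewrite /partial1of2 (der_derive1 (d1 y0 x)).
Qed.

Lemma xavg_derive x0 y0 : is_derive y0 (1 : R) (fun y => xavg g (x0, y)) (xavg (pdy g) (x0, y0)).
Proof.
by apply: (derE (der_mul (der_cst ((2 * pi)^-1 : R) y0) (average_derive y0))); rewrite mul0r add0r.
Qed.

Lemma xavg_continuous : continuous (xavg g).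
Proof.
move=> -[x0 y0]; have c := der_continuous (xavg_derive 0 y0).
exact: (@cvg_comp _ _ _ snd (fun y => xavg g (0, y)) _ _ _ (@cvg_snd _ _ (nbhs x0) (nbhs y0) _) c).
Qed.

Lemma pdy_xavg : pdy (xavg g) = xavg (pdy g).
Proof. by apply/funext => -[x y]; exact: der_derive1 (xavg_derive x y). Qed.

End Average.

Lemma pdx_xavg g : pdx (xavg g) = (fun _ => 0).
Proof. apply/funext => -[x y]; exact: (der_derive1 (der_cst (xavg g (0, y)) x)). Qed.

Lemma pd_cst0 : pdx (fun _ : R * R => 0 : R) = (fun _ => 0) /\ pdy (fun _ : R * R => 0 : R) = (fun _ => 0).
Proof. by split; apply/funext => -[x y]; [exact: (der_derive1 (der_cst (0 : R) x))|exact: (der_derive1 (der_cst (0 : R) y))]. Qed.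

Lemma pd_word_xavg w chi : smooth chi -> pd_word w (xavg chi) = if true \in w then (fun _ => 0) else xavg (pd_word w chi).
Proof.
move=> sc; elim: w => [//|b w IH]; rewrite in_cons -[LHS]/(if b then pdx (pd_word w (xavg chi)) else pdy (pd_word w (xavg chi))) IH.
have [tw|tw] := boolP (true \in w); first by rewrite orbT; case: b; [exact: pd_cst0.1|exact: pd_cst0.2].
rewrite orbF; case: b => /=; first exact: pdx_xavg.
have [c1 _ d1] := sc w; have [c2 _ _] := sc (false :: w).
exact: (pdy_xavg c1 c2 d1).
Qed.

Lemma smooth_xavg chi : smooth chi -> smooth (xavg chi).
Proof.
move=> sc w; rewrite (pd_word_xavg w sc); case: ifP => _.
  by split=> [|x y|x y]; [exact: cst_continuous|have [] := der_cst (0 : R) x|have [] := der_cst (0 : R) y].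
have [c1 _ d1] := sc w; have [c2 _ _] := sc (false :: w).
split; [exact: (xavg_continuous c1 c2 d1)| |].
  by move=> x y; have [] := der_cst (xavg (pd_word w chi) (0, y)) x.
by move=> x y; have [] := xavg_derive c1 c2 d1 x y.
Qed.

Lemma xavg_support chi (A : R) : (forall x y, A < `|y| -> chi (x, y) = 0) -> forall x y, A < `|y| -> xavg chi (x, y) = 0.
Proof.
move=> h x y yA; rewrite xavgE; have -> : (fun x => chi (x, y)) = (fun _ => 0) by apply/funext => x'; exact: h.
by rewrite Rintegral_torus_cst !mulr0.
Qed.

(** The average of a field is moved onto the test function, and the result has to be admissible
    again. *)
Lemma test_xavg chi : test_fun chi -> test_fun (xavg chi).
Proof.
move=> [pc sc [A hA]]; split; [by []|exact: smooth_xavg|].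
by exists A; exact: xavg_support hA.
Qed.

Lemma pd_word_rcons w b chi : pd_word (rcons w b) chi = pd_word w (if b then pdx chi else pdy chi).
Proof. by rewrite /pd_word foldr_rcons; case: b. Qed.

Lemma test_pdx chi : test_fun chi -> test_fun (pdx chi).
Proof.
move=> [pc sc [A hA]]; have [_ dx _] := sc [::]; split.
- move=> x y; have h : is_derive (x + 2 * pi : R) (1 : R) (fun x => chi (x, y)) (pdx chi (x + 2 * pi, y)).
    by split; [exact: dx|rewrite /pdx derive1E].
  have ha : is_derive x (1 : R) (fun x => x + 2 * pi) 1 by der; rewrite addr0.
  have := der_comp (h := fun x => chi (x, y)) (f := fun x => x + 2 * pi) h ha; rewrite mulr1 => h2; rewrite -(der_derive1 h2) /pdx /=.
  by congr (derive1 _ x); apply/funext => x'; rewrite pc.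
- by move=> w; have := sc (rcons w true); rewrite pd_word_rcons.
- exists A => x y yA; rewrite /pdx /=.
  have -> : (fun x => chi (x, y)) = (fun _ => 0) by apply/funext => x'; exact: hA.
  exact: (der_derive1 (der_cst (0 : R) x)).
Qed.

Lemma test_pdy chi : test_fun chi -> test_fun (pdy chi).
Proof.
move=> [pc sc [A hA]]; split.
- by move=> x y; rewrite /pdy /=; congr (derive1 _ y); apply/funext => y'; rewrite pc.
- by move=> w; have := sc (rcons w false); rewrite pd_word_rcons.
- exists A => x y yA; rewrite /pdy /=; apply: der_derive1.
  suff e : \forall y' \near y, 0 = chi (x, y') by exact: (near_eq_is_derive e (der_cst (0 : R) y)).
  near=> y'; apply/esym/hA; near: y'.
  have cn : continuous (fun y : R => `|y|) by exact: norm_continuous.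
  exact: (cn y _ (lt_nbhsr yA)).
Unshelve. all: by end_near.
Qed.

Lemma periodic_int chi (n : int) x y : Defs.periodic chi -> chi (x + n%:~R * (2 * pi), y) = chi (x, y).
Proof.
move=> pc; have h (m : nat) x' : chi (x' + m%:R * (2 * pi), y) = chi (x', y).
  elim: m x' => [|m IH] x'; first by rewrite mul0r addr0.
  by rewrite -natr1 mulrDl mul1r addrA pc IH.
case: n => m; first exact: h.
by rewrite NegzE mulrNz -(h m.+1 (x + _)) mulNr subrK.
Qed.

Lemma test_bounded chi : test_fun chi -> exists A B, [/\ 0 <= A, forall z, `|chi z| <= B & forall z, A < `|z.2| -> chi z = 0].
Proof.
move=> [pc sc [A hA]]; have [cc _ _] := sc [::].
have [C C0 hC] := bounded_on_rectangle (- A) A cc.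
exists (Order.max 0 A), C; split; first by rewrite le_max lexx.
  move=> [x y]; have p0 : 0 < 2 * pi :> R by rewrite mulr_gt0 ?pi_gt0.
  have [yA|yA] := ltP A `|y|; first by rewrite hA// normr0.
  rewrite -(periodic_int (- Num.floor (x / (2 * pi))) x y pc); apply: hC; last by rewrite -ler_norml.
  have h1 : (Num.floor (x / (2 * pi)))%:~R * (2 * pi) <= x by rewrite -ler_pdivlMr// floor_le.
  have h2 : x <= (Num.floor (x / (2 * pi)))%:~R * (2 * pi) + 2 * pi.
    rewrite -[X in _ + X](mul1r (2 * pi)) -(mulrDl _ 1) -ler_pdivrMr//.
    by have := floorD1_gt (x / (2 * pi)); rewrite intrD => /ltW.
  by rewrite mulrNz mulNr subr_ge0 h1 lerBlDr addrC.
by move=> [x y] /=; rewrite gt_max => /andP[_ h]; exact: hA.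
Qed.

Lemma integrable_test f chi : L2fun f -> test_fun chi -> cyl.-integrable setT (EFin \o (fun z => f z * chi z)).
Proof.
move=> f2 tc; have [A [B [A0 hB hA]]] := test_bounded tc; have [_ sc _] := tc; have [cc _ _] := sc [::].
exact: (integrable_bounded_support f2 A0 (continuous2_measurable cc) hB hA).
Qed.

Lemma L2fun_xavg f : L2fun f -> L2fun (xavg f).
Proof.
move=> f2; apply: energy_L2fun; first exact: measurable_xavg f2.1.
exact: le_lt_trans (energy_xavg_le f2.1) (L2fun_energy f2).
Qed.

Lemma xavg_adjoint f chi : L2fun f -> test_fun chi -> \int[cyl]_z (xavg f z * chi z) = \int[cyl]_z (f z * xavg chi z).
Proof.
move=> f2 tc; have i1 := integrable_test (L2fun_xavg f2) tc; have i2 := integrable_test f2 (test_xavg tc).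
have [_ [j1 <-]] := Rfubini (m1 := torus) (m2 := mu) i1; have [_ [j2 <-]] := Rfubini (m1 := torus) (m2 := mu) i2.
congr fine; apply: ae_eq_integral => //; [by case/integrableP: j1|by case/integrableP: j2|].
apply: (ae_imp (L2fun_slice_ae f2)) => y fy _ /=; congr (_%:E).
have if_ := integrable_slice f2.1 fy; have [_ sc _] := tc; have [cc _ _] := sc [::].
have ic : torus.-integrable setT (EFin \o (fun x : mR => chi (x, y))).
  have [A [B [_ hB _]]] := test_bounded tc.
  have i0 : torus.-integrable setT (EFin \o (fun _ => 1 : R)) by exact: finite_measure_integrable_cst.
  have mc : measurable_fun setT (fun x : mR => chi (x, y) : mR) by apply: continuous_measurable_fun; exact: cont_slice'.
  by have := integrableM_bounded mc (fun x => hB (x, y)) i0; under eq_fun do rewrite mul1r.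
transitivity (xavg f (0, y) * \int[torus]_x chi (x, y)); first by rewrite -(RintegralZl _ measurableT ic).
transitivity (xavg chi (0, y) * \int[torus]_x f (x, y)).
  by rewrite !xavgE; ring.
by rewrite -(RintegralZl _ measurableT if_); apply: eq_Rintegral => x _; rewrite mulrC.
Qed.

Lemma xavg_pdx chi : test_fun chi -> xavg (pdx chi) = (fun _ => 0).
Proof.
move=> [pc sc _]; have [_ dx _] := sc [::]; have [cx _ _] := sc [:: true].
apply/funext => -[x y]; rewrite xavgE Rintegral_torus; last first.
  by apply: continuous_measurable_fun; exact: (cont_slice' (g := pdx chi)).
have d x' : is_derive x' (1 : R) (fun x => chi (x, y)) (pdx chi (x', y)).
  by split; [exact: dx|rewrite /pdx derive1E].
have c : continuous (fun x => pdx chi (x, y)) by exact: (cont_slice' (g := pdx chi)).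
rewrite (Rintegral_period d c).
by have := pc 0 y; rewrite add0r => ->; rewrite subrr mulr0.
Qed.

Lemma L2fun_L1loc f : Defs.periodic f -> L2fun f -> in_L1loc f.
Proof.
move=> pf f2; split=> //; first exact: f2.1.
move=> A; pose S := (setT `*` `[- A, A]%classic : set (mR * mR)).
have mS : measurable S by apply: measurableX => //; exact: measurable_itv.
have mi : measurable_fun setT (\1_S : mR * mR -> mR) by exact: measurable_indic.
have i := integrable_bounded_support (w := \1_S) (A := `|A|) (B := 1) f2 (normr_ge0 A) mi.
rewrite integrable_mkcond//.
have h1 z : `|\1_S z : R| <= 1 by rewrite indicE; case: (_ \in _); rewrite ?normr1 ?normr0.
have h2 z : `|A| < `|z.2| -> \1_S z = 0 :> R.
  move=> hz; rewrite indicE memNset//= => -[_]; rewrite /= in_itv /= -ler_norml => hA.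
  by move: hz; rewrite ltNge (le_trans hA)// ler_norm.
apply: eq_integrable (i h1 h2) => // z _; rewrite patchE /= indicE.
by case: (z \in S); rewrite ?mulr1// mulr0.
Qed.

(** Averaging is symmetric and commutes with the y-derivative, and the average of an x-derivative
    vanishes by periodicity. Testing against chi minus its average gives the claim. *)
Lemma weak_grad_nonzero_modes f gx gy : L2fun f -> in_L2 gx -> in_L2 gy -> weak_grad f gx gy ->
  weak_grad (nonzero_modes f) (nonzero_modes gx) (nonzero_modes gy).
Proof.
move=> f2 gx2 gy2 [_ _ hx hy]; have gx2' := in_L2_L2fun gx2; have gy2' := in_L2_L2fun gy2.
have pz g : Defs.periodic g -> Defs.periodic (nonzero_modes g).
  by move=> pg x y; rewrite -[LHS]/(g (x + 2 * pi, y) - xavg g (x, y)) pg.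
have nz g chi : L2fun g -> test_fun chi ->
    distr_of (nonzero_modes g) chi = distr_of g chi - distr_of g (xavg chi).
  move=> g2 tc; rewrite /distr_of -(xavg_adjoint g2 tc).
  rewrite -(RintegralB measurableT (integrable_test g2 tc) (integrable_test (L2fun_xavg g2) tc)).
  by apply: eq_Rintegral => z _; rewrite -mulrBl.
have d0 g : distr_of g (fun _ => 0) = 0.
  rewrite /distr_of; have -> : (fun z => g z * 0) = (fun _ => 0) by apply/funext => z; rewrite mulr0.
  by rewrite /Rintegral integral0.
split.
- by apply: L2fun_L1loc; [exact: pz gx2.1|exact: L2fun_nonzero_modes].
- by apply: L2fun_L1loc; [exact: pz gy2.1|exact: L2fun_nonzero_modes].
- move=> chi tc; rewrite (nz _ _ gx2' tc) -(hx _ tc) -(hx _ (test_xavg tc)) /Dx (nz _ _ f2 (test_pdx tc)).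
  by rewrite (xavg_pdx tc) pdx_xavg d0 !subr0 oppr0 subr0.
- move=> chi tc; rewrite (nz _ _ gy2' tc) -(hy _ tc) -(hy _ (test_xavg tc)) /Dy (nz _ _ f2 (test_pdy tc)).
  have [_ sc _] := tc; have [c1 _ d1] := sc [::]; have [c2 _ _] := sc [:: false].
  by rewrite (pdy_xavg c1 c2 d1) opprB opprK addrC.
Qed.

End TestFunctions.

(** * Summation over the modes *)

Section EnergySums.
Variable R : realType.
Local Notation mu := (@lebesgue_measure R).
Local Notation mR := (measurableTypeR R).
Local Notation torus := (@torus R).
Local Notation cyl := (@cylinder R).
Implicit Types (f g : R * R -> R).

Lemma integer_mode_nat (k : nat) : @integer_mode R k.+1%:R.
Proof. by split; [have := mode2pi_int R k.+1 0; rewrite subr0|rewrite pnatr_eq0]. Qed.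

Lemma ge1_norm_nat (k : nat) : 1 <= `|k.+1%:R : R|.
Proof. by rewrite ger0_norm// ler1n. Qed.

Lemma ramp_nonzero_modes (k : R) f : integer_mode k -> L2fun f -> ramp k (nonzero_modes f) = ramp k f.
Proof.
move=> [hk k0] f2; have [c0 s0] := torus_wave hk k0.
congr fine; apply: ae_eq_integral => //.
- by apply/measurable_EFinP; apply: measurable_amp; exact: (L2fun_nonzero_modes f2).1.
- by apply/measurable_EFinP; apply: measurable_amp; exact: f2.1.
apply: (ae_imp (L2fun_slice_ae f2)) => y fy _; congr (_%:E).
by rewrite /amp (mode_nonzero_modes (unit_wave_cos R) f2.1 fy c0) (mode_nonzero_modes (unit_wave_sin R) f2.1 fy s0).
Qed.

Definition renergy f : R := fine (energy f).

Lemma renergy_ge0 f : 0 <= renergy f.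
Proof. by apply: fine_ge0; exact: energy_ge0. Qed.

Lemma renergyE f : L2fun f -> energy f = (renergy f)%:E.
Proof. by move=> f2; rewrite fineK// ge0_fin_numE ?energy_ge0// L2fun_energy. Qed.

Lemma nonzero_modes_mean0 f y : L2fun (nonzero_modes f) -> (slice_energy (nonzero_modes f) y < +oo)%E ->
  \int[torus]_x nonzero_modes f (x, y) = 0.
Proof.
move=> n2 ny; have i1 := integrable_slice n2.1 ny.
have i2 : torus.-integrable setT (EFin \o (fun _ => xavg f (0, y))) by exact: finite_measure_integrable_cst.
have := RintegralD measurableT i1 i2.
have -> : \int[torus]_x (nonzero_modes f (x, y) + xavg f (0, y)) = \int[torus]_x f (x, y).
  by apply: eq_Rintegral => x _; rewrite -[nonzero_modes f (x, y)]/(f (x, y) - xavg f (x, y)) !xavgE subrK.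
rewrite Rintegral_torus_cst xavgE mulrA mulfV ?mul1r; last by rewrite mulf_neq0// gt_eqF ?pi_gt0.
by move=> h; apply: (@addIr _ (\int[torus]_x f (x, y))); rewrite -h add0r.
Qed.

Lemma parseval_ramp f : L2fun (nonzero_modes f) ->
  (fun n => \sum_(0 <= k < n) ramp k.+1%:R (nonzero_modes f)) @ \oo --> pi * renergy (nonzero_modes f).
Proof.
move=> n2; have m0 : {ae mu, forall y, \int[torus]_x nonzero_modes f (x, y) = 0}.
  by apply: (ae_imp (L2fun_slice_ae n2)) => y ny; exact: nonzero_modes_mean0.
have := parseval_cylinder n2 m0; rewrite (renergyE n2) -EFinM.
have e k : modesq (fun _ => 1) k (nonzero_modes f) = (ramp k (nonzero_modes f))%:E.
  rewrite /ramp EFin_Rintegral; last exact: integrable_amp.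
  by apply: eq_integral => y _; rewrite expr1n mul1r.
under eq_eseriesr do rewrite e.
move=> h.
have c : (fun n => \sum_(0 <= k < n) (ramp k.+1%:R (nonzero_modes f))%:E)%E @ \oo --> (\sum_(0 <= k <oo) (ramp k.+1%:R (nonzero_modes f))%:E)%E.
  by apply: is_cvg_nneseries => k _ _; rewrite lee_fin ramp_ge0.
rewrite h in c; have /fine_cvgP[_] := c.
have -> // : fine \o (fun n => \sum_(0 <= k < n) (ramp k.+1%:R (nonzero_modes f))%:E)%E = (fun n => \sum_(0 <= k < n) ramp k.+1%:R (nonzero_modes f)).
by apply/funext => n /=; rewrite sumEFin.
Qed.

Lemma energy_nonzero_modes_le f : L2fun f -> renergy (nonzero_modes f) <= renergy f.
Proof.
move=> f2; have n2 := L2fun_nonzero_modes f2.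
rewrite -lee_fin -(renergyE f2) -(renergyE n2) (energy_slices f2.1) (energy_slices n2.1).
apply: ae_ge0_le_integral => //.
- by move=> y _; exact: slice_energy_ge0.
- exact: measurable_slice_energy n2.1.
- by move=> y _; exact: slice_energy_ge0.
- exact: measurable_slice_energy f2.1.
apply: (ae_imp2 (L2fun_slice_ae f2) (L2fun_slice_ae n2)) => y fy ny _.
have i1 := integrable_slice n2.1 ny; have m1 := nonzero_modes_mean0 n2 ny.
have isq g : measurable_fun setT (g : mR * mR -> mR) -> (slice_energy g y < +oo)%E -> torus.-integrable setT (EFin \o (fun x => g (x, y) ^+ 2)).
  by move=> mg gy; apply: ge0_fin_integrable; [apply: measurable_funX; exact: measurable_slice mg|by move=> x; exact: sqr_ge0|].
have j1 := isq _ n2.1 ny; have j2 := isq _ f2.1 fy.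
rewrite /slice_energy -(EFin_Rintegral j1) -(EFin_Rintegral j2) lee_fin.
have jz := integrableRZ (2 * xavg f (0, y)) i1.
have jd := integrableRD j1 jz.
(* The added term has mean zero and completes the square: with c the average, the integrand becomes
   f^2 - c^2. *)
have -> : \int[torus]_x nonzero_modes f (x, y) ^+ 2 = \int[torus]_x (nonzero_modes f (x, y) ^+ 2 + 2 * xavg f (0, y) * nonzero_modes f (x, y)).
  by rewrite (RintegralD measurableT j1 jz) (RintegralZl _ measurableT i1) m1 mulr0 addr0.
apply: le_Rintegral => // x _; rewrite -[nonzero_modes f (x, y)]/(f (x, y) - xavg f (x, y)) !xavgE.
by move: (_ * _) (f (x, y)) => a b; have := sqr_ge0 a; nra.
Qed.

Lemma ramp_sum_le f n : L2fun f -> \sum_(0 <= k < n) ramp k.+1%:R f <= pi * renergy f.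
Proof.
move=> f2; have n2 := L2fun_nonzero_modes f2; have c := parseval_ramp n2.
have -> : \sum_(0 <= k < n) ramp k.+1%:R f = \sum_(0 <= k < n) ramp k.+1%:R (nonzero_modes f).
  by apply: eq_bigr => k _; rewrite (ramp_nonzero_modes (integer_mode_nat k) f2).
apply: (@le_trans _ _ (pi * renergy (nonzero_modes f))); last by rewrite ler_wpM2l ?pi_ge0 ?energy_nonzero_modes_le.
have nd : nondecreasing_seq (fun n => \sum_(0 <= k < n) ramp k.+1%:R (nonzero_modes f)).
  by apply/nondecreasing_seqP => m; rewrite big_nat_recr//= lerDl ramp_ge0.
have := nondecreasing_cvgn_le nd (cvgP _ c) n; congr (_ <= _).
by apply: cvg_lim.
Qed.

Lemma sum_mode_le (u1 u2 u3 u4 v1 v2 v3 v4 : nat -> R) (a K b : R) n :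
  (forall k, u1 k + a * (u2 k + u3 k) + u4 k <= K * (v1 k + b * (v2 k + v3 k) + v4 k)) ->
  let s := fun u : nat -> R => \sum_(0 <= k < n) u k in
  s u1 + a * (s u2 + s u3) + s u4 <= K * (s v1 + b * (s v2 + s v3) + s v4).
Proof.
move=> h /=; elim: n => [|n]; first by rewrite !big_geq//= !addr0 !mulr0 !addr0 mulr0.
by rewrite !(big_nat_recr n)//=; have := h n; lra.
Qed.

(** Parseval's equality is needed on the left only, where all fields have zero average; on the
    right, partial sums are bounded by the full energy. *)
Lemma energies_le (f1 f2 f3 f4 g1 g2 g3 g4 : R * R -> R) (a K b : R) :
  L2fun (nonzero_modes f1) -> L2fun (nonzero_modes f2) -> L2fun (nonzero_modes f3) -> L2fun (nonzero_modes f4) ->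
  L2fun g1 -> L2fun g2 -> L2fun g3 -> L2fun g4 -> 0 <= K -> 0 <= b ->
  (forall k : nat, let r := ramp k.+1%:R in
    r (nonzero_modes f1) + a * (r (nonzero_modes f2) + r (nonzero_modes f3)) + r (nonzero_modes f4) <=
    K * (r g1 + b * (r g2 + r g3) + r g4)) ->
  renergy (nonzero_modes f1) + a * (renergy (nonzero_modes f2) + renergy (nonzero_modes f3)) + renergy (nonzero_modes f4) <=
  K * (renergy g1 + b * (renergy g2 + renergy g3) + renergy g4).
Proof.
move=> l1 l2 l3 l4 m1 m2 m3 m4 K0 bb0 h.
have p0 := pi_gt0 R; rewrite -(ler_pM2l p0).
have e1 (q1 q2 q3 q4 : R) : pi * (q1 + a * (q2 + q3) + q4) = pi * q1 + a * (pi * q2 + pi * q3) + pi * q4 by ring.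
pose sm f n := \sum_(0 <= k < n) ramp k.+1%:R (nonzero_modes f).
have cv : (fun n => sm f1 n + a * (sm f2 n + sm f3 n) + sm f4 n) @ \oo --> pi * renergy (nonzero_modes f1)
    + a * (pi * renergy (nonzero_modes f2) + pi * renergy (nonzero_modes f3)) + pi * renergy (nonzero_modes f4).
  by apply: cvgD; [apply: cvgD; [exact: parseval_ramp|apply: cvgMr; apply: cvgD; exact: parseval_ramp]|exact: parseval_ramp].
rewrite e1; apply: (@cvg_le_bound R (fun n => sm f1 n + a * (sm f2 n + sm f3 n) + sm f4 n) _ _ 0 cv) => n; rewrite mul0r addr0 /sm.
have e2 (q1 q2 q3 q4 : R) : pi * (K * (q1 + b * (q2 + q3) + q4)) = K * (pi * q1 + b * (pi * q2 + pi * q3) + pi * q4) by ring.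
rewrite e2; have s g (g2' : L2fun g) := ramp_sum_le n g2'.
apply: (@le_trans _ _ (K * (\sum_(0 <= k < n) ramp k.+1%:R g1 + b * (\sum_(0 <= k < n) ramp k.+1%:R g2 + \sum_(0 <= k < n) ramp k.+1%:R g3)
   + \sum_(0 <= k < n) ramp k.+1%:R g4))); last first.
  by apply: ler_wpM2l K0 _ _ _; apply: lerD; [apply: lerD; [exact: s|apply: ler_wpM2l bb0 _ _ _; apply: lerD; exact: s]|exact: s].
exact: (@sum_mode_le (fun k => ramp k.+1%:R (nonzero_modes f1)) (fun k => ramp k.+1%:R (nonzero_modes f2)) (fun k => ramp k.+1%:R (nonzero_modes f3))
  (fun k => ramp k.+1%:R (nonzero_modes f4)) (fun k => ramp k.+1%:R g1) (fun k => ramp k.+1%:R g2) (fun k => ramp k.+1%:R g3) (fun k => ramp k.+1%:R g4) a K b n h).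
Qed.

Lemma L2norm_energy f : L2fun f -> L2norm f = (Num.sqrt (renergy f))%:E.
Proof. exact: L2norm_fin. Qed.

Lemma energy_vec f g : measurable_fun setT (f : mR * mR -> mR) -> measurable_fun setT (g : mR * mR -> mR) ->
  energy (fun z => Num.sqrt (f z ^+ 2 + g z ^+ 2)) = (energy f + energy g)%E.
Proof.
move=> mf mg; rewrite /energy; under eq_integral do rewrite sqr_sqrtr ?addr_ge0 ?sqr_ge0// EFinD.
by apply: ge0_integralRD; [exact: measurable_funX|exact: measurable_funX|move=> z; exact: sqr_ge0|move=> z; exact: sqr_ge0].
Qed.

Lemma measurable_vec f g : measurable_fun setT (f : mR * mR -> mR) -> measurable_fun setT (g : mR * mR -> mR) ->
  measurable_fun setT ((fun z => Num.sqrt (f z ^+ 2 + g z ^+ 2)) : mR * mR -> mR).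
Proof.
move=> mf mg; apply: (measurableT_comp (f := @Num.sqrt R)); first by apply: continuous_measurable_fun; exact: sqrt_continuous.
by apply: measurable_funD; exact: measurable_funX.
Qed.

Lemma L2norm_vecE f g : L2fun f -> L2fun g -> L2norm_vec f g = (Num.sqrt (renergy f + renergy g))%:E.
Proof.
move=> f2 g2; rewrite /L2norm_vec (L2normE (measurable_vec f2.1 g2.1)) (energy_vec f2.1 g2.1) (renergyE f2) (renergyE g2) -EFinD.
by rewrite poweR_EFin powR12_sqrt// addr_ge0 ?renergy_ge0.
Qed.

Lemma L2norm_vec_fin f g : measurable_fun setT (f : mR * mR -> mR) -> measurable_fun setT (g : mR * mR -> mR) ->
  (L2norm_vec f g < +oo)%E -> L2fun f /\ L2fun g.
Proof.
move=> mf mg; rewrite /L2norm_vec (L2normE (measurable_vec mf mg)) (energy_vec mf mg).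
move=> h; have s0 : (energy f + energy g < +oo)%E.
  rewrite ltNge leye_eq; apply/negP => /eqP e; move: h; rewrite e poweRyr ?ltxx//.
split; apply: energy_L2fun => //; apply: le_lt_trans s0.
  by rewrite leeDl// energy_ge0.
by rewrite leeDr// energy_ge0.
Qed.

End EnergySums.

(** * Explicit rates and constants *)

Section Assembly.
Variable R : realType.

(** 6 * 2 <= 16: the 6 compares the square of a sum of norms with the energies, and the 2 is the
    coefficient of the initial gradient. *)
Lemma norm_compare (L P G m a0 b0 c0 Ct : R) : 0 <= G -> 0 <= m -> 0 <= a0 -> 0 <= b0 -> 0 <= c0 -> 0 <= Ct -> 0 <= L ->
  L ^+ 2 <= 6 * P -> P <= G * (a0 + 2 * m ^+ 2 * b0 + c0) -> 16 * G <= Ct ^+ 2 ->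
  L <= Ct * (Num.sqrt a0 + m * Num.sqrt b0 + Num.sqrt c0).
Proof.
move=> G0 m0 ha hb hc Ct0 L0 h1 h2 h3.
have sa := sqrtr_ge0 a0; have sb := sqrtr_ge0 b0; have sc := sqrtr_ge0 c0.
have D0 : 0 <= Num.sqrt a0 + m * Num.sqrt b0 + Num.sqrt c0 by rewrite !addr_ge0 ?mulr_ge0.
rewrite -(@ler_pXn2r _ 2) ?nnegrE ?mulr_ge0//.
have ea := sqr_sqrtr ha; have eb := sqr_sqrtr hb; have ec := sqr_sqrtr hc.
have hD : a0 + m ^+ 2 * b0 + c0 <= (Num.sqrt a0 + m * Num.sqrt b0 + Num.sqrt c0) ^+ 2.
  rewrite -{1}ea -{1}eb -{1}ec -exprMn; have := mulr_ge0 m0 sb; move: (Num.sqrt a0) (Num.sqrt c0) (m * _) sa sc => u w v u0 w0 v0.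
  by have := mulr_ge0 u0 w0; have := mulr_ge0 u0 v0; have := mulr_ge0 v0 w0; nra.
have q0 : 0 <= m ^+ 2 * b0 by rewrite mulr_ge0 ?sqr_ge0.
set S := a0 + m ^+ 2 * b0 + c0 in hD; have S0 : 0 <= S by rewrite /S !addr_ge0.
rewrite exprMn; apply: le_trans (ler_wpM2l (sqr_ge0 Ct) hD).
apply: le_trans (ler_wpM2r S0 h3); apply: (le_trans h1).
have h4 : G * (a0 + 2 * m ^+ 2 * b0 + c0) <= G * (2 * S) by apply: ler_wpM2l => //; rewrite /S; move: ha hc q0; lra.
have h5 : 0 <= G * S by exact: mulr_ge0.
by move: h2 h4 h5; rewrite (mulrCA G) -(mulrA 16); lra.
Qed.

(** Growth is traded for a small exponential through 1 + s <= 144 exp(s / 144). The value 144 makes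
    the cube cost exp(s / 48), and - 1/12 + 1/48 = - 1/16 is twice the rate 1/32 of the norms. *)
Lemma growth_bound (r T : R) : 0 < r -> r <= 1 -> 0 <= T ->
  2 + 2 * T ^+ 2 <= (2 * r^-1 * (144 * expR (r * T / 144))) ^+ 2.
Proof.
move=> r0 r1 T0; have s0 : 0 <= r * T by rewrite mulr_ge0// ltW.
have h : 1 + r * T <= 144 * expR (r * T / 144).
  have := expR_ge1Dx (r * T / 144); lra.
have ri : 1 <= r^-1 by rewrite invf_ge1.
have rr : r^-1 * r = 1 by rewrite mulVf// gt_eqF.
have h2 : 2 + 2 * T ^+ 2 <= (2 * r^-1 * (1 + r * T)) ^+ 2.
  have -> : 2 * r^-1 * (1 + r * T) = 2 * (r^-1 + T) by field; rewrite gt_eqF.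
  by move: ri; move: (r^-1) => q q1; nra.
apply: (le_trans h2); rewrite lerXn2r ?nnegrE ?mulr_ge0 ?invr_ge0 ?expR_ge0 ?(ltW r0)//; first by lra.
by apply: ler_wpM2l; rewrite ?mulr_ge0 ?invr_ge0 ?(ltW r0).
Qed.

Lemma expR_half_ln_le (y z c : R) : 0 <= c -> 0 < y -> 0 < z -> y <= z ^+ 2 -> expR (c * ln y) <= expR (2 * c * ln z).
Proof.
move=> c0 y0 z0 yz; rewrite ler_expR (mulrC 2) -mulrA; apply: ler_wpM2l => //.
have := yz; rewrite -ler_ln ?posrE ?exprn_gt0// => h; apply: (le_trans h).
by rewrite lnXn// mulr_natl.
Qed.

Let Ce : R := 104 * expR 13500.

(** As pi <= 4, the exponent is at most 641 + 160 M + 160 M^2. The bounds M <= M^2 + 1/4 and 160 M^2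
    <= M^4 + 6400, the latter taken twice, turn it into less than 13500 + 2 M^4. *)
Lemma mode_const_le (M : R) : 0 < M -> mode_const M <= Ce * ((1 + M) ^+ 4 * expR (M ^+ 4)) ^+ 2.
Proof.
move=> M0; rewrite /mode_const /Ce.
have p4 : (pi : R) <= 4.
  by have := @pihalf_lt2 R; lra.
have pge := pi_ge0 R.
have he : (12^-1 + 4 * (40 + 10 * M + 10 * M ^+ 2)) * pi <= 13500 + 2 * M ^+ 4.
  apply: (@le_trans _ _ ((12^-1 + 4 * (40 + 10 * M + 10 * M ^+ 2)) * 4)).
    by apply: ler_wpM2l => //; rewrite !addr_ge0 ?mulr_ge0 ?addr_ge0 ?mulr_ge0 ?sqr_ge0// ltW.
  have -> : M ^+ 4 = (M ^+ 2) ^+ 2 by ring.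
  have h1 := sqr_ge0 (M - 2^-1); have h2 := sqr_ge0 (M ^+ 2 - 80).
  have e1 : (M - 2^-1) ^+ 2 = M ^+ 2 - M + 4^-1 by field.
  have e2 : (M ^+ 2 - 80) ^+ 2 = (M ^+ 2) ^+ 2 - 160 * M ^+ 2 + 6400 by ring.
  rewrite e1 in h1; rewrite e2 in h2; move: h1 h2; lra.
have h3 : (1 + M ^+ 2) ^+ 2 <= (1 + M) ^+ 4.
  have -> : (1 + M) ^+ 4 = ((1 + M) ^+ 2) ^+ 2 by ring.
  by rewrite lerXn2r ?nnegrE ?addr_ge0 ?sqr_ge0//; nra.
have h4 : (1 + M) ^+ 4 <= ((1 + M) ^+ 4) ^+ 2.
  by rewrite [leRHS]expr2 ler_peMl ?exprn_ge0 ?addr_ge0 ?(ltW M0)// exprn_ege1// lerDl ltW.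
have h5 := le_trans h3 h4; have h6 : expR ((12^-1 + 4 * (40 + 10 * M + 10 * M ^+ 2)) * pi) <= expR 13500 * expR (M ^+ 4) ^+ 2.
  by rewrite -expRM_natl -expRD ler_expR; apply: (le_trans he); lra.
have -> : 104 * expR 13500 * ((1 + M) ^+ 4 * expR (M ^+ 4)) ^+ 2 = 104 * ((1 + M) ^+ 4) ^+ 2 * (expR 13500 * expR (M ^+ 4) ^+ 2) by rewrite exprMn; ring.
apply: ler_pM; [by apply: mulr_ge0 (sqr_ge0 _)|exact: expR_ge0|by apply: ler_wpM2l|exact: h6].
Qed.

Lemma rate_step (mc A1 A2 q E Cn K : R) : mc <= Ce * (A1 * A2) ^+ 2 -> 0 <= Cn -> 16 * Cn * Ce <= K ^+ 2 ->
  16 * (mc * (Cn * q ^+ 2) * E ^+ 2) <= (K * A1 * A2 * q * E) ^+ 2.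
Proof.
move=> h1 Cn0 h2; have e : (K * A1 * A2 * q * E) ^+ 2 = K ^+ 2 * ((A1 * A2) ^+ 2 * (q ^+ 2 * E ^+ 2)) by ring.
have t0 : 0 <= Cn * (q ^+ 2 * E ^+ 2) by rewrite mulr_ge0// mulr_ge0 ?sqr_ge0.
rewrite e; apply: (@le_trans _ _ (16 * Cn * Ce * ((A1 * A2) ^+ 2 * (q ^+ 2 * E ^+ 2)))); last first.
  by apply: ler_wpM2r h2; apply: mulr_ge0 (sqr_ge0 _) _; rewrite mulr_ge0 ?sqr_ge0.
have -> : 16 * (mc * (Cn * q ^+ 2) * E ^+ 2) = 16 * (mc * (Cn * (q ^+ 2 * E ^+ 2))) by ring.
have -> : 16 * Cn * Ce * ((A1 * A2) ^+ 2 * (q ^+ 2 * E ^+ 2)) = 16 * (Ce * (A1 * A2) ^+ 2 * (Cn * (q ^+ 2 * E ^+ 2))) by ring.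
by apply: ler_wpM2l => //; exact: ler_wpM2r t0 _ _ h1.
Qed.

(** 128 * 144^3 is 16 times the constant 8 * 144^3 of [core3]. Being at least 1, the whole is below
    its own square, which avoids taking a root. *)
Definition decay_const : R := 128 * 144 ^+ 3 * Ce.

Let Ce1 : 1 <= Ce.
Proof. by rewrite /Ce; have := expR_ge1Dx (13500 : R); lra. Qed.

Lemma decay_const_sqr (c : R) : c <= 128 * 144 ^+ 3 -> c * Ce <= decay_const ^+ 2.
Proof.
move=> hc; have C0 : 0 <= Ce := le_trans ler01 Ce1.
have h : decay_const <= decay_const ^+ 2.
  by rewrite [leRHS]expr2 ler_peMl// /decay_const; move: Ce1; move: Ce => C; lra.
by apply: le_trans h; exact: ler_wpM2r.
Qed.

Lemma decay_const_gt0 : 0 < decay_const.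
Proof. by rewrite /decay_const; have := Ce1; move: Ce => C; lra. Qed.

Section Rates.
Variables (nu M T : R).
Hypotheses (nu0 : 0 < nu) (nu1 : nu <= 1) (M0 : 0 < M) (T0 : 0 <= T).
Local Notation r := (nu `^ 3^-1).

Lemma cube_root_gt0 : 0 < r. Proof. by rewrite powR_gt0. Qed.
Lemma cube_root_le1 : r <= 1.
Proof. have h : r <= 1 `^ 3^-1 by rewrite ge0_ler_powR ?nnegrE ?invr_ge0// ltW.
by move: h; rewrite powR1. Qed.
Lemma cube_rootK : nu = r ^+ 3.
Proof. by rewrite -powR_mulrn ?powR_ge0// -powRrM mulVf// powRr1// ltW. Qed.

Let r0 := cube_root_gt0.
Let r1 := cube_root_le1.
Let z : R := 2 * r^-1 * (144 * expR (r * T / 144)).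
Let z0 : 0 < z. Proof. by rewrite /z !mulr_gt0 ?invr_gt0 ?expR_gt0. Qed.
Let y0 : 0 < 2 + 2 * T ^+ 2 :> R. Proof. by rewrite ltr_pwDl// mulr_ge0// sqr_ge0. Qed.
Let yz : 2 + 2 * T ^+ 2 <= z ^+ 2. Proof. exact: growth_bound. Qed.
Let mc0 : 0 <= mode_const M.
Proof. by rewrite /mode_const mulr_ge0 ?expR_ge0// mulr_ge0 ?sqr_ge0. Qed.

Let sqr_powR (a : R) : (nu `^ a) ^+ 2 = nu `^ (a * 2).
Proof. by rewrite powRrM powR_mulrn// powR_ge0. Qed.

Let Ehalf : expR (- (r / 32) * T) ^+ 2 = expR (- (r * T / 16)).
Proof. by rewrite -expRM_natl; congr expR; field. Qed.

Let core3 : expR (3 / 2 * ln (2 + 2 * T ^+ 2)) * expR (- (r * T / 12)) <= 8 * 144 ^+ 3 * nu^-1 * expR (- (r * T / 16)).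
Proof.
have c0 : 0 <= 3 / 2 :> R by lra.
have := expR_half_ln_le c0 y0 z0 yz.
have -> : expR (2 * (3 / 2) * ln z) = z ^+ 3.
  have -> : 2 * (3 / 2) * ln z = 3%:R * ln z by field.
  by rewrite expRM_natl lnK ?posrE.
have -> : z ^+ 3 = 8 * 144 ^+ 3 * nu^-1 * expR (r * T / 48).
  have -> : nu^-1 = r^-1 ^+ 3 by rewrite exprVn -cube_rootK.
  have -> : r * T / 48 = 3%:R * (r * T / 144) by field.
  by rewrite expRM_natl /z; move: (expR _) => q; field; rewrite gt_eqF.
move=> h; apply: (le_trans (ler_wpM2r (expR_ge0 _) h)); rewrite -(mulrA (8 * 144 ^+ 3 * nu^-1)) -expRD.
have -> : r * T / 48 - r * T / 12 = - (r * T / 16) by field.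
exact: lexx.
Qed.

(** A single power of z suffices: 288 = 2 * 144, and 1/144 - 1/12 is below - 1/16. *)
Let core1 : expR (2^-1 * ln (2 + 2 * T ^+ 2)) * expR (- (r * T / 12)) <= 288 * r^-1 * expR (- (r * T / 16)).
Proof.
have c0 : 0 <= 2^-1 :> R by lra.
have := expR_half_ln_le c0 y0 z0 yz; rewrite mulfV// mul1r lnK ?posrE// => h.
apply: (le_trans (ler_wpM2r (expR_ge0 _) h)).
have -> : z = 288 * r^-1 * expR (r * T / 144) by rewrite /z; ring.
have s0 : 0 <= r * T by rewrite mulr_ge0// ltW.
have h2 : expR (r * T / 144) * expR (- (r * T / 12)) <= expR (- (r * T / 16)).
  by rewrite -expRD ler_expR; move: (r * T) s0 => s s0; lra.
have q0 : 0 <= 288 * r^-1 by apply: mulr_ge0; [exact: ler0n|rewrite invr_ge0; exact: ltW r0].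
apply: le_trans (ler_wpM2l q0 h2).
by rewrite mulrA.
Qed.

Lemma growth_rate : 16 * (growth M T * damping r T) <=
  (decay_const * (1 + M) ^+ 4 * expR (M ^+ 4) * nu `^ (- 2^-1) * expR (- (r / 32) * T)) ^+ 2.
Proof.
have C0 : 0 <= 8 * 144 ^+ 3 :> R by lra.
have CK : 16 * (8 * 144 ^+ 3) * Ce <= decay_const ^+ 2 by apply: decay_const_sqr; lra.
apply: le_trans (rate_step (nu `^ (- 2^-1)) (expR (- (r / 32) * T)) (mode_const_le M0) C0 CK).
rewrite Ehalf sqr_powR mulNr mulVf// powR_inv1 ?(ltW nu0)// /growth /damping.
move: (mode_const M) mc0 core3 => mc m0 h; apply: ler_wpM2l => //.
by rewrite -!(mulrA mc); exact: ler_wpM2l.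
Qed.

Lemma growth_div_rate : 16 * (3 * growth_div M T * damping r T) <=
  (decay_const * (1 + M) ^+ 4 * expR (M ^+ 4) * nu `^ (- 6^-1) * expR (- (r / 32) * T)) ^+ 2.
Proof.
have C0 : 0 <= 3 * 288 :> R by lra.
have CK : 16 * (3 * 288) * Ce <= decay_const ^+ 2 by apply: decay_const_sqr; lra.
apply: le_trans (rate_step (nu `^ (- 6^-1)) (expR (- (r / 32) * T)) (mode_const_le M0) C0 CK).
have e6 : - 6^-1 * 2 = - 3^-1 :> R by field.
rewrite Ehalf sqr_powR e6 powRN /growth_div /damping.
move: (mode_const M) mc0 core1 => mc m0 h; apply: ler_wpM2l => //.
have h3 := ler_wpM2l (mulr_ge0 (ler0n R 3) m0) h.
apply: (le_trans (y := 3 * mc * (expR (2^-1 * ln (2 + 2 * T ^+ 2)) * expR (- (r * T / 12))))).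
  by rewrite le_eqVlt !mulrA eqxx.
apply: (le_trans h3); rewrite le_eqVlt; apply/orP; left; apply/eqP; ring.
Qed.

End Rates.

End Assembly.

(** * From energies to norms *)

Section Norms.
Variable R : realType.

Lemma sqr_norm3_le (a b c m : R) : 0 <= a -> 0 <= b -> 0 <= c -> 0 <= m ->
  (Num.sqrt a + m * Num.sqrt b + Num.sqrt c) ^+ 2 <= 6 * (a + m ^+ 2 / 2 * b + c).
Proof.
move=> a0 b0 c0 m0; rewrite -{2}(sqr_sqrtr a0) -{2}(sqr_sqrtr b0) -{2}(sqr_sqrtr c0).
have -> : m ^+ 2 / 2 * Num.sqrt b ^+ 2 = (m * Num.sqrt b) ^+ 2 / 2 by field.
move: (Num.sqrt a) (m * _) (Num.sqrt c) => u v w.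
by have := sqr_ge0 (u - v); have := sqr_ge0 (u - w); have := sqr_ge0 (v - w); have := sqr_ge0 u; have := sqr_ge0 w; nra.
Qed.

Lemma sqr_norm2_le (a b c m : R) : 0 <= a -> 0 <= b -> 0 <= c -> 0 <= m ->
  (Num.sqrt (a + c) + m * Num.sqrt b) ^+ 2 <= 6 * (a + m ^+ 2 / 2 * (b + b) + c).
Proof.
move=> a0 b0 c0 m0; have ac : 0 <= a + c by exact: addr_ge0.
have -> : a + m ^+ 2 / 2 * (b + b) + c = (a + c) + m ^+ 2 * b by field.
rewrite -{2}(sqr_sqrtr ac) -{2}(sqr_sqrtr b0) -exprMn; move: (Num.sqrt _) (m * _) => u v.
by have := sqr_ge0 (u - v); have := sqr_ge0 u; have := sqr_ge0 v; nra.
Qed.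

(** The initial gradient norm is an infimum over candidates. The bound for each finite candidate
    says that it is at least [x0], so the infimum is too; if the infimum is +oo, so is the
    right-hand side. *)
Lemma ereal_inf_bound (S : set \bar R) (L A C m Ct : R) : 0 < Ct -> 0 < m -> (forall x, S x -> (0 <= x)%E) ->
  (forall x : R, S x%:E -> L <= Ct * (A + m * x + C)) -> (L%:E <= Ct%:E * (A%:E + m%:E * ereal_inf S + C%:E))%E.
Proof.
move=> Ct0 m0 S0 h; pose x0 := (L / Ct - A - C) / m.
have : (x0%:E <= ereal_inf S)%E.
  apply: le_ereal_inf_tmp => -[x|_|/S0//]; last by rewrite leey.
  move=> Sx; rewrite lee_fin /x0 ler_pdivrMr// !lerBlDr ler_pdivrMr//.
  by apply: (le_trans (h x Sx)); rewrite le_eqVlt; apply/orP; left; apply/eqP; ring.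
case: (ereal_inf S) => [x| |] //; last first.
  by move=> _; rewrite mulry gtr0_sg// mul1e addey// addye// mulry gtr0_sg// mul1e leey.
rewrite lee_fin /x0 ler_pdivrMr// !lerBlDr ler_pdivrMr// => hx.
rewrite -!(EFinM, EFinD) lee_fin; apply: (le_trans hx).
by rewrite le_eqVlt; apply/orP; left; apply/eqP; ring.
Qed.

End Norms.

Section SolutionEnergies.
Variables (R : realType) (sp : species) (nu lambda M : R).
Variables (eta ux uy phi psi omega : R -> R * R -> R).
Hypothesis sol : is_solution sp nu lambda M eta ux uy phi psi omega.
Variable r : R.
Hypotheses (M0 : 0 < M) (r0 : 0 < r) (r1 : r <= 1) (nuE : nu = r ^+ 3) (lam0 : 0 <= lambda) (sgM : (nu + lambda) * M ^+ 2 <= 1)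
  (nuM : 16 * nu * M ^+ 2 <= nu + lambda) (sg_half : nu + lambda <= 2^-1).
Variables (T : R) (T0 : 0 <= T).
Local Notation nz := (@nonzero_modes R).

Let mc0 : 0 <= mode_const M.
Proof. by rewrite /mode_const mulr_ge0 ?expR_ge0// mulr_ge0 ?sqr_ge0. Qed.

Lemma growth_ge0 : 0 <= growth M T * damping r T.
Proof. by apply: mulr_ge0 (expR_ge0 _); exact: mulr_ge0 mc0 (expR_ge0 _). Qed.

Lemma growth_div_ge0 : 0 <= 3 * growth_div M T * damping r T.
Proof. by apply: mulr_ge0 (expR_ge0 _); apply: mulr_ge0 => //; exact: mulr_ge0 mc0 (expR_ge0 _). Qed.

Lemma grad_rel_nonzero_modes (k : R) f gx gy : integer_mode k -> L2fun f -> weak_grad (nz f) gx gy -> grad_rel k f gx gy.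
Proof.
move=> hk f2 h; have n2 := L2fun_nonzero_modes f2.
apply: grad_rel_congr (weak_grad_rel hk (L2fun_locint n2) h) => A B b k' zeta d hk' hb.
exact: (pr_nonzero_modes zeta d (L2fun_locint f2) n2 (integer_mode_pm hk hk') hb).
Qed.

Lemma solution_energies : exists gx gy, [/\ weak_grad (nz (eta T)) (nz gx) (nz gy), L2fun (nz gx), L2fun (nz gy) &
  forall hx hy, weak_grad (nz (eta 0)) hx hy -> L2fun hx -> L2fun hy ->
  let D := renergy (nz (psi 0)) + 2 * (M ^+ 2)^-1 * (renergy hx + renergy hy) + renergy (nz (omega 0)) in
  renergy (nz (psi T)) + (M ^+ 2)^-1 / 2 * (renergy (nz gx) + renergy (nz gy)) + renergy (nz (omega T)) <=
    growth M T * damping r T * D /\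
  renergy (nz (ux T)) + (M ^+ 2)^-1 / 2 * (renergy (nz (eta T)) + renergy (nz (eta T))) + renergy (nz (uy T)) <=
    3 * growth_div M T * damping r T * D].
Proof.
have [bj [b0 sb db]] := bump_jet R.
have hj j : exists B, forall y, `|bj j y| <= B by have [B _ hB] := jet_bounded b0 sb db j; exists B.
have [BJ hB] := choice hj.
have [_ [gx [gy [hg gx2 gy2]]]] := sol_eta sol T0.
have gx2' := in_L2_L2fun gx2; have gy2' := in_L2_L2fun gy2.
have e2 t (t0 : 0 <= t) := sol_eta_L2 sol t0; have p2 t (t0 : 0 <= t) := sol_psi_L2 sol t0; have w2 t (t0 : 0 <= t) := sol_omega_L2 sol t0.
have z0 : 0 <= 0 :> R := lexx 0.
have q0 : 0 <= 2 * (M ^+ 2)^-1 by rewrite mulr_ge0 ?invr_ge0 ?sqr_ge0.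
exists gx, gy; split.
- exact: weak_grad_nonzero_modes (e2 _ T0) gx2 gy2 hg.
- exact: L2fun_nonzero_modes.
- exact: L2fun_nonzero_modes.
move=> hx hy h hx2 hy2 D.
have gT (k : nat) : grad_rel (k.+1%:R : R) (eta T) gx gy := weak_grad_rel (integer_mode_nat R k) (L2fun_locint (e2 _ T0)) hg.
have g0 (k : nat) : grad_rel (k.+1%:R : R) (eta 0) hx hy := grad_rel_nonzero_modes (integer_mode_nat R k) (e2 _ z0) h.
have nzr (k : nat) f (f2 : L2fun f) := ramp_nonzero_modes (integer_mode_nat R k) f2.
have N (f : R * R -> R) (f2 : L2fun f) := L2fun_nonzero_modes f2.
split.
  apply: (energies_le (N _ (p2 _ T0)) (N _ gx2') (N _ gy2') (N _ (w2 _ T0)) (N _ (p2 _ z0)) hx2 hy2 (N _ (w2 _ z0)) growth_ge0 q0) => k; cbv zeta.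
  rewrite (nzr k _ (p2 _ T0)) (nzr k _ gx2') (nzr k _ gy2') (nzr k _ (w2 _ T0)) (nzr k _ (p2 _ z0)) (nzr k _ (w2 _ z0)).
  exact: (mode_decay_ramp sol b0 sb db hB M0 r0 r1 nuE lam0 sgM nuM sg_half T0 gx2' gy2' hx2 hy2 (integer_mode_nat R k) (ge1_norm_nat R k) (gT k) (g0 k)).
apply: (energies_le (sol_ux_L2 sol T0) (N _ (e2 _ T0)) (N _ (e2 _ T0)) (sol_uy_L2 sol T0) (N _ (p2 _ z0)) hx2 hy2 (N _ (w2 _ z0)) growth_div_ge0 q0) => k; cbv zeta.
rewrite (nzr k _ (e2 _ T0)) (nzr k _ (p2 _ z0)) (nzr k _ (w2 _ z0)).
exact: (mode_decay_velocity_ramp sol b0 sb db hB M0 r0 r1 nuE lam0 sgM nuM sg_half T0 hx2 hy2 (integer_mode_nat R k) (ge1_norm_nat R k) (gT k) (g0 k)).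
Qed.

Lemma solution_norms (Ct Cd : R) : 0 < Ct -> 0 < Cd -> 16 * (growth M T * damping r T) <= Ct ^+ 2 ->
  16 * (3 * growth_div M T * damping r T) <= Cd ^+ 2 ->
  let Din := (L2norm (nz (psi 0%R)) + (M^-1)%:E * L2norm_grad (nz (eta 0%R)) + L2norm (nz (omega 0%R)))%E in
  (L2norm (nz (psi T)) + (M^-1)%:E * L2norm_grad (nz (eta T)) + L2norm (nz (omega T)) <= Ct%:E * Din)%E /\
  (L2norm_vec (nz (ux T)) (nz (uy T)) + (M^-1)%:E * L2norm (nz (eta T)) <= Cd%:E * Din)%E.
Proof.
move=> Ct0 Cd0 hCt hCd Din; have z0 : 0 <= 0 :> R := lexx 0.
have N (f : R * R -> R) (f2 : L2fun f) := L2fun_nonzero_modes f2.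
have [gx [gy [hg gx2 gy2 hE]]] := solution_energies.
have m0 : 0 < M^-1 by rewrite invr_gt0.
have p0 := N _ (sol_psi_L2 sol z0); have w0 := N _ (sol_omega_L2 sol z0).
have pT := N _ (sol_psi_L2 sol T0); have wT := N _ (sol_omega_L2 sol T0); have eT := N _ (sol_eta_L2 sol T0).
have xT := sol_ux_L2 sol T0; have yT := sol_uy_L2 sol T0.
have rr f := @renergy_ge0 R f.
have cand (x : R) : (exists hx hy, weak_grad (nz (eta 0)) hx hy /\ x%:E = L2norm_vec hx hy) ->
    exists2 b, 0 <= b & x = Num.sqrt b /\
    let D := renergy (nz (psi 0)) + 2 * (M^-1) ^+ 2 * b + renergy (nz (omega 0)) in
    renergy (nz (psi T)) + (M^-1) ^+ 2 / 2 * (renergy (nz gx) + renergy (nz gy)) + renergy (nz (omega T)) <= growth M T * damping r T * D /\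
    renergy (nz (ux T)) + (M^-1) ^+ 2 / 2 * (renergy (nz (eta T)) + renergy (nz (eta T))) + renergy (nz (uy T)) <=
      3 * growth_div M T * damping r T * D.
  move=> [hx [hy [h e]]]; have [l1 l2 _ _] := h.
  have fin : (L2norm_vec hx hy < +oo)%E by rewrite -e ltry.
  have [hx2 hy2] := L2norm_vec_fin (L1loc_measurable l1) (L1loc_measurable l2) fin.
  exists (renergy hx + renergy hy); first exact: addr_ge0.
  split; first by have := e; rewrite (L2norm_vecE hx2 hy2) => -[].
  by rewrite exprVn; exact: (hE _ _ h hx2 hy2).
have S0 x : [set n | exists gx gy, weak_grad (nz (eta 0)) gx gy /\ n = L2norm_vec gx gy] x -> (0 <= x)%E.
  by move=> [hx [hy [_ ->]]]; exact: L2norm_ge0.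
rewrite /Din (L2norm_energy p0) (L2norm_energy w0) (L2norm_energy pT) (L2norm_energy wT) (L2norm_energy eT) (L2norm_vecE xT yT).
split.
- apply: (@le_trans _ _ (Num.sqrt (renergy (nz (psi T))) + M^-1 * Num.sqrt (renergy (nz gx) + renergy (nz gy)) + Num.sqrt (renergy (nz (omega T))))%:E).
    rewrite 2!EFinD EFinM; apply: leeD => //; apply: leeD => //; apply: lee_wpmul2l; first by rewrite lee_fin ltW.
    rewrite -(L2norm_vecE gx2 gy2); apply: ereal_inf_lbound; by exists (nz gx), (nz gy).
  apply: (ereal_inf_bound Ct0 m0 S0) => x /cand [b b0 [-> [h _]]].
  apply: (norm_compare growth_ge0 (ltW m0) (rr _) b0 (rr _) (ltW Ct0) _ _ h hCt).
    by rewrite !addr_ge0 ?sqrtr_ge0// mulr_ge0 ?sqrtr_ge0// ltW.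
  by apply: sqr_norm3_le; rewrite ?rr ?addr_ge0 ?rr// ltW.
- rewrite -EFinM -EFinD; apply: (ereal_inf_bound Cd0 m0 S0) => x /cand [b b0 [-> [_ h]]].
  apply: (norm_compare growth_div_ge0 (ltW m0) (rr _) b0 (rr _) (ltW Cd0) _ _ h hCd).
    by rewrite addr_ge0 ?sqrtr_ge0// mulr_ge0 ?sqrtr_ge0// ltW.
  by apply: sqr_norm2_le; rewrite ?rr// ltW.
Qed.

End SolutionEnergies.

Theorem theorem1p3 (R : realType) :
  exists (K : R) (b : nat), 0 < K /\ (1 <= b)%N /\
  forall (nu lambda M : R), 0 < nu -> 0 <= lambda -> 0 < M ->
  nu + lambda <= 2^-1 ->
  M <= Num.min (nu + lambda)^-1 (nu `^ (- 3^-1)) ->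
  (0 < lambda -> M <= lambda `^ (- 2^-1)) ->
  M ^+ 2 <= Num.min (nu + lambda)^-1
              (Num.min ((nu + lambda) / (16 * nu))
                       (((nu + lambda) / (32 * pi * nu)) `^ 2^-1)) ->
  forall (sp : species) (eta ux uy phi psi omega : R -> R * R -> R),
  is_solution sp nu lambda M eta ux uy phi psi omega ->
  in_H1 (eta 0) -> in_L2 (psi 0) -> in_L2 (omega 0) ->
  let C := K * (1 + M) ^+ b * expR (M ^+ b) in
  let Din := (L2norm (nonzero_modes (psi 0%R))
              + (M^-1)%:E * L2norm_grad (nonzero_modes (eta 0%R))
              + L2norm (nonzero_modes (omega 0%R)))%E in
  forall t : R, 0 <= t ->
  ((L2norm (nonzero_modes (psi t))
    + (M^-1)%:E * L2norm_grad (nonzero_modes (eta t))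
    + L2norm (nonzero_modes (omega t))
    <= (C * nu `^ (- 2^-1) * expR (- (nu `^ 3^-1 / 32) * t))%:E * Din)%E
  /\
   (L2norm_vec (nonzero_modes (ux t)) (nonzero_modes (uy t))
    + (M^-1)%:E * L2norm (nonzero_modes (eta t))
    <= (C * nu `^ (- 6^-1) * expR (- (nu `^ 3^-1 / 32) * t))%:E * Din)%E).
Proof.
(* The exponent 4 serves both factors: (1 + M)^4 absorbs (1 + M^2)^2, and M^4 absorbs the powers of
   M in the exponent of [mode_const]. *)
exists (decay_const R), 4%N; split; first exact: decay_const_gt0.
split=> // nu lambda M nu0 lam0 M0 sg_half _ _.
rewrite !le_min => /and3P[h1 h2 _] sp eta ux uy phi psi omega sol _ _ _ C Din t t0.
have sg0 : 0 < nu + lambda by rewrite ltr_wpDr.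
have nu1 : nu <= 1 by move: sg_half lam0; lra.
have sgM : (nu + lambda) * M ^+ 2 <= 1 by rewrite -ler_pdivlMl// mulr1.
have nuM : 16 * nu * M ^+ 2 <= nu + lambda.
  by move: h2; rewrite ler_pdivlMr ?mulr_gt0// mulrC.
have C0 : 0 < C.
  by rewrite /C; apply: mulr_gt0 (expR_gt0 _); apply: mulr_gt0 (decay_const_gt0 R) _; rewrite exprn_gt0// addr_gt0.
have Cr (a b : R) : 0 < C * nu `^ a * expR b by apply: mulr_gt0 (expR_gt0 _); apply: mulr_gt0 C0 _; exact: powR_gt0.
exact: (solution_norms sol M0 (cube_root_gt0 nu0) (cube_root_le1 nu0 nu1) (cube_rootK nu0) lam0 sgM nuM sg_half t0
  (Cr _ _) (Cr _ _) (growth_rate nu0 nu1 M0 t0) (growth_div_rate nu0 nu1 M0 t0)).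
Qed.
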